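(* Let $f$ be a smooth positive function on $S^{2n+1}$, let $u_0\in C^\infty(S^{2n+1})$ be positive with $\int u_0^{2+\frac2n}dV_{\theta_0}=\int dV_{\theta_0}$, and let $\theta(t)=u(t)^{\frac2n}\theta_0$, $t\ge0$, be the solution of the Webster scalar curvature flow with initial data $u_0$. Then for any $1\le p<\infty$, $$F_p(t)=\int_{S^{2n+1}}|\alpha f-R_\theta|^p\,dV_\theta\to0\quad\text{as }t\to\infty.$$
   Context: Let $n\ge1$, $S^{2n+1}=\{x\in\mathbb C^{n+1}:|x|=1\}$ with its standard CR structure and contact form $\theta_0=\sqrt{-1}\sum_{j=1}^{n+1}(x_jd\bar x_j-\bar x_jdx_j)$. For a contact form $\theta$, $dV_\theta=\theta\wedge d\theta^n$. The sub-gradient $\nabla_{\theta_0}$, Levi form $\langle\cdot,\cdot\rangle_{\theta_0}$ and sub-Laplacian, $\int(\Delta_{\theta_0}\phi)\psi\,dV_{\theta_0}=-\int\langle\nabla_{\theta_0}\phi,\nabla_{\theta_0}\psi\rangle_{\theta_0}dV_{\theta_0}$, are normalized so that $-\Delta_{\theta_0}x_j=\frac n2x_j$ (equivalently, $\langle\nabla_{\theta_0}\phi,\nabla_{\theta_0}\psi\rangle_{\theta_0}$ is one quarter of the round inner product of the projections to $\ker\theta_0$ of the round gradients). For smooth $u>0$ and $\theta=u^{\frac2n}\theta_0$: $dV_\theta=u^{2+\frac2n}dV_{\theta_0}$ and the Webster scalar curvature is $R_\theta=u^{-(1+\frac2n)}\left(-(2+\frac2n)\Delta_{\theta_0}u+R_{\theta_0}u\right)$,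 $R_{\theta_0}=\frac{n(n+1)}2$. The Webster scalar curvature flow with initial data $u_0$ is $\partial_tu=\frac n2(\alpha f-R_\theta)u$, $u|_{t=0}=u_0$, with $\theta=u^{\frac2n}\theta_0$ and $\alpha(t)$ determined by $\alpha\int f\,dV_\theta=\int R_\theta\,dV_\theta$; it has a smooth positive solution for all $t\ge0$. *)

(* Defs.v *)
From HB Require Import structures.
From mathcomp Require Import all_boot all_order all_algebra all_fingroup.
From mathcomp Require Import all_classical all_reals all_analysis.
From mathcomp Require Import complex.

Set Implicit Arguments.
Unset Strict Implicit.
Unset Printing Implicit Defensive.

Import Order.TTheory GRing.Theory Num.Theory.
Import numFieldNormedType.Exports.

Local Open Scope classical_set_scope.
Local Open Scope ring_scope.

Fixpoint iter_derive (R : realType) (V : normedModType R) (vs : seq V)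
    (g : V -> R) : V -> R :=
  if vs is v :: vs' then fun x => 'D_v (iter_derive vs' g) x else g.

Definition smooth_on_open (R : realType) (V : normedModType R)
    (O : set V) (g : V -> R) : Prop :=
  forall (vs : seq V) (x : V), O x ->
    {for x, continuous (iter_derive vs g)} /\
    forall v : V, derivable (iter_derive vs g) x v.

(* g is C^oo on an arbitrary subset A: it has local C^oo extensions.  Only the
   values of g on A matter.  On a closed submanifold this is smoothness in the
   sense of manifolds; on a product with [0, +oo[ it is smoothness up to the
   boundary. *)
Definition smooth_on (R : realType) (V : normedModType R)
    (A : set V) (g : V -> R) : Prop :=
  forall a : V, A a -> exists (O : set V) (h : V -> R),
    [/\ open O, O a, smooth_on_open O h &
        forall x, O x -> A x -> h x = g x].

(* C^(n+1) as a real normed space: the pair (a, b) is the vector a + i b. *)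
Notation Cspace R n := ('rV[R]_n.+1 * 'rV[R]_n.+1)%type.

Section Sphere.
Variables (R : realType) (n : nat).
Implicit Types (x y v w : Cspace R n) (phi psi g : Cspace R n -> R).

Definition coordC x (j : 'I_n.+1) : R[i] := Complex (x.1 0 j) (x.2 0 j).

(* i x *)
Definition Jmul x : Cspace R n := (- x.2, x.1).

(* The Euclidean structure; the library norm on Cspace is the sup norm. *)
Definition edot x y : R :=
  \sum_(j < n.+1) (x.1 0 j * y.1 0 j + x.2 0 j * y.2 0 j).

Definition enorm x : R := Num.sqrt (edot x x).

(* Functions on the sphere are represented by functions on Cspace whose values
   off the sphere are never used. *)
Definition sphere : set (Cspace R n) := [set x | enorm x = 1].

Definition radial_proj x : Cspace R n := (enorm x)^-1 *: x.

(* theta_0 = i * sum_j (x_j d(x_j)^* - (x_j)^* dx_j) at x, applied to v; this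
   complex number has zero imaginary part. *)
Definition theta0 x v : R :=
  complex.Re (Complex 0 1 *
    \sum_(j < n.+1) (coordC x j * conjc (coordC v j)
                     - conjc (coordC x j) * coordC v j)).

Definition ext_deriv (eta : Cspace R n -> Cspace R n -> R) x v w : R :=
  'D_v (fun y => eta y w) x - 'D_w (fun y => eta y v) x.

(* eta /\ (d eta)^n at x, on the 2n+1 vectors vs 0, ..., vs (2n); the wedge
   product is normalized so that (dx /\ dy)(e_x, e_y) = 1. *)
Definition contact_volume (eta : Cspace R n -> Cspace R n -> R) x
    (vs : 'I_(n.*2.+1) -> Cspace R n) : R :=
  (2 ^+ n)^-1 * \sum_(s : 'S_(n.*2.+1)) (-1) ^+ s *
    (eta x (vs (s ord0)) *
     \prod_(k < n) ext_deriv eta x (vs (s (inord k.*2.+1)))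
                                   (vs (s (inord k.*2.+2)))).

(* Inverse stereographic projection from the point (0, ..., 0, i): the
   parametrization of the sphere minus that point by R^(2n+1). *)
Definition stereo (y : 'rV[R]_(n.*2.+1)) : Cspace R n :=
  let r2 := \sum_k y 0 k ^+ 2 in
  (\row_(j < n.+1) (2 * y 0 (inord j) / (r2 + 1)),
   \row_(j < n.+1) if j == ord_max then (r2 - 1) / (r2 + 1)
                   else 2 * y 0 (inord (n.+1 + j)) / (r2 + 1)).

End Sphere.

(* Integral over R^m, as an iterated Lebesgue integral. *)
Fixpoint iterated_integral (R : realType) (m : nat) :
    ('rV[R]_m -> R) -> R :=
  match m with
  | 0 => fun g => g 0
  | m'.+1 => fun g =>
      \int[lebesgue_measure]_(t in setT)
        iterated_integral (fun y : 'rV[R]_m' =>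
          g (row_mx (const_mx t : 'rV[R]_1) y : 'rV[R]_(1 + m')))
  end.

Section WebsterFlow.
Variables (R : realType) (n : nat).
Implicit Types (x v : Cspace R n) (phi psi g h f u : Cspace R n -> R).

(* The integral of g dV_{theta_0}, with dV_{theta_0} = theta_0 /\ (d theta_0)^n,
   pulled back to the stereographic chart, which omits only one point.  The
   absolute value expresses that the sphere carries the orientation for which
   this nowhere vanishing form is positive. *)
Definition int_theta0 g : R :=
  iterated_integral (fun y : 'rV[R]_(n.*2.+1) =>
    g (stereo y) *
    `|contact_volume (@theta0 R n) (stereo y)
        (fun k => 'D_(delta_mx 0 k) (@stereo R n) y)|).

(* Round gradient of a function on the sphere at a point x of the sphere: the
   Euclidean gradient of its extension that is constant on rays, which is
   automatically tangent to the sphere. *)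
Definition sphere_grad phi x : Cspace R n :=
  let phi1 := phi \o @radial_proj R n in
  (\row_(j < n.+1) 'D_((delta_mx 0 j, 0) : Cspace R n) phi1 x,
   \row_(j < n.+1) 'D_((0, delta_mx 0 j) : Cspace R n) phi1 x).

(* Orthogonal projection of a vector tangent to the sphere at x onto
   ker theta_0, which is the orthogonal complement of the unit vector i x since
   theta_0(v) = 2 <i x, v>. *)
Definition horizontal_proj x v : Cspace R n := v - edot v (Jmul x) *: Jmul x.

(* The factor 1/4 is the normalization of the Levi form for which the
   coordinate functions satisfy - Delta_{theta_0} x_j = n/2 x_j. *)
Definition levi_grad phi psi x : R :=
  4^-1 * edot (horizontal_proj x (sphere_grad phi x))
              (horizontal_proj x (sphere_grad psi x)).

Definition is_sublaplacian phi h : Prop :=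
  smooth_on (@sphere R n) h /\
  forall psi, smooth_on (@sphere R n) psi ->
    int_theta0 (fun x => h x * psi x) =
    - int_theta0 (fun x => levi_grad phi psi x).

(* For smooth phi, is_sublaplacian phi determines a unique function on the
   sphere. *)
Definition sublaplacian phi : Cspace R n -> R := get (is_sublaplacian phi).

(* The integral of g dV_theta for theta = u^(2/n) theta_0. *)
Definition int_theta u g : R :=
  int_theta0 (fun x => g x * u x `^ (2 + 2 / n%:R)).

(* R_{theta_0}, in the same normalization *)
Definition webster0 : R := n%:R * (n%:R + 1) / 2.

(* R_theta for theta = u^(2/n) theta_0. *)
Definition webster u x : R :=
  u x `^ (- (1 + 2 / n%:R)) *
  (- (2 + 2 / n%:R) * sublaplacian u x + webster0 * u x).

(* u is a smooth positive solution on [0, +oo[ of the Webster scalar curvature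
   flow with prescribed function f and initial data u0.  At t = 0 the equation
   holds, with the right derivative, by smoothness up to t = 0. *)
Record webster_flow f (u0 : Cspace R n -> R) (u : R -> Cspace R n -> R) (alpha : R -> R) : Prop :=
  WebsterFlow {
    flow_smooth : smooth_on
      [set z : R * Cspace R n | 0 <= z.1 /\ sphere z.2]
      (fun z : R * Cspace R n => u z.1 z.2) ;
    flow_pos : forall (t : R) x, 0 <= t -> sphere x -> 0 < u t x ;
    flow_init : forall x, sphere x -> u 0 x = u0 x ;
    flow_alpha : forall t : R, 0 <= t ->
      alpha t * int_theta (u t) f = int_theta (u t) (webster (u t)) ;
    flow_eq : forall (t : R) x, 0 < t -> sphere x ->
      is_derive t 1 (fun s => u s x)
        (n%:R / 2 * (alpha t * f x - webster (u t) x) * u t x)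
  }.

End WebsterFlow.

(* Main.v *)
Require Import Defs.
From HB Require Import structures.
From mathcomp Require Import all_boot all_order all_algebra all_fingroup.
From mathcomp Require Import all_classical all_reals all_analysis.
From mathcomp Require Import complex measurable_realfun zify ring lra.

Set Implicit Arguments.
Unset Strict Implicit.
Unset Printing Implicit Defensive.

Import Order.TTheory GRing.Theory Num.Theory.
Import numFieldNormedType.Exports.

Local Open Scope classical_set_scope.
Local Open Scope ring_scope.

(** The curvature defect v = alpha f - R_theta tends to zero in every L^p along the flow.

    The basic decrease comes from an energy. The total curvature S, divided by the power
    n/(n+1) of Q, the integral of f, does not increase, and its rate of decrease is
    comparable to F2, the integral of v^2 against dV_theta (energy_derive, F2_tame). So
    F2 is integrable in time. If moreover F2' <= C F2, then F2 tends to zero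
    (ode_vanish). Higher moments are reached one after the other: the derivative of the
    moment of order k (moment_derive) contains the dissipation
    - c * integral of u^2 |v|^(k-2) |grad v|^2 and reaction terms up to the moment of
    order k+1.

    The positive part of v is bounded from time 1 on, by a maximum principle in integral
    form: a high moment of the excess of v over a large constant K vanishes at time 1 and
    does not increase (v_upper). The derivative of alpha, which is not a local quantity, is
    treated there with the inequality of Chebyshev (wint_cheb). For the negative part, the
    moment of order k+1 enters the equation of the moment of order k with the coefficient
    k - (n+1). Below the critical order n+1 this has a good sign and makes the next moment
    integrable in time; then its own equation shows that it tends to zero. From the order
    n+1 on the sign is bad, but by then the moment of order n+1 is known to tend to zero,
    and a critical inequality absorbs the next moment into the dissipation (trace_mom,
    absorb, tame_vanish). Real exponents p follow by interpolation (moment_vanish).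

    The critical inequality is the Folland-Stein embedding, in the form: if w >= 0 and the
    integral of w^(n+1) is at most e^(n+1), then the integral of w psi^2 is at most C e
    times the horizontal energy of psi plus its L2 norm (trace_ineq). It rests on a
    Poincare inequality with an explicit kernel: the mean oscillation of psi against the
    Poisson-Szego kernel of radius r is at most C (1 - r) times the horizontal energy
    (energy_bound). The reason is that the radial derivative of the kernel is the divergence
    of a horizontal field, whose length is exactly (n+1)/n times the kernel divided by
    1 - r^2 (sint_dpoisson, field_bound). Applied to truncations of psi at the heights
    4^k, the kernel inequality gives a recursion for the masses of the level sets
    (trunc_step), and summing it gives the trace inequality.

    Everything is integrated in the stereographic chart. There the contact volume is a
    constant multiple of the round measure, because theta_0 and d theta_0 make an
    alternating form on C^(n+1) which must be a multiple of the determinant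
    (contact_density). The divergence theorem on the sphere (sint_tgrad) comes from
    iterated integrals of derivatives in the chart, and yields the symmetry of the
    sub-Laplacian (sint_Gam, sint_Dsub_sym). *)

(** * Continuity and directional derivatives *)

Lemma continuous_mx (R : realType) (T : topologicalType) m n (f : T -> 'M[R]_(m, n)) :
  (forall i j, continuous (fun t => f t i j)) -> continuous f.
Proof.
move=> fc t A [P tP sPA].
have : \forall s \near t, forall i j, P i j (f s i j).
  apply: filter_forall => i; apply: filter_forall => j.
  by apply: (fc i j); exact: tP.
by apply: filterS => s Ps; apply: sPA.
Qed.

Lemma continuous_pairf (T U W : topologicalType) (f : T -> U) (g : T -> W) :
  continuous f -> continuous g -> continuous (fun t => (f t, g t)).
Proof. by move=> cf cg t; exact: (cvg_pair (cf t) (cg t)). Qed.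

Lemma continuous_pairl (U W : topologicalType) (s : U) :
  continuous (fun y : W => (s, y)).
Proof. by apply: continuous_pairf => y; [exact: cvg_cst|exact: cvg_id]. Qed.

Lemma continuous_pairr (U W : topologicalType) (y : W) :
  continuous (fun s : U => (s, y)).
Proof. by apply: continuous_pairf => s; [exact: cvg_id|exact: cvg_cst]. Qed.

Section PointwiseContinuity.
Variables (R : realType) (T : topologicalType).
Implicit Types (f g : T -> R).

Lemma contf_cst (c : R) : continuous (fun _ : T => c).
Proof. by move=> x; exact: cvg_cst. Qed.

Lemma contf_add f g : continuous f -> continuous g -> continuous (fun x => f x + g x).
Proof. by move=> cf cg x; exact: (cvgD (cf x) (cg x)). Qed.

Lemma contf_opp f : continuous f -> continuous (fun x => - f x).
Proof. by move=> cf x; exact: (cvgN (cf x)). Qed.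

Lemma contf_sub f g : continuous f -> continuous g -> continuous (fun x => f x - g x).
Proof. by move=> cf cg x; exact: (cvgB (cf x) (cg x)). Qed.

Lemma contf_mul f g : continuous f -> continuous g -> continuous (fun x => f x * g x).
Proof. by move=> cf cg x; exact: (cvgM (cf x) (cg x)). Qed.

Lemma contf_scale c f : continuous f -> continuous (fun x => c * f x).
Proof. by move=> cf; apply: contf_mul => //; exact: contf_cst. Qed.

Lemma contf_sum (I : Type) (r : seq I) (P : pred I) (F : I -> T -> R) :
  (forall i, P i -> continuous (F i)) -> continuous (fun x => \sum_(i <- r | P i) F i x).
Proof.
move=> h; elim: r => [|i r IH].
  rewrite (_ : (fun y => _) = (fun=> 0)) ?funeqE => [|y]; last by rewrite big_nil.
  exact: contf_cst.
rewrite (_ : (fun y => _) =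
  (fun y => if P i then F i y + \sum_(j <- r | P j) F j y else \sum_(j <- r | P j) F j y)) ?funeqE => [|y].
  by case: (P i) (h i) => [hi|_]; [exact: contf_add (hi isT) IH|exact: IH].
by rewrite big_cons.
Qed.

Lemma contf_exp n f : continuous f -> continuous (fun x => f x ^+ n).
Proof.
move=> cf; elim: n => [|n IH]; first exact: contf_cst.
rewrite (_ : (fun y => _) = (fun y => f y * f y ^+ n)) ?funeqE => [|y]; last by rewrite exprS.
exact: contf_mul.
Qed.

Lemma contf_comp (F : R -> R) f : continuous f ->
  (forall x, {for f x, continuous F}) -> continuous (fun x => F (f x)).
Proof. by move=> cf cF x; apply: continuous_comp; [exact: cf|exact: cF]. Qed.

Lemma contf_norm f : continuous f -> continuous (fun x => `|f x|).
Proof. by move=> cf; apply: contf_comp => // x; exact: norm_continuous. Qed.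

Lemma contf_inv f : continuous f -> (forall x, f x != 0) -> continuous (fun x => (f x)^-1).
Proof. by move=> cf f0 x; exact: (cvgV (f0 x) (cf x)). Qed.

End PointwiseContinuity.

(** Directional derivatives are derivatives in one real variable, to which the mean
    value theorem applies. *)
Lemma is_derive_line (R : realType) (V W : normedModType R) (f : V -> W) (x v : V) (df : W) :
  is_derive x v f df <-> is_derive (0 : R) 1 (fun s : R => f (x + s *: v)) df.
Proof.
have E : (fun h : R => h^-1 *: (f (h *: v + x) - f x)) =
         (fun h : R => h^-1 *: ((fun s : R => f (x + s *: v)) (h *: 1 + 0) - (fun s : R => f (x + s *: v)) 0)).
  by apply/funext => h; rewrite addr0 [h *: 1]mulr1 scale0r addr0 [x + _]addrC.
split=> [][h1 h2]; apply: DeriveDef.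
- by move: h1; rewrite /derivable E.
- by move: h2; rewrite /derive E.
- by rewrite /derivable E.
- by rewrite /derive E.
Qed.

Section PointwiseDerivatives.
Variables (R : realType) (V : normedModType R).
Implicit Types (f g : V -> R) (x v : V) (c df dg : R).

Lemma pder_eq f x v df dg : is_derive x v f df -> df = dg -> is_derive x v f dg.
Proof. by move=> ? <-. Qed.

Lemma pder_cst x v c : is_derive x v (fun=> c) 0.
Proof. exact: (@is_derive_cst _ V R^o c x v). Qed.

Lemma pderD f g x v df dg : is_derive x v f df -> is_derive x v g dg ->
  is_derive x v (fun y => f y + g y) (df + dg).
Proof. by move=> hf hg; exact: (is_deriveD hf hg). Qed.

Lemma pderN f x v df : is_derive x v f df -> is_derive x v (fun y => - f y) (- df).
Proof. by move=> hf; exact: (is_deriveN hf). Qed.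

Lemma pderB f g x v df dg : is_derive x v f df -> is_derive x v g dg ->
  is_derive x v (fun y => f y - g y) (df - dg).
Proof. by move=> hf hg; exact: (is_deriveB hf hg). Qed.

Lemma pderM f g x v df dg : is_derive x v f df -> is_derive x v g dg ->
  is_derive x v (fun y => f y * g y) (df * g x + f x * dg).
Proof.
move=> hf hg; apply: (pder_eq (is_deriveM hf hg)).
by rewrite /GRing.scale/= addrC [g x * _]mulrC.
Qed.

Lemma pderZ f x v df c : is_derive x v f df ->
  is_derive x v (fun y => c * f y) (c * df).
Proof.
move=> hf; apply: (pder_eq (pderM (pder_cst x v c) hf)).
by rewrite mul0r add0r.
Qed.

Lemma pder_comp (F : R -> R) f x v df dF :
  is_derive (f x) 1 F dF -> is_derive x v f df ->
  is_derive x v (fun y => F (f y)) (dF * df).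
Proof.
move=> hF /is_derive_line hf; apply/is_derive_line.
have hF' : is_derive (f (x + (0 : R) *: v)) 1 F dF by rewrite scale0r addr0.
exact: (is_derive1_comp hF' hf).
Qed.

Lemma pderV f x v df : f x != 0 -> is_derive x v f df ->
  is_derive x v (fun y => (f y)^-1) (- (df / f x ^+ 2)).
Proof.
move=> fx0 hf.
have hd : derivable f x v by case: hf.
apply: DeriveDef; first exact: derivableV.
have /= -> := deriveV fx0 hd; rewrite derive_val.
by rewrite /GRing.scale/= mulNr mulrC.
Qed.

Lemma pderX f x v df n : is_derive x v f df ->
  is_derive x v (fun y => f y ^+ n) (n%:R * f x ^+ n.-1 * df).
Proof.
move=> hf; elim: n => [|n IH]; first by rewrite !mul0r; exact: pder_cst.
rewrite (_ : (fun y => _) = (fun y => f y * f y ^+ n)) ?funeqE => [|y]; last by rewrite exprS.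
apply: (pder_eq (pderM hf IH)) => /=.
by case: n {IH} => [|n]; rewrite -?[in RHS]natr1 /= ?exprS; ring.
Qed.

Lemma pder_near f g x v df : {near x, f =1 g} -> is_derive x v f df -> is_derive x v g df.
Proof.
by move=> fg; apply: near_eq_is_derive; apply: filterS fg => y ->.
Qed.

End PointwiseDerivatives.

Lemma pder_id (R : realType) (x v : R) : is_derive x v (fun s : R => s) v.
Proof. exact: is_derive_id. Qed.

Lemma pder_affine (R : realType) (x a b : R) : is_derive x 1 (fun s : R => a + s * b) b.
Proof.
have h := pderD (pder_cst x 1 a) (pderM (pder_id x 1) (pder_cst x 1 b)).
by apply: (pder_eq h); rewrite add0r mulr0 addr0 mul1r.
Qed.

(** * Iterated integrals of integrands with integrable product tails *)

Section Weight.
Variable R : realType.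
Notation mu := (@lebesgue_measure R).

(** The exponent 5/4 exceeds 1, which makes the weight integrable, and is small enough
    for the product of m = 2n+1 >= 3 copies to dominate the power m-1 of the conformal
    factor of the stereographic chart (tailprod_lower). *)
Definition tailw (t : R) : R := (1 + `|t|) `^ (- (5 / 4)).

Lemma tailw_gt0 t : 0 < tailw t.
Proof. by apply: powR_gt0; rewrite ltr_pwDl. Qed.

Lemma tailw_ge0 t : 0 <= tailw t. Proof. exact/ltW/tailw_gt0. Qed.

Lemma tailw_le1 t : tailw t <= 1.
Proof.
rewrite /tailw -[leRHS](powRr0 (1 + `|t|)) ler_powR ?lerDl//; lra.
Qed.

Lemma powR_continuous (a : R) : {in Num.pos, continuous (fun x : R => x `^ a)}.
Proof.
move=> x; rewrite posrE => x0.
apply: differentiable_continuous; apply/derivable1_diffP.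
by apply: derivable_powR; rewrite in_itv/= x0.
Qed.

Lemma tailw_continuous : continuous tailw.
Proof.
move=> t; rewrite /tailw.
apply: (@continuous_comp R R R (fun t => 1 + `|t|) (fun x => x `^ (- (5 / 4)))).
  by apply: cvgD; [exact: cvg_cst|exact: norm_continuous].
by apply: powR_continuous; rewrite posrE ltr_pwDl.
Qed.

Lemma tailw_integrable : mu.-integrable setT (EFin \o tailw).
Proof.
apply/integrableP; split.
  apply/measurable_EFinP; exact: continuous_measurable_fun tailw_continuous.
under eq_integral do rewrite /= ger0_norm ?tailw_ge0//.
rewrite ge0_symfun_integralT; [|exact: tailw_ge0|exact: tailw_continuous|]; last first.
  by move=> t; rewrite /tailw/= normrN.
have -> : [set x : R | 0 <= x] = `[0, +oo[%classic by rewrite set_itvcy.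
have cF (x : R) : 0 <= x -> is_derive x 1 (fun x : R => - 4 * (1 + x) `^ (- (1 / 4))) ((1 + x) `^ (- (5 / 4))).
  move=> x0.
  have x1 : 0 < (1 + x) by rewrite ltr_pwDl.
  have H : is_derive x 1 (fun x : R => (1 + x) `^ (- (1 / 4))) ((- (1 / 4)) * (1 + x) `^ (- (1 / 4) - 1)).
    have h1 : is_derive x 1 (fun x : R => 1 + x) 1.
      by rewrite -[X in is_derive _ _ _ X](add0r 1); exact: pderD (pder_cst _ _ _) (is_derive_id _ _).
    have := @is_derive1_comp R (fun x => x `^ (- (1 / 4))) (fun x => 1 + x) x _ _ (is_derive1_powR _ x1) h1.
    by rewrite mulr1.
  have := @is_deriveZ _ _ _ _ (-4) x 1 _ H.
  rewrite /GRing.scale/= => H'; apply: (is_derive_eq H').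
  rewrite mulrA (_ : - 4 * _ = 1) ?mul1r; last by field.
  congr (_ `^ _); lra.
rewrite (@ge0_continuous_FTC2y _ tailw (fun x => - 4 * (1 + x) `^ (- (1 / 4))) 0 0).
- by rewrite -EFinB -EFinM ltry.
- by move=> x _; exact: tailw_ge0.
- exact/continuous_subspaceT/tailw_continuous.
- rewrite -[X in _ --> X](mulr0 (-4)); apply: cvgM; first exact: cvg_cst.
  under eq_fun do rewrite powRN.
  apply/gtr0_cvgV0.
    by near=> x; rewrite powR_gt0// ltr_pwDl//; near: x; exact: nbhs_pinfty_ge.
  apply/cvgryPge => A; near=> x.
  have x1 : 0 <= 1 + x by rewrite addr_ge0//; near: x; exact: nbhs_pinfty_ge.
  have A1 : A <= `|A| + 1 by rewrite ler_wpDr// ler_norm.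
  apply: (le_trans A1).
  have A0 : 0 <= `|A| + 1 by rewrite addr_ge0.
  have -> : `|A| + 1 = ((`|A| + 1) ^+ 4) `^ (1 / 4).
    have e : 4%:R * (1 / 4) = 1 :> R by field.
    by rewrite -powR_mulrn// -powRrM e powRr1.
  apply: ge0_ler_powR; rewrite ?nnegrE ?exprn_ge0//.
  apply: le_trans (_ : x <= _); last by rewrite lerDr.
  by near: x; apply: nbhs_pinfty_ge; rewrite num_real.
- by move=> x x0; have := cF x (ltW x0); case.
- have [+ _] := cF 0 (lexx _) => /derivable1_diffP/differentiable_continuous.
  exact: cvg_at_right_filter.
- move=> x; rewrite in_itv/= andbT => x0.
  rewrite derive1E; have [_ ->] := cF x (ltW x0).
  by rewrite /tailw ger0_norm// ltW.
Unshelve. all: by end_near. Qed.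

End Weight.

Section Iterated.
Variable R : realType.
Notation mu := (@lebesgue_measure R).
Notation II := iterated_integral.

Definition rcons0 m (t : R) (y : 'rV[R]_m) : 'rV[R]_m.+1 :=
  (row_mx (const_mx t : 'rV[R]_1) y : 'rV[R]_(1 + m)).

Lemma rcons0_ord0 m t (y : 'rV[R]_m) : rcons0 t y 0 ord0 = t.
Proof.
rewrite /rcons0 (_ : (ord0 : 'I_m.+1) = @lshift 1 m ord0); last exact: val_inj.
by rewrite (@row_mxEl _ 1 1 m) mxE.
Qed.

Lemma rcons0_lift m t (y : 'rV[R]_m) i : rcons0 t y 0 (lift ord0 i) = y 0 i.
Proof.
rewrite /rcons0 (_ : lift ord0 i = rshift 1 i); last exact: val_inj.
by rewrite (@row_mxEr _ 1 1 m).
Qed.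

Lemma rcons0_eta m (y : 'rV[R]_m.+1) :
  y = rcons0 (y 0 ord0) (\row_i y 0 (lift ord0 i)).
Proof.
apply/rowP => i; have [j ->|->] := unliftP ord0 i; last by rewrite rcons0_ord0.
by rewrite rcons0_lift mxE.
Qed.

Lemma rcons0D m t s (y z : 'rV[R]_m) :
  rcons0 t y + rcons0 s z = rcons0 (t + s) (y + z).
Proof.
apply/rowP => i; rewrite mxE.
by have [j ->|->] := unliftP ord0 i; rewrite ?rcons0_ord0// !rcons0_lift mxE.
Qed.

Lemma rcons0Z m c t (y : 'rV[R]_m) : c *: rcons0 t y = rcons0 (c * t) (c *: y).
Proof.
apply/rowP => i; rewrite mxE.
by have [j ->|->] := unliftP ord0 i; rewrite ?rcons0_ord0// !rcons0_lift mxE.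
Qed.

Lemma rcons0_continuous m :
  continuous (fun p : R * 'rV[R]_m => rcons0 p.1 p.2).
Proof.
apply: continuous_mx => i j; rewrite (ord1 i).
have [k ->|->] := unliftP ord0 j.
  have -> : (fun t : R * 'rV[R]_m => rcons0 t.1 t.2 0 (lift ord0 k)) =
            (fun y : 'rV[R]_m => y 0 k) \o snd.
    by apply/funext => t /=; rewrite rcons0_lift.
  by move=> t; apply: continuous_comp; [exact: cvg_snd|exact: coord_continuous].
have -> : (fun t : R * 'rV[R]_m => rcons0 t.1 t.2 0 ord0) = fst.
  by apply/funext => t /=; rewrite rcons0_ord0.
by move=> t; exact: cvg_fst.
Qed.

Definition tailprod m (y : 'rV[R]_m) : R := \prod_i tailw (y 0 i).

Lemma tailprod_cons m t (y : 'rV[R]_m) :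
  tailprod (rcons0 t y) = tailw t * tailprod y.
Proof.
rewrite /tailprod big_ord_recl rcons0_ord0; congr (_ * _).
by apply: eq_bigr => i _; rewrite rcons0_lift.
Qed.

Lemma tailprod_gt0 m (y : 'rV[R]_m) : 0 < tailprod y.
Proof. by apply: prodr_gt0 => i _; exact: tailw_gt0. Qed.

Let K := \int[mu]_t tailw t.

Lemma integrable_tail (h : R -> R) C : continuous h ->
  (forall s, `|h s| <= C * tailw s) -> mu.-integrable setT (EFin \o h).
Proof.
move=> ch hC.
apply: (@le_integrable _ _ _ mu setT measurableT _ (EFin \o (fun s => C * tailw s))).
- by apply/measurable_EFinP; exact: continuous_measurable_fun.
- move=> s _ /=; rewrite lee_fin (le_trans (hC s))// ler_norm//.
- rewrite (_ : EFin \o _ = (fun s => C%:E * (EFin \o @tailw R) s)%E); last first.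
    by apply/funext => s.
  by apply: integrableZl => //; exact: tailw_integrable.
Qed.

Lemma integral_tail_le (h : R -> R) C : continuous h ->
  (forall s, `|h s| <= C * tailw s) -> `|\int[mu]_s h s| <= C * K.
Proof.
move=> ch hC; apply: (le_trans (le_normr_Rintegral measurableT (integrable_tail ch hC))).
rewrite /K -RintegralZl//; last exact: tailw_integrable.
apply: le_Rintegral => //.
- apply: (@integrable_tail _ C) => [|s]; last by rewrite normr_id.
  by move=> s; apply: continuous_comp; [exact: ch|exact: norm_continuous].
- apply: (@integrable_tail _ `|C|) => [s|s].
    by apply: cvgM; [exact: cvg_cst|exact: tailw_continuous].
  by rewrite normrM (ger0_norm (tailw_ge0 s)).
Qed.

Lemma slice_continuous m (g : 'rV[R]_m.+1 -> R) : continuous g ->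
  continuous (fun p : R * 'rV[R]_m => g (rcons0 p.1 p.2)).
Proof.
by move=> cg p; apply: continuous_comp; [exact: rcons0_continuous|exact: cg].
Qed.

(** The two statements need each other in the induction on the dimension: the bound for
    the inner integral is the dominating function for the outer one, and continuity of
    the inner integral makes it integrable in the outer variable. *)
Lemma iterated_main m :
  (forall C (g : 'rV[R]_m -> R), continuous g ->
     (forall y, `|g y| <= C * tailprod y) -> `|II g| <= C * K ^+ m) /\
  (forall C (g : R -> 'rV[R]_m -> R),
     continuous (fun p : R * 'rV[R]_m => g p.1 p.2) ->
     (forall t y, `|g t y| <= C * tailprod y) ->
     continuous (fun t => II (g t))).
Proof.
elim: m => [|m [IHb IHc]]; split.
- move=> C g _ /(_ 0) /=.
  by rewrite /tailprod big_ord0 expr0.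
- move=> C g cg _ t /=.
  apply: (@continuous_comp _ _ _ (fun t => (t, 0 : 'rV[R]_0)) (fun p : R * 'rV[R]_0 => g p.1 p.2)).
    exact: continuous_pairr.
  exact: cg.
- move=> C g cg gC.
  have C0 : 0 <= C.
    by have := le_trans (normr_ge0 _) (gC 0); rewrite pmulr_lge0// tailprod_gt0.
  rewrite exprSr mulrA; apply: integral_tail_le.
    apply: (IHc C) => [|t y]; first exact: slice_continuous.
    rewrite (le_trans (gC _))// tailprod_cons ler_wpM2l//.
    by rewrite ler_piMl ?tailw_le1// ltW// tailprod_gt0.
  move=> s; rewrite mulrAC; apply: IHb => [|y].
    move=> y; apply: (@continuous_comp _ _ _ (fun y => (s, y)) (fun p : R * 'rV[R]_m => g (rcons0 p.1 p.2))).
      exact: continuous_pairl.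
    exact: slice_continuous.
  by rewrite (le_trans (gC _))// tailprod_cons mulrA.
- move=> C g cg gC t0.
  have C0 : 0 <= C.
    by have := le_trans (normr_ge0 _) (gC 0 0); rewrite pmulr_lge0// tailprod_gt0.
  have cgt t : continuous (g t).
    move=> y; apply: (@continuous_comp _ _ _ (fun y => (t, y)) (fun p : R * 'rV[R]_m.+1 => g p.1 p.2)).
      exact: continuous_pairl.
    exact: cg.
  have cs t : continuous (fun s => II (fun y => g t (rcons0 s y))).
    apply: (IHc C) => [|s y]; first exact: slice_continuous.
    rewrite (le_trans (gC _ _))// tailprod_cons ler_wpM2l//.
    by rewrite ler_piMl ?tailw_le1// ltW// tailprod_gt0.
  have bs t s : `|II (fun y => g t (rcons0 s y))| <= C * K ^+ m * tailw s.
    rewrite mulrAC; apply: IHb => [|y].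
      move=> y; apply: (@continuous_comp _ _ _ (fun y => (s, y)) (fun p : R * 'rV[R]_m => g t (rcons0 p.1 p.2))).
        exact: continuous_pairl.
      exact: slice_continuous.
    by rewrite (le_trans (gC _ _))// tailprod_cons mulrA.
  apply: (@continuity_under_integral _ _ _ mu (fun t s => II (fun y => g t (rcons0 s y))) setT measurableT (t0 - 1) (t0 + 1) _ _ (fun s => C * K ^+ m * tailw s)).
  + by move=> t _; exact: integrable_tail (cs t) (bs t).
  + apply: aeW => s _ t _; apply: (IHc C) => [|t' y]; last first.
      rewrite (le_trans (gC _ _))// tailprod_cons ler_wpM2l//.
      by rewrite ler_piMl ?tailw_le1// ltW// tailprod_gt0.
    move=> p.
    apply: (@continuous_comp _ _ _ (fun p : R * 'rV[R]_m => (p.1, rcons0 s p.2)) (fun p : R * 'rV[R]_m.+1 => g p.1 p.2)).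
      apply: continuous_pairf => q; first exact: cvg_fst.
      apply: (@continuous_comp _ _ _ (fun p : R * 'rV[R]_m => (s, p.2)) (fun p : R * 'rV[R]_m => rcons0 p.1 p.2)).
        by apply: continuous_pairf => r; [exact: cvg_cst|exact: cvg_snd].
      exact: rcons0_continuous.
    exact: cg.
  + apply: (@integrable_tail _ `|C * K ^+ m|) => [s|s].
      by apply: cvgM; [exact: cvg_cst|exact: tailw_continuous].
    by rewrite normrM (ger0_norm (tailw_ge0 s)).
  + by move=> t _; apply: aeW => s _; exact: bs.
  + by rewrite inE/= in_itv/= ltrBlDr !ltrDl ltr01.
Qed.

(** The class on which iterated integrals behave well; continuous functions on the
    sphere, read in the chart with their density, belong to it (ctail_sphere). *)
Definition ctail m (g : 'rV[R]_m -> R) :=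
  continuous g /\ exists C, forall y, `|g y| <= C * tailprod y.

Lemma ctail_slice m (g : 'rV[R]_m.+1 -> R) t : ctail g ->
  ctail (fun y => g (rcons0 t y)).
Proof.
move=> [cg [C gC]]; split.
  move=> y; apply: (@continuous_comp _ _ _ (fun y => (t, y)) (fun p : R * 'rV[R]_m => g (rcons0 p.1 p.2))).
    exact: continuous_pairl.
  exact: slice_continuous.
by exists (C * tailw t) => y; rewrite (le_trans (gC _))// tailprod_cons mulrA.
Qed.

Lemma ctail_iter m (g : 'rV[R]_m.+1 -> R) : ctail g ->
  continuous (fun t => II (fun y => g (rcons0 t y))) /\
  exists C, forall t, `|II (fun y => g (rcons0 t y))| <= C * tailw t.
Proof.
move=> [cg [C gC]]; have [IHb IHc] := iterated_main m.
have C0 : 0 <= C.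
  by have := le_trans (normr_ge0 _) (gC 0); rewrite pmulr_lge0// tailprod_gt0.
split.
  apply: (IHc C) => [|t y]; first exact: slice_continuous.
  rewrite (le_trans (gC _))// tailprod_cons ler_wpM2l//.
  by rewrite ler_piMl ?tailw_le1// ltW// tailprod_gt0.
exists (C * K ^+ m) => s; rewrite mulrAC; apply: IHb => [|y].
  by have [] := @ctail_slice m g s (conj cg (ex_intro _ C gC)).
by rewrite (le_trans (gC _))// tailprod_cons mulrA.
Qed.

Lemma ctail_integrable m (g : 'rV[R]_m.+1 -> R) : ctail g ->
  mu.-integrable setT (EFin \o (fun t => II (fun y => g (rcons0 t y)))).
Proof. by move=> /ctail_iter[c [C hC]]; exact: integrable_tail c hC. Qed.

Lemma ctailD m (g h : 'rV[R]_m -> R) : ctail g -> ctail h ->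
  ctail (fun y => g y + h y).
Proof.
move=> [cg [C gC]] [ch [D hD]]; split.
  exact: contf_add.
exists (C + D) => y; rewrite mulrDl (le_trans (ler_normD _ _))// lerD//.
Qed.

Lemma ctailZ m c (g : 'rV[R]_m -> R) : ctail g -> ctail (fun y => c * g y).
Proof.
move=> [cg [C gC]]; split.
  exact: contf_scale.
by exists (`|c| * C) => y; rewrite normrM -mulrA ler_wpM2l.
Qed.

Lemma iteratedD m (g h : 'rV[R]_m -> R) : ctail g -> ctail h ->
  II (fun y => g y + h y) = II g + II h.
Proof.
elim: m g h => [//|m IH] g h tg th /=.
rewrite -RintegralD//; [|exact: ctail_integrable..].
by apply: eq_Rintegral => t _; rewrite IH//; exact: ctail_slice.
Qed.

Lemma iteratedZ m c (g : 'rV[R]_m -> R) : ctail g ->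
  II (fun y => c * g y) = c * II g.
Proof.
elim: m g => [//|m IH] g tg /=.
rewrite -RintegralZl//; last exact: ctail_integrable.
by apply: eq_Rintegral => t _; rewrite IH//; exact: ctail_slice.
Qed.

Lemma iterated_ge0 m (g : 'rV[R]_m -> R) : (forall y, 0 <= g y) -> 0 <= II g.
Proof.
elim: m g => [|m IH] g g0 /=; first exact: g0.
by apply: Rintegral_ge0 => t _; apply: IH.
Qed.

(** A nonnegative function with zero integral vanishes almost everywhere, hence on a
    dense set, and continuity does the rest. *)
Lemma Rintegral_eq0 (h : R -> R) : continuous h -> (forall t, 0 <= h t) ->
  mu.-integrable setT (EFin \o h) -> \int[mu]_t h t = 0 -> forall t, h t = 0.
Proof.
move=> ch h0 ih hi t; apply/eqP; rewrite -[_ == _]negbK; apply/negP => ht.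
have ht0 : 0 < h t by rewrite lt_neqAle eq_sym ht h0.
have ht2 : 0 < h t / 2 by rewrite divr_gt0.
have /cvgrPdist_lt/(_ _ ht2) := ch t; rewrite near_nbhs => /nbhs_ballP[d /= d0 hd].
have : \int[mu]_(s in `[t, t + d / 2]) (h t / 2) <= \int[mu]_s h s.
  apply: (@le_trans _ _ (\int[mu]_(s in `[t, t + d / 2]) h s)).
    apply: le_Rintegral => //.
    - apply: continuous_compact_integrable; first exact: segment_compact.
      by apply: continuous_subspaceT; exact: contf_cst.
    - exact: (integrableS measurableT).
    move=> s; rewrite /= in_itv/= => /andP[ts st].
    have /hd : ball t d s.
      rewrite /ball/= ltr_distlC; apply/andP; split; first by rewrite (lt_le_trans _ ts)// ltrBlDr ltrDl.
      by rewrite (le_lt_trans st)// ltrD2l ltr_pdivrMr// ltr_pMr// ltr1n.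
    rewrite ltr_distlC => /andP[+ _]; lra.
  rewrite /Rintegral fine_le//.
  - apply: integrable_fin_num => //; exact: (integrableS measurableT).
  - exact: integrable_fin_num.
  apply: ge0_subset_integral => //; first by have /integrableP[] := ih.
  by move=> s _; rewrite lee_fin.
rewrite hi Rintegral_cst//.
have -> : fine (mu `[t, t + d / 2]%classic) = d / 2.
  have -> : mu `[t, t + d / 2]%classic = (d / 2)%:E.
    have := @lebesgue_measure_itv R `[t, t + d / 2].
    by rewrite /= lte_fin ltrDl divr_gt0//= -EFinD addrAC subrr add0r.
  by [].
by move/le_lt_trans => /(_ _ (mulr_gt0 ht2 (divr_gt0 d0 (ltr0Sn R 1)))); rewrite ltxx.
Qed.

Lemma iterated_eq0 m (g : 'rV[R]_m -> R) : ctail g -> (forall y, 0 <= g y) ->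
  II g = 0 -> forall y, g y = 0.
Proof.
elim: m g => [|m IH] g tg g0 /=; first by move=> g00 y; rewrite [y]thinmx0.
move=> /Rintegral_eq0 h y; rewrite (rcons0_eta y).
have [c _] := ctail_iter tg.
apply: (IH (fun z => g (rcons0 (y 0 ord0) z))) => //; first exact: ctail_slice.
by apply: h => // [t|]; [exact: iterated_ge0|exact: ctail_integrable].
Qed.

Lemma delta0_rcons m : delta_mx 0 ord0 = rcons0 1 (0 : 'rV[R]_m).
Proof.
apply/rowP => i; rewrite mxE eqxx/=.
have [j ->|->] := unliftP ord0 i; last by rewrite rcons0_ord0 eqxx.
by rewrite rcons0_lift mxE eq_sym (negPf (neq_lift _ _)).
Qed.

Lemma deltaS_rcons m (k : 'I_m) :
  delta_mx 0 (lift ord0 k) = rcons0 (0 : R) (delta_mx 0 k).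
Proof.
apply/rowP => i; rewrite mxE eqxx/=.
have [j ->|->] := unliftP ord0 i; last by rewrite rcons0_ord0 (negPf (neq_lift _ _)).
by rewrite rcons0_lift mxE eqxx (inj_eq (@lift_inj _ _)).
Qed.

Lemma iterated_is_derive m C (g dg : R -> 'rV[R]_m -> R) :
  continuous (fun p : R * 'rV[R]_m => g p.1 p.2) ->
  continuous (fun p : R * 'rV[R]_m => dg p.1 p.2) ->
  (forall t y, `|g t y| <= C * tailprod y) ->
  (forall t y, `|dg t y| <= C * tailprod y) ->
  (forall (t : R) y, is_derive t 1 (g^~ y) (dg t y)) ->
  forall t : R, is_derive t 1 (fun t => II (g t)) (II (dg t)).
Proof.
elim: m g dg C => [|m IH] g dg C cg cdg gC dgC gdg t0 /=; first exact: gdg.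
have C0 : 0 <= C.
  by have := le_trans (normr_ge0 _) (gC 0 0); rewrite pmulr_lge0// tailprod_gt0.
have cc (h : R -> 'rV[R]_m.+1 -> R) s : continuous (fun p : R * 'rV[R]_m.+1 => h p.1 p.2) ->
    continuous (fun p : R * 'rV[R]_m => h p.1 (rcons0 s p.2)).
  move=> ch p; apply: (@continuous_comp _ _ _ (fun p : R * 'rV[R]_m => (p.1, rcons0 s p.2)) (fun p : R * 'rV[R]_m.+1 => h p.1 p.2)).
    apply: continuous_pairf => q; first exact: cvg_fst.
    apply: (@continuous_comp _ _ _ (fun p : R * 'rV[R]_m => (s, p.2)) (fun p : R * 'rV[R]_m => rcons0 p.1 p.2)).
      by apply: continuous_pairf => r; [exact: cvg_cst|exact: cvg_snd].
    exact: rcons0_continuous.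
  exact: ch.
have ct (h : R -> 'rV[R]_m.+1 -> R) t : continuous (fun p : R * 'rV[R]_m.+1 => h p.1 p.2) ->
    (forall y, `|h t y| <= C * tailprod y) -> ctail (h t).
  move=> ch hC; split; last by exists C.
  move=> y; apply: (@continuous_comp _ _ _ (fun y => (t, y)) (fun p : R * 'rV[R]_m.+1 => h p.1 p.2)).
    exact: continuous_pairl.
  exact: ch.
have D (t : R) s : is_derive t 1 (fun t => II (fun y => g t (rcons0 s y))) (II (fun y => dg t (rcons0 s y))).
  apply: (IH _ _ C) => //.
  - exact: cc.
  - exact: cc.
  - move=> t' y; rewrite (le_trans (gC _ _))// tailprod_cons ler_wpM2l//.
    by rewrite ler_piMl ?tailw_le1// ltW// tailprod_gt0.
  - move=> t' y; rewrite (le_trans (dgC _ _))// tailprod_cons ler_wpM2l//.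
    by rewrite ler_piMl ?tailw_le1// ltW// tailprod_gt0.
have D1 t s : partial1of2 (fun t s => II (fun y => g t (rcons0 s y))) t s = II (fun y => dg t (rcons0 s y)).
  by rewrite /partial1of2 derive1E; have [_ ->] := D t s.
have It0 : `]t0 - 1, t0 + 1[%classic t0 by rewrite /= in_itv/= ltrBlDr !ltrDl ltr01.
have [IHb _] := iterated_main m.
have bnd t s : `|II (fun y => dg t (rcons0 s y))| <= C * K ^+ m * tailw s.
  rewrite mulrAC; apply: IHb => [|y].
    by have [] := ctail_slice s (ct _ t cdg (dgC t)).
  by rewrite (le_trans (dgC _ _))// tailprod_cons mulrA.
have CK : 0 <= C * K ^+ m.
  by have := le_trans (normr_ge0 _) (bnd 0 0); rewrite pmulr_lge0// tailw_gt0.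
have h1 : forall x, `]t0 - 1, t0 + 1[%classic x -> mu.-integrable setT (EFin \o (fun s => II (fun y => g x (rcons0 s y)))).
  by move=> x _; apply: ctail_integrable; exact: ct.
have h2 : forall x y, `]t0 - 1, t0 + 1[%classic x -> setT y -> derivable ((fun t s => II (fun y => g t (rcons0 s y)))^~ y) x 1.
  by move=> x y _ _; have [] := D x y.
have h3 : forall s, 0 <= C * K ^+ m * tailw s by move=> s; rewrite mulr_ge0// tailw_ge0.
have h4 : mu.-integrable setT (EFin \o (fun s => C * K ^+ m * tailw s)).
  apply: (@integrable_tail _ (C * K ^+ m)) => s.
    by apply: cvgM; [exact: cvg_cst|exact: tailw_continuous].
  by rewrite ger0_norm.
have h5 : forall x y, `]t0 - 1, t0 + 1[%classic x -> setT y -> `|partial1of2 (fun t s => II (fun y => g t (rcons0 s y))) x y| <= C * K ^+ m * tailw y.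
  by move=> x y _ _; rewrite D1.
apply: DeriveDef.
  exact: (derivable_under_integral measurableT It0 h1 h2 h3 h4 h5).
rewrite -derive1E (differentiation_under_integral measurableT It0 h1 h2 h3 h4 h5).
by apply: eq_Rintegral => s _; rewrite D1.
Qed.

Lemma Rintegral_derive0 (J dJ : R -> R) C : continuous dJ ->
  (forall t, `|J t| <= C * tailw t) -> (forall t, `|dJ t| <= C * tailw t) ->
  (forall t : R, is_derive t 1 J (dJ t)) -> \int[mu]_t dJ t = 0.
Proof.
move=> cdJ bJ bdJ D.
have cJ : continuous J.
  by move=> t; apply: differentiable_continuous; apply/derivable1_diffP; case: (D t).
have C0 : 0 <= C.
  by have := le_trans (normr_ge0 _) (bJ 0); rewrite pmulr_lge0// tailw_gt0.
have idJ := integrable_tail cdJ bdJ.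
pose I n : R := \int[mu]_(t in `[- n.+1%:R, n.+1%:R]) dJ t.
have IE n : I n = J n.+1%:R - J (- n.+1%:R).
  rewrite /I /Rintegral (@continuous_FTC2 _ dJ J) //.
  - by rewrite (lt_trans (_ : - n.+1%:R < 0))// oppr_lt0.
  - exact/continuous_subspaceT.
  - split.
    + by move=> t _; case: (D t).
    + by apply: cvg_at_right_filter; exact: cJ.
    + by apply: cvg_at_left_filter; exact: cJ.
  - by move=> t _; rewrite derive1E; have [_ ->] := D t.
have tw0 : (tailw (n.+1%:R : R)) @[n --> \oo] --> (0 : R).
  rewrite /tailw; under eq_fun do rewrite powRN.
  apply/gtr0_cvgV0; first by apply: nearW => n; rewrite powR_gt0 ?ltr_pwDl.
  apply/cvgryPge => A; near=> n.
  have h1 : 1 <= 1 + `|n.+1%:R| :> R by rewrite lerDl.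
  apply: (@le_trans _ _ ((1 + `|n.+1%:R|) `^ 1)); last first.
    by rewrite ler_powR//; lra.
  rewrite powRr1; last exact: le_trans h1.
  rewrite ger0_norm// -natr1.
  apply: (@le_trans _ _ n%:R); last by lra.
  by near: n; exact: nbhs_infty_ger.
have Ilim0 : I n @[n --> \oo] --> (0 : R).
  apply/norm_cvg0P.
  apply: (@squeeze_cvgr _ _ _ _ (cst 0) (fun n => 2 * C * tailw (n.+1%:R))).
  - apply: nearW => n; rewrite normr_ge0/= IE (le_trans (ler_normB _ _))//.
    have -> : 2 * C * tailw n.+1%:R = C * tailw n.+1%:R + C * tailw (- n.+1%:R) :> R.
      by rewrite /tailw normrN; ring.
    by rewrite lerD.
  - exact: cvg_cst.
  - by rewrite -[X in _ --> X](mulr0 (2 * C)); apply: cvgM; [exact: cvg_cst|].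
have Ilim : I n @[n --> \oo] --> \int[mu]_t dJ t.
  rewrite /I; under eq_fun do rewrite Rintegral_mkcond.
  apply: fine_cvg; rewrite fineK; last exact: integrable_fin_num.
  apply: (@dominated_cvg _ _ _ mu setT measurableT
    (fun n t => ((dJ \_ `[- n.+1%:R, n.+1%:R]) t)%:E) _ (fun t => (C * tailw t)%:E)).
  - move=> n; apply/measurable_EFinP/(measurable_restrictT _ _).1 => //.
    by apply: measurable_funTS; exact: (@continuous_measurable_fun R dJ cdJ).
  - move=> t _; apply: cvg_EFin; first exact: nearW.
    apply: (@cvg_near_cst) => //; near=> n.
    rewrite /= patchE mem_set//= in_itv/= -ler_norml.
    rewrite (@le_trans _ _ n%:R)// ?ler_nat//.
    by near: n; exact: nbhs_infty_ger.
  - by [].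
  - apply: (@integrable_tail _ C) => s.
      by apply: cvgM; [exact: cvg_cst|exact: tailw_continuous].
    by rewrite ger0_norm// mulr_ge0// tailw_ge0.
  - move=> n t _; rewrite lee_fin patchE; case: ifP => // _.
    by rewrite normr0 mulr_ge0// tailw_ge0.
exact: (cvg_unique _ Ilim Ilim0).
Unshelve. all: by end_near. Qed.

(** The boundary terms at infinity vanish because of the tails. All integrations by
    parts on the sphere come from this lemma. *)
Lemma iterated_derive0 m (k : 'I_m) (g dg : 'rV[R]_m -> R) :
  ctail g -> ctail dg ->
  (forall y, is_derive y (delta_mx 0 k) g (dg y)) -> II dg = 0.
Proof.
elim: m k g dg => [[]//|m IH] k g dg tg tdg D /=.
have [j kj|k0] := unliftP ord0 k.
  rewrite (@eq_Rintegral _ _ _ _ _ (fun=> 0)) => [|t _].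
    by rewrite Rintegral_cst// mul0r.
  apply: (IH j (fun y => g (rcons0 t y))).
  - exact: ctail_slice.
  - exact: ctail_slice.
  move=> y; have := D (rcons0 t y); rewrite kj deltaS_rcons.
  move=> /is_derive_line h; apply/is_derive_line; move: h.
  by congr is_derive; apply/funext => s; rewrite rcons0Z rcons0D mulr0 addr0.
have [cg [C gC]] := tg; have [cdg [C' dgC]] := tdg.
have [cJ [D1 J1]] := ctail_iter tg; have [cdJ [D2 J2]] := ctail_iter tdg.
have le_max (a b c : R) : 0 <= c -> a * c <= Num.max a b * c /\ b * c <= Num.max a b * c.
  by move=> c0; rewrite !ler_wpM2r ?le_max ?lexx ?orbT.
apply: (@Rintegral_derive0 (fun t => II (fun y => g (rcons0 t y))) _ (Num.max D1 D2)) => //.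
- by move=> t; rewrite (le_trans (J1 t))//; have [] := le_max D1 D2 _ (tailw_ge0 t).
- by move=> t; rewrite (le_trans (J2 t))//; have [] := le_max D1 D2 _ (tailw_ge0 t).
have bnd (h : 'rV[R]_m.+1 -> R) (E : R) : (forall y, `|h y| <= E * tailprod y) -> forall t y, `|h (@rcons0 m t y)| <= `|E| * tailprod y.
  move=> hE t y; rewrite (le_trans (hE _))// tailprod_cons.
  rewrite (@le_trans _ _ (`|E| * (tailw t * tailprod y)))//.
    by rewrite ler_wpM2r ?ler_norm// mulr_ge0 ?tailw_ge0// ltW// tailprod_gt0.
  rewrite ler_wpM2l// ler_piMl ?tailw_le1// ltW// tailprod_gt0//.
apply: (@iterated_is_derive m (Num.max `|C| `|C'|)
   (fun t y => g (rcons0 t y)) (fun t y => dg (rcons0 t y))).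
- exact: slice_continuous.
- exact: slice_continuous.
- move=> t y; rewrite (le_trans (bnd _ _ gC t y))//.
  by have [] := le_max `|C| `|C'| _ (ltW (tailprod_gt0 y)).
- move=> t y; rewrite (le_trans (bnd _ _ dgC t y))//.
  by have [] := le_max `|C| `|C'| _ (ltW (tailprod_gt0 y)).
- move=> t y; have := D (rcons0 t y); rewrite k0 delta0_rcons.
  move=> /is_derive_line h; apply/is_derive_line; move: h.
  by congr is_derive; apply/funext => s; rewrite rcons0Z rcons0D scaler0 addr0 [s *: 1]/GRing.scale.
Qed.

End Iterated.

(** * Alternating multilinear functions *)

Section AlternatingForm.
Variables (R : realType) (N : nat) (D : 'M[R]_N -> R).
Hypothesis multi : forall (A B C : 'M[R]_N) i0 b c,
  row i0 A = b *: row i0 B + c *: row i0 C ->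
  (forall i, i != i0 -> row i B = row i A) ->
  (forall i, i != i0 -> row i C = row i A) -> D A = b * D B + c * D C.
Hypothesis alt : forall (A : 'M[R]_N) i1 i2, i1 != i2 -> A i1 =1 A i2 -> D A = 0.

Definition set_row (A : 'M[R]_N) i (v : 'rV[R]_N) : 'M[R]_N :=
  \matrix_(k, j) if k == i then v 0 j else A k j.

Lemma row_set_row A i v : row i (set_row A i v) = v.
Proof. by apply/rowP => j; rewrite !mxE eqxx. Qed.

Lemma row_set_row_neq A i v k : k != i -> row k (set_row A i v) = row k A.
Proof. by move=> ki; apply/rowP => j; rewrite !mxE (negPf ki). Qed.

Lemma set_rowD A i b c v w :
  D (set_row A i (b *: v + c *: w)) = b * D (set_row A i v) + c * D (set_row A i w).
Proof.
by apply: (multi (i0 := i)) => [|k ki|k ki]; rewrite ?row_set_row ?row_set_row_neq.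
Qed.

Lemma set_row_sum A i (I : Type) (r : seq I) (c : I -> R) (v : I -> 'rV[R]_N) :
  D (set_row A i (\sum_(j <- r) c j *: v j)) = \sum_(j <- r) c j * D (set_row A i (v j)).
Proof.
elim: r => [|j r IH].
  rewrite !big_nil -[0 in LHS](addr0 0) -[0 in X in X + _](scale0r (0 : 'rV[R]_N)).
  by rewrite -[0 in X in _ + X](scale0r (0 : 'rV[R]_N)) set_rowD !mul0r addr0.
by rewrite !big_cons -[\sum_(_ <- _) _ *: _]scale1r set_rowD IH mul1r.
Qed.

Lemma alt_swap (A : 'M[R]_N) i1 i2 : i1 != i2 -> D (xrow i1 i2 A) = - D A.
Proof.
move=> i12.
pose M v w := set_row (set_row A i1 v) i2 w.
have ME v w : M v w = set_row (set_row A i2 w) i1 v.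
  apply/matrixP => k j; rewrite !mxE.
  by have [->|] := eqVneq k i2; rewrite // eq_sym (negPf i12).
have M0 v : D (M v v) = 0.
  apply: (alt i12) => j; rewrite !mxE eqxx (negPf i12) eqxx//.
have Ml v v' w : D (M (v + v') w) = D (M v w) + D (M v' w).
  by have := set_rowD (set_row A i2 w) i1 1 1 v v'; rewrite !scale1r !mul1r -!ME.
have Mr v w w' : D (M v (w + w')) = D (M v w) + D (M v w').
  by have := set_rowD (set_row A i1 v) i2 1 1 w w'; rewrite !scale1r !mul1r.
have AE : A = M (row i1 A) (row i2 A).
  apply/matrixP => k j; rewrite !mxE.
  by have [->//|_] := eqVneq k i2; have [->|] := eqVneq k i1.
have XE : xrow i1 i2 A = M (row i2 A) (row i1 A).
  apply/matrixP => k j; rewrite !mxE.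
  have [->|k2] := eqVneq k i2; first by rewrite tpermR.
  by have [->|k1] := eqVneq k i1; rewrite ?tpermL// tpermD// eq_sym.
have := M0 (row i1 A + row i2 A).
rewrite Ml !Mr !M0 add0r addr0 -XE -AE => /eqP.
by rewrite addrC addr_eq0 => /eqP.
Qed.

Lemma alt_perm (s : 'S_N) (A : 'M[R]_N) : D (row_perm s A) = (-1) ^+ s * D A.
Proof.
have [ts -> dts] := prod_tpermP s.
elim: ts dts A => [_ A|t ts IH /= /andP[t12 dts] A].
  by rewrite big_nil row_perm1 odd_perm1 expr0 mul1r.
rewrite big_cons odd_mul_tperm t12 row_permM.
rewrite -[row_perm (tperm _ _) _]/(xrow t.1 t.2 _) alt_swap// IH//.
by case: (odd_perm _) => /=; rewrite ?expr1 ?expr0; ring.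
Qed.

Lemma alt_basis (g : 'I_N -> 'I_N) : D 1%:M = 0 ->
  D (\matrix_(i, j) (j == g i)%:R) = 0.
Proof.
move=> D1; have [gi|/injectivePn[i1 [i2 i12 g12]]] := boolP (injectiveb g).
  have -> : \matrix_(i, j) (j == g i)%:R = row_perm (perm (injectiveP _ gi)) (1%:M : 'M[R]_N).
    by apply/matrixP => i j; rewrite !mxE permE eq_sym.
  by rewrite alt_perm D1 mulr0.
by apply: (alt i12) => j; rewrite !mxE g12.
Qed.

(** Expanding one row after the other in the canonical basis leaves matrices whose rows
    are basis vectors, and these are permutations of the identity unless two rows agree. *)
Lemma alt_zero : D 1%:M = 0 -> forall A, D A = 0.
Proof.
move=> D1.
suff H k : (k <= N)%N -> forall A g, (forall i : 'I_N, (k <= i)%N -> row i A = delta_mx 0 (g i)) -> D A = 0.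
  move=> A; apply: (H N (leqnn N) A id) => i.
  by rewrite leqNgt ltn_ord.
elim: k => [|k IH] kN A g Ag.
  rewrite (_ : A = \matrix_(i, j) (j == g i)%:R) ?alt_basis//.
  apply/matrixP => i j; have /rowP/(_ j) := Ag i (leq0n _).
  by rewrite !mxE eqxx.
pose i0 := Ordinal kN.
have -> : A = set_row A i0 (\sum_j A i0 j *: delta_mx 0 j).
  apply/matrixP => i j; rewrite !mxE.
  have [->|//] := eqVneq i i0; rewrite summxE (bigD1 j)//= !mxE !eqxx mulr1 big1 ?addr0// => l lj.
  by rewrite !mxE eq_sym (negPf lj) mulr0.
rewrite set_row_sum big1// => j _.
rewrite (IH (ltnW kN) _ (fun i => if i == i0 then j else g i)) ?mulr0// => i ki.
have [->|ii0] := eqVneq i i0; first by rewrite row_set_row.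
rewrite row_set_row_neq// Ag// ltn_neqAle ki andbT.
by apply: contra ii0 => /eqP ki'; apply/eqP/val_inj.
Qed.

End AlternatingForm.

(** The difference of the two sides is alternating and vanishes at the identity, see
    alt_zero. *)
Lemma alternating_det (R : realType) N (D : 'M[R]_N -> R) :
  (forall (A B C : 'M[R]_N) i0 b c,
    row i0 A = b *: row i0 B + c *: row i0 C ->
    (forall i, i != i0 -> row i B = row i A) ->
    (forall i, i != i0 -> row i C = row i A) -> D A = b * D B + c * D C) ->
  (forall (A : 'M[R]_N) i1 i2, i1 != i2 -> A i1 =1 A i2 -> D A = 0) ->
  forall A, D A = \det A * D 1%:M.
Proof.
move=> multi alt A; apply/eqP; rewrite -subr_eq0; apply/eqP.
apply: (@alt_zero R N (fun A => D A - \det A * D 1%:M)) => [{}A B C i0 b c h1 h2 h3|{}A i1 i2 i12 A12|].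
- have row'E (X Y : 'M[R]_N) : (forall i, i != i0 -> row i X = row i Y) -> row' i0 X = row' i0 Y.
    move=> h; apply/matrixP => i j; rewrite !mxE.
    have li : lift i0 i != i0 by rewrite eq_sym neq_lift.
    by have /rowP/(_ j) := h _ li; rewrite !mxE.
  rewrite (multi _ _ _ _ _ _ h1 h2 h3) (determinant_multilinear h1 (row'E _ _ h2) (row'E _ _ h3)).
  ring.
- by rewrite (alt _ _ _ i12 A12) (determinant_alternate i12 A12) mul0r subrr.
- by rewrite det1 mul1r subrr.
Qed.

(** * The contact volume form *)

Section EuclideanForm.
Variables (R : realType) (n : nat).
Notation V := (Cspace R n).
Notation m := (n.*2.+1).
Implicit Types (x y v w : V).

Lemma edotC x y : edot x y = edot y x.
Proof. by apply: eq_bigr => j _; rewrite mulrC [X in _ + X]mulrC. Qed.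

Lemma edotDl x y v : edot (x + y) v = edot x v + edot y v.
Proof. by rewrite -big_split; apply: eq_bigr => j _ /=; rewrite !mxE; ring. Qed.

Lemma edotZl c x v : edot (c *: x) v = c * edot x v.
Proof. by rewrite /edot mulr_sumr; apply: eq_bigr => j _ /=; rewrite !mxE; ring. Qed.

Lemma edotNl x v : edot (- x) v = - edot x v.
Proof. by rewrite -scaleN1r edotZl mulN1r. Qed.

Lemma edotBl x y v : edot (x - y) v = edot x v - edot y v.
Proof. by rewrite edotDl edotNl. Qed.

Lemma edotDr x y v : edot v (x + y) = edot v x + edot v y.
Proof. by rewrite edotC edotDl !(edotC v). Qed.

Lemma edotZr c x v : edot v (c *: x) = c * edot v x.
Proof. by rewrite edotC edotZl (edotC v). Qed.

Lemma edotNr x v : edot v (- x) = - edot v x.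
Proof. by rewrite edotC edotNl (edotC v). Qed.

Lemma edotBr x y v : edot v (x - y) = edot v x - edot v y.
Proof. by rewrite edotDr edotNr. Qed.

Lemma edot0l x : edot 0 x = 0.
Proof. by rewrite -[0 in LHS](scale0r x) edotZl mul0r. Qed.

Lemma edot_suml (I : Type) (r : seq I) (P : pred I) (F : I -> V) x :
  edot (\sum_(i <- r | P i) F i) x = \sum_(i <- r | P i) edot (F i) x.
Proof.
elim: r => [|i r IH]; first by rewrite !big_nil edot0l.
by rewrite !big_cons; case: ifP => _; rewrite ?edotDl IH.
Qed.

Lemma edot_sumr (I : Type) (r : seq I) (P : pred I) (F : I -> V) x :
  edot x (\sum_(i <- r | P i) F i) = \sum_(i <- r | P i) edot x (F i).
Proof. by rewrite edotC edot_suml; apply: eq_bigr => i _; exact: edotC. Qed.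

Lemma edot_ge0 x : 0 <= edot x x.
Proof. by apply: sumr_ge0 => j _; rewrite addr_ge0// -expr2 sqr_ge0. Qed.

Lemma JmulZ c x : Jmul (c *: x) = c *: Jmul x.
Proof. by rewrite /Jmul [c *: (_, _)]surjective_pairing/= scalerN. Qed.

Lemma JmulD x y : Jmul (x + y) = Jmul x + Jmul y.
Proof. by rewrite /Jmul [(- _, _) + _]surjective_pairing/= opprD. Qed.

Lemma edotJ x y : edot (Jmul x) (Jmul y) = edot x y.
Proof. by apply: eq_bigr => j _ /=; rewrite !mxE; ring. Qed.

Lemma edotJl x y : edot (Jmul x) y = - edot x (Jmul y).
Proof. by rewrite -sumrN; apply: eq_bigr => j _ /=; rewrite !mxE; ring. Qed.

Lemma edotJx x : edot x (Jmul x) = 0.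
Proof. by apply: big1 => j _ /=; rewrite !mxE; ring. Qed.

(** The standard symplectic form: up to constants both theta_0 (with the base point as
    first argument) and its exterior derivative. *)
Definition omega x y : R := edot (Jmul x) y.

Lemma omegaDl x y v : omega (x + y) v = omega x v + omega y v.
Proof. by rewrite /omega JmulD edotDl. Qed.
Lemma omegaZl c x v : omega (c *: x) v = c * omega x v.
Proof. by rewrite /omega JmulZ edotZl. Qed.
Lemma omegaDr x y v : omega v (x + y) = omega v x + omega v y.
Proof. exact: edotDr. Qed.
Lemma omegaZr c x v : omega v (c *: x) = c * omega v x.
Proof. exact: edotZr. Qed.
Lemma omegaxx x : omega x x = 0.
Proof. by rewrite /omega edotC edotJx. Qed.
Lemma omegaC x y : omega x y = - omega y x.
Proof. by rewrite /omega edotJl edotC. Qed.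

Lemma theta0E x v : theta0 x v = 2 * omega x v.
Proof.
rewrite /theta0 /omega /edot [RHS]mulr_sumr.
have -> : (Complex 0 1 * \sum_(j < n.+1) (coordC x j * conjc (coordC v j) - conjc (coordC x j) * coordC v j)) =
  \sum_(j < n.+1) Complex (2 * ((Jmul x).1 0 j * v.1 0 j + (Jmul x).2 0 j * v.2 0 j)) 0.
  rewrite mulr_sumr; apply: eq_bigr => j _; rewrite /coordC /=.
  by apply/eqP; rewrite eq_complex /= !mxE; apply/andP; split; apply/eqP; ring.
by rewrite raddf_sum.
Qed.

Lemma ext_deriv_theta0 x v w : ext_deriv (@theta0 R n) x v w = 4 * omega v w.
Proof.
have D (a b : V) : is_derive x a (fun y => theta0 y b) (2 * omega a b).
  apply/is_derive_line.
  rewrite (_ : (fun s : R => _) = (fun s : R => 2 * omega x b + s * (2 * omega a b))); last first.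
    by apply/funext => s; rewrite theta0E omegaDl omegaZl; ring.
  exact: pder_affine.
rewrite /ext_deriv; have [_ ->] := D v w; have [_ ->] := D w v.
by rewrite (omegaC w v); ring.
Qed.

(** The slots 2k+1 and 2k+2 are the two arguments of the k-th factor d theta_0. *)
Definition pos1 (k : 'I_n) : 'I_m := inord k.*2.+1.
Definition pos2 (k : 'I_n) : 'I_m := inord k.*2.+2.

Lemma pos1E k : pos1 k = k.*2.+1 :> nat.
Proof. rewrite inordK//; have := ltn_ord k; lia. Qed.
Lemma pos2E k : pos2 k = k.*2.+2 :> nat.
Proof. rewrite inordK//; have := ltn_ord k; lia. Qed.

Lemma pos1_neq0 k : pos1 k != ord0.
Proof. by apply/eqP => /(congr1 val)/=; rewrite pos1E. Qed.
Lemma pos2_neq0 k : pos2 k != ord0.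
Proof. by apply/eqP => /(congr1 val)/=; rewrite pos2E. Qed.
Lemma pos12_neq k l : pos1 k != pos2 l.
Proof. by apply/eqP => /(congr1 val)/=; rewrite pos1E pos2E; lia. Qed.
Lemma pos1_inj : injective pos1.
Proof. by move=> k l /(congr1 val)/=; rewrite !pos1E => kl; apply: val_inj => /=; lia. Qed.
Lemma pos2_inj : injective pos2.
Proof. by move=> k l /(congr1 val)/=; rewrite !pos2E => kl; apply: val_inj => /=; lia. Qed.

Lemma pos_cases (i : 'I_m) : i = ord0 \/ exists k, i = pos1 k \/ i = pos2 k.
Proof.
have [->|i0] := eqVneq i ord0; first by left.
right; have i_gt0 : (0 < i)%N.
  by rewrite lt0n; apply: contra i0 => /eqP i0; apply/eqP/val_inj.
have kn : ((i.-1)./2 < n)%N by have := ltn_ord i; lia.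
exists (Ordinal kn); case: (boolP (odd i)) => oi; [left|right].
  by apply: val_inj; rewrite /= pos1E /=; lia.
by apply: val_inj; rewrite /= pos2E /=; lia.
Qed.

Definition wedge_term (w0 : V) (w : 'I_m -> V) (s : 'S_m) : R :=
  omega w0 (w (s ord0)) * \prod_(k < n) omega (w (s (pos1 k))) (w (s (pos2 k))).

(** The contact volume form up to a constant, with the base point as an additional
    vector w0. As a function of w0 and of the 2n+1 others it is alternating, hence a
    multiple of the determinant on C^(n+1). *)
Definition wedge (w0 : V) (w : 'I_m -> V) : R := \sum_(s : 'S_m) (-1) ^+ s * wedge_term w0 w s.

Lemma wedge_termD1 k w0 (w : 'I_m -> V) (s : 'S_m) : wedge_term w0 w s = omega w0 (w (s ord0)) *
  (omega (w (s (pos1 k))) (w (s (pos2 k))) *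
   \prod_(i < n | i != k) omega (w (s (pos1 i))) (w (s (pos2 i)))).
Proof. by rewrite /wedge_term (bigD1 k). Qed.

Lemma contact_volumeE x vs :
  contact_volume (@theta0 R n) x vs = (2 ^+ n)^-1 * (2 * 4 ^+ n) * wedge x vs.
Proof.
rewrite /contact_volume -mulrA; congr (_ * _).
rewrite /wedge mulr_sumr; apply: eq_bigr => s _.
rewrite theta0E /wedge_term.
under eq_bigr do rewrite ext_deriv_theta0.
rewrite big_split /= prodr_const card_ord.
by move: ((-1) ^+ s) (\prod_(k < n) _) (4 ^+ n) => e P q; ring.
Qed.

Lemma wedgeDl a b x y (w : 'I_m -> V) : wedge (a *: x + b *: y) w = a * wedge x w + b * wedge y w.
Proof.
rewrite /wedge !mulr_sumr -big_split; apply: eq_bigr => s _ /=.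
by rewrite /wedge_term omegaDl !omegaZl; move: ((-1) ^+ s) (\prod_(k < n) _) => e P; ring.
Qed.

Lemma wedgeDr a b x j (w w1 w2 : 'I_m -> V) : w j = a *: w1 j + b *: w2 j ->
  (forall i, i != j -> w1 i = w i) -> (forall i, i != j -> w2 i = w i) ->
  wedge x w = a * wedge x w1 + b * wedge x w2.
Proof.
move=> wj h1 h2; rewrite /wedge !mulr_sumr -big_split; apply: eq_bigr => s _ /=.
suff -> : wedge_term x w s = a * wedge_term x w1 s + b * wedge_term x w2 s.
  by move: ((-1) ^+ s) => e; ring.
have sE : s (s^-1%g j) = j by rewrite permKV.
have ne i : i != s^-1%g j -> s i != j.
  by apply: contra => /eqP <-; rewrite permK.
have [p0|[k pk]] := pos_cases (s^-1%g j).
  rewrite /wedge_term p0 in sE ne *.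
  have e1 : \prod_(k < n) omega (w1 (s (pos1 k))) (w1 (s (pos2 k))) = \prod_(k < n) omega (w (s (pos1 k))) (w (s (pos2 k))).
    by apply: eq_bigr => k _; rewrite !h1 ?ne ?pos1_neq0 ?pos2_neq0.
  have e2 : \prod_(k < n) omega (w2 (s (pos1 k))) (w2 (s (pos2 k))) = \prod_(k < n) omega (w (s (pos1 k))) (w (s (pos2 k))).
    by apply: eq_bigr => k _; rewrite !h2 ?ne ?pos1_neq0 ?pos2_neq0.
  by rewrite e1 e2 sE wj omegaDr !omegaZr; move: (\prod_(k < n) _) => P; ring.
have n0 : s ord0 != j.
  by apply: ne; case: pk => ->; rewrite eq_sym ?pos1_neq0 ?pos2_neq0.
have nk i : i != k -> (s (pos1 i) != j) && (s (pos2 i) != j).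
  move=> ik; rewrite !ne//; case: pk => ->.
  - by rewrite eq_sym pos12_neq.
  - by apply: contra ik => /eqP/pos2_inj ->.
  - by apply: contra ik => /eqP/pos1_inj ->.
  - by rewrite pos12_neq.
have e1 : \prod_(i < n | i != k) omega (w1 (s (pos1 i))) (w1 (s (pos2 i))) = \prod_(i < n | i != k) omega (w (s (pos1 i))) (w (s (pos2 i))).
  by apply: eq_bigr => i /nk/andP[i1 i2]; rewrite !h1.
have e2 : \prod_(i < n | i != k) omega (w2 (s (pos1 i))) (w2 (s (pos2 i))) = \prod_(i < n | i != k) omega (w (s (pos1 i))) (w (s (pos2 i))).
  by apply: eq_bigr => i /nk/andP[i1 i2]; rewrite !h2.
rewrite !(wedge_termD1 k) e1 e2 (h1 _ n0) (h2 _ n0).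
move: (\prod_(i < n | _) _) => P {e1 e2}.
case: pk => pk.
  have n2 : s (pos2 k) != j by apply: ne; rewrite pk eq_sym pos12_neq.
  by rewrite -pk sE wj (h1 _ n2) (h2 _ n2) omegaDl !omegaZl; ring.
have n1 : s (pos1 k) != j by apply: ne; rewrite pk pos12_neq.
by rewrite -pk sE wj (h1 _ n1) (h2 _ n1) omegaDr !omegaZr; ring.
Qed.

(** Exchanging the two equal arguments is a sign reversing involution on the
    permutations. *)
Lemma wedge_alt x (w : 'I_m -> V) j j' : j != j' -> w j = w j' -> wedge x w = 0.
Proof.
move=> jj wj.
have h : wedge x w = - wedge x w.
  rewrite {1}/wedge (reindex_inj (mulIg (tperm j j'))) -sumrN; apply: eq_bigr => s _ /=.
  rewrite odd_permM odd_tperm jj.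
  have -> : wedge_term x w (s * tperm j j')%g = wedge_term x w s.
    have wt i : w (tperm j j' i) = w i by case: tpermP => // ->.
    rewrite /wedge_term permM wt; congr (_ * _).
    by apply: eq_bigr => k _; rewrite !permM !wt.
  by case: (odd_perm s); rewrite ?expr0 ?expr1 ?mul1r ?mulN1r ?opprK.
lra.
Qed.

(** Group the permutations by the slot i that receives w j. For i = 0 the first factor
    is omega (w j) (w j) = 0. Otherwise exchange slot 0 with the partner i' of i: the
    product of the two symplectic factors involved is symmetric under this exchange,
    while the signature changes sign. *)
Lemma wedge_alt0 (w : 'I_m -> V) j : wedge (w j) w = 0.
Proof.
have partner (i : 'I_m) : i != ord0 -> exists i', i' != ord0 /\ i' != i /\
    forall s : 'S_m, s i = j -> wedge_term (w j) w (tperm ord0 i' * s)%g = wedge_term (w j) w s.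
  move=> i0; have [|[k [->|->]]] := pos_cases i; first by move/eqP; rewrite (negPf i0).
    exists (pos2 k); rewrite pos2_neq0 eq_sym pos12_neq; do 2!split => //; move=> s si.
    rewrite !(wedge_termD1 k) !permM tpermL tpermR tpermD; [|by rewrite eq_sym pos1_neq0|by rewrite eq_sym pos12_neq].
    rewrite si mulrA [RHS]mulrA; congr (_ * _); first by rewrite mulrC.
    apply: eq_bigr => l lk; rewrite !permM !tpermD//; rewrite 1?eq_sym ?pos1_neq0 ?pos2_neq0 ?pos12_neq//.
    by apply: contra lk => /eqP/pos2_inj ->.
  exists (pos1 k); rewrite pos1_neq0 pos12_neq; do 2!split => //; move=> s si.
  rewrite !(wedge_termD1 k) !permM tpermL tpermR tpermD; [|by rewrite eq_sym pos2_neq0|by rewrite pos12_neq].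
  rewrite si mulrA [RHS]mulrA; congr (_ * _); first by rewrite [RHS]mulrC omegaC (omegaC (w (s ord0))) mulrNN.
  apply: eq_bigr => l lk; rewrite !permM !tpermD//; rewrite 1?eq_sym ?pos1_neq0 ?pos2_neq0// 1?eq_sym ?pos12_neq//.
  by apply: contra lk => /eqP/pos1_inj ->.
rewrite /wedge (partition_big (fun s : 'S_m => s^-1%g j) xpredT)//=; apply: big1 => i _.
have [->|i0] := eqVneq i ord0.
  apply: big1 => s /eqP sj; rewrite /wedge_term -sj permKV omegaxx mul0r mulr0//.
have [i' [i'0 [i'i h]]] := partner i i0.
set S := \sum_(_ | _) _.
suff : S = - S by lra.
rewrite {1}/S (reindex_inj (mulgI (tperm ord0 i'))) -sumrN.
apply: eq_big => s /=.
  rewrite invMg permM tpermV.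
  by case: tpermP => // ->; rewrite ?(negPf i'i) [ord0 == i]eq_sym (negPf i0).
rewrite invMg permM tpermV => /eqP sj.
have si : s i = j.
  have : tperm ord0 i' (tperm ord0 i' (s^-1%g j)) = i.
    by rewrite sj tpermD// eq_sym.
  by rewrite tpermK => <-; rewrite permKV.
rewrite h// odd_permM odd_tperm eq_sym i'0.
by case: (odd_perm s); rewrite ?expr0 ?expr1 ?mul1r ?mulN1r ?opprK.
Qed.

End EuclideanForm.

(** * Stereographic projection *)

Section StereoGeometry.
Variables (R : realType) (n : nat).
Notation V := (Cspace R n).
Notation m := (n.*2.+1).
Implicit Types (x v w : V) (y z : 'rV[R]_m).

Definition emb (y : 'rV[R]_m) : V :=
  (\row_(j < n.+1) y 0 (inord j),
   \row_(j < n.+1) if j == ord_max then 0 else y 0 (inord (n.+1 + j))).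
Definition pole : V := (0, delta_mx 0 ord_max).
Definition prj (x : V) : 'rV[R]_m :=
  \row_(k < m) if (k < n.+1)%N then x.1 0 (inord k) else x.2 0 (inord (k - n.+1)).
Definition sqn (y : 'rV[R]_m) : R := \sum_k y 0 k ^+ 2.
Definition lam (y : 'rV[R]_m) : R := 2 / (sqn y + 1).

Lemma sqn_ge0 y : 0 <= sqn y.
Proof. by apply: sumr_ge0 => k _; exact: sqr_ge0. Qed.

Lemma sqn1_gt0 y : 0 < sqn y + 1.
Proof. by rewrite ltr_wpDl// sqn_ge0. Qed.

Lemma lam_gt0 y : 0 < lam y.
Proof. by rewrite divr_gt0// sqn1_gt0. Qed.

Lemma lam_sqn y : lam y * sqn y = 2 - lam y.
Proof. by rewrite /lam; field; rewrite gt_eqF// sqn1_gt0. Qed.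

Lemma embD y z : emb (y + z) = emb y + emb z.
Proof.
rewrite /emb [RHS]surjective_pairing/=; congr pair; apply/rowP => j; rewrite !mxE//.
by case: eqVneq; rewrite ?addr0.
Qed.

Lemma embZ c y : emb (c *: y) = c *: emb y.
Proof.
rewrite /emb [RHS]surjective_pairing/=; congr pair; apply/rowP => j; rewrite !mxE//.
by case: eqVneq; rewrite ?mulr0.
Qed.

Lemma stereoE y : stereo y = pole + lam y *: (emb y - pole).
Proof.
have h := sqn1_gt0 y.
rewrite /stereo -/(sqn y) [RHS]surjective_pairing/=.
congr pair; apply/rowP => j; rewrite !mxE ?eqxx/=.
  by rewrite /lam; field; rewrite gt_eqF.
by case: (eqVneq j ord_max) => _ /=; rewrite /lam; field; rewrite gt_eqF.
Qed.

Lemma edot_pole x : edot x pole = x.2 0 ord_max.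
Proof.
rewrite /edot (bigD1 ord_max)//= big1 => [|j jm].
  by rewrite !mxE !eqxx /=; ring.
by rewrite !mxE (negPf jm) andbF /=; ring.
Qed.

Lemma edot_pole_pole : edot pole pole = 1.
Proof. by rewrite edot_pole !mxE !eqxx. Qed.

Lemma edot_emb_pole y : edot (emb y) pole = 0.
Proof. by rewrite edot_pole mxE eqxx. Qed.

Lemma edot_emb y z : edot (emb y) (emb z) = \sum_k y 0 k * z 0 k.
Proof.
pose F (k : nat) := y 0 (inord k) * z 0 (inord k).
have -> : \sum_(k < m) y 0 k * z 0 k = \sum_(0 <= k < m) F k.
  by rewrite big_mkord; apply: eq_bigr => k _; rewrite /F inord_val.
rewrite (@big_cat_nat _ _ _ n.+1)//=; last by lia.
rewrite /edot big_split/=; congr (_ + _).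
  by rewrite big_mkord; apply: eq_bigr => j _; rewrite !mxE.
have -> : \sum_(n.+1 <= i < m) F i = \sum_(0 <= i < n) F (i + n.+1)%N.
  by rewrite -{1}[n.+1]add0n big_addn (_ : m - n.+1 = n)%N//; lia.
rewrite big_ord_recr/= !mxE eqxx mulr0 addr0 big_mkord.
apply: eq_bigr => j _; rewrite !mxE.
have /negPf -> : widen_ord (leqnSn n) j != ord_max.
  by apply/eqP => /(congr1 val)/=; have := ltn_ord j; lia.
by rewrite /F /= addnC.
Qed.

Lemma emb_prj x : emb (prj x) = x - edot x pole *: pole.
Proof.
rewrite edot_pole [RHS]surjective_pairing/=; congr pair; apply/rowP => j; rewrite !mxE/=.
  have jm : (j < m)%N by have := ltn_ord j; lia.
  by rewrite inordK// ltn_ord inord_val mulr0 subr0.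
case: eqVneq => [->|jm]; first by rewrite mulr1 subrr.
have jn : (j < n)%N.
  have := ltn_ord j; rewrite ltnS leq_eqVlt => /orP[/eqP jn|//].
  by move: jm; rewrite -val_eqE/= jn eqxx.
rewrite mulr0 subr0 inordK; last by lia.
by rewrite ifN; [rewrite addKn inord_val|rewrite -leqNgt leq_addr].
Qed.

Lemma edot_stereo y : edot (stereo y) (stereo y) = 1.
Proof.
rewrite stereoE !(edotDl, edotDr, edotZl, edotZr, edotNl, edotNr) edot_pole_pole edot_emb.
rewrite (edotC pole) edot_emb_pole.
have -> : \sum_k y 0 k * y 0 k = sqn y by apply: eq_bigr => k _; rewrite expr2.
transitivity (1 + lam y * (lam y * sqn y + lam y - 2)); first by ring.
by rewrite lam_sqn; ring.
Qed.

Lemma sphere_stereo y : sphere (stereo y).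
Proof. by rewrite /sphere/= /enorm edot_stereo sqrtr1. Qed.

(** The partial derivatives of the chart (stereo_is_derive); they are orthogonal,
    tangent to the sphere and all of length lam y. *)
Definition dstereo y (k : 'I_m) : V :=
  lam y *: emb (delta_mx 0 k) - (lam y ^+ 2 * y 0 k) *: (emb y - pole).

Lemma edot_emb_delta y k : edot (emb y) (emb (delta_mx 0 k)) = y 0 k.
Proof.
rewrite edot_emb (bigD1 k)//= big1 ?addr0 => [|l lk].
  by rewrite mxE !eqxx mulr1.
by rewrite mxE (negPf lk) andbF mulr0.
Qed.

Lemma edot_dstereo y k l : edot (dstereo y k) (dstereo y l) = lam y ^+ 2 * (k == l)%:R.
Proof.
rewrite !(edotDl, edotDr, edotZl, edotZr, edotNl, edotNr) edot_pole_pole.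
rewrite !(edotC pole) !edot_emb_pole !(edotC (emb (delta_mx 0 k))) !edot_emb_delta edot_emb.
have -> : \sum_k y 0 k * y 0 k = sqn y by apply: eq_bigr => i _; rewrite expr2.
rewrite [delta_mx _ _ _ _]mxE eqxx/=.
transitivity (lam y ^+ 2 * (k == l)%:R + lam y ^+ 3 * y 0 k * y 0 l * (lam y * sqn y + lam y - 2)); first by ring.
by rewrite lam_sqn; ring.
Qed.

Lemma edot_stereo_dstereo y k : edot (stereo y) (dstereo y k) = 0.
Proof.
rewrite stereoE !(edotDl, edotDr, edotZl, edotZr, edotNl, edotNr) edot_pole_pole.
rewrite !(edotC pole) !edot_emb_pole !edot_emb_delta edot_emb.
have -> : \sum_k y 0 k * y 0 k = sqn y by apply: eq_bigr => i _; rewrite expr2.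
transitivity (lam y ^+ 2 * y 0 k * (2 - lam y - lam y * sqn y)); first by ring.
by rewrite lam_sqn; ring.
Qed.

Lemma sqn_line y k s : sqn (y + s *: delta_mx 0 k) = sqn y + 2 * s * y 0 k + s ^+ 2.
Proof.
rewrite /sqn (bigD1 k)//= (bigD1 k (P := xpredT))//=.
rewrite !mxE !eqxx (eq_bigr (fun i => y 0 i ^+ 2)); last first.
  by move=> i ik; rewrite !mxE (negPf ik) andbF mulr0 addr0.
by move: (\sum_(i | _) _) => P /=; ring.
Qed.

Lemma lam_is_derive y k : is_derive y (delta_mx 0 k) lam (- (lam y ^+ 2 * y 0 k)).
Proof.
apply/is_derive_line.
have h1 : is_derive (0 : R) 1 (fun s : R => sqn (y + s *: delta_mx 0 k) + 1) (2 * y 0 k).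
  rewrite (_ : (fun s : R => _) = (fun s : R => (sqn y + 1 + s * (2 * y 0 k)) + s ^+ 2)); last first.
    by apply/funext => s; rewrite sqn_line; ring.
  have h := pderD (pder_affine (0 : R) (sqn y + 1) (2 * y 0 k)) (pderX 2 (pder_id (0 : R) 1)).
  apply: (pder_eq h).
  by rewrite /= expr1; ring.
have e0 : sqn (y + (0 : R) *: delta_mx 0 k) = sqn y by rewrite scale0r addr0.
have h2 : sqn (y + (0 : R) *: delta_mx 0 k) + 1 != 0 by rewrite e0 gt_eqF// sqn1_gt0.
have h := pderZ 2 (pderV (f := fun s : R => sqn (y + s *: delta_mx 0 k) + 1) h2 h1).
apply: (pder_eq h).
rewrite e0 /lam; field; rewrite gt_eqF// sqn1_gt0//.
Qed.

Lemma pderZv (a : R -> R) (v : V) (t da : R) : is_derive t 1 a da ->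
  is_derive t 1 (fun s => a s *: v) (da *: v).
Proof.
move=> [ha hda].
have h : (fun h : R => h^-1 *: ((fun s => a s *: v) (h *: 1 + t) - a t *: v)) @ 0^' --> da *: v.
  rewrite (_ : (fun h : R => _) = (fun h : R => (h^-1 *: (a (h *: 1 + t) - a t)) *: v)); last first.
    by apply/funext => h; rewrite -scalerBl scalerA.
  by apply: cvgZr_tmp; rewrite -hda; exact: ha.
by apply: DeriveDef; [apply/cvg_ex; exists (da *: v)|exact/cvg_lim].
Qed.

Lemma stereo_line y k (s : R) : stereo (y + s *: delta_mx 0 k) =
  pole + lam (y + s *: delta_mx 0 k) *: (emb y - pole) + (s * lam (y + s *: delta_mx 0 k)) *: emb (delta_mx 0 k).
Proof.
rewrite stereoE embD embZ -[RHS]addrA; congr (_ + _).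
by rewrite addrAC scalerDr scalerA (mulrC s).
Qed.

Lemma stereo_is_derive y k : is_derive y (delta_mx 0 k) (@stereo R n) (dstereo y k).
Proof.
apply/(is_derive_line (W := V)).
rewrite (_ : (fun s : R => _) = (fun s : R => (pole + lam (y + s *: delta_mx 0 k) *: (emb y - pole))
   + (s * lam (y + s *: delta_mx 0 k)) *: emb (delta_mx 0 k))); last by apply/funext => s; exact: stereo_line.
have /is_derive_line hl := lam_is_derive y k.
have h1 := pderZv (emb y - pole) hl.
have h2 := pderZv (emb (delta_mx 0 k)) (pderM (pder_id (0 : R) 1) hl).
have h3 := is_deriveD (is_deriveD (is_derive_cst pole (0 : R) 1) h1) h2.
apply: (is_derive_eq h3).
rewrite add0r mul0r addr0 mul1r scale0r addr0 /dstereo scaleNr addrC.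
by [].
Qed.

Definition bas (i : 'I_m.+1) : V :=
  if unlift ord0 i is Some k then emb (delta_mx 0 k) else pole.

Lemma emb_sum y : emb y = \sum_k y 0 k *: emb (delta_mx 0 k).
Proof.
rewrite {1}[y]row_sum_delta.
elim/big_rec2: _ => [|k v w _ <-]; last by rewrite embD embZ.
by rewrite -(scale0r (0 : 'rV[R]_m)) embZ scale0r.
Qed.

Lemma edot_bas_bas i : edot (bas i) (bas i) = 1.
Proof.
rewrite /bas; case: unliftP => [k _|_]; last exact: edot_pole_pole.
by rewrite edot_emb_delta mxE !eqxx.
Qed.

Lemma bas_expand x : x = \sum_i edot x (bas i) *: bas i.
Proof.
rewrite big_ord_recl /bas unlift_none.
rewrite -[LHS](subrK (edot x pole *: pole)) -emb_prj addrC; congr (_ + _).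
rewrite emb_sum; apply: eq_bigr => k _; rewrite liftK; congr (_ *: _).
have -> : edot x (emb (delta_mx 0 k)) = edot (emb (prj x)) (emb (delta_mx 0 k)).
  by rewrite emb_prj edotBl edotZl (edotC pole) edot_emb_pole mulr0 subr0.
by rewrite edot_emb_delta.
Qed.

Lemma edot_bas x v : edot x v = \sum_i edot x (bas i) * edot v (bas i).
Proof.
rewrite {1}[x]bas_expand edot_suml; apply: eq_bigr => i _.
by rewrite edotZl [edot (bas i) v]edotC.
Qed.

Definition comb (r : 'rV[R]_m.+1) : V := \sum_j r 0 j *: bas j.

Lemma combD a b (r s : 'rV[R]_m.+1) : comb (a *: r + b *: s) = a *: comb r + b *: comb s.
Proof.
rewrite /comb !scaler_sumr -big_split; apply: eq_bigr => j _ /=.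
by rewrite !mxE scalerDl !scalerA.
Qed.

Definition wedge_mx (A : 'M[R]_m.+1) : R :=
  wedge (comb (row ord0 A)) (fun k => comb (row (lift ord0 k) A)).

Lemma wedge_mxE A : wedge_mx A = \det A * wedge_mx 1%:M.
Proof.
apply: alternating_det => {A} [A B C i0 b c h1 h2 h3|A i1 i2 i12 A12].
  rewrite /wedge_mx; have [k ik|i00] := unliftP ord0 i0.
    have n0 : ord0 != i0 by rewrite ik neq_lift.
    rewrite (h2 _ n0) (h3 _ n0); apply: (@wedgeDr _ _ b c _ k).
    - by rewrite -ik h1 combD.
    - by move=> i ki; rewrite h2// ik (inj_eq (@lift_inj _ _)).
    - by move=> i ki; rewrite h3// ik (inj_eq (@lift_inj _ _)).
  rewrite i00 in h1 h2 h3; rewrite h1 combD wedgeDl.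
  congr (_ + _); congr (_ * _); congr wedge; apply/funext => k.
    by rewrite h2// eq_sym neq_lift.
  by rewrite h3// eq_sym neq_lift.
have rE i j : A i =1 A j -> row i A = row j A by move=> h; apply/rowP => k; rewrite !mxE.
have comb0 k : A ord0 =1 A (lift ord0 k) -> wedge_mx A = 0.
  by move=> /rE h; rewrite /wedge_mx h (wedge_alt0 (fun k => comb (row (lift ord0 k) A))).
have [k1 ik1|i10] := unliftP ord0 i1; have [k2 ik2|i20] := unliftP ord0 i2.
- apply: (@wedge_alt _ _ _ _ k1 k2); last by rewrite -ik1 -ik2 (rE _ _ A12).
  by apply: contra i12 => /eqP kk; rewrite ik1 ik2 kk.
- by apply: (comb0 k1) => j; rewrite -ik1 -i20 A12.
- by apply: (comb0 k2) => j; rewrite -ik2 -i10 A12.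
- by move: i12; rewrite i10 i20 eqxx.
Qed.

Definition stereo_mx y : 'M[R]_m.+1 :=
  \matrix_(i, j) edot (if unlift ord0 i is Some k then dstereo y k else stereo y) (bas j).

Lemma wedge_stereo y : wedge (stereo y) (dstereo y) = wedge_mx (stereo_mx y).
Proof.
rewrite /wedge_mx; congr wedge.
  rewrite [LHS]bas_expand; apply: eq_bigr => j _.
  by rewrite !mxE unlift_none.
apply/funext => k; rewrite [LHS]bas_expand; apply: eq_bigr => j _.
by rewrite !mxE liftK.
Qed.

(** The Gram matrix of the frame is diagonal, because the chart is conformal with factor
    lam y and the point stereo y is a unit normal. *)
Lemma det_stereo_mx y : `|\det (stereo_mx y)| = lam y ^+ m.
Proof.
have l0 := ltW (lam_gt0 y).
suff h : \det (stereo_mx y) ^+ 2 = (lam y ^+ m) ^+ 2.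
  by rewrite -[RHS]ger0_norm ?exprn_ge0// -!sqrtr_sqr h.
rewrite expr2 -{2}det_tr -det_mulmx.
have -> : stereo_mx y *m (stereo_mx y)^T =
    diag_mx (\row_i if unlift ord0 i is Some k then lam y ^+ 2 else 1).
  apply/matrixP => i j; rewrite !mxE.
  under eq_bigr do rewrite !mxE.
  rewrite -edot_bas.
  have [k ->|->] := unliftP ord0 i; have [l ->|->] := unliftP ord0 j.
  - by rewrite edot_dstereo (inj_eq (@lift_inj _ _)) mulr_natr.
  - by rewrite edotC edot_stereo_dstereo eq_sym (negPf (neq_lift _ _)).
  - by rewrite edot_stereo_dstereo (negPf (neq_lift _ _)).
  - by rewrite edot_stereo eqxx.
rewrite det_diag big_ord_recl mxE unlift_none mul1r.
under eq_bigr do rewrite mxE liftK.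
by rewrite prodr_const card_ord -!exprM mulnC.
Qed.

(** By wedge_mxE the form is a constant times the determinant of the frame, whose
    absolute value is lam y ^+ m. *)
Lemma contact_density : exists2 c : R, 0 <= c & forall y,
  `|contact_volume (@theta0 R n) (stereo y)
        (fun k => 'D_(delta_mx 0 k) (@stereo R n) y)| = c * lam y ^+ m.
Proof.
exists (`|(2 ^+ n)^-1 * (2 * 4 ^+ n) * wedge_mx 1%:M|) => // y.
have -> : (fun k => 'D_(delta_mx 0 k) (@stereo R n) y) = dstereo y.
  by apply/funext => k; have [_ ->] := stereo_is_derive y k.
rewrite contact_volumeE wedge_stereo wedge_mxE -det_stereo_mx -normrM.
by move: (_ * (2 * _)) (\det _) (wedge_mx _) => a b c; rewrite (mulrC b) mulrA.
Qed.

End StereoGeometry.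

(** * First order calculus on the sphere *)

(** Chain rule along a curve x + a s v + b s w. The mean value theorem is applied in the
    direction v only, so that continuity is required of the derivative in that direction
    alone. *)
Lemma pder_curve2 (R : realType) (V : normedModType R) (f dv : V -> R) (x v w : V)
    (a b : R -> R) (da db dw : R) :
  (\forall p \near x, is_derive p v f (dv p)) -> {for x, continuous dv} ->
  is_derive x w f dw -> a 0 = 0 -> b 0 = 0 ->
  is_derive (0 : R) 1 a da -> is_derive (0 : R) 1 b db ->
  is_derive (0 : R) 1 (fun s => f (x + a s *: v + b s *: w)) (da * dv x + db * dw).
Proof.
move=> fv cdv fw a0 b0 ha hb.
have ca : {for 0, continuous a}.
  by apply: differentiable_continuous; apply/derivable1_diffP; case: ha.
have cb : {for 0, continuous b}.
  by apply: differentiable_continuous; apply/derivable1_diffP; case: hb.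
pose h s := f (x + a s *: v + b s *: w) - f (x + b s *: w).
pose th s := if a s == 0 then dv x else h s / a s.
have hE s : h s = a s * th s.
  rewrite /th; case: eqVneq => [as0|as0]; last by rewrite mulrC divfK.
  by rewrite /h as0 scale0r addr0 subrr mul0r.
have thc : th @ 0 --> dv x.
  apply/cvgrPdist_lt => e e0.
  have hne : \forall p \near x, is_derive p v f (dv p) /\ `|dv x - dv p| < e.
    apply: filterI => //; move: e e0; exact/cvgrPdist_lt.
  move: hne => /nbhs_ballP[d /= d0 hd].
  have na : \forall s \near (0 : R), `|a s| * `|v| + `|b s| * `|w| < d.
    have : (fun s => `|a s| * `|v| + `|b s| * `|w|) @ (0 : R) --> `|a 0| * `|v| + `|b 0| * `|w|.
      apply: cvgD; apply: cvgM; [|exact: cvg_cst| |exact: cvg_cst].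
        exact: (cvg_norm ca).
      exact: (cvg_norm cb).
    rewrite a0 b0 normr0 !mul0r addr0 => hc.
    by apply: (cvgr_lt _ hc).
  near=> s; rewrite /th; case: eqVneq => [as0|as0]; first by rewrite subrr normr0.
  have sd : `|a s| * `|v| + `|b s| * `|w| < d by near: s.
  have inb (r : R) : `|r| <= `|a s| -> ball x d (x + b s *: w + r *: v).
    move=> ra; rewrite -ball_normE/= -addrA opprD addrA subrr sub0r normrN.
    rewrite (le_lt_trans (ler_normD _ _))// !normrZ (le_lt_trans _ sd)// addrC lerD2r.
    by rewrite ler_wpM2r.
  pose F r := f (x + b s *: w + r *: v).
  have dF (r : R) : `|r| <= `|a s| -> is_derive r 1 F (dv (x + b s *: w + r *: v)).
    move=> ra; have [/is_derive_line + _] := hd _ (inb r ra).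
    move=> H; apply/(is_derive_line (W := R)); move: H; congr is_derive.
    by apply/funext => q; rewrite /F [q *: 1]mulr1 scalerDl !addrA.
  have FE : h s = F (a s) - F 0 by rewrite /h /F scale0r addr0 addrAC.
  have [c ca1 hc] : exists2 c, `|c| <= `|a s| & h s = dv (x + b s *: w + c *: v) * a s.
    have Fcont (u1 u2 : R) : (forall r, u1 <= r <= u2 -> `|r| <= `|a s|) -> {within `[u1, u2], continuous F}.
      move=> hu; apply: derivable_within_continuous => r; rewrite in_itv/= => /hu ra.
      by case: (dF r ra).
    have [as1|as1|as1] := ltgtP (a s) 0; last by rewrite as1 eqxx in as0.
      have ra r : a s <= r <= 0 -> `|r| <= `|a s|.
        by move=> /andP[r1 r2]; rewrite !ler0_norm ?lerN2// ltW.
      have [c] := @MVT R F (fun r => dv (x + b s *: w + r *: v)) _ _ as1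
        (fun r (hr : r \in `]a s, 0[) => dF r (ra r ltac:(by move: hr; rewrite in_itv/= => /andP[/ltW -> /ltW ->]))) (Fcont _ _ ra).
      rewrite in_itv/= => /andP[/ltW c1 /ltW c2] hc; exists c; first by rewrite ra// c1.
      by rewrite FE -opprB hc sub0r mulrN opprK.
    have ra r : 0 <= r <= a s -> `|r| <= `|a s|.
      by move=> /andP[r1 r2]; rewrite !ger0_norm// (le_trans r1).
    have [c] := @MVT R F (fun r => dv (x + b s *: w + r *: v)) _ _ as1
        (fun r (hr : r \in `]0, a s[) => dF r (ra r ltac:(by move: hr; rewrite in_itv/= => /andP[/ltW -> /ltW ->]))) (Fcont _ _ ra).
    rewrite in_itv/= => /andP[/ltW c1 /ltW c2] hc; exists c; first by rewrite ra// c1.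
    by rewrite FE hc subr0.
  rewrite hc mulfK//.
  by have [_] := hd _ (inb c ca1).
have h0 : h 0 = 0 by rewrite hE a0 mul0r.
have dh : is_derive (0 : R) 1 h (da * dv x).
  have ac : (fun s : R => s^-1 *: (a (s *: 1 + 0) - a 0)) @ 0^' --> da.
    by case: ha => h1 <-; exact: h1.
  have hc : (fun s : R => s^-1 *: (h (s *: 1 + 0) - h 0)) @ 0^' --> da * dv x.
    rewrite (_ : (fun s : R => _) = (fun s : R => (s^-1 *: (a (s *: 1 + 0) - a 0)) * th s)).
      by apply: cvgM => //; apply: cvg_trans thc; apply: cvg_app; exact: cvg_within.
    apply/funext => s; rewrite h0 a0 !subr0 addr0 [s *: 1]mulr1 hE.
    by rewrite /GRing.scale/= mulrA.
  by apply: DeriveDef; [apply/cvg_ex; exists (da * dv x)|exact/cvg_lim].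
have dw' : is_derive (0 : R) 1 (fun s => f (x + b s *: w)) (db * dw).
  have /is_derive_line hw := fw.
  have hw' : is_derive (b 0) 1 (fun s : R => f (x + s *: w)) dw by rewrite b0.
  by apply: (pder_eq (pder_comp hw' hb)); rewrite mulrC.
have hsum := pderD dh dw'.
rewrite (_ : (fun s => _) = (fun s => h s + f (x + b s *: w)))//.
by apply/funext => s; rewrite /h subrK.
Unshelve. all: by end_near. Qed.

Section SphereTopology.
Variables (R : realType) (n : nat).
Notation V := (Cspace R n).
Notation m := (n.*2.+1).
Notation S := (@sphere R n).
Notation rp := (@radial_proj R n).
Implicit Types (x v w z : V) (phi psi : V -> R).

Lemma coord1_continuous (j : 'I_n.+1) : continuous (fun x : V => x.1 0 j).
Proof.
by move=> x; apply: (@continuous_comp _ _ _ fst (fun y : 'rV[R]_n.+1 => y 0 j)); [exact: cvg_fst|exact: coord_continuous].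
Qed.

Lemma coord2_continuous (j : 'I_n.+1) : continuous (fun x : V => x.2 0 j).
Proof.
by move=> x; apply: (@continuous_comp _ _ _ snd (fun y : 'rV[R]_n.+1 => y 0 j)); [exact: cvg_snd|exact: coord_continuous].
Qed.

Lemma Cspace_continuous (T : topologicalType) (f : T -> V) :
  (forall j, continuous (fun t => (f t).1 0 j)) ->
  (forall j, continuous (fun t => (f t).2 0 j)) -> continuous f.
Proof.
move=> c1 c2.
have -> : f = (fun t => ((f t).1, (f t).2)) by apply/funext => t; case: (f t).
by apply: continuous_pairf; apply: continuous_mx => i j; rewrite (ord1 i).
Qed.

Lemma edot_continuous (T : topologicalType) (f g : T -> V) :
  continuous f -> continuous g -> continuous (fun t => edot (f t) (g t)).
Proof.
have c1 (h : T -> V) : continuous h -> forall j, continuous (fun t => (h t).1 0 j).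
  by move=> ch j t; apply: (@continuous_comp _ _ _ h (fun x : V => x.1 0 j)); [exact: ch|exact: coord1_continuous].
have c2 (h : T -> V) : continuous h -> forall j, continuous (fun t => (h t).2 0 j).
  by move=> ch j t; apply: (@continuous_comp _ _ _ h (fun x : V => x.2 0 j)); [exact: ch|exact: coord2_continuous].
move=> cf cg; apply: contf_sum => j _; apply: contf_add; apply: contf_mul.
- exact: c1.
- exact: c1.
- exact: c2.
- exact: c2.
Qed.

Lemma sphereP x : S x <-> edot x x = 1.
Proof.
rewrite /sphere/= /enorm; split=> [h|->]; last exact: sqrtr1.
by rewrite -(sqr_sqrtr (edot_ge0 x)) h expr1n.
Qed.

Lemma enorm_ge0 x : 0 <= enorm x. Proof. exact: sqrtr_ge0. Qed.

Lemma enorm_sqr x : enorm x ^+ 2 = edot x x.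
Proof. by rewrite sqr_sqrtr// edot_ge0. Qed.

Lemma rp_id x : S x -> rp x = x.
Proof. by rewrite /sphere/= /radial_proj => ->; rewrite invr1 scale1r. Qed.

Lemma rp_sphere w : enorm w != 0 -> S (rp w).
Proof.
move=> w0; apply/sphereP; rewrite /radial_proj edotZl edotZr -enorm_sqr.
by field.
Qed.

Lemma enorm_continuous : continuous (@enorm R n).
Proof.
move=> x; apply: (@continuous_comp V R R (fun x => edot x x) Num.sqrt).
  by apply: edot_continuous => y; exact: cvg_id.
exact: sqrt_continuous.
Qed.

Lemma sphere_neq0 x : S x -> enorm x != 0.
Proof. by rewrite /sphere/= => ->; exact: oner_neq0. Qed.

Lemma near_enorm_neq0 w : enorm w != 0 -> \forall p \near w, enorm p != 0.
Proof.
move=> w0; have wp : 0 < enorm w by rewrite lt_neqAle eq_sym w0 enorm_ge0.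
apply: (filterS _ (cvgr_gt _ (@enorm_continuous w) _ wp)) => p.
by move/gt_eqF => ->.
Qed.

Lemma rp_continuous w : enorm w != 0 -> {for w, continuous rp}.
Proof.
move=> w0; rewrite /radial_proj; apply: cvgZ; last exact: cvg_id.
by apply: cvgV => //; exact: enorm_continuous.
Qed.

Lemma sphere_compact : compact S.
Proof.
have cI : compact [set x : V | (forall i, `[-1, 1]%classic (x.1 ord0 i)) /\ (forall i, `[-1, 1]%classic (x.2 ord0 i))].
  apply: (@compact_setX _ _ [set y : 'rV[R]_n.+1 | forall i, `[-1, 1]%classic (y ord0 i)] [set y : 'rV[R]_n.+1 | forall i, `[-1, 1]%classic (y ord0 i)]).
    by apply: (@rV_compact R _ (fun=> `[-1, 1]%classic)) => i; exact: segment_compact.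
  by apply: (@rV_compact R _ (fun=> `[-1, 1]%classic)) => i; exact: segment_compact.
apply: (subclosed_compact _ cI).
  have -> : S = @enorm R n @^-1` [set 1] by apply/seteqP; split.
  apply: closed_comp => [x _|]; first exact: enorm_continuous.
  exact: closed_eq.
move=> x /sphereP x1.
have h j : x.1 0 j ^+ 2 + x.2 0 j ^+ 2 <= 1.
  rewrite -x1 /edot (bigD1 j)//= -!expr2 lerDl.
  by apply: sumr_ge0 => i _; rewrite addr_ge0// -expr2 sqr_ge0.
have b (a c : R) : a ^+ 2 + c ^+ 2 <= 1 -> -1 <= a <= 1.
  move=> ac; rewrite -ler_norml -(@expr_le1 _ 2)// -normrX ger0_norm ?sqr_ge0//.
  by rewrite (le_trans _ ac)// lerDl sqr_ge0.
split=> i /=; rewrite in_itv/=; first exact: b (h i).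
by apply: (b _ (x.1 0 i)); rewrite addrC.
Qed.

Definition contS phi := {within S, continuous phi}.

Lemma contS_bounded phi : contS phi -> exists2 M, 0 <= M & forall x, S x -> `|phi x| <= M.
Proof.
move=> cphi.
have c : compact (phi @` S) by apply: continuous_compact => //; exact: sphere_compact.
have [M [_ hM]] := compact_bounded c.
exists (Num.max 0 (M + 1)); first by rewrite le_max lexx.
move=> x Sx; rewrite le_max; apply/orP; right.
by apply: (hM (M + 1)); [rewrite ltrDl|exists x].
Qed.

Lemma contS_T phi : continuous phi -> contS phi.
Proof. exact: continuous_subspaceT. Qed.

Lemma contS_comp (T : topologicalType) (f : T -> V) phi : contS phi -> continuous f ->
  (forall t, S (f t)) -> continuous (fun t => phi (f t)).
Proof.
move=> /subspace_continuousP cphi cf Sf t U hU.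
have hn : nbhs (f t) (fun y => S y -> U (phi y)) by exact: (cphi (f t) (Sf t) U hU).
have h1 : nbhs t (fun s => S (f s) -> U (phi (f s))) by exact: (cf t _ hn).
have h2 : nbhs t (fun s => U (phi (f s))) by apply: (filterS _ h1) => s h; exact: h (Sf s).
exact: h2.
Qed.

Lemma contS_rp phi w : contS phi -> enorm w != 0 -> {for w, continuous (phi \o rp)}.
Proof.
move=> /subspace_continuousP cphi w0 U hU.
have hn : nbhs (rp w) (fun y => S y -> U (phi y)) by exact: (cphi _ (rp_sphere w0) U hU).
have h1 : nbhs w (fun p => S (rp p) -> U (phi (rp p))) by exact: (rp_continuous w0 hn).
apply: (filterS _ (filterI h1 (near_enorm_neq0 w0))) => p [h2 /rp_sphere]; exact: h2.
Qed.

Lemma contS_ext phi psi : (forall x, S x -> phi x = psi x) -> contS phi -> contS psi.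
Proof.
move=> e; apply: subspace_eq_continuous => x Sx; exact: e (set_mem Sx).
Qed.

Lemma contS_compat (F : R -> R) phi : contS phi ->
  (forall x, S x -> {for phi x, continuous F}) -> contS (fun x => F (phi x)).
Proof.
move=> /subspace_continuousP cphi cF; apply/subspace_continuousP => x Sx.
exact: (cvg_comp _ _ (cphi x Sx) (cF x Sx)).
Qed.

End SphereTopology.

(** Derivative of the extension of phi that is constant on rays: for a direction z that
    is not tangent this is the derivative along the tangential part of z. Locked, so
    that unification does not look inside. *)
HB.lock Definition tgrad (R : realType) (n : nat) (z : Cspace R n)
    (phi : Cspace R n -> R) (x : Cspace R n) : R :=
  'D_z (phi \o @radial_proj R n) x.
Arguments tgrad {R n} z phi x.

Section TangentialCalculus.
Variables (R : realType) (n : nat).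
Notation V := (Cspace R n).
Notation m := (n.*2.+1).
Notation S := (@sphere R n).
Notation rp := (@radial_proj R n).
Implicit Types (x v w z : V) (phi psi : V -> R).

(** Regularity is expressed by the derivatives of the extension constant on rays, so
    that only the values on the sphere matter. *)
Record C1 phi : Prop := MkC1 {
  C1_cont : contS phi ;
  C1_derivable : forall z x, S x -> derivable (phi \o rp) x z ;
  C1_grad : forall z, contS (tgrad z phi) }.

Lemma C1P phi (d : V -> V -> R) : contS phi ->
  (forall z x, S x -> is_derive x z (phi \o rp) (d z x)) ->
  (forall z, contS (d z)) -> C1 phi.
Proof.
move=> c h cd; split => // [z x /(h z)[]//|z].
by apply: contS_ext (cd z) => x /(h z)[_ <-]; rewrite tgrad.unlock.
Qed.

Lemma C1_is_derive phi z x : C1 phi -> S x -> is_derive x z (phi \o rp) (tgrad z phi x).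
Proof. by rewrite tgrad.unlock => -[_ h _] Sx; apply: DeriveDef => //; exact: h. Qed.

Lemma tgradE phi z x d : is_derive x z (phi \o rp) d -> tgrad z phi x = d.
Proof. by rewrite tgrad.unlock; case. Qed.

Lemma C1_cst (c : R) : C1 (fun=> c).
Proof.
apply: (@C1P _ (fun _ _ => 0)) => [|z x _|z].
- by apply: contS_T; exact: contf_cst.
- exact: pder_cst.
- by apply: contS_T; exact: contf_cst.
Qed.

Lemma tgrad_cst (c : R) z x : tgrad z (fun=> c) x = 0.
Proof. by apply: tgradE; exact: pder_cst. Qed.

Section Algebra.
Variables (phi psi : V -> R).
Hypotheses (hp : C1 phi) (hq : C1 psi).

Lemma tgradD z x : S x -> tgrad z (fun y => phi y + psi y) x = tgrad z phi x + tgrad z psi x.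
Proof. by move=> Sx; apply: tgradE; exact: (pderD (C1_is_derive z hp Sx) (C1_is_derive z hq Sx)). Qed.

Lemma C1D : C1 (fun y => phi y + psi y).
Proof.
apply: (@C1P _ (fun z x => tgrad z phi x + tgrad z psi x)) => [|z x Sx|z].
- by apply: contf_add; exact: C1_cont.
- exact: (pderD (C1_is_derive z hp Sx) (C1_is_derive z hq Sx)).
- by apply: contf_add; exact: C1_grad.
Qed.

Lemma tgradM z x : S x -> tgrad z (fun y => phi y * psi y) x =
  tgrad z phi x * psi x + phi x * tgrad z psi x.
Proof.
move=> Sx; apply: tgradE.
have := pderM (C1_is_derive z hp Sx) (C1_is_derive z hq Sx).
by rewrite /= rp_id.
Qed.

Lemma C1M : C1 (fun y => phi y * psi y).
Proof.
apply: (@C1P _ (fun z x => tgrad z phi x * psi x + phi x * tgrad z psi x)) => [|z x Sx|z].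
- by apply: contf_mul; exact: C1_cont.
- have := pderM (C1_is_derive z hp Sx) (C1_is_derive z hq Sx).
  by rewrite /= rp_id.
- by apply: contf_add; apply: contf_mul; do ?[exact: C1_cont|exact: C1_grad].
Qed.

Lemma tgrad_comp (F dF : R -> R) z x : S x -> is_derive (phi x) 1 F (dF (phi x)) ->
  tgrad z (fun y => F (phi y)) x = dF (phi x) * tgrad z phi x.
Proof.
move=> Sx hF; apply: tgradE.
have hF' : is_derive ((phi \o rp) x) 1 F (dF (phi x)) by rewrite /= rp_id.
exact: (pder_comp hF' (C1_is_derive z hp Sx)).
Qed.

Lemma C1_comp (F dF : R -> R) :
  (forall x, S x -> is_derive (phi x) 1 F (dF (phi x))) ->
  (forall x, S x -> {for phi x, continuous dF}) -> C1 (fun y => F (phi y)).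
Proof.
move=> hF cF.
apply: (@C1P _ (fun z x => dF (phi x) * tgrad z phi x)) => [|z x Sx|z].
- apply: contS_compat => [|x Sx]; first exact: C1_cont.
  by apply: differentiable_continuous; apply/derivable1_diffP; case: (hF x Sx).
- have hF' : is_derive ((phi \o rp) x) 1 F (dF (phi x)) by rewrite /= rp_id//; exact: hF.
  exact: (pder_comp hF' (C1_is_derive z hp Sx)).
- apply: contf_mul; last exact: C1_grad.
  by apply: contS_compat; [exact: C1_cont|].
Qed.

End Algebra.

Lemma C1Z c phi : C1 phi -> C1 (fun y => c * phi y).
Proof. by move=> h; exact: C1M (C1_cst c) h. Qed.

Lemma tgradZ c phi z x : C1 phi -> S x -> tgrad z (fun y => c * phi y) x = c * tgrad z phi x.
Proof. by move=> h Sx; rewrite (tgradM (C1_cst c) h)// tgrad_cst mul0r add0r. Qed.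

Lemma C1N phi : C1 phi -> C1 (fun y => - phi y).
Proof.
move=> h; rewrite (_ : (fun y => _) = (fun y => (-1) * phi y)); first exact: C1Z.
by apply/funext => y; rewrite mulN1r.
Qed.

Lemma tgradN phi z x : C1 phi -> S x -> tgrad z (fun y => - phi y) x = - tgrad z phi x.
Proof.
move=> h Sx; rewrite (_ : (fun y => _) = (fun y => (-1) * phi y)) ?tgradZ ?mulN1r//.
by apply/funext => y; rewrite mulN1r.
Qed.

Lemma C1B phi psi : C1 phi -> C1 psi -> C1 (fun y => phi y - psi y).
Proof. by move=> h k; exact: C1D h (C1N k). Qed.

Lemma tgradB phi psi z x : C1 phi -> C1 psi -> S x ->
  tgrad z (fun y => phi y - psi y) x = tgrad z phi x - tgrad z psi x.
Proof. by move=> h k Sx; rewrite (tgradD h (C1N k))// tgradN. Qed.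

Lemma C1_ext phi psi : (forall x, S x -> phi x = psi x) -> C1 phi -> C1 psi.
Proof.
move=> e h; apply: (@C1P _ (fun z => tgrad z phi)) => [|z x Sx|z].
- exact: contS_ext e (C1_cont h).
- apply: pder_near (C1_is_derive z h Sx).
  apply: filterS (near_enorm_neq0 (sphere_neq0 Sx)) => p p0 /=.
  by rewrite e//; exact: rp_sphere.
- exact: C1_grad.
Qed.

Lemma tgrad_ext phi psi z x : (forall y, S y -> phi y = psi y) -> S x ->
  tgrad z phi x = tgrad z psi x.
Proof.
move=> e Sx; rewrite tgrad.unlock; apply: near_eq_derive.
apply: filterS (near_enorm_neq0 (sphere_neq0 Sx)) => p p0 /=.
by rewrite e//; exact: rp_sphere.
Qed.

(** The extension is homogeneous of degree 0, hence its derivatives are homogeneous of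
    degree -1. *)
Lemma tgrad_homog phi z w : C1 phi -> enorm w != 0 ->
  is_derive w z (phi \o rp) ((enorm w)^-1 * tgrad z phi (rp w)).
Proof.
move=> h w0.
have /is_derive_line H := C1_is_derive z h (rp_sphere w0).
apply/is_derive_line.
have rpZ (c : R) v : 0 < c -> rp (c *: v) = rp v.
  move=> c0; rewrite /radial_proj /enorm edotZl edotZr mulrA -expr2 sqrtrM ?sqr_ge0//.
  rewrite sqrtr_sqr gtr0_norm// scalerA invfM mulrAC mulVf ?gt_eqF// mul1r//.
have wp : 0 < enorm w by rewrite lt_neqAle eq_sym w0 enorm_ge0.
have e (s : R) : rp (w + s *: z) = rp (rp w + (s * (enorm w)^-1) *: z).
  rewrite -(@rpZ (enorm w) (rp w + _))// scalerDr scalerA.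
  by rewrite /radial_proj scalerA mulfV// scale1r mulrCA mulfV// mulr1.
rewrite (_ : (fun s : R => _) = (fun s : R => (phi \o rp) (rp w + (s * (enorm w)^-1) *: z))); last first.
  by apply/funext => s /=; rewrite e.
have H' : is_derive ((0 : R) * (enorm w)^-1) 1 (fun s : R => (phi \o rp) (rp w + s *: z)) (tgrad z phi (rp w)) by rewrite mul0r.
have l : is_derive (0 : R) 1 (fun s : R => s * (enorm w)^-1) (enorm w)^-1.
  apply: (pder_eq (pderM (pder_id (0 : R) 1) (pder_cst (0 : R) 1 (enorm w)^-1))).
  by rewrite mul1r mulr0 addr0.
have q := pder_comp (f := fun s : R => s * (enorm w)^-1) H' l.
by apply: (pder_eq q); rewrite mulrC.
Qed.

Lemma tgrad_curve phi x v w (a b : R -> R) (da db : R) : C1 phi -> S x ->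
  a 0 = 0 -> b 0 = 0 -> is_derive (0 : R) 1 a da -> is_derive (0 : R) 1 b db ->
  is_derive (0 : R) 1 (fun s => (phi \o rp) (x + a s *: v + b s *: w))
    (da * tgrad v phi x + db * tgrad w phi x).
Proof.
move=> h Sx a0 b0 ha hb.
have x0 := sphere_neq0 Sx.
have := @pder_curve2 R V (phi \o rp) (fun p => (enorm p)^-1 * tgrad v phi (rp p)) x v w a b da db.
move=> H; have {H} := H (tgrad w phi x) _ _ _ a0 b0 ha hb.
have -> : (enorm x)^-1 * tgrad v phi (rp x) = tgrad v phi x.
  by rewrite rp_id// (_ : enorm x = 1)// invr1 mul1r.
apply.
- by apply: filterS (near_enorm_neq0 x0) => p p0; exact: tgrad_homog.
- have c1 : {for x, continuous (fun p : V => (enorm p)^-1)}.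
    by apply: cvgV => //; exact: enorm_continuous.
  have c2 := contS_rp (@C1_grad _ h v) x0.
  exact: (cvgM c1 c2).
- exact: C1_is_derive.
Qed.

(** Two continuous directional derivatives suffice for linearity in the direction, by
    the chain rule tgrad_curve. *)
Lemma tgrad_lin phi x (c d : R) v w : C1 phi -> S x ->
  tgrad (c *: v + d *: w) phi x = c * tgrad v phi x + d * tgrad w phi x.
Proof.
move=> h Sx; apply: tgradE; apply/is_derive_line.
have l (e : R) : is_derive (0 : R) 1 (fun s => s * e) e.
  apply: (pder_eq (pderM (pder_id (0 : R) 1) (pder_cst (0 : R) 1 e))).
  by rewrite mul1r mulr0 addr0.
have := tgrad_curve v w h Sx (mul0r c) (mul0r d) (l c) (l d).
congr is_derive; apply/funext => s.
by rewrite scalerDr !scalerA addrA.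
Qed.

Lemma tgradvD phi x v w : C1 phi -> S x ->
  tgrad (v + w) phi x = tgrad v phi x + tgrad w phi x.
Proof.
move=> h Sx; rewrite -{1}[v]scale1r -{1}[w]scale1r tgrad_lin//.
by congr (_ + _); exact: mul1r.
Qed.

Lemma tgradvZ phi x c v : C1 phi -> S x -> tgrad (c *: v) phi x = c * tgrad v phi x.
Proof.
by move=> h Sx; have := tgrad_lin c 0 v 0 h Sx; rewrite scale0r mul0r !addr0.
Qed.

Lemma tgradv_sum phi x (I : Type) (r : seq I) (F : I -> V) : C1 phi -> S x ->
  tgrad (\sum_(i <- r) F i) phi x = \sum_(i <- r) tgrad (F i) phi x.
Proof.
move=> h Sx; elim: r => [|i r IH].
  by rewrite !big_nil -(scale0r (0 : V)) tgradvZ// mul0r.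
by rewrite !big_cons tgradvD// IH.
Qed.

Lemma tgrad_radial phi x : C1 phi -> S x -> tgrad x phi x = 0.
Proof.
move=> h Sx; apply: tgradE; apply/is_derive_line.
have Sx' : enorm x = 1 := Sx.
have hc := pder_cst (0 : R) 1 (phi x).
refine (pder_near _ hc).
near=> s; rewrite /=.
have s0 : 0 < 1 + s.
  rewrite -ltrBlDl sub0r; near: s; apply: lt_nbhsr; rewrite oppr_lt0//.
have -> : x + s *: x = (1 + s) *: x by rewrite scalerDl scale1r.
rewrite /radial_proj /enorm edotZl edotZr mulrA -expr2 sqrtrM ?sqr_ge0// sqrtr_sqr.
rewrite -/(enorm x) Sx' mulr1 gtr0_norm// scalerA mulVf ?scale1r// gt_eqF//.
Unshelve. all: by end_near. Qed.

End TangentialCalculus.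

(** * The rotation invariant integral *)

Section StereoIntegral.
Variables (R : realType) (n : nat).
Notation V := (Cspace R n).
Notation m := (n.*2.+1).
Notation S := (@sphere R n).
Notation rp := (@radial_proj R n).
Notation II := iterated_integral.
Local Notation pole := (@pole R n).
Hypothesis n_gt0 : (0 < n)%N.
Implicit Types (x v w z : V) (phi psi : V -> R) (y : 'rV[R]_m).

(** Each factor satisfies (1 + |y_k|)^2 <= 2 (1 + |y|^2), which bounds the product of
    the weights below by a power of lam y. *)
Lemma tailprod_lower : exists2 C : R, 0 < C & forall y, lam y ^+ m.-1 <= C * tailprod y.
Proof.
exists (4 ^+ m.-1) => [|y]; first exact: exprn_gt0.
set mu := lam y / 4.
have l0 := lam_gt0 y.
have mu0 : 0 < mu by rewrite divr_gt0.
have l2 : lam y <= 2.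
  by rewrite /lam ler_pdivrMr ?sqn1_gt0// ler_pMr// lerDr sqn_ge0.
have mu1 : mu <= 1 by rewrite ler_pdivrMr// mul1r (le_trans l2)// ler_nat.
have tw k : mu `^ (5 / 8) <= tailw (y 0 k).
  rewrite /tailw; set a := 1 + `|y 0 k|.
  have a0 : 0 < a by rewrite ltr_pwDl.
  have ha : a ^+ 2 <= mu^-1.
    have : y 0 k ^+ 2 <= sqn y.
      by rewrite /sqn (bigD1 k)//= lerDl sumr_ge0// => i _; exact: sqr_ge0.
    have -> : mu^-1 = 2 * (sqn y + 1).
      by rewrite /mu /lam; field; rewrite gt_eqF// sqn1_gt0.
    have : 0 <= (1 - `|y 0 k|) ^+ 2 by exact: sqr_ge0.
    rewrite -[y 0 k ^+ 2](real_normK (num_real _)) /a.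
    by move: `|y 0 k| (sqn y) => u t; nra.
  have -> : - (5 / 4) = 2%:R * (- (5 / 8)) :> R by field.
  rewrite (powRrM a) powR_mulrn ?(ltW a0)// powRN.
  rewrite -[leLHS]invrK lef_pV2 ?posrE ?invr_gt0 ?powR_gt0 ?exprn_gt0//.
  rewrite -powRN -powR_inv1 ?(ltW mu0)// in ha *.
  rewrite (_ : mu `^ (- (5 / 8)) = (mu `^ (-1)) `^ (5 / 8)); last first.
    by rewrite -powRrM; congr (_ `^ _); ring.
  apply: ge0_ler_powR => //; rewrite ?nnegrE ?exprn_ge0 ?powR_ge0 ?(ltW a0)//.
have h1 : (mu `^ (5 / 8)) ^+ m <= tailprod y.
  rewrite /tailprod -[X in _ ^+ X]card_ord -prodr_const.
  by apply: ler_prod => k _; rewrite powR_ge0 tw.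
(* m - 1 >= 5/8 m because m >= 3 *)
have h2 : mu ^+ m.-1 <= (mu `^ (5 / 8)) ^+ m.
  rewrite -[leRHS]powR_mulrn ?powR_ge0// -powRrM -[leLHS]powR_mulrn ?(ltW mu0)//.
  rewrite ger_powR ?mu0//.
  have : (1 : R) <= n%:R by rewrite ler1n.
  have -> : m%:R = 2 * n%:R + 1 :> R by rewrite -addn1 natrD -muln2 natrM mulrC.
  have -> : (n.*2.+1.-1)%:R = 2 * n%:R :> R by rewrite /= -muln2 natrM mulrC.
  move: (n%:R) => u; lra.
have -> : lam y ^+ m.-1 = 4 ^+ m.-1 * mu ^+ m.-1.
  by rewrite -exprMn /mu mulrCA mulfV// mulr1.
by rewrite ler_wpM2l ?exprn_ge0// (le_trans h2).
Qed.

Lemma sqn_continuous : continuous (@sqn R n).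
Proof. by apply: contf_sum => k _; apply: contf_exp; exact: coord_continuous. Qed.

Lemma lam_continuous : continuous (@lam R n).
Proof.
apply: contf_scale; apply: contf_inv => [|y]; last by rewrite gt_eqF// sqn1_gt0.
by apply: contf_add; [exact: sqn_continuous|exact: contf_cst].
Qed.

Lemma stereo_continuous : continuous (@stereo R n).
Proof.
apply: Cspace_continuous => j.
  rewrite (_ : (fun t => _) = (fun t : 'rV[R]_m => 2 * t 0 (inord j) * (sqn t + 1)^-1)); last first.
    by apply/funext => t; rewrite !mxE.
  apply: contf_mul; first by apply: contf_scale; exact: coord_continuous.
  apply: contf_inv => [|t]; last by rewrite gt_eqF// sqn1_gt0.
  by apply: contf_add; [exact: sqn_continuous|exact: contf_cst].
rewrite (_ : (fun t => _) = (fun t : 'rV[R]_m => if j == ord_max then (sqn t - 1) * (sqn t + 1)^-1 else 2 * t 0 (inord (n.+1 + j)) * (sqn t + 1)^-1)); last first.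
  by apply/funext => t; rewrite !mxE.
have cV : continuous (fun t : 'rV[R]_m => (sqn t + 1)^-1).
  apply: contf_inv => [|t]; last by rewrite gt_eqF// sqn1_gt0.
  by apply: contf_add; [exact: sqn_continuous|exact: contf_cst].
case: (_ == _); apply: contf_mul => //.
  by apply: contf_sub; [exact: sqn_continuous|exact: contf_cst].
by apply: contf_scale; exact: coord_continuous.
Qed.

Lemma contS_stereo phi : contS phi -> continuous (fun y => phi (stereo y)).
Proof. by move=> c; apply: contS_comp => //; [exact: stereo_continuous|exact: sphere_stereo]. Qed.

Lemma ctail_lam (g : 'rV[R]_m -> R) C : continuous g ->
  (forall y, `|g y| <= C * lam y ^+ m.-1) -> ctail g.
Proof.
move=> cg gC; split => //; have [D D0 hD] := tailprod_lower.
have C0 : 0 <= C.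
  by have := le_trans (normr_ge0 _) (gC 0); rewrite pmulr_lge0// exprn_gt0// lam_gt0.
exists (C * D) => y; rewrite (le_trans (gC y))// -mulrA ler_wpM2l//.
Qed.

(** The integral over the sphere for the round measure: lam y ^+ m is the Jacobian of
    the chart. *)
Definition sint phi : R := II (fun y => phi (stereo y) * lam y ^+ m).

Lemma lam_le2 y : lam y <= 2.
Proof. by rewrite /lam ler_pdivrMr ?sqn1_gt0// ler_pMr// lerDr sqn_ge0. Qed.

Lemma ctail_sphere phi : contS phi -> ctail (fun y => phi (stereo y) * lam y ^+ m).
Proof.
move=> c; have [M M0 hM] := contS_bounded c.
apply: (@ctail_lam _ (M * 2)) => [|y].
  apply: contf_mul; first exact: contS_stereo.
  by apply: contf_exp; exact: lam_continuous.
have l0 := ltW (lam_gt0 y).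
rewrite normrM (ger0_norm (exprn_ge0 _ l0)) -mulrA exprS.
apply: ler_pM => //; first by rewrite mulr_ge0// exprn_ge0.
  by apply: hM; exact: sphere_stereo.
by rewrite ler_wpM2r ?exprn_ge0// lam_le2.
Qed.

Lemma sintD phi psi : contS phi -> contS psi ->
  sint (fun x => phi x + psi x) = sint phi + sint psi.
Proof.
move=> cp cq; rewrite /sint -iteratedD; [|exact: ctail_sphere..].
by congr II; apply/funext => y; rewrite mulrDl.
Qed.

Lemma sintZ c phi : contS phi -> sint (fun x => c * phi x) = c * sint phi.
Proof.
move=> cp; rewrite /sint -iteratedZ; last exact: ctail_sphere.
by congr II; apply/funext => y; rewrite mulrA.
Qed.

Lemma sint_ext phi psi : (forall x, S x -> phi x = psi x) -> sint phi = sint psi.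
Proof.
move=> e; congr II; apply/funext => y; rewrite e//; exact: sphere_stereo.
Qed.

Lemma sint_ge0 phi : (forall x, S x -> 0 <= phi x) -> 0 <= sint phi.
Proof.
move=> h; apply: iterated_ge0 => y; rewrite mulr_ge0 ?exprn_ge0 ?(ltW (lam_gt0 y))//.
by apply: h; exact: sphere_stereo.
Qed.

Lemma sint_eq0 phi : contS phi -> (forall x, S x -> 0 <= phi x) -> sint phi = 0 ->
  forall y, phi (stereo y) = 0.
Proof.
move=> c h h0 y.
have := iterated_eq0 (ctail_sphere c) _ h0 => H.
have /H/(_ y)/eqP : forall y, 0 <= phi (stereo y) * lam y ^+ m.
  move=> z; rewrite mulr_ge0 ?exprn_ge0 ?(ltW (lam_gt0 z))//.
  by apply: h; exact: sphere_stereo.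
by rewrite mulf_eq0 expf_eq0/= (gt_eqF (lam_gt0 y)) orbF => /eqP.
Qed.

(** By contact_density, dV_theta_0 is c times the round measure. Instead of computing c,
    the case c = 0, where all integrals vanish whether or not the integrand is
    continuous, is kept apart. *)
Lemma int_theta0E : exists2 c : R, 0 <= c & forall phi,
  (contS phi -> int_theta0 phi = c * sint phi) /\ (c = 0 -> int_theta0 phi = 0).
Proof.
have [c c0 hc] := contact_density R n.
exists c => // phi.
have e : int_theta0 phi = II (fun y => phi (stereo y) * (c * lam y ^+ m)).
  by congr II; apply/funext => y; rewrite hc.
split=> [cp|c00].
  rewrite e /sint -iteratedZ; last exact: ctail_sphere.
  by congr II; apply/funext => y; rewrite mulrCA.
rewrite e c00.
have h := iteratedZ 0 (ctail_sphere (contS_T (@contf_cst R V 1))).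
rewrite mul0r in h; rewrite -[RHS]h; congr II; apply/funext => y.
by rewrite !mul0r mulr0.
Qed.

Lemma edot_stereo_pole y : edot (stereo y) pole = 1 - lam y.
Proof.
rewrite stereoE edotDl edotZl edotBl edot_pole_pole edot_emb_pole; ring.
Qed.

Lemma edot_stereo_emb y k : edot (stereo y) (emb (delta_mx 0 k)) = lam y * y 0 k.
Proof.
rewrite stereoE edotDl edotZl edotBl (edotC pole) edot_emb_pole edot_emb_delta; ring.
Qed.

Lemma tgrad_stereo_radial phi y : C1 phi ->
  lam y * tgrad (emb y - pole) phi (stereo y) = - tgrad pole phi (stereo y).
Proof.
move=> h; have Sx := sphere_stereo y; have := tgrad_radial h Sx.
by rewrite {1}stereoE tgradvD// tgradvZ// => /eqP; rewrite addrC addr_eq0 => /eqP.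
Qed.

Lemma stereo_pder phi y k : C1 phi ->
  is_derive y (delta_mx 0 k) (fun y => phi (stereo y))
    (tgrad pole phi (stereo y) * (lam y * y 0 k) + tgrad (emb (delta_mx 0 k)) phi (stereo y) * lam y).
Proof.
move=> h; have Sx := sphere_stereo y; apply/is_derive_line.
have /is_derive_line hl := lam_is_derive y k.
have l0 : lam (y + (0 : R) *: delta_mx 0 k) = lam y by rewrite scale0r addr0.
have ha := pderB hl (pder_cst (0 : R) 1 (lam y)).
have hb := pderM (pder_id (0 : R) 1) hl.
have a0 : lam (y + (0 : R) *: delta_mx 0 k) - lam y = 0 by rewrite l0 subrr.
have b0 : 0 * lam (y + (0 : R) *: delta_mx 0 k) = 0 by rewrite mul0r.
have := tgrad_curve (emb y - pole) (emb (delta_mx 0 k)) h Sx a0 b0 ha hb.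
rewrite l0 mul1r mul0r addr0 subr0 => H.
rewrite (_ : (fun s : R => _) = (fun s : R => (phi \o rp) (stereo y + (lam (y + s *: delta_mx 0 k) - lam y) *: (emb y - pole)
   + (s * lam (y + s *: delta_mx 0 k)) *: emb (delta_mx 0 k)))); last first.
  apply/funext => s /=; rewrite -[in LHS](@rp_id R n (stereo _)); last exact: sphere_stereo.
  congr (phi (rp _)); rewrite stereo_line [in RHS]stereoE; congr (_ + _).
  by rewrite -addrA -scalerDl [lam y + _]addrC subrK.
apply: (pder_eq H).
have e := tgrad_stereo_radial y h.
transitivity (- (lam y * y 0 k) * (lam y * tgrad (emb y - pole) phi (stereo y)) + lam y * tgrad (emb (delta_mx 0 k)) phi (stereo y)); first by ring.
by rewrite e; ring.
Qed.

(** In the chart, the derivative in the direction of the pole is the Euler field. *)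
Lemma tgrad_stereo_euler phi y : C1 phi ->
  \sum_k y 0 k * (tgrad pole phi (stereo y) * (lam y * y 0 k) + tgrad (emb (delta_mx 0 k)) phi (stereo y) * lam y)
  = tgrad pole phi (stereo y).
Proof.
move=> h; have Sx := sphere_stereo y.
have e := tgrad_stereo_radial y h.
have q : tgrad (emb y) phi (stereo y) = \sum_k y 0 k * tgrad (emb (delta_mx 0 k)) phi (stereo y).
  rewrite {1}(emb_sum y) tgradv_sum//; apply: eq_bigr => k _; exact: tgradvZ.
have q2 : tgrad (emb y - pole) phi (stereo y) = tgrad (emb y) phi (stereo y) - tgrad pole phi (stereo y).
  by rewrite tgradvD// -scaleN1r tgradvZ// mulN1r.
transitivity (lam y * sqn y * tgrad pole phi (stereo y) + lam y * tgrad (emb y) phi (stereo y)).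
  rewrite q /sqn !mulr_sumr mulr_suml -big_split; apply: eq_bigr => k _ /=; ring.
move: e; rewrite q2 lam_sqn mulrBr => e.
by move: e; move: (tgrad (emb y) _ _) (tgrad pole _ _) => A B e; lra.
Qed.

Lemma ctail_prod phi (r : 'rV[R]_m -> R) C : contS phi -> continuous r ->
  (forall y, `|r y| <= C * lam y ^+ m.-1) -> ctail (fun y => phi (stereo y) * r y).
Proof.
move=> c cr rC; have [M M0 hM] := contS_bounded c.
apply: (@ctail_lam _ (M * C)) => [|y].
  by apply: contf_mul => //; exact: contS_stereo.
rewrite normrM -mulrA; apply: ler_pM => //.
by apply: hM; exact: sphere_stereo.
Qed.

Lemma iterated_sum k (F : 'I_k -> 'rV[R]_m -> R) : (forall i, ctail (F i)) ->
  ctail (fun y => \sum_i F i y) /\ II (fun y => \sum_i F i y) = \sum_i II (F i).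
Proof.
elim: k F => [|k IH] F h.
  have e : (fun y : 'rV[R]_m => \sum_(i < 0) F i y) = (fun y => 0 * (1 * lam y ^+ m)).
    by apply/funext => y; rewrite big_ord0 mul0r.
  have c1 := ctail_sphere (contS_T (@contf_cst R V 1)).
  by rewrite e big_ord0; split; [exact: ctailZ|rewrite iteratedZ// mul0r].
have [c1 e1] := IH (fun i => F (lift ord0 i)) (fun i => h _).
have e : (fun y : 'rV[R]_m => \sum_(i < k.+1) F i y) = (fun y => F ord0 y + \sum_(i < k) F (lift ord0 i) y).
  by apply/funext => y; rewrite big_ord_recl.
rewrite e big_ord_recl -e1; split; first exact: ctailD.
exact: iteratedD.
Qed.

Lemma lam_coord_le y k : `|lam y * y 0 k| <= 1.
Proof.
have : y 0 k ^+ 2 <= sqn y.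
  by rewrite /sqn (bigD1 k)//= lerDl sumr_ge0// => i _; exact: sqr_ge0.
rewrite normrM gtr0_norm ?lam_gt0// /lam mulrAC ler_pdivrMr ?sqn1_gt0// mul1r.
have : 0 <= (1 - `|y 0 k|) ^+ 2 by exact: sqr_ge0.
rewrite -[y 0 k ^+ 2](real_normK (num_real _)).
by move: `|y 0 k| (sqn y) => u t; nra.
Qed.

Lemma lam_coord2_le y k l : `|lam y * y 0 k * y 0 l| <= 2.
Proof.
have b i : y 0 i ^+ 2 <= sqn y.
  by rewrite /sqn (bigD1 i)//= lerDl sumr_ge0// => j _; exact: sqr_ge0.
rewrite -mulrA normrM gtr0_norm ?lam_gt0// (@le_trans _ _ (lam y * sqn y))//; last first.
  by rewrite lam_sqn; have := lam_gt0 y; lra.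
rewrite ler_pM2l ?lam_gt0// normrM.
have := b k; have := b l.
rewrite -[y 0 k ^+ 2](real_normK (num_real _)) -[y 0 l ^+ 2](real_normK (num_real _)).
have : 0 <= (`|y 0 k| - `|y 0 l|) ^+ 2 by exact: sqr_ge0.
by move: `|y 0 k| `|y 0 l| (sqn y) => u t s; nra.
Qed.

(** The flat divergence theorem for phi times the field Y, with the partial derivatives
    of phi \o stereo expressed by tangential derivatives. *)
Lemma divergence_field phi C (Y dY : 'I_m -> 'rV[R]_m -> R) : C1 phi ->
  (forall k, continuous (Y k)) -> (forall k, continuous (dY k)) ->
  (forall k y, `|Y k y| <= C * lam y ^+ m.-1) ->
  (forall k y, `|dY k y| <= C * lam y ^+ m.-1) ->
  (forall k y, is_derive y (delta_mx 0 k) (Y k) (dY k y)) ->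
  II (fun y => \sum_k ((tgrad pole phi (stereo y) * (lam y * y 0 k) +
                       tgrad (emb (delta_mx 0 k)) phi (stereo y) * lam y) * Y k y
                      + phi (stereo y) * dY k y)) = 0.
Proof.
move=> h cY cdY bY bdY dYY.
have cl := lam_continuous.
have l0 y := ltW (lam_gt0 y).
have C0 : 0 <= C.
  by have := le_trans (normr_ge0 _) (bY ord0 0); rewrite pmulr_lge0// exprn_gt0// lam_gt0.
have ct k : ctail (fun y => (tgrad pole phi (stereo y) * (lam y * y 0 k) +
                       tgrad (emb (delta_mx 0 k)) phi (stereo y) * lam y) * Y k y
                      + phi (stereo y) * dY k y).
  apply: ctailD; last by apply: ctail_prod (bdY k) => //; exact: C1_cont.
  rewrite (_ : (fun y => _) = (fun y => tgrad pole phi (stereo y) * ((lam y * y 0 k) * Y k y)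
     + tgrad (emb (delta_mx 0 k)) phi (stereo y) * (lam y * Y k y))); last first.
    by apply/funext => y; ring.
  apply: ctailD; apply: (@ctail_prod _ _ (2 * C)).
  - exact: C1_grad.
  - by apply: contf_mul => //; apply: contf_mul => //; exact: coord_continuous.
  - move=> y; rewrite normrM -mulrA; apply: ler_pM => //.
    by rewrite (le_trans (lam_coord_le y k))// ler1n.
  - exact: C1_grad.
  - by apply: contf_mul.
  - move=> y; rewrite normrM -mulrA; apply: ler_pM => //.
    by rewrite ger0_norm// lam_le2.
have [_ ->] := iterated_sum ct; apply: big1 => k _.
apply: (@iterated_derive0 R m k (fun y => phi (stereo y) * Y k y)) => //.
- by apply: ctail_prod (bY k) => //; exact: C1_cont.
- by move=> y; exact: (pderM (stereo_pder y k h) (dYY k y)).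
Qed.

Lemma pder_lamX y k i : is_derive y (delta_mx 0 k) (fun y => lam y ^+ i) (- (i%:R * lam y ^+ i.+1 * y 0 k)).
Proof.
apply: (pder_eq (pderX i (lam_is_derive y k))).
by case: i => [|i]; rewrite ?mul0r ?oppr0//= !exprS; ring.
Qed.

Lemma pder_coord y k l : is_derive y (delta_mx 0 k) (fun y => y 0 l) ((k == l)%:R).
Proof.
apply/is_derive_line.
rewrite (_ : (fun s : R => _) = (fun s : R => y 0 l + s * (k == l)%:R)); first exact: pder_affine.
by apply/funext => s; rewrite !mxE eqxx/= eq_sym.
Qed.

Lemma lamXm y : lam y ^+ m = lam y * lam y ^+ m.-1.
Proof. exact: exprS. Qed.

Lemma lamXm1 y : lam y ^+ m.+1 = lam y * (lam y * lam y ^+ m.-1).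
Proof. by rewrite exprS lamXm. Qed.

(** divergence_field for lam^m times the Euler field, see tgrad_stereo_euler. *)
Lemma sint_tgrad_pole phi : C1 phi ->
  sint (tgrad pole phi) = m%:R * sint (fun x => edot x pole * phi x).
Proof.
move=> h; have l0 y := ltW (lam_gt0 y).
have cl := lam_continuous.
pose Y (k : 'I_m) (y : 'rV[R]_m) := y 0 k * lam y ^+ m.
pose dY (k : 'I_m) (y : 'rV[R]_m) := lam y ^+ m - m%:R * (y 0 k ^+ 2 * lam y ^+ m.+1).
have cY k : continuous (Y k).
  by apply: contf_mul; [exact: coord_continuous|exact: contf_exp].
have cdY k : continuous (dY k).
  apply: contf_sub; first exact: contf_exp.
  apply: contf_scale; apply: contf_mul; last exact: contf_exp.
  by apply: contf_exp; exact: coord_continuous.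
have lm y : 0 <= lam y ^+ m.-1 by exact: exprn_ge0.
have C2 : 0 <= 4 * m%:R :> R by rewrite mulr_ge0.
have bY k y : `|Y k y| <= (2 + 4 * m%:R) * lam y ^+ m.-1.
  rewrite /Y (_ : y 0 k * lam y ^+ m = lam y * y 0 k * lam y ^+ m.-1); last by rewrite lamXm; ring.
  rewrite normrM (ger0_norm (lm y)) ler_wpM2r// (le_trans (lam_coord_le y k))//; lra.
have bdY k y : `|dY k y| <= (2 + 4 * m%:R) * lam y ^+ m.-1.
  rewrite /dY (_ : _ - _ = (lam y - m%:R * (lam y * y 0 k * y 0 k * lam y)) * lam y ^+ m.-1); last first.
    by rewrite lamXm1 lamXm; ring.
  rewrite normrM (ger0_norm (lm y)) ler_wpM2r// (le_trans (ler_normB _ _))// lerD//.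
    by rewrite ger0_norm// lam_le2.
  rewrite normrM (ger0_norm (ler0n _ _)) mulrC ler_wpM2r// normrM (_ : 4 = 2 * 2); last by ring.
  by apply: ler_pM => //; [exact: lam_coord2_le|rewrite ger0_norm// lam_le2].
have dYY k y : is_derive y (delta_mx 0 k) (Y k) (dY k y).
  apply: (pder_eq (pderM (pder_coord y k k) (pder_lamX y k m))).
  have -> : (k == k)%:R = 1 :> R by rewrite eqxx.
  by rewrite /dY; ring.
have := divergence_field h cY cdY bY bdY dYY.
pose P := (fun y : 'rV[R]_m => tgrad pole phi (stereo y) * lam y ^+ m + (- m%:R) * (edot (stereo y) pole * phi (stereo y) * lam y ^+ m)).
rewrite (_ : (fun y => _) = P); last first.
  apply/funext => y; rewrite /P -[in RHS](tgrad_stereo_euler y h) mulr_suml edot_stereo_pole.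
  transitivity (\sum_k y 0 k * (tgrad pole phi (stereo y) * (lam y * y 0 k) + tgrad (emb (delta_mx 0 k)) phi (stereo y) * lam y) * lam y ^+ m + \sum_k phi (stereo y) * dY k y).
    by rewrite -big_split; apply: eq_bigr => k _; rewrite /Y /=; ring.
  congr (_ + _); rewrite -mulr_sumr /dY sumrB sumr_const card_ord -mulr_sumr -mulr_suml -/(sqn y).
  apply/eqP; rewrite -subr_eq0; apply/eqP.
  transitivity (- (phi (stereo y) * m%:R * lam y ^+ m) * (lam y * sqn y - (2 - lam y))); last by rewrite lam_sqn subrr mulr0.
  by rewrite [lam y ^+ m.+1]exprS; ring.
rewrite /P iteratedD; last first.
- apply: ctailZ; apply: (@ctail_sphere (fun x => edot x pole * phi x)); apply: contf_mul; last exact: C1_cont.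
  by apply: contS_T; apply: edot_continuous => t; [exact: cvg_id|exact: cvg_cst].
- by apply: (@ctail_sphere (tgrad pole phi)); exact: C1_grad.
rewrite iteratedZ; last first.
  apply: (@ctail_sphere (fun x => edot x pole * phi x)); apply: contf_mul; last exact: C1_cont.
  by apply: contS_T; apply: edot_continuous => t; [exact: cvg_id|exact: cvg_cst].
by rewrite mulNr => /eqP; rewrite subr_eq0 => /eqP.
Qed.

(** In the chart, the derivative in the a-th coordinate direction is lam^-1 times the
    a-th partial derivative minus y_a times the Euler field; weight it with lam^m and
    use divergence_field. *)
Lemma sint_tgrad_emb phi a : C1 phi ->
  sint (tgrad (emb (delta_mx 0 a)) phi) = m%:R * sint (fun x => edot x (emb (delta_mx 0 a)) * phi x).
Proof.
move=> h; have l0 y := ltW (lam_gt0 y).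
have cl := lam_continuous.
have cc l : continuous (fun y : 'rV[R]_m => y 0 l) by exact: coord_continuous.
pose Y (k : 'I_m) (y : 'rV[R]_m) := (k == a)%:R * lam y ^+ m.-1 - y 0 a * y 0 k * lam y ^+ m.
pose dY (k : 'I_m) (y : 'rV[R]_m) := - ((k == a)%:R * m%:R * y 0 a * lam y ^+ m) - y 0 a * lam y ^+ m
   + m%:R * (y 0 a * y 0 k ^+ 2 * lam y ^+ m.+1).
have cY k : continuous (Y k).
  apply: contf_sub; first by apply: contf_scale; exact: contf_exp.
  by apply: contf_mul; [apply: contf_mul|exact: contf_exp].
have cdY k : continuous (dY k).
  apply: contf_add; first apply: contf_sub.
  - apply: contf_opp; apply: contf_mul; last exact: contf_exp.
    by apply: contf_scale.
  - by apply: contf_mul => //; exact: contf_exp.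
  - apply: contf_scale; apply: contf_mul; last exact: contf_exp.
    by apply: contf_mul => //; exact: contf_exp.
have lm y : 0 <= lam y ^+ m.-1 by exact: exprn_ge0.
have m0 : 0 <= m%:R :> R by [].
have d1 k : `|((k == a)%:R : R)| <= 1 by case: (_ == _); rewrite ?normr1 ?normr0.
have bY k y : `|Y k y| <= (3 + 3 * m%:R) * lam y ^+ m.-1.
  rewrite /Y (_ : _ - _ = ((k == a)%:R - lam y * y 0 a * y 0 k) * lam y ^+ m.-1); last by rewrite lamXm; ring.
  rewrite normrM (ger0_norm (lm y)) ler_wpM2r// (le_trans (ler_normB _ _))//.
  rewrite (@le_trans _ _ (1 + 2))//; first by rewrite lerD// lam_coord2_le.
  lra.
have bdY k y : `|dY k y| <= (3 + 3 * m%:R) * lam y ^+ m.-1.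
  rewrite /dY (_ : _ + _ = (- ((k == a)%:R * m%:R * (lam y * y 0 a)) - lam y * y 0 a + m%:R * ((lam y * y 0 a) * (lam y * y 0 k * y 0 k))) * lam y ^+ m.-1); last first.
    by rewrite lamXm1 lamXm; ring.
  rewrite normrM (ger0_norm (lm y)) ler_wpM2r//.
  rewrite (le_trans (ler_normD _ _))// (@le_trans _ _ ((m%:R + 1) + 2 * m%:R))//; last by lra.
  rewrite lerD// ?(le_trans (ler_normB _ _)) ?lerD//.
  - rewrite normrN (_ : _ * (lam y * y 0 a) = m%:R * ((k == a)%:R * (lam y * y 0 a))); last by ring.
    rewrite normrM (ger0_norm m0) -[leRHS]mulr1 ler_wpM2l// normrM -[leRHS]mulr1.
    by apply: ler_pM => //; exact: lam_coord_le.
  - exact: lam_coord_le.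
  - rewrite normrM (ger0_norm m0) mulrC ler_wpM2r// normrM -[2]mul1r; apply: ler_pM => //.
      exact: lam_coord_le.
    exact: lam_coord2_le.
have dYY k y : is_derive y (delta_mx 0 k) (Y k) (dY k y).
  have e := pderB (pderZ (k == a)%:R (pder_lamX y k m.-1)) (pderM (pderM (pder_coord y k a) (pder_coord y k k)) (pder_lamX y k m)).
  apply: (pder_eq e); rewrite eqxx /dY.
  have e1 : (k == a)%:R * y 0 k = (k == a)%:R * y 0 a :> R by case: eqVneq => [->|]; rewrite ?mul0r.
  have e2 : m%:R = m.-1%:R + 1 :> R by rewrite -natr1.
  transitivity (- ((k == a)%:R * y 0 k) * (m.-1%:R + 1) * lam y ^+ m - y 0 a * lam y ^+ m + m%:R * (y 0 a * y 0 k ^+ 2 * lam y ^+ m.+1)).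
    by rewrite /=; ring.
  by rewrite e1 -e2; ring.
have := divergence_field h cY cdY bY bdY dYY.
pose P := (fun y : 'rV[R]_m => tgrad (emb (delta_mx 0 a)) phi (stereo y) * lam y ^+ m + (- m%:R) * (edot (stereo y) (emb (delta_mx 0 a)) * phi (stereo y) * lam y ^+ m)).
rewrite (_ : (fun y => _) = P); last first.
  apply/funext => y; rewrite /P edot_stereo_emb.
  pose q k := tgrad pole phi (stereo y) * (lam y * y 0 k) + tgrad (emb (delta_mx 0 k)) phi (stereo y) * lam y.
  have delta_sum (F : 'I_m -> R) : \sum_k (k == a)%:R * F k = F a.
    rewrite (bigD1 a)//= eqxx mul1r big1 ?addr0// => k ka.
    by rewrite (negPf ka) mul0r.
  transitivity (\sum_k (k == a)%:R * (lam y ^+ m.-1 * q k) - y 0 a * lam y ^+ m * (\sum_k y 0 k * q k)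
    + phi (stereo y) * (\sum_k (- ((k == a)%:R * (m%:R * y 0 a * lam y ^+ m)) - y 0 a * lam y ^+ m + m%:R * y 0 a * lam y ^+ m.+1 * (y 0 k ^+ 2)))).
    rewrite !mulr_sumr -sumrB -big_split; apply: eq_bigr => k _ /=; rewrite /Y /dY -/(q k); ring.
  rewrite delta_sum (tgrad_stereo_euler y h) !big_split /= sumrN delta_sum sumr_const card_ord -mulr_sumr -/(sqn y).
  apply/eqP; rewrite -subr_eq0; apply/eqP.
  transitivity (phi (stereo y) * m%:R * y 0 a * lam y ^+ m * (lam y * sqn y - (2 - lam y))); last by rewrite lam_sqn subrr mulr0.
  by rewrite /q lamXm1 lamXm; ring.
have cE : contS (fun x : V => edot x (emb (delta_mx 0 a)) * phi x).
  apply: contf_mul; last exact: C1_cont.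
  by apply: contS_T; apply: edot_continuous => t; [exact: cvg_id|exact: cvg_cst].
rewrite /P iteratedD; last first.
- by apply: ctailZ; exact: ctail_sphere cE.
- by apply: (@ctail_sphere (tgrad (emb (delta_mx 0 a)) phi)); exact: C1_grad.
rewrite iteratedZ; last exact: ctail_sphere cE.
by rewrite mulNr => /eqP; rewrite subr_eq0 => /eqP.
Qed.

End StereoIntegral.

(** * Strict positivity, derivatives under the integral, Fubini *)

Lemma within_contP (R : realType) (T : topologicalType) (A : set T) (f : T -> R) :
  {within A, continuous f} <->
  (forall a, A a -> forall e, 0 < e -> \forall t \near a, A t -> `|f a - f t| < e).
Proof.
split=> [/subspace_continuousP cf a Aa e e0|h].
  by have /cvgrPdist_lt/(_ _ e0) := cf a Aa.
apply/subspace_continuousP => a Aa; apply/cvgrPdist_lt => e e0; exact: h.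
Qed.

Section SphereIntegral.
Variables (R : realType) (n : nat).
Notation V := (Cspace R n).
Notation m := (n.*2.+1).
Notation S := (@sphere R n).
Local Notation pole := (@pole R n).
Hypothesis n_gt0 : (0 < n)%N.
Implicit Types (x v w z : V) (phi psi : V -> R).

Lemma contS_cst (c : R) : contS (fun _ : V => c).
Proof. by apply: contS_T; exact: (@contf_cst R V c). Qed.

Lemma contS_edot z : contS (fun x : V => edot x z).
Proof. by apply: contS_T; apply: edot_continuous => t; [exact: cvg_id|exact: cvg_cst]. Qed.

(** Divergence theorem for a constant field projected to the sphere, by linearity in z
    from the basis given by the chart and the pole. *)
Lemma sint_tgrad phi z : C1 phi ->
  sint (tgrad z phi) = m%:R * sint (fun x => edot x z * phi x).
Proof.
move=> h; have cp := C1_cont h.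
have cE z' : contS (fun x => edot x z' * phi x) by apply: contf_mul => //; exact: contS_edot.
pose B := [set z | sint (tgrad z phi) = m%:R * sint (fun x => edot x z * phi x)].
have lin (c d : R) v w : B v -> B w -> B (c *: v + d *: w).
  rewrite /B/= => hv hw.
  rewrite (@sint_ext _ _ _ (fun x => c * tgrad v phi x + d * tgrad w phi x)); last first.
    by move=> x Sx; exact: tgrad_lin.
  rewrite sintD//; [|apply: contf_scale; exact: C1_grad..].
  rewrite !sintZ//; [|exact: C1_grad..].
  rewrite hv hw (@sint_ext _ _ (fun x => edot x (c *: v + d *: w) * phi x)
    (fun x => c * (edot x v * phi x) + d * (edot x w * phi x))); last first.
    by move=> x _; rewrite edotDr !edotZr; ring.
  rewrite sintD//; [|apply: contf_scale; exact: cE..].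
  by rewrite !sintZ//; ring.
have B0 : B 0.
  have := lin 0 0 pole pole (sint_tgrad_pole n_gt0 h) (sint_tgrad_pole n_gt0 h).
  by rewrite !scale0r addr0.
have Bsum k (F : 'I_k -> V) (c : 'I_k -> R) : (forall i, B (F i)) -> B (\sum_i c i *: F i).
  elim: k F c => [|k IH] F c hF; first by rewrite big_ord0.
  rewrite big_ord_recl -[\sum_(i < k) _]scale1r.
  by apply: lin => //; apply: IH.
suff : B z by [].
have -> : z = 1 *: (\sum_k (prj z) 0 k *: emb (delta_mx 0 k)) + edot z pole *: pole.
  by rewrite scale1r -emb_sum emb_prj subrK.
apply: lin; last exact: sint_tgrad_pole.
by apply: Bsum => k; exact: sint_tgrad_emb.
Qed.

Lemma sintN phi : contS phi -> sint (fun x => - phi x) = - sint phi.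
Proof.
move=> c; rewrite -mulN1r -sintZ//; apply: sint_ext => x _; by rewrite mulN1r.
Qed.

Lemma sintB phi psi : contS phi -> contS psi ->
  sint (fun x => phi x - psi x) = sint phi - sint psi.
Proof. by move=> c d; rewrite sintD// ?sintN//; exact: contf_opp. Qed.

Lemma sint_le phi psi : contS phi -> contS psi -> (forall x, S x -> phi x <= psi x) ->
  sint phi <= sint psi.
Proof.
move=> c d h; rewrite -subr_ge0 -sintB//; apply: sint_ge0 => x Sx.
by rewrite subr_ge0 h.
Qed.

Definition vol : R := @sint R n (fun=> 1).

Lemma sint_cst c : sint (fun _ : V => c) = c * vol.
Proof.
rewrite /vol -sintZ//; last exact: contS_cst.
by apply: sint_ext => x _; rewrite mulr1.
Qed.

Lemma vol_ge0 : 0 <= vol. Proof. exact: sint_ge0. Qed.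

Lemma vol_gt0 : 0 < vol.
Proof.
rewrite lt_neqAle vol_ge0 andbT eq_sym; apply/eqP => v0.
have := sint_eq0 n_gt0 (@contS_cst 1) (fun _ _ => ler01) v0 0.
by apply/eqP; exact: oner_neq0.
Qed.

Lemma sint_abs phi M : contS phi -> (forall x, S x -> `|phi x| <= M) -> `|sint phi| <= M * vol.
Proof.
move=> c h; rewrite ler_norml -mulNr -!sint_cst; apply/andP; split; apply: sint_le => //.
- exact: contS_cst.
- by move=> x /h; rewrite ler_norml => /andP[].
- exact: contS_cst.
- by move=> x /h; rewrite ler_norml => /andP[].
Qed.

Lemma sint_sum (I : Type) (r : seq I) (F : I -> V -> R) : (forall i, contS (F i)) ->
  contS (fun x => \sum_(i <- r) F i x) /\
  sint (fun x => \sum_(i <- r) F i x) = \sum_(i <- r) sint (F i).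
Proof.
move=> h; split; first by apply: contf_sum => i _; exact: h.
elim: r => [|i r IH].
  rewrite big_nil (@sint_ext _ _ _ (fun=> 0)) ?sint_cst ?mul0r// => x _.
  by rewrite big_nil.
rewrite big_cons -IH -sintD//; last by apply: contf_sum => j _; exact: h.
by apply: sint_ext => x _; rewrite big_cons.
Qed.

Lemma edot_eq0 x : edot x x = 0 -> x = 0.
Proof.
move=> h.
have c0 j : (x.1 0 j = 0) * (x.2 0 j = 0).
  have : x.1 0 j ^+ 2 + x.2 0 j ^+ 2 <= 0.
    rewrite -h /edot (bigD1 j)//= -!expr2 lerDl.
    by apply: sumr_ge0 => i _; rewrite addr_ge0// -expr2 sqr_ge0.
  have := sqr_ge0 (x.1 0 j); have := sqr_ge0 (x.2 0 j) => h1 h2 h3.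
  have e1 : x.1 0 j ^+ 2 = 0 by lra.
  have e2 : x.2 0 j ^+ 2 = 0 by lra.
  by split; apply/eqP; rewrite -sqrf_eq0 ?e1 ?e2.
rewrite [x]surjective_pairing; congr pair; apply/rowP => j; rewrite mxE; by case: (c0 j).
Qed.

Lemma stereo_surj x : S x -> x != pole -> exists y, stereo y = x.
Proof.
move=> /sphereP x1 xp; pose t := 1 - edot x pole.
have tE : 2 * t = edot (x - pole) (x - pole).
  by rewrite !(edotBl, edotBr) x1 edot_pole_pole (edotC pole) /t; ring.
have t0 : t != 0.
  apply: contra xp => /eqP t0; rewrite -subr_eq0; apply/eqP/edot_eq0.
  by rewrite -tE t0 mulr0.
have e1 : edot (emb (prj x)) (emb (prj x)) = 2 * t - t ^+ 2.
  by rewrite emb_prj !(edotBl, edotBr, edotZl, edotZr) x1 edot_pole_pole (edotC pole) /t; ring.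
have sq : sqn (t^-1 *: prj x) = 2 / t - 1.
  have -> : sqn (t^-1 *: prj x) = edot (emb (t^-1 *: prj x)) (emb (t^-1 *: prj x)).
    by rewrite edot_emb; apply: eq_bigr => k _; rewrite expr2.
  by rewrite embZ edotZl edotZr e1; field.
exists (t^-1 *: prj x); rewrite stereoE /lam sq subrK invf_div mulrC divfK// embZ.
rewrite scalerBr scalerA mulfV// scale1r emb_prj /t scalerBl scale1r.
have -> : x - edot x pole *: pole - (pole - edot x pole *: pole) = x - pole.
  by rewrite opprB addrA subrK.
by rewrite addrC subrK.
Qed.

Lemma near_pole_stereo (d : R) : 0 < d -> exists y, `|pole - stereo y| < d.
Proof.
move=> d0; pose e : V := emb (delta_mx 0 ord0).
pose a := `|e| + `|pole| + 1.
have a0 : 0 < a by rewrite ltr_wpDl// addr_ge0.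
pose s := Num.max 1 (3 * a / d).
have s1 : 1 <= s by rewrite le_max lexx.
have sd : 3 * a / d <= s by rewrite le_max lexx orbT.
have s0 : 0 < s by rewrite (lt_le_trans _ s1).
exists (s *: delta_mx 0 ord0).
rewrite stereoE opprD addrA subrr sub0r normrN normrZ gtr0_norm ?lam_gt0// embZ.
have h1 : `|s *: e - pole| <= s * a.
  rewrite (le_trans (ler_normB _ _))// normrZ (gtr0_norm s0) /a -addrA mulrDr lerD2l.
  rewrite (@le_trans _ _ (1 * (`|pole| + 1)))//; first by rewrite mul1r lerDl.
  by rewrite ler_wpM2r// addr_ge0.
have sq : @sqn R n (s *: delta_mx 0 ord0) = s ^+ 2.
  have -> : @sqn R n (s *: delta_mx 0 ord0) = @edot R n (emb (s *: delta_mx 0 ord0)) (emb (s *: delta_mx 0 ord0)).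
    by rewrite edot_emb; apply: eq_bigr => k _; rewrite expr2.
  by rewrite embZ edotZl edotZr edot_emb_delta mxE !eqxx mulr1 -expr2.
rewrite (@le_lt_trans _ _ (@lam R n (s *: delta_mx 0 ord0) * (s * a)))//.
  by rewrite ler_wpM2l// ltW// lam_gt0.
rewrite /lam sq mulrAC ltr_pdivrMr ?ltr_wpDl ?sqr_ge0//.
have : 3 * a <= s * d by rewrite -ler_pdivrMr.
have : 0 < s * d by exact: mulr_gt0.
have sa : 0 < s * a by exact: mulr_gt0.
nra.
Qed.

(** The chart misses only the pole, which is a limit of other points. *)
Lemma sint_pos phi : contS phi -> (forall x, S x -> 0 <= phi x) -> sint phi = 0 ->
  forall x, S x -> phi x = 0.
Proof.
move=> c h0 hi x Sx; have hs := sint_eq0 n_gt0 c h0 hi.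
have [xp|xp] := eqVneq x pole; last by have [y <-] := stereo_surj Sx xp.
rewrite xp in Sx *; apply/eqP; rewrite -[_ == _]negbK; apply/negP => p0.
have pp : 0 < phi pole by rewrite lt_neqAle eq_sym p0 h0.
have /within_contP/(_ _ Sx _ pp)/nbhs_ballP[d /= d0 hd] := c.
have [y yd] := near_pole_stereo d0.
have /hd/(_ (sphere_stereo y)) : ball pole d (stereo y) by rewrite -ball_normE.
by rewrite hs subr0 gtr0_norm// ltxx.
Qed.

(** Compactness of the sphere makes continuity in the parameter uniform in the point. *)
Lemma tube (T : topologicalType) (A : set T) (F : T -> V -> R) (a : T) :
  {within A `*` S, continuous (fun p => F p.1 p.2)} -> A a ->
  forall e, 0 < e -> \forall t \near a, A t -> forall y, S y -> `|F a y - F t y| < e.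
Proof.
move=> /within_contP cF Aa e e0.
have cov := (compact_near_coveringP _).1 (@sphere_compact R n).
have e2 : 0 < e / 2 by rewrite divr_gt0.
have := cov T (nbhs a) (fun t y => A t -> S y -> `|F a y - F t y| < e) _.
have H : forall y0, S y0 -> \forall x' \near y0 & i \near nbhs a, A i -> S x' -> `|F a x' - F i x'| < e.
  move=> y0 Sy0; have [[U W]/= [hU hW] UW] := cF (a, y0) (conj Aa Sy0) _ e2.
  exists (W, U) => //= -[y t]/= [Wy Ut] At Sy.
  have h1 := UW (t, y) (conj Ut Wy) (conj At Sy).
  have h2 := UW (a, y) (conj (nbhs_singleton hU) Wy) (conj Aa Sy).
  have -> : F a y - F t y = (F a y0 - F t y) - (F a y0 - F a y) by ring.
  by rewrite (le_lt_trans (ler_normB _ _))// [e]splitr ltrD.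
move=> /(_ _ H); apply: filterS => t h At y Sy; exact: h.
Qed.

Lemma slice_contS (T : topologicalType) (A : set T) (F : T -> V -> R) (a : T) :
  {within A `*` S, continuous (fun p => F p.1 p.2)} -> A a -> contS (F a).
Proof.
move=> /within_contP cF Aa; apply/within_contP => y Sy e e0.
have [[U W]/= [hU hW] UW] := cF (a, y) (conj Aa Sy) _ e0.
apply: filterS hW => z Wz Sz.
exact: (UW (a, z) (conj (nbhs_singleton hU) Wz) (conj Aa Sz)).
Qed.

Lemma sint_within_cont (T : topologicalType) (A : set T) (F : T -> V -> R) :
  {within A `*` S, continuous (fun p => F p.1 p.2)} ->
  {within A, continuous (fun t => sint (F t))}.
Proof.
move=> cF; apply/within_contP => a Aa e e0.
have v1 : 0 < vol + 1 by rewrite ltr_wpDl// vol_ge0.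
have e1 : 0 < e / (vol + 1) by rewrite divr_gt0.
apply: filterS (tube cF Aa e1) => t ht At.
have ca := slice_contS cF Aa; have ct := slice_contS cF At.
rewrite -sintB//; apply: le_lt_trans (@sint_abs _ (e / (vol + 1)) _ _) _.
- exact: contf_sub.
- by move=> y Sy; apply/ltW/ht.
- by rewrite mulrAC ltr_pdivrMr// ltr_pM2l// ltrDl.
Qed.

(** The mean value theorem replaces the difference quotients by dG at intermediate
    times, which are uniformly close to dG t by tube. *)
Lemma sint_is_derive (A : set R) (G dG : R -> V -> R) : open A ->
  (forall t, A t -> contS (G t)) ->
  {within A `*` S, continuous (fun p => dG p.1 p.2)} ->
  (forall (t : R) x, A t -> S x -> is_derive t 1 (G^~ x) (dG t x)) ->
  forall t : R, A t -> is_derive t 1 (fun s => sint (G s)) (sint (dG t)).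
Proof.
move=> oA cG cdG D t0 At0.
have cd := slice_contS cdG At0.
suff H : (fun h : R => h^-1 *: ((fun s => sint (G s)) (h *: 1 + t0) - sint (G t0))) @ 0^' --> sint (dG t0).
  by apply: DeriveDef; [apply/cvg_ex; exists (sint (dG t0))|exact/cvg_lim].
apply/cvgrPdist_lt => e e0.
have v1 : 0 < vol + 1 by rewrite ltr_wpDl// vol_ge0.
have e1 : 0 < e / (vol + 1) by rewrite divr_gt0.
have hA : \forall t \near t0, A t by exact: open_nbhs_nbhs.
have /nbhs_ballP[d /= d0 hd] : \forall t \near t0, A t /\ (A t -> forall y, S y -> `|dG t0 y - dG t y| < e / (vol + 1)) by exact: filterI hA (tube cdG At0 e1).
apply/nbhs_ballP; exists d => //= h hh h0.
rewrite [h *: 1]mulr1.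
have hd0 : `|h| < d by move: hh; rewrite /ball/= sub0r normrN.
have inb s : `|s| <= `|h| -> ball t0 d (s + t0).
  move=> sh; rewrite /ball/= opprD addrCA subrr addr0 normrN.
  exact: le_lt_trans sh hd0.
have [Ah _] := hd _ (inb h (lexx _)).
rewrite [_ *: _]mulrC -sintB; [|exact: cG..].
have h0' : h != 0 := h0.
have -> : sint (dG t0) - sint (fun x => G (h + t0) x - G t0 x) / h =
          sint (fun x => dG t0 x - h^-1 * (G (h + t0) x - G t0 x)).
  rewrite [in LHS]mulrC -sintZ//; last by apply: contf_sub; exact: cG.
  rewrite sintB//; apply: contf_scale; apply: contf_sub; exact: cG.
apply: le_lt_trans (@sint_abs _ (e / (vol + 1)) _ _) _.
- apply: contf_sub => //; apply: contf_scale; apply: contf_sub; exact: cG.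
- move=> x Sx.
  have [c ch hc] : exists2 c, `|c| <= `|h| & G (h + t0) x - G t0 x = dG (c + t0) x * h.
    have Dx s : `|s| <= `|h| -> is_derive (s + t0) 1 (G^~ x) (dG (s + t0) x).
      by move=> /inb/hd[As _]; exact: D.
    have Dx' (a b : R) : (forall r, a <= r <= b -> `|r - t0| <= `|h|) ->
        forall r, r \in `]a, b[ -> is_derive r 1 (G^~ x) (dG r x).
      move=> hab r; rewrite in_itv/= => /andP[/ltW ar /ltW rb].
      by have := Dx (r - t0); rewrite subrK; apply; apply: hab; rewrite ar.
    have Cx (a b : R) : (forall r, a <= r <= b -> `|r - t0| <= `|h|) ->
        {within `[a, b], continuous (G^~ x)}.
      move=> hab; apply: derivable_within_continuous => r; rewrite in_itv/= => /hab hr.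
      by have := Dx (r - t0) hr; rewrite subrK => -[].
    have [hn|hp|h00] := ltgtP h 0; last by rewrite h00 eqxx in h0'.
      have ht : h + t0 < t0 by rewrite gtrDr.
      have hab r : h + t0 <= r <= t0 -> `|r - t0| <= `|h|.
        move=> /andP[r1 r2]; rewrite (ltr0_norm hn) ler0_norm ?subr_le0// opprB; lra.
      have [c] := MVT ht (Dx' _ _ hab) (Cx _ _ hab).
      rewrite in_itv/= => /andP[/ltW c1 /ltW c2] hc; exists (c - t0).
        by apply: hab; rewrite c1.
      by rewrite subrK -opprB hc; ring.
    have ht : t0 < h + t0 by rewrite ltrDr.
    have hab r : t0 <= r <= h + t0 -> `|r - t0| <= `|h|.
      move=> /andP[r1 r2]; rewrite (gtr0_norm hp) ger0_norm ?subr_ge0//; lra.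
    have [c] := MVT ht (Dx' _ _ hab) (Cx _ _ hab).
    rewrite in_itv/= => /andP[/ltW c1 /ltW c2] hc; exists (c - t0).
      by apply: hab; rewrite c1.
    by rewrite subrK hc; ring.
  rewrite hc mulrC mulfK//; have [Ac ht] := hd _ (inb c ch).
  exact/ltW/ht.
- by rewrite mulrAC ltr_pdivrMr// ltr_pM2l// ltrDl.
Qed.

(** A partition of unity subordinate to small balls: F x y is uniformly close to the sum
    of the products eta i x * F (p i) y, for which the order of integration is
    immaterial. *)
Lemma sint_swap_approx (F : V -> V -> R) (e : R) :
  {within S `*` S, continuous (fun p => F p.1 p.2)} -> 0 < e ->
  exists (k : nat) (p : 'I_k -> V) (eta : 'I_k -> V -> R),
    [/\ forall i, S (p i), forall i, contS (eta i), forall i x, 0 <= eta i x,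
       forall x, S x -> \sum_i eta i x = 1 &
       forall i x y, S x -> S y -> eta i x != 0 -> `|F (p i) y - F x y| <= e].
Proof.
move=> cF e0.
have dP a : exists d : R, S a -> 0 < d /\ forall x, ball a d x -> S x -> forall y, S y -> `|F a y - F x y| < e.
  have [Sa|nSa] := pselect (S a); last by exists 1 => /nSa.
  have /nbhs_ballP[d /= d0 hd] := tube cF Sa e0.
  by exists d => _; split.
pose d a := sval (cid (dP a)).
have dS a : S a -> 0 < d a /\ forall x, ball a (d a) x -> S x -> forall y, S y -> `|F a y - F x y| < e.
  by rewrite /d; case: cid.
(* the finite subsets of the sphere, directed by inclusion: compactness in its covering
   form yields a finite subcover *)
pose Fil : set_system (seq V) := [set P : set (seq V) | exists2 s0 : seq V,
  (forall a, a \in s0 -> S a) & forall s : seq V, {subset s0 <= s} -> P s].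
have FF : Filter Fil.
  split=> [|P Q [s1 h1 P1] [s2 h2 Q2]|P Q PQ [s0 h0 P0]].
  - by exists [::].
  - exists (s1 ++ s2) => [a|s0 h]; first by rewrite mem_cat => /orP[/h1|/h2].
    by split; [apply: P1|apply: Q2] => a as_; apply: h; rewrite mem_cat as_ ?orbT.
  - by exists s0 => // s1 /P0/PQ.
have [s sS SD] : Fil (fun s => S `<=` (fun x => exists2 a, a \in s & ball a (d a) x)).
  have := (compact_near_coveringP _).1 (@sphere_compact R n) _ Fil (fun (s : seq V) (x : V) => exists2 a, a \in s & ball a (d a) x) FF.
  apply => x Sx.
  exists (ball x (d x), [set s : seq V | (x : V) \in s]).
    split; first by apply: nbhsx_ballx; have [] := dS x Sx.
    by exists [:: x] => [a|s h]; [rewrite inE => /eqP ->|apply: h; rewrite inE].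
  by move=> [y s] /= [xy xs]; exists x.
have {}SD := SD s (fun a h => h).
pose k := size s.
pose p (i : 'I_k) := nth 0 s i.
have pS i : S (p i) by apply: sS; exact: mem_nth.
pose w (i : 'I_k) x := d (p i) - `|p i - x|.
pose b (i : 'I_k) x := w i x + `|w i x|.
have b0 i x : 0 <= b i x by rewrite /b addrC -lerBlDr sub0r -normrN ler_norm.
have cb i : continuous (b i).
  have cw : continuous (w i).
    move=> x; apply: cvgB; first exact: cvg_cst.
    by apply: cvg_norm; apply: cvgB; [exact: cvg_cst|exact: cvg_id].
  by move=> x; apply: cvgD; [exact: cw|apply: cvg_norm; exact: cw].
pose B x := \sum_i b i x.
have B0 x : S x -> B x != 0.
  move=> /SD[a aD ax]; have ia : (index a s < k)%N by rewrite index_mem.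
  rewrite gt_eqF// /B (bigD1 (Ordinal ia))//= ltr_pwDl ?sumr_ge0//.
  have : 0 < w (Ordinal ia) x.
    by rewrite /w /p/= nth_index// subr_gt0; move: ax; rewrite -ball_normE.
  by move=> w0; rewrite /b gtr0_norm// addr_gt0.
exists k, p, (fun i x => b i x / B x); split => //.
- move=> i; apply: contf_mul; first exact: contS_T.
  have cB : contS B by apply: contS_T; apply: contf_sum => j _; exact: cb.
  by apply: (contS_compat cB) => x Sx; apply: cvgV; [exact: B0|exact: cvg_id].
- by move=> i x; rewrite divr_ge0// sumr_ge0.
- by move=> x Sx; rewrite -mulr_suml mulfV// B0.
- move=> i x y Sx Sy; rewrite mulf_eq0 negb_or => /andP[bi _].
  have [_ h] := dS _ (pS i); apply/ltW/h => //.
  rewrite -ball_normE/= -subr_gt0; move: bi; apply: contraNT.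
  by rewrite -leNgt /b -/(w i x) => w0; rewrite ler0_norm// subrr.
Qed.

Lemma swap_within (F : V -> V -> R) : {within S `*` S, continuous (fun p => F p.1 p.2)} ->
  {within S `*` S, continuous (fun p => F p.2 p.1)}.
Proof.
move=> /within_contP cF; apply/within_contP => -[x y] [/= Sx Sy] e e0.
have [[U W]/= [hU hW] UW] := cF (y, x) (conj Sy Sx) _ e0.
exists (W, U) => //= -[a b]/= [Wa Ub] [/= Sa Sb].
exact: (UW (b, a) (conj Ub Wa) (conj Sb Sa)).
Qed.

Lemma sint_fubini (F : V -> V -> R) : {within S `*` S, continuous (fun p => F p.1 p.2)} ->
  sint (fun x => sint (fun y => F x y)) = sint (fun y => sint (fun x => F x y)).
Proof.
move=> cF; have cF' := swap_within cF.
have c1 x : S x -> contS (F x) by move=> Sx; exact: (slice_contS cF Sx).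
have c2 y : S y -> contS (F^~ y) by move=> Sy; exact: (@slice_contS V S (fun y x => F x y) y cF' Sy).
have i1 : contS (fun x => sint (F x)) by exact: sint_within_cont cF.
have i2 : contS (fun y => sint (F^~ y)) by exact: (@sint_within_cont V S (fun y x => F x y) cF').
apply/eqP; rewrite -subr_eq0 -normr_eq0; apply/eqP/le_anti; rewrite normr_ge0 andbT.
apply/ler_addgt0Pr => e e0; rewrite add0r.
have v1 : 0 < vol ^+ 2 * 2 + 1 by rewrite ltr_wpDl// mulr_ge0// sqr_ge0.
set e' := e / (vol ^+ 2 * 2 + 1).
have e'0 : 0 < e' by rewrite divr_gt0.
have [k [p [eta [pS ce eta0 eta1 he]]]] := sint_swap_approx cF e'0.
have key x y (f : V -> R) : S x -> (forall i, eta i x != 0 -> `|f (p i) - f x| <= y) ->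
    `|\sum_i eta i x * f (p i) - f x| <= y.
  move=> Sx hf; rewrite -[f x in X in `|_ - X|]mul1r -(eta1 x Sx) mulr_suml -sumrB.
  rewrite (le_trans (ler_norm_sum _ _ _))// -[leRHS]mul1r -(eta1 x Sx) mulr_suml.
  apply: ler_sum => i _; rewrite -mulrBr normrM (ger0_norm (eta0 _ _)).
  have [->|ei] := eqVneq (eta i x) 0; first by rewrite !mul0r.
  by rewrite ler_wpM2l// hf.
pose A := \sum_i sint (eta i) * sint (F (p i)).
have h1 : `|A - sint (fun x => sint (F x))| <= e' * vol ^+ 2.
  have -> : A = sint (fun x => \sum_i eta i x * sint (F (p i))).
    have [_ ->] := @sint_sum _ (index_enum 'I_k) (fun i x => eta i x * sint (F (p i))) (fun i => contf_mul (ce i) (@contS_cst _)).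
    apply: eq_bigr => i _; rewrite mulrC -sintZ//; apply: sint_ext => x _; exact: mulrC.
  have cs : contS (fun x => \sum_i eta i x * sint (F (p i))).
    apply: contf_sum => i _; apply: contf_mul; [exact: ce|exact: contf_cst].
  rewrite -sintB// expr2 mulrA; apply: sint_abs => [|x Sx]; first exact: contf_sub.
  apply: (key x _ (fun z => sint (F z))) => // i ei.
  rewrite -sintB; [|exact: c1..]; apply: sint_abs => [|y Sy]; last exact: he.
  by apply: contf_sub; exact: c1.
have h2 : `|A - sint (fun y => sint (F^~ y))| <= e' * vol ^+ 2.
  have -> : A = sint (fun y => \sum_i sint (eta i) * F (p i) y).
    have cFi i : contS (fun y => sint (eta i) * F (p i) y) by apply: contf_scale; exact: c1.
    have [_ ->] := @sint_sum _ (index_enum 'I_k) (fun i y => sint (eta i) * F (p i) y) cFi.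
    by apply: eq_bigr => i _; rewrite sintZ//; exact: c1.
  have cs : contS (fun y => \sum_i sint (eta i) * F (p i) y).
    apply: contf_sum => i _; apply: contf_scale; exact: c1.
  rewrite -sintB// expr2 mulrA; apply: sint_abs => [|y Sy]; first exact: contf_sub.
  have -> : \sum_i sint (eta i) * F (p i) y = sint (fun x => \sum_i eta i x * F (p i) y).
    have [_ ->] := @sint_sum _ (index_enum 'I_k) (fun i x => eta i x * F (p i) y) (fun i => contf_mul (ce i) (@contS_cst _)).
    apply: eq_bigr => i _; rewrite mulrC -sintZ//; apply: sint_ext => x _; exact: mulrC.
  have cs2 : contS (fun x => \sum_i eta i x * F (p i) y).
    apply: contf_sum => i _; apply: contf_mul; [exact: ce|exact: contf_cst].
  rewrite -sintB//; last exact: c2.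
  apply: sint_abs => [|x Sx]; first by apply: contf_sub => //; exact: c2.
  by apply: (key x _ (F^~ y)) => // i ei; exact: he.
move: h1 h2; move: (A) (sint (fun x => sint (F x))) (sint (fun y => sint (F^~ y))) => a X Y h1 h2.
have -> : X - Y = (a - Y) - (a - X) by ring.
rewrite (le_trans (ler_normB _ _))// (le_trans (lerD h2 h1))//.
have -> : e' * vol ^+ 2 + e' * vol ^+ 2 = e * ((vol ^+ 2 * 2) / (vol ^+ 2 * 2 + 1)) by rewrite /e'; ring.
rewrite -[leRHS]mulr1; apply: ler_wpM2l; first exact: ltW.
by rewrite ler_pdivrMr// mul1r lerDl.
Qed.

End SphereIntegral.

(** * The sub-Riemannian structure *)

Section SubRiemannian.
Variables (R : realType) (n : nat).
Notation V := (Cspace R n).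
Notation m := (n.*2.+1).
Notation S := (@sphere R n).
Notation rp := (@radial_proj R n).
Local Notation bas := (@bas R n).
Implicit Types (x v w z : V) (phi psi chi : V -> R).

(** The derivative along the Reeb direction, up to normalization. *)
Definition Tder phi x : R := tgrad (Jmul x) phi x.

(** The product of the horizontal gradients: full tangential gradients minus their Reeb
    components. It is 4 times the Levi form (levi_gradE). *)
Definition Gam phi psi x : R :=
  \sum_i tgrad (bas i) phi x * tgrad (bas i) psi x - Tder phi x * Tder psi x.

(** Laplacian minus second Reeb derivative; this is 4 times the sub-Laplacian
    (sublaplacianE). *)
Definition Dsub phi x : R :=
  \sum_i tgrad (bas i) (tgrad (bas i) phi) x - Tder (Tder phi) x.

Record C2 phi : Prop := MkC2 { C2_C1 : C1 phi ; C2_grad : forall z, C1 (tgrad z phi) }.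

Lemma JbasE x i : edot (Jmul x) (bas i) = - edot x (Jmul (bas i)).
Proof. exact: edotJl. Qed.

Lemma edot_rp_is_derive z v x : S x ->
  is_derive x v ((fun y : V => edot y z) \o rp) (edot v z - edot x v * edot x z).
Proof.
move=> Sx; have x1 := (sphereP x).1 Sx.
have lin w y : is_derive y w (fun y : V => edot y z) (edot w z).
  apply/(is_derive_line (W := R)).
  have -> : (fun s : R => edot (y + s *: w) z) = (fun s => edot y z + s * edot w z).
    by apply/funext => s; rewrite edotDl edotZl.
  exact: pder_affine.
have linq w : is_derive x w (fun y : V => edot y y) (2 * edot x w).
  apply/(is_derive_line (W := R)).
  have -> : (fun s : R => edot (x + s *: w) (x + s *: w)) =
    (fun s => (edot x x + s * (2 * edot x w)) + s * (s * edot w w)).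
    by apply/funext => s; rewrite !(edotDl, edotDr, edotZl, edotZr) (edotC w x); ring.
  rewrite -[X in is_derive _ _ _ X]addr0; apply: pderD; first exact: pder_affine.
  apply: pder_eq (pderM (pder_id _ _) (pderM (pder_id _ _) (pder_cst _ _ _))) _.
  by rewrite /=; ring.
have hs : is_derive (1 : R) 1 (@Num.sqrt R) ((2 * Num.sqrt 1)^-1).
  exact: is_derive1_sqrt.
have -> : (fun y : V => edot y z) \o rp = (fun y => (enorm y)^-1 * edot y z).
  by apply/funext => y; rewrite /= /radial_proj edotZl.
have e1 : enorm x = 1 by [].
have he : is_derive x v (@enorm R n) (edot x v).
  have H : is_derive (edot x x) 1 (@Num.sqrt R) ((2 * Num.sqrt 1)^-1) by rewrite x1.
  apply: pder_eq (pder_comp (f := fun y => edot y y) H (linq v)) _.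
  by rewrite sqrtr1 mulr1 mulrA mulVf ?mul1r// pnatr_eq0.
have en0 : enorm x != 0 by rewrite e1 oner_neq0.
apply: pder_eq (pderM (pderV en0 he) (lin v x)) _.
by rewrite e1 /= invr1 expr1n divr1 mul1r addrC mulNr.
Qed.

Lemma C1_edot z : C1 (fun x : V => edot x z).
Proof.
apply: (@C1P _ _ _ (fun v x => edot v z - edot x v * edot x z)).
- exact: contS_edot.
- by move=> v x Sx; exact: edot_rp_is_derive.
- move=> v; apply: contf_sub; first exact: contS_cst.
  by apply: contf_mul; exact: contS_edot.
Qed.

Lemma tgrad_edot z v x : S x ->
  tgrad v (fun y : V => edot y z) x = edot v z - edot x v * edot x z.
Proof. by move=> Sx; apply: tgradE; exact: edot_rp_is_derive. Qed.

Lemma C2_edot z : C2 (fun x : V => edot x z).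
Proof.
split=> [|v]; first exact: C1_edot.
apply: (@C1_ext _ _ (fun x => edot v z - edot x v * edot x z)).
  by move=> x Sx; rewrite tgrad_edot.
by apply: C1B; [exact: C1_cst|apply: C1M; exact: C1_edot].
Qed.

Lemma TderE phi x : C1 phi -> S x -> Tder phi x = \sum_i edot (Jmul x) (bas i) * tgrad (bas i) phi x.
Proof.
move=> h Sx; rewrite /Tder {1}[Jmul x]bas_expand tgradv_sum//.
by apply: eq_bigr => i _; rewrite tgradvZ.
Qed.

Lemma C1_sum (I : Type) (r : seq I) (F : I -> V -> R) : (forall i, C1 (F i)) ->
  C1 (fun x => \sum_(i <- r) F i x).
Proof.
move=> h; elim: r => [|i r IH].
  by apply: (@C1_ext _ _ (fun=> 0)) => [x _|]; [rewrite big_nil|exact: C1_cst].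
apply: (@C1_ext _ _ (fun x => F i x + \sum_(i <- r) F i x)) => [x _|]; first by rewrite big_cons.
exact: C1D.
Qed.

Lemma C1_Tder phi : C2 phi -> C1 (Tder phi).
Proof.
move=> [h1 h2]; apply: (@C1_ext _ _ (fun x => \sum_i - edot x (Jmul (bas i)) * tgrad (bas i) phi x)).
  by move=> x Sx; rewrite TderE//; apply: eq_bigr => i _; rewrite JbasE.
by apply: C1_sum => i; apply: C1M => //; apply: C1N; exact: C1_edot.
Qed.

Lemma contS_Tder phi : C1 phi -> contS (Tder phi).
Proof.
move=> h; apply: (@contS_ext _ _ (fun x => \sum_i - edot x (Jmul (bas i)) * tgrad (bas i) phi x)).
  by move=> x Sx; rewrite TderE//; apply: eq_bigr => i _; rewrite JbasE.
by apply: contf_sum => i _; apply: contf_mul; [apply: contf_opp; exact: contS_edot|exact: C1_grad].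
Qed.

Lemma contS_Gam phi psi : C1 phi -> C1 psi -> contS (Gam phi psi).
Proof.
move=> h1 h2; apply: contf_sub; last by apply: contf_mul; exact: contS_Tder.
by apply: contf_sum => i _; apply: contf_mul; exact: C1_grad.
Qed.

Lemma contS_Dsub phi : C2 phi -> contS (Dsub phi).
Proof.
move=> h; apply: contf_sub; last by apply: contS_Tder; exact: C1_Tder.
by apply: contf_sum => i _; apply: C1_grad; exact: C2_grad.
Qed.

Lemma GamC phi psi x : Gam phi psi x = Gam psi phi x.
Proof. by rewrite /Gam [X in _ - X]mulrC; congr (_ - _); apply: eq_bigr => i _; rewrite mulrC. Qed.

Lemma Gam_lin phi1 phi2 psi chi (a b : R) x :
  (forall z, tgrad z psi x = a * tgrad z phi1 x + b * tgrad z phi2 x) ->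
  Gam psi chi x = a * Gam phi1 chi x + b * Gam phi2 chi x.
Proof.
move=> h; rewrite /Gam /Tder.
have -> : \sum_i tgrad (bas i) psi x * tgrad (bas i) chi x =
  a * (\sum_i tgrad (bas i) phi1 x * tgrad (bas i) chi x) +
  b * (\sum_i tgrad (bas i) phi2 x * tgrad (bas i) chi x).
  rewrite !mulr_sumr -big_split; apply: eq_bigr => i _ /=; rewrite h.
  by rewrite mulrDl !mulrA.
rewrite h; move: (\sum_i _) (\sum_i _) (tgrad (Jmul x) phi1 x) (tgrad (Jmul x) phi2 x) (tgrad (Jmul x) chi x).
by move=> p q r s t; ring.
Qed.

Lemma GamMl phi psi chi x : C1 phi -> C1 psi -> S x ->
  Gam (fun y => phi y * psi y) chi x = psi x * Gam phi chi x + phi x * Gam psi chi x.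
Proof. by move=> h1 h2 Sx; apply: Gam_lin => z; rewrite tgradM// mulrC. Qed.

Lemma Gam_comp (F dF : R -> R) phi chi x : C1 phi -> S x -> is_derive (phi x) 1 F (dF (phi x)) ->
  Gam (fun y => F (phi y)) chi x = dF (phi x) * Gam phi chi x.
Proof.
move=> h Sx D; rewrite (@Gam_lin phi phi _ _ (dF (phi x)) 0) ?mul0r ?addr0// => z.
by rewrite (@tgrad_comp _ _ _ h _ dF) // mul0r addr0.
Qed.

Lemma GamZl c phi chi x : C1 phi -> S x ->
  Gam (fun y => c * phi y) chi x = c * Gam phi chi x.
Proof.
move=> h Sx; rewrite (@Gam_lin phi phi _ _ c 0) ?mul0r ?addr0// => z.
by rewrite tgradZ// mul0r addr0.
Qed.

Lemma GamDl phi psi chi x : C1 phi -> C1 psi -> S x ->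
  Gam (fun y => phi y + psi y) chi x = Gam phi chi x + Gam psi chi x.
Proof.
move=> h h' Sx; rewrite (@Gam_lin phi psi _ _ 1 1) ?mul1r// => z.
by rewrite tgradD// !mul1r.
Qed.

Lemma Gam_ge0 phi x : C1 phi -> S x -> 0 <= Gam phi phi x.
Proof.
move=> h Sx; rewrite /Gam; pose g : V := \sum_i tgrad (bas i) phi x *: bas i.
have gE v : edot g v = tgrad v phi x.
  rewrite {2}[v]bas_expand tgradv_sum// edot_suml; apply: eq_bigr => i _.
  by rewrite edotZl tgradvZ// mulrC edotC.
have -> : \sum_i tgrad (bas i) phi x * tgrad (bas i) phi x = edot g g.
  by rewrite edot_bas; apply: eq_bigr => i _; rewrite gE.
rewrite /Tder -gE; have x1 := (sphereP x).1 Sx.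
have := edot_ge0 (g - edot g (Jmul x) *: Jmul x).
rewrite !(edotBl, edotBr, edotZl, edotZr) edotJ x1 (edotC (Jmul x)).
move: (edot g g) (edot g (Jmul x)) => p q; nra.
Qed.

Lemma edot_delta1 v j : edot v ((delta_mx 0 j, 0) : V) = v.1 0 j.
Proof.
rewrite /edot (bigD1 j)//= big1 ?addr0 => [|i ij].
  by rewrite !mxE !eqxx mulr1 mulr0 addr0.
by rewrite !mxE eqxx (negPf ij) !mulr0 addr0.
Qed.

Lemma edot_delta2 v j : edot v ((0, delta_mx 0 j) : V) = v.2 0 j.
Proof.
rewrite /edot (bigD1 j)//= big1 ?addr0 => [|i ij].
  by rewrite !mxE !eqxx mulr1 mulr0 add0r.
by rewrite !mxE eqxx (negPf ij) !mulr0 addr0.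
Qed.

(** The tangential gradient represents the tangential derivatives. *)
Lemma sphere_grad_edot phi x v : C1 phi -> S x -> edot (sphere_grad phi x) v = tgrad v phi x.
Proof.
move=> h Sx.
have -> : v = \sum_(j < n.+1) v.1 0 j *: ((delta_mx 0 j, 0) : V) + \sum_(j < n.+1) v.2 0 j *: ((0, delta_mx 0 j) : V).
  have e1 : \sum_(j < n.+1) v.1 0 j *: ((delta_mx 0 j, 0) : V) = (v.1, 0).
    rewrite [v.1 in RHS]row_sum_delta; elim/big_rec2: _ => [//|j y1 y2 _ ->].
    by rewrite /GRing.scale/= /scale_pair/= scaler0 /GRing.add/= /add_pair/= add0r.
  have e2 : \sum_(j < n.+1) v.2 0 j *: ((0, delta_mx 0 j) : V) = (0, v.2).
    rewrite [v.2 in RHS]row_sum_delta; elim/big_rec2: _ => [//|j y1 y2 _ ->].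
    by rewrite /GRing.scale/= /scale_pair/= scaler0 /GRing.add/= /add_pair/= add0r.
  by rewrite e1 e2 /GRing.add/= /add_pair/= addr0 add0r -surjective_pairing.
rewrite tgradvD// !tgradv_sum// edotDr !edot_sumr; congr (_ + _); apply: eq_bigr => j _.
  by rewrite edotZr tgradvZ// edot_delta1 mxE tgrad.unlock.
by rewrite edotZr tgradvZ// edot_delta2 mxE tgrad.unlock.
Qed.

Lemma levi_gradE phi psi x : C1 phi -> C1 psi -> S x ->
  levi_grad phi psi x = 4^-1 * Gam phi psi x.
Proof.
move=> h1 h2 Sx; rewrite /levi_grad /Gam /horizontal_proj; congr (_ * _).
have x1 := (sphereP x).1 Sx.
rewrite !(edotBl, edotBr, edotZl, edotZr) edotJ x1 !(edotC (Jmul x)).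
rewrite !(sphere_grad_edot (Jmul x))// -!/(Tder _ _).
have -> : edot (sphere_grad phi x) (sphere_grad psi x) = \sum_i tgrad (bas i) phi x * tgrad (bas i) psi x.
  by rewrite edot_bas; apply: eq_bigr => i _; rewrite !sphere_grad_edot.
by move: (\sum_i _) (Tder phi x) (Tder psi x) => p q r; ring.
Qed.

Hypothesis n_gt0 : (0 < n)%N.

(** sint_tgrad for each component of a tangent field: the zeroth order terms add up to
    its normal component, which is zero. *)
Lemma sint_div (F : 'I_m.+1 -> V -> R) : (forall i, C1 (F i)) ->
  (forall x, S x -> \sum_i edot x (bas i) * F i x = 0) ->
  sint (fun x => \sum_i tgrad (bas i) (F i) x) = 0.
Proof.
move=> h hx; have cF i : contS (tgrad (bas i) (F i)) by exact: C1_grad.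
have [_ ->] := sint_sum n_gt0 (index_enum 'I_m.+1) cF.
have ce i : contS (fun x => edot x (bas i) * F i x).
  by apply: contf_mul; [exact: contS_edot|exact: C1_cont].
have [_ e2] := sint_sum n_gt0 (index_enum 'I_m.+1) ce.
under eq_bigr do rewrite sint_tgrad//.
rewrite -mulr_sumr -e2 (@sint_ext _ _ _ (fun=> 0)) ?sint_cst ?mul0r ?mulr0//.
Qed.

(** The Reeb field is tangent, and divergence free since i is skew. *)
Lemma sint_Tder phi : C1 phi -> sint (Tder phi) = 0.
Proof.
move=> h.
pose F i x := - edot x (Jmul (bas i)) * phi x.
have cF i : C1 (F i) by apply: C1M => //; apply: C1N; exact: C1_edot.
rewrite (@sint_ext _ _ _ (fun x => \sum_i tgrad (bas i) (F i) x)); last first.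
  move=> x Sx; rewrite TderE//.
  have e i : tgrad (bas i) (F i) x = edot (Jmul x) (bas i) * tgrad (bas i) phi x
      - (edot (Jmul x) (bas i) * edot x (bas i)) * phi x.
    rewrite /F tgradM//; last by apply: C1N; exact: C1_edot.
    rewrite tgradN//; last exact: C1_edot.
    rewrite tgrad_edot// edotJx sub0r opprK JbasE addrC; congr (_ + _).
    by rewrite mulNr mulNr opprK [X in X * phi x]mulrC.
  rewrite (eq_bigr _ (fun i _ => e i)) sumrB -mulr_suml -edot_bas.
  by rewrite (edotC (Jmul x)) edotJx mul0r subr0.
apply: sint_div => // x Sx.
rewrite (eq_bigr (fun i => edot x (bas i) * edot (Jmul x) (bas i) * phi x)).
  by rewrite -mulr_suml -edot_bas edotJx mul0r.
by move=> i _; rewrite /F JbasE !mulrA.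
Qed.

(** The horizontal gradient of psi, multiplied by phi, is a tangent field: apply
    sint_div and sint_Tder. *)
Lemma sint_Gam phi psi : C1 phi -> C2 psi ->
  sint (Gam phi psi) = - sint (fun x => phi x * Dsub psi x).
Proof.
move=> h [h1 h2].
pose F i x := phi x * tgrad (bas i) psi x.
have cF i : C1 (F i) by exact: C1M.
have cT : C1 (Tder psi) by exact: C1_Tder.
have k1 : sint (fun x => \sum_i tgrad (bas i) (F i) x) = 0.
  apply: sint_div => // x Sx.
  rewrite (eq_bigr (fun i => phi x * (edot x (bas i) * tgrad (bas i) psi x))); last first.
    by move=> i _; rewrite mulrCA.
  rewrite -mulr_sumr (eq_bigr (fun i => tgrad (edot x (bas i) *: bas i) psi x)); last first.
    by move=> i _; rewrite tgradvZ.
  by rewrite -tgradv_sum// -bas_expand tgrad_radial// mulr0.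
have k2 : sint (Tder (fun x => phi x * Tder psi x)) = 0 by apply: sint_Tder; exact: C1M.
have c1 : contS (fun x => \sum_i tgrad (bas i) (F i) x) by apply: contf_sum => i _; exact: C1_grad.
have c2 : contS (Tder (fun x => phi x * Tder psi x)) by apply: contS_Tder; exact: C1M.
have c3 : contS (fun x => phi x * Dsub psi x).
  by apply: contf_mul; [exact: C1_cont|exact: contS_Dsub].
apply/eqP; rewrite -addr_eq0 -sintD//; last exact: contS_Gam.
apply/eqP.
have k3 := sintB n_gt0 c1 c2; rewrite k1 k2 subrr in k3.
rewrite -k3; apply: sint_ext => x Sx.
rewrite (eq_bigr (fun i => tgrad (bas i) phi x * tgrad (bas i) psi x + phi x * tgrad (bas i) (tgrad (bas i) psi) x)); last first.
  by move=> i _; rewrite tgradM.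
have -> : Tder (fun y => phi y * Tder psi y) x = Tder phi x * Tder psi x + phi x * Tder (Tder psi) x.
  exact: tgradM.
rewrite big_split/= -mulr_sumr /Gam /Dsub.
move: (\sum_i _) (\sum_i _) (Tder phi x) (Tder psi x) (Tder (Tder psi) x) (phi x) => p q r s t a.
by ring.
Qed.

Lemma sint_Dsub_sym phi psi : C2 phi -> C2 psi ->
  sint (fun x => phi x * Dsub psi x) = sint (fun x => psi x * Dsub phi x).
Proof.
move=> h1 h2; apply: oppr_inj; rewrite -!sint_Gam; [|exact: C2_C1|by []|exact: C2_C1|by []].
by apply: sint_ext => x _; rewrite GamC.
Qed.

End SubRiemannian.

(** * Smooth functions on the sphere and on space-time *)

Section SmoothOpen.
Variables (R : realType) (W : normedModType R).
Implicit Types (O A : set W) (g h : W -> R) (v w x : W).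

Lemma iter_derive_rcons vs v g :
  iter_derive (rcons vs v) g = iter_derive vs (fun x => 'D_v g x).
Proof. by elim: vs => //= w vs ->. Qed.

Lemma smooth_derive O v g : smooth_on_open O g -> smooth_on_open O (fun x => 'D_v g x).
Proof. by move=> h vs x Ox; have := h (rcons vs v) x Ox; rewrite iter_derive_rcons. Qed.

Lemma smooth_cont O g x : smooth_on_open O g -> O x -> {for x, continuous g}.
Proof. by move=> h Ox; case: (h [::] x Ox). Qed.

Lemma smooth_is_derive O g x v : smooth_on_open O g -> O x -> is_derive x v g ('D_v g x).
Proof. by move=> h Ox; case: (h [::] x Ox) => _ /(_ v) d; exact: DeriveDef. Qed.

Lemma smooth_subset O O' g : O' `<=` O -> smooth_on_open O g -> smooth_on_open O' g.
Proof. by move=> s h vs x /s; exact: h. Qed.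

(** Coinduction: a class of continuous functions that is stable, up to equality on O,
    under all directional derivatives consists of smooth functions. *)
Lemma smooth_coind (P : (W -> R) -> Prop) O g : open O ->
  (forall h, P h -> forall x, O x -> {for x, continuous h}) ->
  (forall h, P h -> forall v, exists2 k, P k & forall x, O x -> is_derive x v h (k x)) ->
  P g -> smooth_on_open O g.
Proof.
move=> oO Pc Pd Pg.
have H vs : exists2 k, P k & forall x, O x -> iter_derive vs g x = k x.
  elim: vs => [|v vs [k poisson kE]] /=; first by exists g.
  have [l Pl lE] := Pd k poisson v; exists l => // x Ox.
  have := lE x Ox => dk.
  suff dg : is_derive x v (iter_derive vs g) (l x) by rewrite (@derive_val _ _ _ _ _ _ _ dg).
  apply: pder_near dk; apply: filterS (open_nbhs_nbhs (conj oO Ox)) => y Oy.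
  by rewrite kE.
move=> vs x Ox; have [k poisson kE] := H vs.
have nx : {near x, k =1 iter_derive vs g}.
  by apply: filterS (open_nbhs_nbhs (conj oO Ox)) => y Oy; rewrite kE.
split=> [|v].
  have kc : k @ x --> k x by exact: Pc.
  rewrite /prop_for /continuous_at kE//; apply: cvg_trans kc; exact: near_eq_cvg.
have [l _ lE] := Pd k poisson v; have dk := lE x Ox.
by case: (pder_near nx dk).
Qed.

(** Polynomial expressions in smooth and in linear functions. This class satisfies the
    hypotheses of smooth_coind, which gives stability of smoothness under sums and
    products at once. *)
Inductive alg O : (W -> R) -> Prop :=
| alg_base g : smooth_on_open O g -> alg O g
| alg_cst c : alg O (fun=> c)
| alg_lin (l : W -> R) : continuous l -> (forall x v s, l (x + s *: v) = l x + s * l v) -> alg O l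
| alg_add g h : alg O g -> alg O h -> alg O (fun x => g x + h x)
| alg_mul g h : alg O g -> alg O h -> alg O (fun x => g x * h x).

Lemma alg_smooth O g : open O -> alg O g -> smooth_on_open O g.
Proof.
move=> oO; apply: smooth_coind => // {}g.
- elim=> [{}g hg x Ox|c x _|l lc _ x _|{}g h _ IH1 _ IH2 x Ox|{}g h _ IH1 _ IH2 x Ox].
  + exact: smooth_cont hg Ox.
  + exact: cvg_cst.
  + exact: lc.
  + by apply: cvgD; [exact: IH1|exact: IH2].
  + by apply: cvgM; [exact: IH1|exact: IH2].
- move=> + v; elim=> [{}g hg|c|l lc ll|{}g h ag [k1 P1 D1] ah [k2 P2 D2]|{}g h ag [k1 P1 D1] ah [k2 P2 D2]].
  + exists (fun x => 'D_v g x); first by apply: alg_base; exact: smooth_derive.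
    by move=> x Ox; exact: smooth_is_derive Ox.
  + by exists (fun=> 0); [exact: alg_cst|move=> x _; exact: pder_cst].
  + exists (fun=> l v); first exact: alg_cst.
    move=> x _; apply/(is_derive_line (W := R)).
    have -> : (fun s : R => l (x + s *: v)) = (fun s => l x + s * l v) by apply/funext => s.
    exact: pder_affine.
  + exists (fun x => k1 x + k2 x); first exact: alg_add.
    by move=> x Ox; apply: pderD; [exact: D1|exact: D2].
  + exists (fun x => k1 x * h x + g x * k2 x).
      by apply: alg_add; exact: alg_mul.
    by move=> x Ox; apply: pderM; [exact: D1|exact: D2].
Qed.

Lemma smooth_on_alg2 (op : (W -> R) -> (W -> R) -> W -> R) A g h :
  (forall O g h, alg O g -> alg O h -> alg O (op g h)) ->
  (forall g h g' h' x, g x = g' x -> h x = h' x -> op g h x = op g' h' x) ->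
  smooth_on A g -> smooth_on A h -> smooth_on A (op g h).
Proof.
move=> opalg opext sg sh a Aa.
have [ O1 [g1 [ o1 O1a s1 e1]]] := sg a Aa; have [ O2 [h1 [ o2 O2a s2 e2]]] := sh a Aa.
have o12 : open (O1 `&` O2) by exact: openI.
exists (O1 `&` O2), (op g1 h1); split => //.
  apply: alg_smooth => //; apply: opalg; apply: alg_base.
    exact: smooth_subset s1.
  exact: smooth_subset s2.
by move=> x [Ox1 Ox2] Ax; apply: opext; [exact: e1|exact: e2].
Qed.

Lemma smooth_on_add A g h : smooth_on A g -> smooth_on A h -> smooth_on A (fun x => g x + h x).
Proof.
apply: (@smooth_on_alg2 (fun g h x => g x + h x)) => [ O|].
  exact: alg_add.
by move=> {}g {}h g' h' x -> ->.
Qed.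

Lemma smooth_on_mul A g h : smooth_on A g -> smooth_on A h -> smooth_on A (fun x => g x * h x).
Proof.
apply: (@smooth_on_alg2 (fun g h x => g x * h x)) => [ O|].
  exact: alg_mul.
by move=> {}g {}h g' h' x -> ->.
Qed.

Lemma smooth_on_T A g : alg setT g -> smooth_on A g.
Proof.
move=> h a Aa; exists setT, g; split => //; first exact: openT.
by apply: alg_smooth => //; exact: openT.
Qed.

Lemma smooth_on_cst A c : smooth_on A (fun=> c).
Proof. by apply: smooth_on_T; exact: alg_cst. Qed.

Lemma smooth_on_ext A g h : (forall x, A x -> g x = h x) -> smooth_on A g -> smooth_on A h.
Proof.
move=> gh sg a Aa; have [ O [k [oO Oa sk ek]]] := sg a Aa.
by exists O, k; split => // x Ox Ax; rewrite ek// gh.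
Qed.

Lemma smooth_on_opp A g : smooth_on A g -> smooth_on A (fun x => - g x).
Proof.
move=> sg; apply: (@smooth_on_ext _ (fun x => -1 * g x)) => [x _|]; first by rewrite mulN1r.
by apply: smooth_on_mul => //; exact: smooth_on_cst.
Qed.

Lemma smooth_on_sum A (I : Type) (r : seq I) (F : I -> W -> R) : (forall i, smooth_on A (F i)) ->
  smooth_on A (fun x => \sum_(i <- r) F i x).
Proof.
move=> h; elim: r => [|i r IH].
  by apply: (@smooth_on_ext _ (fun=> 0)) => [x _|]; [rewrite big_nil|exact: smooth_on_cst].
apply: (@smooth_on_ext _ (fun x => F i x + \sum_(i <- r) F i x)) => [x _|]; first by rewrite big_cons.
exact: smooth_on_add.
Qed.

Lemma smooth_on_sub A A' g : A' `<=` A -> smooth_on A g -> smooth_on A' g.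
Proof.
move=> s sg a /s Aa; have [ O [k [oO Oa sk ek]]] := sg a Aa.
by exists O, k; split => // x Ox /s; exact: ek.
Qed.

Lemma smooth_on_cont A g : smooth_on A g -> {within A, continuous g}.
Proof.
move=> sg; apply/within_contP => a Aa e e0.
have [ O [k [oO Oa sk ek]]] := sg a Aa.
have /cvgrPdist_lt/(_ _ e0) := smooth_cont sk Oa.
apply: filter_app; apply: filterS (open_nbhs_nbhs (conj oO Oa)) => x Ox h Ax.
by rewrite -!ek.
Qed.

Lemma derive_lin O g x v w c d : open O -> smooth_on_open O g -> O x ->
  'D_(c *: v + d *: w) g x = c * 'D_v g x + d * 'D_w g x.
Proof.
move=> oO sg Ox.
have H : is_derive (0 : R) 1 (fun s : R => g (x + (s * c) *: v + (s * d) *: w)) (c * 'D_v g x + d * 'D_w g x).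
  apply: (@pder_curve2 R W g (fun p => 'D_v g p)).
  - by apply: filterS (open_nbhs_nbhs (conj oO Ox)) => y Oy; exact: smooth_is_derive Oy.
  - exact: smooth_cont (smooth_derive v sg) Ox.
  - exact: smooth_is_derive Ox.
  - by rewrite mul0r.
  - by rewrite mul0r.
  - have := pder_affine (0 : R) 0 c; congr is_derive; by apply/funext => s; rewrite add0r.
  - have := pder_affine (0 : R) 0 d; congr is_derive; by apply/funext => s; rewrite add0r.
have K : is_derive x (c *: v + d *: w) g (c * 'D_v g x + d * 'D_w g x).
  apply/(is_derive_line (W := R)); move: H; congr is_derive; apply/funext => s.
  by rewrite scalerDr !scalerA addrA.
exact: (@derive_val _ _ _ _ _ _ _ K).
Qed.

End SmoothOpen.

Section SmoothSlices.
Variables (R : realType) (n : nat).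
Notation V := (Cspace R n).
Notation S := (@sphere R n).
Notation rp := (@radial_proj R n).
Local Notation bas := (@bas R n).
Notation W := (R * V)%type.
Implicit Types (x v w z : V) (phi psi : V -> R) (g : R -> V -> R).

(** Space-time at positive times, so that derivatives in time are two-sided. *)
Definition cyl : set W := [set z : W | 0 < z.1] `&` [set z : W | S z.2].
Definition flowC g := smooth_on cyl (fun z : W => g z.1 z.2).

Lemma line_slice (t : R) x v (s : R) : ((t, x) : W) + s *: ((0, v) : W) = (t, x + s *: v).
Proof. by apply: injective_projections; rewrite /= ?scaler0 ?addr0. Qed.

Lemma line_time (t : R) x (s : R) : ((t, x) : W) + s *: ((1, 0) : W) = (t + s *: (1 : R), x).
Proof. by apply: injective_projections; rewrite /= ?scaler0 ?addr0. Qed.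

Lemma slice_derive (h : W -> R) (t : R) x v : 'D_((0, v) : W) h (t, x) = 'D_v (fun y => h (t, y)) x.
Proof.
rewrite /derive.
have -> : (fun s : R => s^-1 *: ((h \o shift ((t, x) : W)) (s *: ((0, v) : W)) - h (t, x))) =
  (fun s : R => s^-1 *: (((fun y : V => h (t, y)) \o shift x) (s *: v) - h (t, x))).
  by apply/funext => s; rewrite /= [X in h X - _]addrC line_slice [x + _]addrC.
by [].
Qed.

Lemma slice_is_derive (h : W -> R) (t : R) x v d :
  is_derive ((t, x) : W) ((0, v) : W) h d <-> is_derive x v (fun y => h (t, y)) d.
Proof.
have E : (fun s : R => h (((t, x) : W) + s *: ((0, v) : W))) = (fun s : R => h (t, x + s *: v)).
  by apply/funext => s; rewrite line_slice.
by split=> /(is_derive_line (W := R)) H; apply/(is_derive_line (W := R)); move: H; rewrite E.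
Qed.

Lemma slice_smooth (O : set W) (h : W -> R) t : smooth_on_open O h ->
  smooth_on_open [set x | O (t, x)] (fun x => h (t, x)).
Proof.
move=> sh vs x Ox.
have E us : iter_derive us (fun x => h (t, x)) = fun x => iter_derive (map (fun v => ((0, v) : W)) us) h (t, x).
  by elim: us => //= v us ->; apply/funext => y; rewrite -slice_derive.
rewrite E; have [hc hd] := sh (map (fun v => ((0, v) : W)) vs) (t, x) Ox; split.
  have c1 : {for x, continuous (fun y : V => ((t, y) : W))} by apply: continuous_pairl.
  exact: (@continuous_comp _ _ _ (fun y : V => ((t, y) : W)) (iter_derive _ h) x c1 hc).
move=> v; have /derivableP/slice_is_derive := hd (0, v).
by case.
Qed.

Lemma flowC_slice g (t : R) : 0 < t -> flowC g -> smooth_on S (g t).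
Proof.
move=> t0 sg x Sx; have [ O [h [oO Oa sh eh]]] := sg (t, x) (conj t0 Sx).
exists [set y | O (t, y)], (fun y => h (t, y)); split => //.
- exact: (open_comp (f := fun y : V => ((t, y) : W)) (fun y _ => @continuous_pairl _ _ t y) oO).
- exact: slice_smooth.
- by move=> y Oy Sy; exact: (eh (t, y) Oy).
Qed.

Lemma const_derive (h : V -> R) (p v : W) : 'D_v (fun p : W => h p.2) p = 'D_(v.2) h p.2.
Proof. by rewrite /derive. Qed.

Lemma flowC_const phi : smooth_on S phi -> flowC (fun=> phi).
Proof.
move=> sp [t x] [/= t0 Sx]; have [ O [h [oO Oa sh eh]]] := sp x Sx.
exists [set p : W | O p.2], (fun p => h p.2); split => //.
- by apply: (open_comp (f := fun p : W => p.2)) => // p _; exact: cvg_snd.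
- move=> vs p Op.
  have E us : iter_derive us (fun p : W => h p.2) = fun p => iter_derive (map snd us) h p.2.
    by elim: us => //= v us ->; apply/funext => y; rewrite const_derive.
  rewrite E; have [hc hd] := sh (map snd vs) p.2 Op; split.
    have c1 : {for p, continuous (fun p : W => p.2)} by exact: cvg_snd.
    exact: (@continuous_comp _ _ _ (fun p : W => p.2) (iter_derive _ h) p c1 hc).
  by move=> v; exact: (hd v.2).
- by move=> p Op [_ Sp]; exact: eh.
Qed.

Lemma smooth_tgrad (O : set V) (h : V -> R) phi z x : open O -> smooth_on_open O h ->
  (forall y, O y -> S y -> h y = phi y) -> O x -> S x ->
  is_derive x z (phi \o rp) ('D_z h x - edot x z * 'D_x h x).
Proof.
move=> oO sh eh Ox Sx; have x1 := (sphereP x).1 Sx.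
apply/(is_derive_line (W := R)).
have mean_osc s : enorm (x + s *: z) = Num.sqrt (1 + s * (2 * edot x z + s * edot z z)).
  rewrite /enorm !(edotDl, edotDr, edotZl, edotZr) x1 (edotC z x); congr Num.sqrt.
  by ring.
pose c s := (enorm (x + s *: z))^-1.
have c0 : c 0 = 1 by rewrite /c scale0r addr0 (Sx : enorm x = 1) invr1.
have dc : is_derive (0 : R) 1 c (- edot x z).
  have q : is_derive (0 : R) 1 (fun s : R => 1 + s * (2 * edot x z + s * edot z z)) (2 * edot x z).
    apply: pder_eq (pderD (pder_cst _ _ _) (pderM (pder_id _ _) (pderD (pder_cst _ _ _) (pderM (pder_id _ _) (pder_cst _ _ _))))) _.
    by rewrite /=; ring.
  have H : is_derive ((fun s : R => 1 + s * (2 * edot x z + s * edot z z)) 0) 1 (@Num.sqrt R) ((2 * Num.sqrt 1)^-1).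
    by rewrite /= mul0r addr0; exact: is_derive1_sqrt.
  have n0 : Num.sqrt (1 + 0 * (2 * edot x z + 0 * edot z z)) != 0 :> R.
    by rewrite mul0r addr0 sqrtr1 oner_neq0.
  have := pderV (f := fun s : R => Num.sqrt (1 + s * (2 * edot x z + s * edot z z))) n0 (pder_comp (f := fun s : R => 1 + s * (2 * edot x z + s * edot z z)) H q).
  have -> : (fun y : R => (Num.sqrt (1 + y * (2 * edot x z + y * edot z z)))^-1) = c.
    by apply/funext => s; rewrite /c mean_osc.
  move=> K; apply: pder_eq K _.
  by rewrite /= mul0r addr0 sqrtr1; field.
have H : is_derive (0 : R) 1 (fun s : R => h (x + (c s - 1) *: x + (c s * s) *: z)) (- edot x z * 'D_x h x + 1 * 'D_z h x).
  apply: (@pder_curve2 R V h (fun p => 'D_x h p)).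
  - by apply: filterS (open_nbhs_nbhs (conj oO Ox)) => y Oy; exact: smooth_is_derive Oy.
  - exact: smooth_cont (smooth_derive x sh) Ox.
  - exact: smooth_is_derive Ox.
  - by rewrite c0 subrr.
  - by rewrite mulr0.
  - by apply: pder_eq (pderB dc (pder_cst _ _ _)) _; rewrite subr0.
  - by apply: pder_eq (pderM dc (pder_id _ _)) _; rewrite c0 mulr0 add0r mulr1.
have E s : x + (c s - 1) *: x + (c s * s) *: z = rp (x + s *: z).
  by rewrite /radial_proj -/(c s) scalerDr scalerA scalerBl scale1r addrCA subrr addr0.
have -> : 'D_z h x - edot x z * 'D_x h x = - edot x z * 'D_x h x + 1 * 'D_z h x.
  by rewrite addrC mul1r mulNr.
apply: (@pder_near R R (fun s : R => h (rp (x + s *: z)))); last first.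
  by move: H; congr is_derive; apply/funext => s; rewrite E.
have hx : {for x, continuous rp} by apply: rp_continuous; exact: sphere_neq0.
have ct : {for 0, continuous (fun s : R => x + s *: z)}.
  by apply: cvgD; [exact: cvg_cst|apply: cvgZr_tmp; exact: cvg_id].
have ct2 : {for 0, continuous (fun s : R => rp (x + s *: z))}.
  apply: (@continuous_comp _ _ _ (fun s : R => x + s *: z) rp 0 ct).
  by rewrite /= scale0r addr0.
have n1 : \forall s \near (0 : R), O (rp (x + s *: z)).
  apply: ct2; rewrite /= scale0r addr0 rp_id//; exact: open_nbhs_nbhs.
have n2 : \forall s \near (0 : R), enorm (x + s *: z) != 0.
  apply: (ct [set p | enorm p != 0]); rewrite /= scale0r addr0.
  by apply: near_enorm_neq0; exact: sphere_neq0.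
near=> s; rewrite /= eh//; last apply: rp_sphere; near: s => //.
Unshelve. all: by end_near.
Qed.

(** Tangential derivatives can be computed from any smooth local extension h, by
    removing the radial derivative; this exhibits a smooth local extension of the
    tangential derivative itself. *)
Lemma tgrad_smooth (O : set V) (h : V -> R) phi z x : open O -> smooth_on_open O h ->
  (forall y, O y -> S y -> h y = phi y) -> O x -> S x ->
  tgrad z phi x = 'D_z h x + \sum_i (- edot x z * edot x (bas i)) * 'D_(bas i) h x.
Proof.
move=> oO sh eh Ox Sx; rewrite (tgradE (smooth_tgrad z oO sh eh Ox Sx)); congr (_ + _).
have L k (c : 'I_k -> R) (b : 'I_k -> V) : 'D_(\sum_i c i *: b i) h x = \sum_i c i * 'D_(b i) h x.
  elim: k c b => [|k IH] c b.
    by rewrite !big_ord0; have := derive_lin 0 0 0 0 oO sh Ox; rewrite !scale0r addr0 !mul0r addr0.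
  rewrite !big_ord_recl -IH -[\sum_(i < k) _ *: _]scale1r (derive_lin _ _ _ _ oO sh Ox).
  by rewrite mul1r scale1r.
have Lx := L _ (fun i => edot x (bas i)) bas; rewrite -bas_expand in Lx.
by rewrite Lx -mulNr mulr_sumr; apply: eq_bigr => i _; exact: mulrA.
Qed.

Lemma flowC_tgrad g z : flowC g -> flowC (fun t => tgrad z (g t)).
Proof.
move=> sg [t x] [/= t0 Sx]; have [ O [h [oO Oa sh eh]]] := sg (t, x) (conj t0 Sx).
pose hh (p : W) := 'D_((0, z) : W) h p + \sum_i (- edot p.2 z * edot p.2 (bas i)) * 'D_((0, bas i) : W) h p.
have alin w : alg O (fun p : W => edot p.2 w).
  apply: alg_lin => [|p v s].
    by apply: edot_continuous => p; [exact: cvg_snd|exact: cvg_cst].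
  by rewrite edotDl edotZl.
exists O, hh; split => //.
  apply: alg_smooth => //; apply: alg_add; first by apply: alg_base; exact: smooth_derive.
  elim: (index_enum _) => [|i r IH].
    by have := alg_cst O 0; congr alg; apply/funext => p; rewrite big_nil.
  have : alg O (fun p : W => (- edot p.2 z * edot p.2 (bas i)) * 'D_((0, bas i) : W) h p +
      \sum_(i <- r) (- edot p.2 z * edot p.2 (bas i)) * 'D_((0, bas i) : W) h p).
    apply: alg_add => //; apply: alg_mul; last by apply: alg_base; exact: smooth_derive.
    apply: alg_mul; last exact: alin.
    have := alg_mul (alg_cst O (-1)) (alin z); congr alg; apply/funext => p; exact: mulN1r.
  by congr alg; apply/funext => p; rewrite big_cons.
move=> [s y] Oy [/= s0 Sy].
have o' : open [set y : V | O (s, y)].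
  exact: (open_comp (f := fun y : V => ((s, y) : W)) (fun y _ => @continuous_pairl _ _ s y) oO).
have s' := @slice_smooth O h s sh.
have e' (y' : V) : O (s, y') -> S y' -> h (s, y') = g s y' by move=> Oy' Sy'; exact: (eh (s, y') Oy').
rewrite /= (tgrad_smooth z o' s' e' Oy Sy).
rewrite /hh slice_derive; congr (_ + _); apply: eq_bigr => i _; congr (_ * _).
exact: slice_derive.
Qed.

Lemma smooth_C1 phi : smooth_on S phi -> C1 phi.
Proof.
move=> sp; have sf := flowC_const sp.
apply: (@C1P _ _ _ (fun z => tgrad z phi)).
- exact: smooth_on_cont.
- move=> z x Sx; have [ O [h [oO Oa sh eh]]] := sp x Sx.
  have := smooth_tgrad z oO sh eh Oa Sx => D.
  by rewrite (tgradE D).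
- move=> z; apply: smooth_on_cont.
  exact: (flowC_slice ltr01 (flowC_tgrad z sf)).
Qed.

Lemma smooth_tgrad_smooth phi z : smooth_on S phi -> smooth_on S (tgrad z phi).
Proof. by move=> sp; exact: (flowC_slice ltr01 (flowC_tgrad z (flowC_const sp))). Qed.

Lemma smooth_C2 phi : smooth_on S phi -> C2 phi.
Proof.
by move=> sp; split=> [|z]; apply: smooth_C1 => //; exact: smooth_tgrad_smooth.
Qed.

Lemma flowC_edot z : flowC (fun _ x => edot x z).
Proof.
apply: smooth_on_T; apply: alg_lin => [|p v s].
  by apply: edot_continuous => p; [exact: cvg_snd|exact: cvg_cst].
by rewrite edotDl edotZl.
Qed.

Lemma flowC_Tder g : flowC g -> flowC (fun t => Tder (g t)).
Proof.
move=> sg; apply: (@smooth_on_ext _ _ _ (fun p : W => \sum_i - edot p.2 (Jmul (bas i)) * tgrad (bas i) (g p.1) p.2)).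
  move=> [t x] [/= t0 Sx]; rewrite TderE//; last exact: smooth_C1 (flowC_slice t0 sg).
  by apply: eq_bigr => i _; rewrite JbasE.
apply: smooth_on_sum => i; apply: smooth_on_mul; last exact: (flowC_tgrad (bas i) sg).
by apply: smooth_on_opp; exact: flowC_edot.
Qed.

Lemma flowC_Dsub g : flowC g -> flowC (fun t => Dsub (g t)).
Proof.
move=> sg; apply: smooth_on_add; last first.
  by apply: smooth_on_opp; exact: flowC_Tder (flowC_Tder sg).
apply: smooth_on_sum => i; exact: (flowC_tgrad (bas i) (flowC_tgrad (bas i) sg)).
Qed.

Lemma smooth_Dsub phi : smooth_on S phi -> smooth_on S (Dsub phi).
Proof. by move=> sp; exact: (flowC_slice ltr01 (flowC_Dsub (flowC_const sp))). Qed.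

(** The time derivative of a local extension does not depend on the extension, since the
    time direction is tangent to space-time. *)
Lemma flowC_dt g : flowC g -> exists2 dg, flowC dg &
  forall (t : R) x, 0 < t -> S x -> is_derive t 1 (fun s => g s x) (dg t x).
Proof.
move=> sg; pose dg (t : R) x := 'D_1 (fun s => g s x) t.
have key (t : R) x (O : set W) h : 0 < t -> S x -> open O -> O (t, x) -> smooth_on_open O h ->
    (forall p, O p -> cyl p -> h p = g p.1 p.2) ->
    is_derive t 1 (fun s => g s x) ('D_((1, 0) : W) h (t, x)).
  move=> t0 Sx oO Oa sh eh.
  have D := smooth_is_derive ((1, 0) : W) sh Oa.
  have {}D : is_derive t 1 (fun s => h (s, x)) ('D_((1, 0) : W) h (t, x)).
    move/is_derive_line: D => D; apply/(is_derive_line (W := R)).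
    move: D; congr is_derive; apply/funext => s.
    by rewrite line_time.
  apply: pder_near D.
  have n1 : \forall s \near t, 0 < s by exact: lt_nbhsr.
  have n2 : \forall s \near t, O (s, x).
    by apply: (@continuous_pairr R V x t); exact: open_nbhs_nbhs.
  by near=> s; apply: (eh (s, x)); [near: s|split; [near: s|]].
exists dg => [[t x] [/= t0 Sx]|t x t0 Sx].
  have [ O [h [oO Oa sh eh]]] := sg (t, x) (conj t0 Sx).
  exists O, (fun p => 'D_((1, 0) : W) h p); split => //; first exact: smooth_derive.
  move=> [s y] Oy [/= s0 Sy]; rewrite /dg.
  by have D := key s y O h s0 Sy oO Oy sh eh; rewrite (@derive_val _ _ _ _ _ _ _ D).
have [ O [h [oO Oa sh eh]]] := sg (t, x) (conj t0 Sx).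
have D := key t x O h t0 Sx oO Oa sh eh.
by rewrite /dg (@derive_val _ _ _ _ _ _ _ D).
Unshelve. all: by end_near.
Qed.

End SmoothSlices.

(** * Functions of the Hermitian product with a fixed point *)

Section WithinContinuity.
Variables (R : realType) (n : nat) (T : topologicalType) (B : set T).
Notation S := (@sphere R n).

Lemma contw_T (f : T -> R) : continuous f -> {within B, continuous f}.
Proof. exact: continuous_subspaceT. Qed.

Lemma contw_inv (f : T -> R) : {within B, continuous f} -> (forall x, B x -> f x != 0) ->
  {within B, continuous (fun x => (f x)^-1)}.
Proof.
move=> /subspace_continuousP cf f0; apply/subspace_continuousP => x Bx.
by apply: cvgV; [exact: f0|exact: cf].
Qed.

Lemma contw_comp (phi : Cspace R n -> R) (g : T -> Cspace R n) : contS phi -> continuous g ->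
  (forall x, B x -> S (g x)) -> {within B, continuous (fun x => phi (g x))}.
Proof.
move=> /within_contP cp cg gS; apply/within_contP => x Bx e e0.
have H : nbhs x (g @^-1` [set y | S y -> `|phi (g x) - phi y| < e]).
  by apply: cg; exact: cp _ (gS x Bx) _ e0.
by apply: filterS H => t /= h Bt; exact/h/gS.
Qed.

End WithinContinuity.

Section Poisson.
Variables (R : realType) (n : nat).
Notation V := (Cspace R n).
Notation m := (n.*2.+1).
Notation S := (@sphere R n).
Local Notation bas := (@bas R n).
Hypothesis n_gt0 : (0 < n)%N.
Implicit Types (x y v w z : V) (phi psi chi : V -> R) (r : R).

(** cre and cim are the real and imaginary parts of the Hermitian product with x; the
    kernel depends on y only through them. *)
Definition cre x y : R := edot y x.
Definition cim x y : R := edot y (Jmul x).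

Lemma creC x y : cre x y = cre y x. Proof. exact: edotC. Qed.
Lemma cimC x y : cim x y = - cim y x. Proof. by rewrite /cim edotC edotJl. Qed.

Section FixedCentre.
Variable x : V.
Hypothesis Sx : S x.
Local Notation a := (cre x).
Local Notation b := (cim x).

Lemma T_cre y : S y -> Tder a y = - b y.
Proof. by move=> Sy; rewrite /Tder tgrad_edot// edotJx mul0r subr0 edotJl. Qed.

Lemma T_cim y : S y -> Tder b y = a y.
Proof. by move=> Sy; rewrite /Tder tgrad_edot// edotJx mul0r subr0 edotJ. Qed.

Lemma sum_tgrad_edot v w y : S y ->
  \sum_i tgrad (bas i) (cre v) y * tgrad (bas i) (cre w) y = edot v w - edot y v * edot y w.
Proof.
move=> Sy; have y1 := (sphereP y).1 Sy.
transitivity (\sum_i edot (v - edot y v *: y) (bas i) * edot (w - edot y w *: y) (bas i)).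
  apply: eq_bigr => i _; rewrite !tgrad_edot// !edotBl !edotZl ![edot (bas i) _]edotC.
  by rewrite ![edot y (bas i) * _]mulrC.
rewrite -edot_bas !(edotBl, edotBr, edotZl, edotZr) y1 (edotC v y); ring.
Qed.

Lemma Gam_aa y : S y -> Gam a a y = 1 - a y ^+ 2 - b y ^+ 2.
Proof.
by move=> Sy; rewrite /Gam T_cre// sum_tgrad_edot// ((sphereP x).1 Sx) /cre /cim; ring.
Qed.

Lemma Gam_bb y : S y -> Gam b b y = 1 - a y ^+ 2 - b y ^+ 2.
Proof.
by move=> Sy; rewrite /Gam T_cim// sum_tgrad_edot// edotJ ((sphereP x).1 Sx) /cre /cim; ring.
Qed.

(** The real and the imaginary part of the Hermitian product satisfy the Cauchy-Riemann
    equations, so that their horizontal gradients are orthogonal and of equal length. *)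
Lemma Gam_ab y : S y -> Gam a b y = 0.
Proof.
by move=> Sy; rewrite /Gam T_cim// T_cre// sum_tgrad_edot// edotJx /cre /cim; ring.
Qed.

Lemma cre2_cim2_le1 y : S y -> a y ^+ 2 + b y ^+ 2 <= 1.
Proof.
move=> Sy; have := Gam_ge0 (C1_edot x) Sy; rewrite (Gam_aa Sy); lra.
Qed.

Lemma tgrad2_edot v z y : S y -> tgrad z (tgrad z (cre v)) y =
  - ((edot z z - edot y z ^+ 2) * edot y v + edot y z * (edot z v - edot y z * edot y v)).
Proof.
move=> Sy.
rewrite (@tgrad_ext _ _ _ (fun y => edot z v - edot y z * edot y v) z y)//; last first.
  by move=> y' Sy'; rewrite tgrad_edot.
have c1 := C1_edot z; have c2 := C1_edot v.
rewrite tgradB//; [|exact: C1_cst|exact: C1M].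
rewrite tgrad_cst tgradM// !tgrad_edot//; ring.
Qed.

Lemma sum_tgrad2_edot v y : S y -> \sum_i tgrad (bas i) (tgrad (bas i) (cre v)) y = - m%:R * edot y v.
Proof.
move=> Sy; have y1 := (sphereP y).1 Sy.
have bb i : edot (bas i) (bas i) = 1 by exact: edot_bas_bas.
transitivity (\sum_i (2 * edot y v * (edot y (bas i) * edot y (bas i)) - (edot v (bas i) * edot y (bas i)) - edot y v)).
  by apply: eq_bigr => i _; rewrite tgrad2_edot// bb (edotC v); ring.
rewrite !sumrB -mulr_sumr -!edot_bas y1 sumr_const card_ord (edotC v) -(mulr_natr _ m.+1).
rewrite -[m.+1]addn1 natrD; ring.
Qed.

Lemma Dsub_cre y : S y -> Dsub a y = - (2 * n%:R) * a y.
Proof.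
move=> Sy; rewrite /Dsub sum_tgrad2_edot//.
have -> : Tder (Tder a) y = - a y.
  rewrite /Tder (@tgrad_ext _ _ _ (fun y => - b y))//; last by move=> y' Sy'; exact: T_cre.
  by rewrite tgradN//; [rewrite -[tgrad _ _ _]/(Tder b y) T_cim|exact: C1_edot].
by rewrite /cre -addn1 natrD -muln2 natrM; ring.
Qed.

Lemma Dsub_cim y : S y -> Dsub b y = - (2 * n%:R) * b y.
Proof.
move=> Sy; rewrite /Dsub sum_tgrad2_edot//.
have -> : Tder (Tder b) y = - b y.
  rewrite /Tder (@tgrad_ext _ _ _ a)//; last by move=> y' Sy'; exact: T_cim.
  by rewrite -[tgrad _ _ _]/(Tder a y) T_cre.
by rewrite /cim -addn1 natrD -muln2 natrM; ring.
Qed.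

(** F is a differentiable function of the two variables cre x and cim x alone, with
    partial derivatives Fa and Fb. *)
Record D2 (F Fa Fb : V -> R) : Prop := MkD2 { D2_C1 : C1 F ;
  D2_grad : forall z y, S y -> tgrad z F y = Fa y * tgrad z a y + Fb y * tgrad z b y }.

Lemma D2_eq F Fa Fb Ga Gb : D2 F Fa Fb -> (forall y, S y -> Fa y = Ga y) ->
  (forall y, S y -> Fb y = Gb y) -> D2 F Ga Gb.
Proof. by move=> [c h] ea eb; split=> // z y Sy; rewrite h// ea// eb. Qed.

Lemma D2_cst c : D2 (fun=> c) (fun=> 0) (fun=> 0).
Proof. by split=> [|z y _]; [exact: C1_cst|rewrite tgrad_cst !mul0r addr0]. Qed.

Lemma D2_a : D2 a (fun=> 1) (fun=> 0).
Proof. by split=> [|z y _]; [exact: C1_edot|rewrite mul1r mul0r addr0]. Qed.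

Lemma D2_b : D2 b (fun=> 0) (fun=> 1).
Proof. by split=> [|z y _]; [exact: C1_edot|rewrite mul1r mul0r add0r]. Qed.

Lemma D2_add F Fa Fb G Ga Gb : D2 F Fa Fb -> D2 G Ga Gb ->
  D2 (fun y => F y + G y) (fun y => Fa y + Ga y) (fun y => Fb y + Gb y).
Proof.
move=> [c h] [c' h']; split=> [|z y Sy]; first exact: C1D.
rewrite tgradD// h// h'//; move: (tgrad z a y) (tgrad z b y) => p q; ring.
Qed.

Lemma D2_mul F Fa Fb G Ga Gb : D2 F Fa Fb -> D2 G Ga Gb ->
  D2 (fun y => F y * G y) (fun y => Fa y * G y + F y * Ga y) (fun y => Fb y * G y + F y * Gb y).
Proof.
move=> [c h] [c' h']; split=> [|z y Sy]; first exact: C1M.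
rewrite tgradM// h// h'//; move: (tgrad z a y) (tgrad z b y) => p q; ring.
Qed.

Lemma D2_comp F Fa Fb (G dG : R -> R) : D2 F Fa Fb ->
  (forall y, S y -> is_derive (F y) 1 G (dG (F y))) ->
  (forall y, S y -> {for F y, continuous dG}) ->
  D2 (fun y => G (F y)) (fun y => dG (F y) * Fa y) (fun y => dG (F y) * Fb y).
Proof.
move=> [c h] d dc; split=> [|z y Sy]; first exact: (C1_comp c d dc).
have dy := d y Sy; rewrite (@tgrad_comp _ _ _ c G dG)//.
by rewrite h// mulrDr !mulrA.
Qed.

Lemma D2_exp k F Fa Fb : D2 F Fa Fb ->
  D2 (fun y => F y ^+ k) (fun y => k%:R * F y ^+ k.-1 * Fa y) (fun y => k%:R * F y ^+ k.-1 * Fb y).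
Proof.
move=> d; apply: (@D2_comp F Fa Fb (fun s => s ^+ k) (fun s => k%:R * s ^+ k.-1)) => // y _.
  by apply: pder_eq (pderX (x := F y) (v := 1) k (pder_id _ _)) _; rewrite mulr1.
by apply: cvgM; [exact: cvg_cst|apply: exprn_continuous].
Qed.

Lemma D2_inv F Fa Fb : D2 F Fa Fb -> (forall y, S y -> F y != 0) ->
  D2 (fun y => (F y)^-1) (fun y => - (F y)^-1 ^+ 2 * Fa y) (fun y => - (F y)^-1 ^+ 2 * Fb y).
Proof.
move=> d F0; apply: (@D2_comp F Fa Fb (fun s => s^-1) (fun s => - s^-1 ^+ 2)) => // y Sy.
  by apply: pder_eq (pderV (x := F y) (v := 1) (F0 y Sy) (pder_id _ _)) _; rewrite div1r exprVn.
apply: cvgN; have h : (fun s : R => s^-1) @ F y --> (F y)^-1 by apply: cvgV; [exact: F0|exact: cvg_id].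
by rewrite expr2; under eq_fun do rewrite expr2; apply: cvgM.
Qed.

(** Integration by parts against the horizontal field A grad a + B grad b. Because Gam a
    b = 0 and Gam a a = Gam b b, its divergence H involves only the derivative of A in a
    and that of B in b. *)
Lemma div_identity A Aa Ab B Ba Bb phi H : D2 A Aa Ab -> D2 B Ba Bb -> C1 phi -> contS H ->
  (forall y, S y -> (1 - a y ^+ 2 - b y ^+ 2) * (Aa y + Bb y) - 2 * n%:R * (a y * A y + b y * B y) = H y) ->
  sint (fun y => phi y * H y) = - sint (fun y => A y * Gam a phi y + B y * Gam b phi y).
Proof.
move=> [cA hA] [cB hB] cp cH hH.
have cc : contS (fun y => phi y * H y) by apply: contf_mul => //; exact: C1_cont.
have ca : C2 a := C2_edot x. have cb : C2 b := C2_edot (Jmul x).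
have e1 := sint_Gam n_gt0 (C1M cA cp) ca.
have e2 := sint_Gam n_gt0 (C1M cB cp) cb.
have cA' := C1_cont cA; have cB' := C1_cont cB; have cp' := C1_cont cp.
have ca' := C1_cont (C2_C1 ca); have cb' := C1_cont (C2_C1 cb).
have cG1 : contS (Gam a phi) by apply: contS_Gam => //; exact: C2_C1.
have cG2 : contS (Gam b phi) by apply: contS_Gam => //; exact: C2_C1.
have c2 : contS (fun y => A y * Gam a phi y + B y * Gam b phi y).
  by apply: contf_add; apply: contf_mul.
have d1 : contS (Gam (fun y => A y * phi y) a) by apply: contS_Gam; [exact: C1M|exact: C2_C1].
have d2 : contS (Gam (fun y => B y * phi y) b) by apply: contS_Gam; [exact: C1M|exact: C2_C1].
have d3 : contS (fun y => A y * phi y * Dsub a y).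
  by apply: contf_mul; [exact: contf_mul|exact: contS_Dsub].
have d4 : contS (fun y => B y * phi y * Dsub b y).
  by apply: contf_mul; [exact: contf_mul|exact: contS_Dsub].
apply/eqP; rewrite -addr_eq0 -sintD//; apply/eqP.
transitivity (sint (fun y => (Gam (fun y => A y * phi y) a y + A y * phi y * Dsub a y) + (Gam (fun y => B y * phi y) b y + B y * phi y * Dsub b y))).
  apply: sint_ext => y Sy; rewrite -hH// !GamMl//.
  have -> : Gam A a y = Aa y * (1 - a y ^+ 2 - b y ^+ 2).
    by rewrite (@Gam_lin _ _ a b A a (Aa y) (Ab y)) => [|z]; [rewrite Gam_aa// [Gam b a y]GamC Gam_ab// mulr0 addr0|exact: hA].
  have -> : Gam B b y = Bb y * (1 - a y ^+ 2 - b y ^+ 2).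
    by rewrite (@Gam_lin _ _ a b B b (Ba y) (Bb y)) => [|z]; [rewrite Gam_bb// Gam_ab// mulr0 add0r|exact: hB].
  rewrite Dsub_cre// Dsub_cim// (GamC phi a) (GamC phi b).
  by move: (Gam a phi y) (Gam b phi y) (a y) (b y) => p q s t; ring.
rewrite sintD//; [|exact: contf_add..].
by rewrite (sintD n_gt0 d1 d3) (sintD n_gt0 d2 d4) e1 e2 !addNr addr0.
Qed.

End FixedCentre.
End Poisson.

(** * The Poisson-Szego kernel *)

Section PoissonKernel.
Variables (R : realType) (n : nat).
Notation V := (Cspace R n).
Notation m := (n.*2.+1).
Notation S := (@sphere R n).
Hypothesis n_gt0 : (0 < n)%N.
Implicit Types (x y v w z : V) (phi psi chi : V -> R) (r : R).

(** The square modulus of 1 - r z, where z is the Hermitian product of x and y. *)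
Definition qf r x y : R := (1 - r * cre x y) ^+ 2 + r ^+ 2 * cim x y ^+ 2.
(** The Poisson-Szego kernel of the unit ball at r x, up to the volume of the sphere. *)
Definition poisson r x y : R := ((1 - r ^+ 2) * (qf r x y)^-1) ^+ n.+1.
(** The derivative of the kernel in the radius r. *)
Definition dpoisson r x y : R := 2 * n.+1%:R * (1 - r ^+ 2) ^+ n * (qf r x y)^-1 ^+ n.+2 *
  ((1 + r ^+ 2) * cre x y - r * (1 + cre x y ^+ 2 + cim x y ^+ 2)).
Definition kap r : R := n.+1%:R / n%:R * (1 - r ^+ 2) ^+ n.
(** field_re and field_im are the components of a horizontal field with divergence dpoisson (sint_dpoisson):
    moving the radius is a divergence, which is how horizontal energies control the
    kernel. *)
Definition field_re r x y : R := - kap r * ((qf r x y)^-1 ^+ n.+2 *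
  ((1 - r * cre x y) ^+ 2 - r ^+ 2 * cim x y ^+ 2)).
Definition field_im r x y : R := kap r * ((qf r x y)^-1 ^+ n.+2 *
  (2 * r * (cim x y * (1 - r * cre x y)))).

Lemma qfC r x y : qf r x y = qf r y x.
Proof. by rewrite /qf creC cimC sqrrN. Qed.

Lemma poissonC r x y : poisson r x y = poisson r y x.
Proof. by rewrite /poisson qfC. Qed.

Lemma cre_le1 x y : S x -> S y -> `|cre x y| <= 1.
Proof.
move=> Sx Sy; have h := cre2_cim2_le1 Sx Sy; have := sqr_ge0 (cim x y) => h2.
by rewrite -(expr_le1 (n := 2)) // -normrX ger0_norm ?sqr_ge0//; lra.
Qed.

Lemma qf_ge r x y : S x -> S y -> `|r| < 1 -> (1 - `|r|) ^+ 2 <= qf r x y.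
Proof.
move=> Sx Sy r1; have h := cre_le1 Sx Sy.
have h1 : `|r * cre x y| <= `|r| by rewrite normrM ler_piMr.
have h2 : r * cre x y <= `|r| := le_trans (ler_norm _) h1.
have h3 : 0 <= r ^+ 2 * cim x y ^+ 2 by rewrite mulr_ge0// sqr_ge0.
rewrite /qf; move: h2 h3 r1; move: (`|r|) (r * cre x y) (r ^+ 2 * _) => p q t; nra.
Qed.

Lemma qf_gt0 r x y : S x -> S y -> `|r| < 1 -> 0 < qf r x y.
Proof.
move=> Sx Sy r1; apply: lt_le_trans (qf_ge Sx Sy r1); rewrite exprn_gt0// subr_gt0//.
Qed.

Lemma one_sub_sqr_gt0 r : `|r| < 1 -> 0 < 1 - r ^+ 2.
Proof. by rewrite ltr_norml => /andP[h1 h2]; nra. Qed.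

Lemma poisson_gt0 r x y : S x -> S y -> `|r| < 1 -> 0 < poisson r x y.
Proof.
move=> Sx Sy r1; rewrite exprn_gt0// mulr_gt0// ?invr_gt0 ?qf_gt0//.
exact: one_sub_sqr_gt0.
Qed.

Lemma poisson_le r x y : S x -> S y -> 0 <= r -> r < 1 -> poisson r x y <= (2 / (1 - r)) ^+ n.+1.
Proof.
move=> Sx Sy r0 r1; have rr : `|r| < 1 by rewrite ger0_norm.
have := qf_ge Sx Sy rr; rewrite ger0_norm// => hq.
have s0 : 0 < 1 - r by rewrite subr_gt0.
have o := one_sub_sqr_gt0 rr.
have q0 := qf_gt0 Sx Sy rr.
have s0' := ltW s0; have o' := ltW o; have q0' := ltW q0.
rewrite /poisson lerXn2r// ?nnegrE; [by rewrite mulr_ge0 ?invr_ge0|by rewrite mulr_ge0 ?invr_ge0|].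
rewrite ler_pdivrMr// mulrAC ler_pdivlMr//.
have h3 := mulr_ge0 s0' (sqr_ge0 (1 - r)).
by move: hq h3; move: (qf r x y) => q; nra.
Qed.

Lemma poisson_is_derive r x y : S x -> S y -> `|r| < 1 ->
  is_derive r 1 (fun r => poisson r x y) (dpoisson r x y).
Proof.
move=> Sx Sy r1; have q0 := qf_gt0 Sx Sy r1; have qn0 : qf r x y != 0 by rewrite gt_eqF.
have dq : is_derive r 1 (fun r => qf r x y) (- 2 * cre x y * (1 - r * cre x y) + 2 * r * cim x y ^+ 2).
  have d1 := pderB (pder_cst r 1 (1 : R)) (pderM (pder_id r 1) (pder_cst r 1 (cre x y))).
  apply: pder_eq (pderD (pderX 2 d1) (pderM (pderX 2 (pder_id r 1)) (pder_cst r 1 (cim x y ^+ 2)))) _.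
  by rewrite /=; ring.
have dn := pderB (pder_cst r 1 (1 : R)) (pderX 2 (pder_id r 1)).
apply: pder_eq (pderX n.+1 (pderM dn (pderV (f := fun r => qf r x y) qn0 dq))) _.
rewrite /= /dpoisson exprMn -[n.+2]addn2 exprD -[n.+1]addn1 natrD.
move: ((qf r x y)^-1 ^+ n) ((1 - r ^+ 2) ^+ n) => c d.
move: qn0; rewrite /qf; move: (cre x y) (cim x y) => a b q0'.
by field; rewrite exprMn.
Qed.

Lemma D2_q r x : D2 x (qf r x) (fun y => - 2 * r * (1 - r * cre x y)) (fun y => 2 * r ^+ 2 * cim x y).
Proof.
have d1 := D2_add (D2_cst x 1) (D2_mul (D2_cst x (- r)) (D2_a x)).
have := D2_add (D2_exp 2 d1) (D2_mul (D2_cst x (r ^+ 2)) (D2_exp 2 (D2_b x))).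
have -> : (fun y => (1 + - r * cre x y) ^+ 2 + r ^+ 2 * cim x y ^+ 2) = qf r x.
  by apply/funext => y; rewrite /qf mulNr.
by move=> h; apply: D2_eq h _ _ => y _ /=; ring.
Qed.

Lemma D2_Q r x : S x -> `|r| < 1 -> D2 x (fun y => (qf r x y)^-1)
  (fun y => - (qf r x y)^-1 ^+ 2 * (- 2 * r * (1 - r * cre x y)))
  (fun y => - (qf r x y)^-1 ^+ 2 * (2 * r ^+ 2 * cim x y)).
Proof. by move=> Sx r1; apply: D2_inv (D2_q r x) _ => y Sy; rewrite gt_eqF// qf_gt0. Qed.

Section Fixed.
Variables (r : R) (x : V).
Hypotheses (Sx : S x) (r1 : `|r| < 1).
Local Notation a := (cre x).
Local Notation b := (cim x).
Local Notation Q := (fun y => (qf r x y)^-1).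

Let qn0 y : S y -> qf r x y != 0. Proof. by move=> Sy; rewrite gt_eqF// qf_gt0. Qed.
Let dl : D2 x (fun y => 1 - r * a y) (fun=> - r) (fun=> 0).
Proof.
have := D2_add (D2_cst x 1) (D2_mul (D2_cst x (- r)) (D2_a x)).
have -> : (fun y => 1 + - r * a y) = (fun y => 1 - r * a y).
  by apply/funext => y; rewrite mulNr.
by move=> h; apply: D2_eq h _ _ => y _ /=; ring.
Qed.

Let contSQ : contS Q. Proof. exact: C1_cont (D2_C1 (D2_Q Sx r1)). Qed.
Let contSa : contS a. Proof. exact: C1_cont (C1_edot x). Qed.
Let contSb : contS b. Proof. exact: C1_cont (C1_edot _). Qed.

Lemma contS_poisson : contS (poisson r x).
Proof. by apply: contf_exp; apply: contf_scale. Qed.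

Lemma contS_dpoisson : contS (dpoisson r x).
Proof.
apply: contf_mul; first by apply: contf_scale; exact: contf_exp.
apply: contf_sub; first exact: contf_scale.
apply: contf_scale; apply: contf_add; last exact: contf_exp.
by apply: contf_add; [exact: contS_cst|exact: contf_exp].
Qed.

Lemma sint_dpoisson phi : C1 phi -> sint (fun y => phi y * dpoisson r x y) =
  - sint (fun y => field_re r x y * Gam a phi y + field_im r x y * Gam b phi y).
Proof.
move=> cp; have cp' := C1_cont cp.
have dQ := D2_exp n.+2 (D2_Q Sx r1).
have dM := D2_add (D2_exp 2 dl) (D2_mul (D2_cst x (- r ^+ 2)) (D2_exp 2 (D2_b x))).
have dA := D2_mul (D2_cst x (- kap r)) (D2_mul dQ dM).
have dB := D2_mul (D2_cst x (kap r)) (D2_mul dQ (D2_mul (D2_cst x (2 * r)) (D2_mul (D2_b x) dl))).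
have -> := div_identity n_gt0 Sx dA dB cp contS_dpoisson _.
  congr (- _); apply: sint_ext => y Sy /=; rewrite /field_re /field_im.
  congr (_ * (_ * (_ + _)) * _ + _); exact: mulNr.
move=> y Sy /=; have := qn0 Sy; rewrite /dpoisson /kap.
have k0 : n%:R != 0 :> R by rewrite pnatr_eq0 -lt0n.
have eQ k : (qf r x y)^-1 ^+ k.+1 = (qf r x y)^-1 * (qf r x y)^-1 ^+ k by rewrite exprS.
rewrite !(eQ n.+1) !(eQ n) -[n.+2]addn2 -[n.+1]addn1 !natrD.
move: ((1 - r ^+ 2) ^+ n) ((qf r x y)^-1 ^+ n) (n%:R : R) k0; rewrite /qf; move: (a y) (b y) => {}a {}b c d k k0 q0.
field. by rewrite ?k0 ?exprMn ?q0.
Qed.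

(** The integrand is, up to a constant, the divergence of the horizontal gradient of qf
    ^- n. *)
Lemma sint_poisson_moment : sint (fun y => (qf r x y)^-1 ^+ n.+1 * (r - a y)) = 0.
Proof.
have dQ := D2_exp n.+1 (D2_Q Sx r1).
have dA := D2_mul dQ dl.
have dB := D2_mul (D2_cst x (- r)) (D2_mul dQ (D2_b x)).
have cH : contS (fun y => 2 * n%:R * ((qf r x y)^-1 ^+ n.+1 * (r - a y))).
  apply: contf_scale; apply: contf_mul; first exact: contf_exp.
  by apply: contf_sub => //; exact: contS_cst.
have := div_identity n_gt0 Sx dA dB (@C1_cst R n 1) cH _.
have -> : sint (fun y => (qf r x y)^-1 ^+ n.+1 * (1 - r * a y) * Gam a (fun=> 1) y +
     - r * ((qf r x y)^-1 ^+ n.+1 * b y) * Gam b (fun=> 1) y) = 0.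
  have G0 c y : Gam c (fun=> 1) y = 0 :> R.
    by rewrite GamC /Gam /Tder tgrad_cst mul0r big1 ?subrr// => i _; rewrite tgrad_cst mul0r.
  rewrite (@sint_ext _ _ _ (fun=> 0)) ?sint_cst ?mul0r// => y _.
  by rewrite !G0 !mulr0 addr0.
have -> : sint (fun y => (fun=> 1) y * (2 * n%:R * ((qf r x y)^-1 ^+ n.+1 * (r - a y)))) =
  2 * n%:R * sint (fun y => (qf r x y)^-1 ^+ n.+1 * (r - a y)).
  rewrite -sintZ//; last first.
    by apply: contf_mul; [exact: contf_exp|apply: contf_sub => //; exact: contS_cst].
  by apply: sint_ext => y _; rewrite mul1r.
have n0 : n%:R != 0 :> R by rewrite pnatr_eq0 -lt0n.
rewrite oppr0 => H; have /eqP : 2 * n%:R * sint (fun y => (qf r x y)^-1 ^+ n.+1 * (r - a y)) = 0.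
  apply: H => y Sy /=; have := qn0 Sy.
  have eQ k : (qf r x y)^-1 ^+ k.+1 = (qf r x y)^-1 * (qf r x y)^-1 ^+ k by rewrite exprS.
  rewrite !(eQ n) -[n.+1]addn1 !natrD.
  move: ((qf r x y)^-1 ^+ n) (n%:R : R); rewrite /qf; move: (a y) (b y) => {}a {}b d k q0.
  by field; rewrite exprMn.
by rewrite !mulf_eq0 (negPf n0) pnatr_eq0/= => /eqP.
Qed.

End Fixed.
End PoissonKernel.

(** * Mass and concentration of the kernel *)

Section PoissonEnergy.
Variables (R : realType) (n : nat).
Notation V := (Cspace R n).
Notation m := (n.*2.+1).
Notation S := (@sphere R n).
Hypothesis n_gt0 : (0 < n)%N.
Implicit Types (x y v w z : V) (phi psi chi : V -> R) (r : R).

Section Joint.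
Variables (T : topologicalType) (B : set T) (rho : T -> R) (X Y : T -> V).
Hypotheses (crho : continuous rho) (cX : continuous X) (cY : continuous Y).
Hypotheses (Brho : forall t, B t -> `|rho t| < 1) (BX : forall t, B t -> S (X t))
  (BY : forall t, B t -> S (Y t)).

Lemma contw_cre : {within B, continuous (fun t => cre (X t) (Y t))}.
Proof. by apply: contw_T; exact: edot_continuous. Qed.

Lemma contw_cim : {within B, continuous (fun t => cim (X t) (Y t))}.
Proof.
apply: contw_T; apply: edot_continuous; first exact: cY.
apply: Cspace_continuous => j; last first.
  by move=> t; apply: (@continuous_comp _ _ _ X (fun x : V => x.1 0 j)); [exact: cX|exact: coord1_continuous].
have -> : (fun t => (Jmul (X t)).1 0 j) = (fun t => - (X t).2 0 j) by apply/funext => t; rewrite mxE.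
apply: contf_opp => t.
by apply: (@continuous_comp _ _ _ X (fun x : V => x.2 0 j)); [exact: cX|exact: coord2_continuous].
Qed.

Lemma contw_Q : {within B, continuous (fun t => (qf (rho t) (X t) (Y t))^-1)}.
Proof.
apply: contw_inv; last first.
  by move=> t Bt; rewrite gt_eqF//; apply: qf_gt0; [exact: BX|exact: BY|exact: Brho].
have cr : {within B, continuous rho} by exact: contw_T.
apply: contf_add.
  apply: contf_exp; apply: contf_sub; first exact: contf_cst.
  by apply: contf_mul => //; exact: contw_cre.
apply: contf_mul; first exact: contf_exp.
by apply: contf_exp; exact: contw_cim.
Qed.

Lemma contw_poisson : {within B, continuous (fun t => poisson (rho t) (X t) (Y t))}.
Proof.
have cr : {within B, continuous rho} by exact: contw_T.
apply: contf_exp; apply: contf_mul; last exact: contw_Q.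
by apply: contf_sub; [exact: contf_cst|exact: contf_exp].
Qed.

Lemma contw_dpoisson : {within B, continuous (fun t => dpoisson (rho t) (X t) (Y t))}.
Proof.
have cr : {within B, continuous rho} by exact: contw_T.
have ca := contw_cre; have cb := contw_cim; have cQ := contw_Q.
apply: contf_mul.
  apply: contf_mul; last exact: contf_exp.
  apply: contf_scale; apply: contf_exp.
  by apply: contf_sub; [exact: contf_cst|exact: contf_exp].
apply: contf_sub.
  by apply: contf_mul => //; apply: contf_add; [exact: contf_cst|exact: contf_exp].
apply: contf_mul => //; apply: contf_add; last exact: contf_exp.
by apply: contf_add; [exact: contf_cst|exact: contf_exp].
Qed.

End Joint.

Definition unitint : set R := [set r | `|r| < 1].

Lemma unitint_open : open unitint.
Proof.
have -> : unitint = (fun r : R => `|r|) @^-1` [set s | s < 1] by [].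
apply: open_comp; last exact: open_lt.
by move=> r _; exact: norm_continuous.
Qed.

(** The mass is constant in r, because sint_dpoisson with a constant function shows that its
    derivative vanishes, and it is the volume at r = 0. *)
Lemma poisson_mass r x : S x -> 0 <= r -> r < 1 -> sint (poisson r x) = vol R n.
Proof.
move=> Sx r0 r1.
have cP : {within unitint `*` S, continuous (fun p : R * V => dpoisson p.1 x p.2)}.
  apply: contw_dpoisson => [t|t|t|t|t|t]; [exact: cvg_fst|exact: cvg_cst|exact: cvg_snd|by case|by []|by case].
have D (s : R) : `|s| < 1 -> is_derive s 1 (fun s => sint (poisson s x)) 0.
  move=> s1; have := @sint_is_derive R n n_gt0 unitint (fun s => poisson s x) (fun s => dpoisson s x) unitint_open _ cP _ s s1.
  have -> : sint (dpoisson s x) = 0.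
    have := sint_dpoisson n_gt0 Sx s1 (@C1_cst R n 1).
    have -> : sint (fun y => (fun=> 1) y * dpoisson s x y) = sint (dpoisson s x).
      by apply: sint_ext => y _; rewrite mul1r.
    move=> ->; rewrite (@sint_ext _ _ _ (fun=> 0)) ?sint_cst ?mul0r ?oppr0// => y _.
    have G0 c : Gam c (fun=> 1) y = 0 :> R.
      by rewrite GamC /Gam /Tder tgrad_cst mul0r big1 ?subrr// => i _; rewrite tgrad_cst mul0r.
    by rewrite !G0 !mulr0 addr0.
  apply => [t t1|t y t1 Sy]; first exact: contS_poisson.
  exact: poisson_is_derive.
have P0 : sint (poisson 0 x) = vol R n.
  by apply: sint_ext => y _; rewrite /poisson /qf mul0r expr0n /= mul0r subr0 addr0 expr1n invr1 mulr1 expr1n.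
have [->//|rn0] := eqVneq r 0.
have rp : 0 < r by rewrite lt_neqAle eq_sym rn0.
have hs s : 0 <= s <= r -> `|s| < 1.
  by move=> /andP[s0 s1]; rewrite ger0_norm// (le_lt_trans s1).
have D1 s : s \in `]0, r[ -> is_derive s 1 (fun s => sint (poisson s x)) 0.
  by rewrite in_itv/= => /andP[s0 s1]; apply/D/hs; rewrite !ltW.
have D2 : {within `[0, r], continuous (fun s => sint (poisson s x))}.
  by apply: derivable_within_continuous => s; rewrite in_itv/= => /hs/D; case.
have [c _] := MVT rp D1 D2.
by rewrite mul0r => /eqP; rewrite subr_eq0 P0 => /eqP.
Qed.

(** The kernel concentrates at x at the rate 1 - r. It is a combination of poisson_mass and
    sint_poisson_moment. *)
Lemma poisson_mean r x : S x -> 0 <= r -> r < 1 ->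
  sint (fun y => poisson r x y * (1 - cre x y)) = (1 - r) * vol R n.
Proof.
move=> Sx r0 r1; have rr : `|r| < 1 by rewrite ger0_norm.
have cP := contS_poisson Sx rr.
have ca : contS (cre x) by exact: C1_cont (C1_edot x).
have cr : contS (fun y => r - cre x y) by apply: contf_sub => //; exact: contS_cst.
rewrite (@sint_ext _ _ _ (fun y => (1 - r) * poisson r x y + poisson r x y * (r - cre x y))); last first.
  by move=> y _; move: (poisson r x y) (cre x y) => p a; ring.
rewrite sintD//; [|exact: contf_scale|exact: contf_mul].
rewrite sintZ// poisson_mass//.
have -> : sint (fun y => poisson r x y * (r - cre x y)) = (1 - r ^+ 2) ^+ n.+1 * sint (fun y => (qf r x y)^-1 ^+ n.+1 * (r - cre x y)).
  rewrite -sintZ//; last first.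
    apply: contf_mul => //; apply: contf_exp; exact: C1_cont (D2_C1 (D2_Q Sx rr)).
  by apply: sint_ext => y _; rewrite /poisson exprMn mulrA.
by rewrite sint_poisson_moment// mulr0 addr0.
Qed.

Lemma horiz_ge0 x y : S x -> S y -> 0 <= 1 - cre x y ^+ 2 - cim x y ^+ 2.
Proof. by move=> Sx Sy; have := cre2_cim2_le1 Sx Sy; lra. Qed.

Lemma poisson_horiz r y : S y -> 0 <= r -> r < 1 ->
  sint (fun x => poisson r x y * (1 - cre x y ^+ 2 - cim x y ^+ 2)) <= 2 * (1 - r) * vol R n.
Proof.
move=> Sy r0 r1; have rr : `|r| < 1 by rewrite ger0_norm.
have cP := contS_poisson Sy rr.
have ca : contS (cre y) by exact: C1_cont (C1_edot y).
have cb : contS (cim y) by exact: C1_cont (C1_edot _).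
rewrite (@sint_ext _ _ _ (fun x => poisson r y x * (1 - cre y x ^+ 2 - cim y x ^+ 2))); last first.
  by move=> x _; rewrite poissonC creC cimC sqrrN.
rewrite -mulrA -(poisson_mean Sy)// -sintZ//; last first.
  by apply: contf_mul => //; apply: contf_sub => //; exact: contS_cst.
apply: sint_le => //.
- apply: contf_mul => //; apply: contf_sub; last exact: contf_exp.
  by apply: contf_sub; [exact: contS_cst|exact: contf_exp].
- apply: contf_scale; apply: contf_mul => //; apply: contf_sub => //; exact: contS_cst.
- move=> x Sx; rewrite mulrCA; apply: ler_wpM2l; first exact/ltW/poisson_gt0.
  have := cre_le1 Sy Sx; rewrite ler_norml => /andP[h1 h2].
  have := sqr_ge0 (cim y x); move: (cre y x) h1 h2 => a h1 h2; nra.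
Qed.

Lemma Gam_comb (s t : R) phi psi chi x : C1 phi -> C1 psi -> S x ->
  Gam (fun y => s * phi y + t * psi y) chi x = s * Gam phi chi x + t * Gam psi chi x.
Proof. by move=> h1 h2 Sx; rewrite (GamDl chi (C1Z s h1) (C1Z t h2) Sx) !GamZl. Qed.

Lemma Gam_CS phi psi x : C1 phi -> C1 psi -> S x ->
  Gam phi psi x ^+ 2 <= Gam phi phi x * Gam psi psi x.
Proof.
move=> h1 h2 Sx.
have H (s t : R) : 0 <= s ^+ 2 * Gam phi phi x + 2 * s * t * Gam phi psi x + t ^+ 2 * Gam psi psi x.
  have c : C1 (fun y => s * phi y + t * psi y) by apply: C1D; exact: C1Z.
  have := Gam_ge0 c Sx; rewrite Gam_comb// (GamC phi (fun _ => _)) (GamC psi (fun _ => _)) !Gam_comb// (GamC psi phi).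
  by move: (Gam phi phi x) (Gam phi psi x) (Gam psi psi x) => p q k; congr (0 <= _); ring.
move: (Gam_ge0 h2 Sx) H; move: (Gam phi phi x) (Gam phi psi x) (Gam psi psi x) => p q k k0 H.
have [k00|kn0] := eqVneq k 0.
  rewrite k00 mulr0; have [->|q0] := eqVneq q 0; first by rewrite expr0n.
  have := H 1 (- (p + 1) / (2 * q)); rewrite k00.
  have -> : 1 ^+ 2 * p + 2 * 1 * (- (p + 1) / (2 * q)) * q + (- (p + 1) / (2 * q)) ^+ 2 * 0 = - 1.
    by field.
  by rewrite lerNr oppr0 ler10.
have kp : 0 < k by rewrite lt_neqAle eq_sym kn0.
have := H k (- q).
have -> : k ^+ 2 * p + 2 * k * - q * q + (- q) ^+ 2 * k = k * (p * k - q ^+ 2) by ring.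
by rewrite pmulr_rge0// subr_ge0.
Qed.

(** The ratio between the length of the field with components field_re, field_im and the kernel, up
    to the factor 1 - r ^+ 2. *)
Definition cn : R := n.+1%:R / n%:R.

(** Cauchy-Schwarz for the horizontal product; the coefficients satisfy A^2 + B^2 = (cn
    P / (1 - r^2))^2 exactly. *)
Lemma field_bound r x y psi : S x -> S y -> `|r| < 1 -> C1 psi ->
  (field_re r x y * Gam (cre x) psi y + field_im r x y * Gam (cim x) psi y) ^+ 2 <=
  (cn / (1 - r ^+ 2) * poisson r x y) ^+ 2 * ((1 - cre x y ^+ 2 - cim x y ^+ 2) * Gam psi psi y).
Proof.
move=> Sx Sy r1 h; set A := field_re r x y; set B := field_im r x y.
have ca : C1 (cre x) := C1_edot x; have cb : C1 (cim x) := C1_edot (Jmul x).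
have c := C1D (C1Z A ca) (C1Z B cb).
have E chi := Gam_comb A B chi ca cb Sy.
have := Gam_CS c h Sy; rewrite E; move/le_trans; apply.
rewrite mulrA ler_wpM2r ?Gam_ge0// E (GamC (cre x) (fun _ => _)) (GamC (cim x) (fun _ => _)) !E.
rewrite (GamC (cim x) (cre x)) Gam_ab// Gam_aa// Gam_bb//.
have q0 := qf_gt0 Sx Sy r1; have o := one_sub_sqr_gt0 r1.
have -> : (cn / (1 - r ^+ 2) * poisson r x y) ^+ 2 = A ^+ 2 + B ^+ 2.
  rewrite /A /B /field_re /field_im /kap /cn /poisson [(_ * _) ^+ n.+1]exprMn.
  have k0 : n%:R != 0 :> R by rewrite pnatr_eq0 -lt0n.
  have eQ k : (qf r x y)^-1 ^+ k.+1 = (qf r x y)^-1 * (qf r x y)^-1 ^+ k by rewrite exprS.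
  rewrite [(1 - r ^+ 2) ^+ n.+1]exprS !(eQ n.+1) !(eQ n) -[n.+1]addn1 !natrD.
  have on0 : 1 - r ^+ 2 != 0 by rewrite gt_eqF.
  have qn0 : qf r x y != 0 by rewrite gt_eqF.
  move: ((1 - r ^+ 2) ^+ n) ((qf r x y)^-1 ^+ n) (n%:R : R) k0 qn0; rewrite /qf.
  move: (cre x y) (cim x y) => a b d f k k0 qn0.
  field. by rewrite ?k0 ?on0 ?exprMn ?qn0.
by rewrite le_eqVlt; apply/orP; left; apply/eqP; move: (cre x y) (cim x y) => a b; ring.
Qed.

End PoissonEnergy.

(** * The mean oscillation is controlled by the horizontal energy *)

Lemma norm_sqr_le (R : realType) (n : nat) (v : Cspace R n) : `|v| ^+ 2 <= edot v v.
Proof.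
have c j : v.1 0 j ^+ 2 + v.2 0 j ^+ 2 <= edot v v.
  rewrite /edot (bigD1 j)//= -!expr2 lerDl.
  by apply: sumr_ge0 => i _; rewrite addr_ge0// -expr2 sqr_ge0.
have rv (w : 'rV[R]_n.+1) : (forall j, w 0 j ^+ 2 <= edot v v) -> `|w| ^+ 2 <= edot v v.
  move=> h; have [w0|w0] := eqVneq (mx_norm w) 0.
    by rewrite [`|w|]w0 expr0n/= edot_ge0.
  have [[i j] /= e] := mx_norm_neq0 w0.
  have -> : `|w| = `|w 0 j| by rewrite -[LHS]/(mx_norm w) e (ord1 i).
  by rewrite real_normK ?num_real// h.
rewrite prod_normE; have [_|_] := leP `|v.1| `|v.2|; apply: rv => j; apply: le_trans (c j).
  by rewrite lerDr sqr_ge0.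
by rewrite lerDl sqr_ge0.
Qed.

(** Turns a bound for the increment of the square root p of e + d into a bound for e. *)
Lemma sqr_shift_le (R : realDomainType) (p q k e d : R) : 0 < p -> 0 < q -> p <= q + k ->
  p ^+ 2 = e + d -> q ^+ 2 <= 2 * d -> e <= 2 * k ^+ 2 + 4 * d.
Proof.
move=> p0 q0 h1 h2 h3.
have : p ^+ 2 <= (q + k) ^+ 2 by rewrite lerXn2r ?nnegrE ?(ltW p0)//; lra.
have := sqr_ge0 (q - k); have := sqr_ge0 q; nra.
Qed.

Section Energy.
Variables (R : realType) (n : nat).
Notation V := (Cspace R n).
Notation S := (@sphere R n).
Hypothesis n_gt0 : (0 < n)%N.
Local Notation unitint := (@unitint R).
Local Notation vol := (@vol R n).
Variable psi : V -> R.
Hypothesis psi1 : C1 psi.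
Implicit Types (x y : V) (r : R).

Let cpsi : contS psi := C1_cont psi1.

Section JointDiff.
Variables (T : topologicalType) (B : set T) (rho : T -> R) (X Y : T -> V).
Hypotheses (crho : continuous rho) (cX : continuous X) (cY : continuous Y).
Hypotheses (Brho : forall t, B t -> `|rho t| < 1) (BX : forall t, B t -> S (X t))
  (BY : forall t, B t -> S (Y t)).

Lemma contw_diff : {within B, continuous (fun t => psi (X t) - psi (Y t))}.
Proof. by apply: contf_sub; apply: contw_comp. Qed.

Lemma contw_poisson_diff : {within B, continuous (fun t => poisson (rho t) (X t) (Y t) * (psi (X t) - psi (Y t)) ^+ 2)}.
Proof. by apply: contf_mul; [exact: contw_poisson|apply: contf_exp; exact: contw_diff]. Qed.

Lemma contw_dpoisson_diff : {within B, continuous (fun t => dpoisson (rho t) (X t) (Y t) * (psi (X t) - psi (Y t)) ^+ 2)}.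
Proof. by apply: contf_mul; [exact: contw_dpoisson|apply: contf_exp; exact: contw_diff]. Qed.
End JointDiff.

(** Mean oscillation of psi at scale 1 - r, measured by the kernel. *)
Definition mean_osc r : R := sint (fun x => sint (fun y => poisson r x y * (psi x - psi y) ^+ 2)).
Definition dmean_osc r : R := sint (fun x => sint (fun y => dpoisson r x y * (psi x - psi y) ^+ 2)).

Let SS : set (V * V) := S `*` S.

Lemma cpoisson_diff r : `|r| < 1 -> {within SS, continuous (fun p : V * V => poisson r p.1 p.2 * (psi p.1 - psi p.2) ^+ 2)}.
Proof.
move=> r1; apply: (@contw_poisson_diff _ _ (fun=> r) (fun p => p.1) (fun p => p.2)) => [t|t|t|t|t|t] //.
- exact: cvg_cst.
- exact: cvg_fst.
- exact: cvg_snd.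
- by case.
- by case.
Qed.

Lemma cdpoisson_diff r : `|r| < 1 -> {within SS, continuous (fun p : V * V => dpoisson r p.1 p.2 * (psi p.1 - psi p.2) ^+ 2)}.
Proof.
move=> r1; apply: (@contw_dpoisson_diff _ _ (fun=> r) (fun p => p.1) (fun p => p.2)) => [t|t|t|t|t|t] //.
- exact: cvg_cst.
- exact: cvg_fst.
- exact: cvg_snd.
- by case.
- by case.
Qed.

Lemma mean_osc_is_derive r : `|r| < 1 -> is_derive r 1 mean_osc (dmean_osc r).
Proof.
move=> r1.
apply: (@sint_is_derive R n n_gt0 unitint (fun s x => sint (fun y => poisson s x y * (psi x - psi y) ^+ 2))
   (fun s x => sint (fun y => dpoisson s x y * (psi x - psi y) ^+ 2))) => //.
- exact: unitint_open.
- move=> s s1; exact: (@sint_within_cont R n n_gt0 V S (fun x y => poisson s x y * (psi x - psi y) ^+ 2) (cpoisson_diff s1)).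
- apply: (@sint_within_cont R n n_gt0 (R * V)%type (unitint `*` S) (fun p y => dpoisson p.1 p.2 y * (psi p.2 - psi y) ^+ 2)).
  apply: (@contw_dpoisson_diff _ _ (fun p : R * V * V => p.1.1) (fun p => p.1.2) (fun p => p.2)) => [t|t|t|t|t|t].
  + by apply: (@continuous_comp _ _ _ (fun p : R * V * V => p.1) (fun p : R * V => p.1)); exact: cvg_fst.
  + by apply: (@continuous_comp _ _ _ (fun p : R * V * V => p.1) (fun p : R * V => p.2)); [exact: cvg_fst|exact: cvg_snd].
  + exact: cvg_snd.
  + by case=> [[]].
  + by case=> [[]].
  + by case.
- move=> s x s1 Sx.
  apply: (@sint_is_derive R n n_gt0 unitint (fun s y => poisson s x y * (psi x - psi y) ^+ 2)
   (fun s y => dpoisson s x y * (psi x - psi y) ^+ 2)) => //.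
  + exact: unitint_open.
  + move=> t t1; exact: (@slice_contS R n V S (fun x y => poisson t x y * (psi x - psi y) ^+ 2) x (cpoisson_diff t1)).
  + apply: (@contw_dpoisson_diff _ _ (fun p : R * V => p.1) (fun p => x) (fun p => p.2)) => [t|t|t|t|t|t].
    * exact: cvg_fst.
    * exact: cvg_cst.
    * exact: cvg_snd.
    * by case.
    * by [].
    * by case.
  + move=> t y t1 Sy; apply: pder_eq (pderM (poisson_is_derive Sx Sy t1) (pder_cst _ _ _)) _.
    by rewrite mulr0 addr0.
Qed.

Definition dirichlet : R := sint (Gam psi psi).

Lemma dirichlet_ge0 : 0 <= dirichlet.
Proof. by apply: sint_ge0 => x Sx; exact: Gam_ge0. Qed.

Lemma mean_osc_ge0 r : `|r| < 1 -> 0 <= mean_osc r.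
Proof.
move=> r1; apply: sint_ge0 => x Sx; apply: sint_ge0 => y Sy.
by rewrite mulr_ge0 ?sqr_ge0// ltW// poisson_gt0.
Qed.

(** Integrate dpoisson by parts with sint_dpoisson, estimate the field by field_bound, and split
    the product by the Young inequality with parameter th. poisson_horiz, after exchanging
    the integrals, bounds the energy term. *)
Lemma dmean_osc_ge r (th : R) : 0 <= r -> r < 1 -> 0 < th ->
  - (cn R n / (1 - r) * (th * mean_osc r + th^-1 * (2 * (1 - r) * vol * dirichlet))) <= dmean_osc r.
Proof.
move=> r0 r1 th0; have rr : `|r| < 1 by rewrite ger0_norm.
have o := one_sub_sqr_gt0 rr; have s0 : 0 < 1 - r by rewrite subr_gt0.
pose M := cn R n / (1 - r ^+ 2).
have c0 : 0 < cn R n by rewrite divr_gt0// ltr0n.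
have M0 : 0 < M by rewrite divr_gt0.
pose H x y := poisson r x y * (1 - cre x y ^+ 2 - cim x y ^+ 2) * Gam psi psi y.
have cG : contS (Gam psi psi) by exact: contS_Gam.
have cHT (T : topologicalType) (B : set T) (X Y : T -> V) : continuous X -> continuous Y ->
    (forall t, B t -> S (X t)) -> (forall t, B t -> S (Y t)) -> {within B, continuous (fun t => H (X t) (Y t))}.
  move=> cX cY BX BY; apply: contf_mul; last exact: contw_comp.
  apply: contf_mul; first by apply: contw_poisson => // t; exact: cvg_cst.
  apply: contf_sub; last by apply: contf_exp; exact: contw_cim.
  by apply: contf_sub; [exact: contf_cst|apply: contf_exp; exact: contw_cre].
have cH : {within SS, continuous (fun p : V * V => H p.1 p.2)}.
  apply: cHT => [t|t|t|t]; [exact: cvg_fst|exact: cvg_snd|by case|by case].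
have pd := cpoisson_diff rr; have dd := cdpoisson_diff rr.
have pdx x : S x -> contS (fun y => poisson r x y * (psi x - psi y) ^+ 2).
  by move=> Sx; exact: (@slice_contS R n V S (fun x y => poisson r x y * (psi x - psi y) ^+ 2) x pd Sx).
have ddx x : S x -> contS (fun y => dpoisson r x y * (psi x - psi y) ^+ 2).
  by move=> Sx; exact: (@slice_contS R n V S (fun x y => dpoisson r x y * (psi x - psi y) ^+ 2) x dd Sx).
have Hx x : S x -> contS (H x) by move=> Sx; exact: (@slice_contS R n V S H x cH Sx).
have i1 : contS (fun x => sint (fun y => poisson r x y * (psi x - psi y) ^+ 2)).
  exact: (@sint_within_cont R n n_gt0 V S _ pd).
have i2 : contS (fun x => sint (fun y => dpoisson r x y * (psi x - psi y) ^+ 2)).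
  exact: (@sint_within_cont R n n_gt0 V S _ dd).
have i3 : contS (fun x => sint (H x)) by exact: (@sint_within_cont R n n_gt0 V S _ cH).
have key x : S x -> - (M * th) * sint (fun y => poisson r x y * (psi x - psi y) ^+ 2) - (M / th) * sint (H x) <=
    sint (fun y => dpoisson r x y * (psi x - psi y) ^+ 2).
  move=> Sx; pose phi y := (psi x - psi y) ^+ 2.
  have Cf : forall y, S y -> is_derive (psi y) 1 (fun s : R => (psi x - s) ^+ 2) ((fun s => - 2 * (psi x - s)) (psi y)).
    move=> y Sy; apply: pder_eq (pderX 2 (pderB (pder_cst _ _ _) (pder_id _ _))) _.
    by rewrite /=; ring.
  have cphi : C1 phi.
    apply: (@C1_comp _ _ _ psi1 (fun s => (psi x - s) ^+ 2) (fun s => - 2 * (psi x - s)) Cf) => y Sy.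
    by apply: cvgM; [exact: cvg_cst|apply: cvgB; [exact: cvg_cst|exact: cvg_id]].
  have Gphi chi y : S y -> Gam chi phi y = - 2 * (psi x - psi y) * Gam chi psi y.
    move=> Sy; have dy := Cf y Sy; rewrite GamC.
    by rewrite (@Gam_comp _ _ _ (fun s => - 2 * (psi x - s)) psi chi y psi1 Sy dy) (GamC psi).
  have -> : sint (fun y => dpoisson r x y * (psi x - psi y) ^+ 2) = sint (fun y => phi y * dpoisson r x y).
    by apply: sint_ext => y _; rewrite mulrC.
  rewrite (sint_dpoisson n_gt0 Sx rr cphi) -[- (M / th * _)]mulNr.
  have cP := pdx x Sx; have cHx := Hx x Sx.
  have ca : C1 (cre x) := C1_edot x; have cb : C1 (cim x) := C1_edot (Jmul x).
  have cA : contS (fun y => field_re r x y * Gam (cre x) phi y + field_im r x y * Gam (cim x) phi y).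
    have cQ := C1_cont (D2_C1 (D2_Q Sx rr)); have ca' := C1_cont ca; have cb' := C1_cont cb.
    have cl : contS (fun y => 1 - r * cre x y) by apply: contf_sub; [exact: contS_cst|exact: contf_scale].
    apply: contf_add; (apply: contf_mul; last exact: contS_Gam); apply: contf_scale; apply: contf_mul; try exact: contf_exp.
      by apply: contf_sub; [exact: contf_exp|apply: contf_scale; exact: contf_exp].
    by apply: contf_scale; exact: contf_mul.
  rewrite -!sintZ// -sintD//; [|exact: contf_scale..].
  rewrite -sintN//; apply: sint_le => //.
  - by apply: contf_add; exact: contf_scale.
  - exact: contf_opp.
  move=> y Sy; rewrite !Gphi//.
  have := field_bound n_gt0 Sx Sy rr psi1.
  have -> : - (field_re r x y * (-2 * (psi x - psi y) * Gam (cre x) psi y) + field_im r x y * (-2 * (psi x - psi y) * Gam (cim x) psi y))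
     = 2 * (psi x - psi y) * (field_re r x y * Gam (cre x) psi y + field_im r x y * Gam (cim x) psi y).
    move: (field_re r x y) (field_im r x y) (Gam _ psi y) (Gam _ psi y) (psi x) (psi y) => A B g h p q; ring.
  rewrite -/M /H; have := horiz_ge0 Sx Sy; have := Gam_ge0 psi1 Sy; have := poisson_gt0 Sx Sy rr.
  move: (field_re r x y * _ + _) (poisson r x y) (psi x - psi y) (1 - _ - _) (Gam psi psi y) => X P d h g P0 g0 h0 hX.
  have MP : 0 < M * P * th by apply: mulr_gt0 => //; exact: mulr_gt0.
  have := sqr_ge0 (M * P * th * d + X).
  have -> : (M * P * th * d + X) ^+ 2 = (M * P * th) * (M * P * th * d ^+ 2 + 2 * d * X) + X ^+ 2 by ring.
  move=> h1; have {}h1 : 0 <= (M * P * th) * (M * P * th * d ^+ 2 + 2 * d * X) + (M * P) ^+ 2 * (h * g).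
    by rewrite (le_trans h1)// lerD2l.
  have e1 : (M * P * th) * (M * P * th * d ^+ 2 + 2 * d * X) + (M * P) ^+ 2 * (h * g) =
    (M * P * th) * (M * P * th * d ^+ 2 + 2 * d * X + M / th * (P * h * g)).
    by field; rewrite gt_eqF.
  move: h1; rewrite e1 pmulr_rge0// => h1.
  rewrite -subr_ge0; move: h1; congr (0 <= _); ring.
have K : sint (fun x => sint (H x)) <= 2 * (1 - r) * vol * dirichlet.
  rewrite (sint_fubini n_gt0 cH) -sintZ//; apply: sint_le => //.
  - exact: (@sint_within_cont R n n_gt0 V S (fun y x => H x y) (@swap_within R n H cH)).
  - exact: contf_scale.
  - move=> y Sy.
    rewrite (@sint_ext _ _ _ (fun x => Gam psi psi y * (poisson r x y * (1 - cre x y ^+ 2 - cim x y ^+ 2)))); last first.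
      by move=> x _; rewrite mulrC.
    rewrite sintZ//; last first.
      rewrite (_ : (fun x => _) = (fun x => poisson r y x * (1 - cre y x ^+ 2 - cim y x ^+ 2))); last first.
        by apply/funext => x; rewrite poissonC creC cimC sqrrN.
      apply: contf_mul; first exact: contS_poisson.
      apply: contf_sub; last by apply: contf_exp; exact: C1_cont (C1_edot _).
      by apply: contf_sub; [exact: contS_cst|apply: contf_exp; exact: C1_cont (C1_edot _)].
    by rewrite mulrC; apply: ler_wpM2r; [exact: Gam_ge0|exact: poisson_horiz].
have := sint_le n_gt0 _ i2 key.
rewrite sintB//; [|exact: contf_scale..].
rewrite !sintZ// -/(mean_osc r) -/(dmean_osc r) => h.
apply: le_trans (h _); last by apply: contf_sub; exact: contf_scale.
have Mle : M <= cn R n / (1 - r).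
  rewrite /M ler_pM2l// lef_pV2 ?posrE//; nra.
have e0 := mean_osc_ge0 rr.
rewrite mulNr -opprD lerN2.
have -> : M * th * mean_osc r + M / th * sint (fun x => sint (H x)) = M * (th * mean_osc r + th^-1 * sint (fun x => sint (H x))).
  by ring.
apply: ler_pM => //.
- exact: ltW.
- have iH : 0 <= sint (fun x => sint (H x)).
    apply: sint_ge0 => x Sx; apply: sint_ge0 => y Sy.
    apply: mulr_ge0; last exact: Gam_ge0.
    by apply: mulr_ge0; [exact/ltW/poisson_gt0|exact: horiz_ge0].
  apply: addr_ge0; apply: mulr_ge0; [exact: ltW|exact: e0| |exact: iH].
  by rewrite invr_ge0; exact: ltW.
- by rewrite lerD2l ler_wpM2l// invr_ge0 ltW.
Qed.

(** Uniform continuity; away from the diagonal 1 - cre x y is bounded below. *)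
Lemma psi_modulus (e : R) : 0 < e -> exists C : R, 0 <= C /\
  forall x y, S x -> S y -> (psi x - psi y) ^+ 2 <= e + C * (1 - cre x y).
Proof.
move=> e0.
have [d d0 hd] : exists2 d : R, 0 < d & forall x y, S x -> S y -> `|x - y| < d -> (psi x - psi y) ^+ 2 < e.
  have cov := (compact_near_coveringP _).1 (@sphere_compact R n).
  have H := cov R (at_right (0 : R)) (fun d x => S x -> forall y, S y -> `|x - y| < d -> (psi x - psi y) ^+ 2 < e) _.
  have {}H : \forall d \near at_right (0 : R), S `<=` (fun x => S x -> forall y, S y -> `|x - y| < d -> (psi x - psi y) ^+ 2 < e).
    apply: H => x Sx.
    have e4 : 0 < Num.sqrt e / 2 by rewrite divr_gt0// sqrtr_gt0.
    have /within_contP/(_ _ Sx _ e4)/nbhs_ballP[d /= d0 hd] := cpsi.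
    have d20 : 0 < d / 2 by rewrite divr_gt0.
    exists (ball x (d / 2), [set s : R | s < d / 2]).
      by split; [exact: nbhsx_ballx|exact: nbhs_right_lt].
    move=> [x' s] /= [xx' sd] Sx' y Sy xy.
    have h1 : `|psi x - psi x'| < Num.sqrt e / 2.
      by apply: hd => //; apply: le_ball xx'; lra.
    have h2 : `|psi x - psi y| < Num.sqrt e / 2.
      apply: hd => //; rewrite [d]splitr; apply: ball_triangle xx' _.
      by rewrite -ball_normE/=; apply: lt_trans xy sd.
    rewrite -real_normK ?num_real// -[ltRHS](@sqr_sqrtr _ e) ?ltW// ltrXn2r ?nnegrE ?sqrtr_ge0//.
    have -> : psi x' - psi y = (psi x - psi y) - (psi x - psi x') by ring.
    by rewrite (le_lt_trans (ler_normB _ _))// [ltRHS]splitr ltrD.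
  have [d [d0 hd]] := filter_ex (filterI (nbhs_right_gt 0) H).
  by exists d => // x y Sx Sy; exact: hd.
have [M M0 hM] := contS_bounded cpsi.
exists ((2 * M) ^+ 2 * (2 / d ^+ 2)); split; first by rewrite mulr_ge0 ?sqr_ge0// divr_ge0// sqr_ge0.
move=> x y Sx Sy; have x1 := (sphereP x).1 Sx; have y1 := (sphereP y).1 Sy.
have a1 : 0 <= 1 - cre x y by rewrite subr_ge0 (le_trans (ler_norm _))// cre_le1.
have [xy|xy] := ltP (`|x - y|) d.
  by apply: (le_trans (ltW (hd x y Sx Sy xy))); rewrite lerDl mulr_ge0// mulr_ge0 ?divr_ge0 ?sqr_ge0.
have h1 : d ^+ 2 <= 2 * (1 - cre x y).
  have -> : 2 * (1 - cre x y) = edot (x - y) (x - y).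
    by rewrite !(edotBl, edotBr) x1 y1 (edotC x y) /cre; ring.
  by rewrite (le_trans _ (norm_sqr_le _))// lerXn2r ?nnegrE// ltW.
have h2 : (psi x - psi y) ^+ 2 <= (2 * M) ^+ 2.
  rewrite -real_normK ?num_real// lerXn2r ?nnegrE// ?mulr_ge0//.
  have := hM x Sx; have := hM y Sy => k1 k2.
  by rewrite (le_trans (ler_normB _ _))//; lra.
rewrite (le_trans h2)// ler_wpDl ?(ltW e0)// -mulrA ler_peMr ?sqr_ge0//.
have d2 : 0 < d ^+ 2 by rewrite exprn_gt0.
by rewrite mulrAC ler_pdivlMr// mul1r.
Qed.

(** With psi_modulus this shows that the oscillation tends to zero as r tends to 1. *)
Lemma mean_osc_le_modulus (e C r : R) : 0 <= r -> r < 1 -> 0 <= C ->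
  (forall x y, S x -> S y -> (psi x - psi y) ^+ 2 <= e + C * (1 - cre x y)) ->
  mean_osc r <= (e + C * (1 - r)) * vol ^+ 2.
Proof.
move=> r0 r1 C0 h; have rr : `|r| < 1 by rewrite ger0_norm.
have -> : (e + C * (1 - r)) * vol ^+ 2 = sint (fun _ : V => (e + C * (1 - r)) * vol).
  by rewrite sint_cst// expr2 mulrA.
apply: sint_le => //.
- exact: (@sint_within_cont R n n_gt0 V S _ (cpoisson_diff rr)).
- exact: contS_cst.
move=> x Sx.
have cP := contS_poisson Sx rr.
have ca : contS (fun y => 1 - cre x y) by apply: contf_sub; [exact: contS_cst|exact: C1_cont (C1_edot x)].
have cPa : contS (fun y => poisson r x y * (1 - cre x y)) by exact: contf_mul.
have -> : (e + C * (1 - r)) * vol = sint (fun y => e * poisson r x y + C * (poisson r x y * (1 - cre x y))).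
  rewrite sintD//; [|exact: contf_scale..].
  by rewrite !sintZ// poisson_mass// poisson_mean// mulrDl -mulrA.
apply: sint_le => //.
- exact: (@slice_contS R n V S (fun x y => poisson r x y * (psi x - psi y) ^+ 2) x (cpoisson_diff rr) Sx).
- by apply: contf_add; exact: contf_scale.
move=> y Sy; have P0 := poisson_gt0 Sx Sy rr.
have -> : e * poisson r x y + C * (poisson r x y * (1 - cre x y)) = poisson r x y * (e + C * (1 - cre x y)) by ring.
by rewrite ler_pM2l// h.
Qed.

(** By dmean_osc_ge, with the best th, the square root of the oscillation has derivative at
    least - C (dirichlet / (1 - r))^(1/2). Integrate from r to 1, where the oscillation
    vanishes. *)
Lemma energy_bound r : 0 <= r -> r < 1 ->
  mean_osc r <= 16 * cn R n ^+ 2 * vol * dirichlet * (1 - r).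
Proof.
move=> r0 r1; have vol0 : 0 < vol := vol_gt0 R n_gt0.
have D0 := dirichlet_ge0; have c0 : 0 < cn R n by rewrite divr_gt0// ltr0n.
pose s0 : R := Num.sqrt (1 - r).
have s00 : 0 < s0 by rewrite sqrtr_gt0 subr_gt0.
have s0E : s0 ^+ 2 = 1 - r by rewrite sqr_sqrtr// subr_ge0 ltW.
have s01 : s0 <= 1 by rewrite -(expr_le1 (n := 2))// ?(ltW s00)// s0E; lra.
suff K dl : 0 < dl -> mean_osc r <= 16 * cn R n ^+ 2 * vol * (dirichlet + dl) * (1 - r) + 4 * dl.
  apply/ler_addgt0Pr => e e0.
  have A0 : 0 < 16 * cn R n ^+ 2 * vol * (1 - r) + 4.
    by rewrite ltr_wpDl// !mulr_ge0 ?sqr_ge0 ?subr_ge0 ?(ltW vol0) ?(ltW r1).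
  have := K (e / (16 * cn R n ^+ 2 * vol * (1 - r) + 4)) (divr_gt0 e0 A0).
  move/le_trans; apply; rewrite le_eqVlt; apply/orP; left; apply/eqP.
  by field; rewrite gt_eqF.
move=> dl0.
pose be := Num.sqrt (2 * vol * (dirichlet + dl)).
have be0 : 0 < be by rewrite sqrtr_gt0 !mulr_gt0// ltr_wpDl.
have beE : be ^+ 2 = 2 * vol * (dirichlet + dl) by rewrite sqr_sqrtr// !mulr_ge0 ?addr_ge0// ltW.
(* With r = 1 - s ^+ 2 the derivative of the square root stays bounded up to r = 1, and
   dl > 0 keeps it away from the singularity at 0. *)
pose g (s : R) := Num.sqrt (mean_osc (1 - s ^+ 2) + dl).
have in1 (s : R) : 0 < s -> s <= s0 -> [/\ 0 <= 1 - s ^+ 2, 1 - s ^+ 2 < 1 & `|1 - s ^+ 2| < 1].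
  move=> sp ss; have h1 : 0 <= 1 - s ^+ 2 by nra.
  by split=> //; [nra|rewrite ger0_norm//; nra].
have ep (s : R) : 0 < s -> s <= s0 -> 0 < mean_osc (1 - s ^+ 2) + dl.
  by move=> sp ss; have [_ _ h] := in1 s sp ss; rewrite ltr_wpDl// mean_osc_ge0.
have gE (s : R) : 0 < s -> s <= s0 -> g s ^+ 2 = mean_osc (1 - s ^+ 2) + dl.
  by move=> sp ss; rewrite sqr_sqrtr// ltW// ep.
have gp (s : R) : 0 < s -> s <= s0 -> 0 < g s by move=> sp ss; rewrite sqrtr_gt0 ep.
have Dg (s : R) : 0 < s -> s <= s0 -> is_derive s 1 g (- (s * dmean_osc (1 - s ^+ 2) / g s)).
  move=> sp ss; have [_ _ h] := in1 s sp ss.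
  have dq : is_derive s 1 (fun s : R => 1 - s ^+ 2) (- (2 * s)).
    by apply: pder_eq (pderB (pder_cst _ _ _) (pderX 2 (pder_id _ _))) _; rewrite /=; ring.
  have de := pderD (pder_comp (f := fun s : R => 1 - s ^+ 2) (mean_osc_is_derive h) dq) (pder_cst s 1 dl).
  have := pder_comp (f := fun s : R => mean_osc (1 - s ^+ 2) + dl) (is_derive1_sqrt (ep s sp ss)) de.
  move=> H; apply: pder_eq H _; rewrite -/(g s) addr0.
  by have := gp s sp ss => g0; field; rewrite gt_eqF.
have Dle (s : R) : 0 < s -> s <= s0 -> - (s * dmean_osc (1 - s ^+ 2) / g s) <= 2 * cn R n * be.
  move=> sp ss; have [h0 h1 h] := in1 s sp ss; have g0 := gp s sp ss.
  (* this th balances the two terms of dmean_osc_ge *)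
  have th0 : 0 < be * s / g s by rewrite divr_gt0// mulr_gt0.
  have := dmean_osc_ge h0 h1 th0.
  have -> : 1 - (1 - s ^+ 2) = s ^+ 2 by ring.
  have e0 := mean_osc_ge0 h; have eg : mean_osc (1 - s ^+ 2) <= g s ^+ 2 by rewrite gE// lerDl ltW.
  have b2 : 2 * vol * dirichlet <= be ^+ 2.
    by rewrite beE ler_pM2l ?mulr_gt0// lerDl ltW.
  move: (mean_osc _) (dmean_osc _) (g s) g0 th0 e0 eg => E D G G0 th0 E0 EG hD.
  have hE : cn R n / s ^+ 2 * (be * s / G * E + (be * s / G)^-1 * (2 * s ^+ 2 * vol * dirichlet)) <= cn R n / s ^+ 2 * (2 * be * s * G).
    apply: ler_wpM2l; first by rewrite divr_ge0 ?sqr_ge0// ltW.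
    have t1 : be * s / G * E <= be * s * G.
      by rewrite mulrAC ler_pdivrMr// -[X in _ <= X]mulrA -expr2 ler_pM2l ?mulr_gt0.
    have t2 : (be * s / G)^-1 * (2 * s ^+ 2 * vol * dirichlet) <= be * s * G.
      rewrite invf_div mulrAC ler_pdivrMr ?mulr_gt0//.
      have -> : be * s * G * (be * s) = G * (s ^+ 2 * be ^+ 2) by ring.
      rewrite ler_pM2l//.
      have -> : 2 * s ^+ 2 * vol * dirichlet = s ^+ 2 * (2 * vol * dirichlet) by ring.
      by rewrite ler_pM2l// exprn_gt0.
    have -> : 2 * be * s * G = be * s * G + be * s * G by ring.
    exact: lerD.
  have hD2 : - D <= cn R n / s ^+ 2 * (2 * be * s * G) by rewrite (le_trans _ hE)// lerNl.
  rewrite -mulNr -mulrN ler_pdivrMr//.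
  have -> : 2 * cn R n * be * G = s * (cn R n / s ^+ 2 * (2 * be * s * G)).
    by field; rewrite gt_eqF.
  by rewrite ler_pM2l.
have [C [C0 hC]] := psi_modulus (e := dl / (2 * vol ^+ 2)) (ltac:(by rewrite divr_gt0// mulr_gt0// exprn_gt0)).
have v2 : 0 < vol ^+ 2 by rewrite exprn_gt0.
have [eta [eta0 etas etaC]] : exists eta : R, [/\ 0 < eta, eta < s0 & C * eta ^+ 2 * vol ^+ 2 <= dl / 2].
  pose q := Num.min (s0 / 2) (dl / (2 * (C + 1) * vol ^+ 2)).
  have q0 : 0 < q.
    by rewrite lt_min !divr_gt0// !mulr_gt0// ltr_wpDl.
  have q1 : q <= s0 / 2 by rewrite ge_min lexx.
  have q2 : q <= dl / (2 * (C + 1) * vol ^+ 2) by rewrite ge_min lexx orbT.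
  exists q; split=> //; first by lra.
  have qq : q ^+ 2 <= q by rewrite expr2 ler_piMl ?(ltW q0)//; lra.
  move: q2; rewrite ler_pdivlMr ?mulr_gt0// ?ltr_wpDl// => q2.
  have : C * q ^+ 2 * vol ^+ 2 <= (C + 1) * q * vol ^+ 2.
    rewrite ler_pM2r// ler_pM ?sqr_ge0// ler_wpDr//.
  nra.
have g_eta : g eta ^+ 2 <= 2 * dl.
  have [h0 h1 h] := in1 eta eta0 (ltW etas).
  rewrite gE// ?(ltW etas)// (_ : 2 * dl = dl + dl); last by ring.
  rewrite lerD2r; have := mean_osc_le_modulus h0 h1 C0 hC.
  have -> : 1 - (1 - eta ^+ 2) = eta ^+ 2 by ring.
  move/le_trans; apply; rewrite mulrDl.
  have -> : dl / (2 * vol ^+ 2) * vol ^+ 2 = dl / 2 by field; rewrite gt_eqF.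
  by lra.
have D1 s : s \in `]eta, s0[ -> is_derive s 1 g (- (s * dmean_osc (1 - s ^+ 2) / g s)).
  by rewrite in_itv/= => /andP[h1 h2]; apply: Dg; [exact: lt_trans h1|exact: ltW].
have D2 : {within `[eta, s0], continuous g}.
  apply: derivable_within_continuous => s; rewrite in_itv/= => /andP[h1 h2].
  by case: (Dg s (lt_le_trans eta0 h1) h2).
have [c] := MVT etas D1 D2.
rewrite in_itv/= => /andP[c1 c2] hg.
have gs : g s0 <= g eta + 2 * cn R n * be * s0.
  rewrite -lerBlDl hg (@le_trans _ _ (2 * cn R n * be * (s0 - eta)))//.
    by rewrite ler_wpM2r ?subr_ge0 ?(ltW etas)// Dle// ?(ltW c2)// (lt_trans eta0).
  apply: ler_wpM2l; last by rewrite gerBl ltW.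
  by rewrite !mulr_ge0// ltW.
have gs2 : g s0 ^+ 2 = mean_osc r + dl.
  by rewrite (gE s0 s00 (lexx _)) s0E subKr.
have -> : 16 * cn R n ^+ 2 * vol * (dirichlet + dl) * (1 - r) = 2 * (2 * cn R n * be * s0) ^+ 2.
  by rewrite !exprMn beE s0E; ring.
have := gp s0 s00 (lexx _); have := gp eta eta0 (ltW etas) => q0 p0.
exact: (sqr_shift_le p0 q0) gs gs2 g_eta.
Qed.

End Energy.

(** * Positive parts and smooth steps *)

Section PositivePart.
Variable R : realType.
Implicit Types (s t : R).

Definition pos_part s : R := (s + `|s|) / 2.

Lemma pos_part_id s : 0 <= s -> pos_part s = s.
Proof. by move=> s0; rewrite /pos_part ger0_norm//; lra. Qed.

Lemma pos_part_0 s : s <= 0 -> pos_part s = 0.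
Proof. by move=> s0; rewrite /pos_part ler0_norm//; lra. Qed.

Lemma pos_part_ge0 s : 0 <= pos_part s.
Proof. by have [s0|/ltW s0] := leP 0 s; [rewrite pos_part_id|rewrite pos_part_0]. Qed.

Lemma pos_part_le s : pos_part s <= `|s|.
Proof. by have [s0|/ltW s0] := leP 0 s; [rewrite pos_part_id// ger0_norm|rewrite pos_part_0]. Qed.

Lemma le_posp s : s <= pos_part s.
Proof. by have [s0|s0] := leP 0 s; [rewrite pos_part_id|rewrite pos_part_0 ltW]. Qed.

Lemma pos_part_continuous : continuous pos_part.
Proof.
move=> s; apply: cvgM; last exact: cvg_cst.
by apply: cvgD; [exact: cvg_id|apply: cvg_norm; exact: cvg_id].
Qed.

Lemma pos_part_is_derive k s : is_derive s 1 (fun s => pos_part s ^+ k.+2) (k.+2%:R * pos_part s ^+ k.+1).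
Proof.
have [s0|s0|s0] := ltgtP s 0.
- rewrite pos_part_0 ?(ltW s0)// expr0n mulr0.
  apply: (@pder_near R R (fun=> 0)).
  have : \forall t \near s, t < 0 by exact: lt_nbhsl.
  by apply: filterS => t t0; rewrite pos_part_0 ?(ltW t0)// expr0n.
- rewrite pos_part_id ?(ltW s0)//.
  apply: (@pder_near R R (fun t => t ^+ k.+2)).
    have : \forall t \near s, 0 < t by exact: lt_nbhsr.
    by apply: filterS => t t0; rewrite pos_part_id ?ltW.
  by apply: pder_eq (pderX (x := s) (v := 1) k.+2 (pder_id _ _)) _; rewrite mulr1.
rewrite s0 pos_part_0// expr0n mulr0.
suff H : (fun h : R => h^-1 *: (((fun s => pos_part s ^+ k.+2) \o shift (0 : R)) (h *: 1) - pos_part 0 ^+ k.+2)) @ 0^' --> (0 : R).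
  by apply: DeriveDef; [apply/cvg_ex; exists 0|exact/cvg_lim].
apply/cvgrPdist_lt => e e0; rewrite near_withinE.
have : \forall t \near (0 : R), ball (0 : R) (Num.min 1 e) t.
  by apply: nbhsx_ballx; rewrite lt_min e0 ltr01.
apply: filterS => t; rewrite /ball/= sub0r normrN lt_min => /andP[t1 te] t0.
rewrite [t *: 1]mulr1 addr0 (pos_part_0 (lexx 0)) expr0n subr0 sub0r normrN [_ *: _]mulrC normrM normfV.
rewrite ltr_pdivrMr ?normr_gt0// normrX.
rewrite (@le_lt_trans _ _ (`|t| ^+ k.+2))//.
  by rewrite lerXn2r ?nnegrE// ger0_norm ?pos_part_ge0// pos_part_le.
rewrite !exprS mulrC ltr_pM2r ?normr_gt0//.
rewrite (@le_lt_trans _ _ (`|t| * 1))//; last by rewrite mulr1.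
by rewrite ler_wpM2l// exprn_ile1// ltW.
Qed.

End PositivePart.

Section Step.
Variable R : realType.
Implicit Types (s t : R).

Let A t : R := pos_part (t - 1).
Let B t : R := pos_part (4 - t).
(** A C1 step, equal to 0 below 1 and to 1 above 4. *)
Definition hstep t : R := A t ^+ 2 / (A t ^+ 2 + B t ^+ 2).
Definition dhstep t : R := 2 * A t * B t * (A t + B t) / (A t ^+ 2 + B t ^+ 2) ^+ 2.

Let AB_gt0 t : 0 < A t ^+ 2 + B t ^+ 2.
Proof.
have [t2|t2] := leP 2 t.
  by rewrite ltr_pwDl ?sqr_ge0// exprn_gt0// /A pos_part_id; lra.
by rewrite ltr_wpDl ?sqr_ge0// exprn_gt0// /B pos_part_id; lra.
Qed.

Lemma hstep_ge0 t : 0 <= hstep t.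
Proof. by rewrite divr_ge0 ?sqr_ge0// ltW. Qed.

Lemma hstep_le1 t : hstep t <= 1.
Proof. by rewrite ler_pdivrMr// mul1r lerDl sqr_ge0. Qed.

Lemma hstep_0 t : t <= 1 -> hstep t = 0.
Proof. by move=> t1; rewrite /hstep /A pos_part_0 ?expr0n ?mul0r//; lra. Qed.

Lemma hstep_1 t : 4 <= t -> hstep t = 1.
Proof.
by move=> t4; have := AB_gt0 t; rewrite /hstep /B pos_part_0 ?expr0n ?addr0; [move=> h; rewrite mulfV// gt_eqF|lra].
Qed.

Lemma hstep_le t : 0 <= t -> hstep t <= t.
Proof.
by move=> t0; have [t1|/ltW t1] := leP t 1; [rewrite hstep_0|rewrite (le_trans (hstep_le1 _))].
Qed.

Lemma hstep_is_derive t : is_derive t 1 hstep (dhstep t).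
Proof.
have dA : is_derive t 1 (fun t => A t ^+ 2) (2 * A t).
  have d1 := pderB (pder_id t 1) (pder_cst t 1 (1 : R)).
  have := pder_comp (f := fun t => t - 1) (pos_part_is_derive 0 (t - 1)) d1.
  by move=> h; apply: pder_eq h _; rewrite expr1 subr0 mulr1.
have dB : is_derive t 1 (fun t => B t ^+ 2) (- (2 * B t)).
  have d1 := pderB (pder_cst t 1 (4 : R)) (pder_id t 1).
  have := pder_comp (f := fun t => 4 - t) (pos_part_is_derive 0 (4 - t)) d1.
  by move=> h; apply: pder_eq h _; rewrite expr1 sub0r mulrN1.
have n0 : A t ^+ 2 + B t ^+ 2 != 0 by rewrite gt_eqF.
apply: pder_eq (pderM dA (pderV (f := fun t => A t ^+ 2 + B t ^+ 2) n0 (pderD dA dB))) _.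
by rewrite /dhstep; move: n0; move: (A t) (B t) => a b n0; field.
Qed.

Lemma dhstep_continuous : continuous dhstep.
Proof.
have cA : continuous A.
  move=> t; apply: (@continuous_comp _ _ _ (fun t : R => t - 1) (@pos_part R)); last exact: pos_part_continuous.
  by apply: cvgB; [exact: cvg_id|exact: cvg_cst].
have cB : continuous B.
  move=> t; apply: (@continuous_comp _ _ _ (fun t : R => 4 - t) (@pos_part R)); last exact: pos_part_continuous.
  by apply: cvgB; [exact: cvg_cst|exact: cvg_id].
apply: contf_mul.
  apply: contf_mul; last exact: contf_add.
  by apply: contf_mul => //; exact: contf_scale.
apply: contf_inv => [|t]; last by rewrite gt_eqF// exprn_gt0.
by apply: contf_exp; apply: contf_add; exact: contf_exp.
Qed.

Lemma dhstep_supp t : (t <= 1) || (4 <= t) -> dhstep t = 0.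
Proof.
case/orP => h; first by rewrite /dhstep /A pos_part_0 ?mulr0 ?mul0r//; lra.
by rewrite /dhstep /B pos_part_0 ?mulr0 ?mul0r//; lra.
Qed.

Lemma dhstep_bound t : 4 * t * dhstep t ^+ 2 <= 8.
Proof.
have [t1|t1] := leP t 1; first by rewrite dhstep_supp ?t1// expr0n mulr0.
have [t4|t4] := leP 4 t; first by rewrite dhstep_supp ?t4 ?orbT// expr0n mulr0.
have e0 : 0 <= dhstep t.
  have A0 : 0 <= A t by exact: pos_part_ge0. have B0 : 0 <= B t by exact: pos_part_ge0.
  by rewrite /dhstep divr_ge0 ?sqr_ge0// mulr_ge0 ?addr_ge0// mulr_ge0// mulr_ge0.
have e1 : dhstep t <= 2 / 3.
  have a0 : 0 <= t - 1 by lra.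
  have b0 : 0 <= 4 - t by lra.
  rewrite ler_pdivrMr ?exprn_gt0// /A /B !pos_part_id//.
  have p0 : 0 <= (t - 1) * (4 - t) by rewrite mulr_ge0//; lra.
  have p1 : (t - 1) * (4 - t) <= 9 / 4 by have := sqr_ge0 (2 * t - 5); nra.
  have -> : (t - 1) ^+ 2 + (4 - t) ^+ 2 = 9 - 2 * ((t - 1) * (4 - t)) by ring.
  have -> : 2 * (t - 1) * (4 - t) * (t - 1 + (4 - t)) = 6 * ((t - 1) * (4 - t)) by ring.
  by move: ((t - 1) * (4 - t)) p0 p1 => p p0 p1; nra.
have : dhstep t ^+ 2 <= (2 / 3) ^+ 2 by rewrite lerXn2r ?nnegrE//.
have := sqr_ge0 (dhstep t); move: (dhstep t ^+ 2) => d; nra.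
Qed.

(** The derivative is supported between 1 and 4, so at most one term is not zero. *)
Lemma sum_one_step M (c : R) : 
  \sum_(k < M) 4 * (c / 4 ^+ k) * dhstep (c / 4 ^+ k) ^+ 2 <= 8.
Proof.
have p4 k : 0 < 4 ^+ k :> R by rewrite exprn_gt0.
have [/existsP[k0 hk0]|] := boolP [exists k : 'I_M, dhstep (c / 4 ^+ k) != 0]; last first.
  rewrite negb_exists => /forallP h; rewrite big1// => k _.
  by have := h k; rewrite negbK => /eqP ->; rewrite expr0n mulr0.
have supp (k : nat) : dhstep (c / 4 ^+ k) != 0 -> 4 ^+ k < c /\ c < 4 ^+ k.+1.
  move=> h; split.
    rewrite ltNge; apply: contra h => h; rewrite dhstep_supp//.
    by rewrite ler_pdivrMr// mul1r h.
  rewrite ltNge; apply: contra h => h; rewrite dhstep_supp//.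
  by rewrite ler_pdivlMr// -exprS h orbT.
have mono (i j : nat) : (i < j)%N -> 4 ^+ i.+1 <= 4 ^+ j :> R.
  by move=> ij; rewrite ler_weXn2l// ler1n.
rewrite (bigD1 k0)//= big1 ?addr0; first exact: dhstep_bound.
move=> k kk0; apply/eqP; rewrite mulf_eq0; apply/orP; right; rewrite expf_eq0/=.
apply/negPn/negP => /supp[h1 h2]; have [h3 h4] := supp _ hk0.
have [lt|lt|e] := ltngtP k k0; last by rewrite (val_inj e) eqxx in kk0.
  by have := mono _ _ lt => h; have := lt_trans h3 h2; rewrite ltNge h.
by have := mono _ _ lt => h; have := lt_trans h1 h4; rewrite ltNge h.
Qed.

(** Only the scales 4^(k+1) <= c contribute, and they form a geometric series. *)
Lemma sum_geom_step M (c : R) : 0 <= c ->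
  \sum_(k < M) 4 ^+ k * hstep (c / 4 ^+ k.+1) <= c.
Proof.
have p4 k : 0 < 4 ^+ k :> R by rewrite exprn_gt0.
move=> c0; elim: M => [|M IH]; first by rewrite big_ord0.
have [h|h] := leP (c / 4 ^+ M.+1) 1.
  by rewrite big_ord_recr/= hstep_0// mulr0 addr0.
have geo K : \sum_(k < K) 4 ^+ k <= 4 ^+ K :> R.
  elim: K => [|K IHK]; first by rewrite big_ord0 expr0.
  rewrite big_ord_recr/= exprS; have := p4 K; move: (\sum_(k < K) _) (4 ^+ K : R) IHK => a b; lra.
apply: (@le_trans _ _ (\sum_(k < M.+1) 4 ^+ k)).
  by apply: ler_sum => k _; rewrite ler_piMr ?hstep_le1// ltW.
rewrite (le_trans (geo _))// ltW//; move: h.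
by rewrite ltr_pdivlMr// mul1r.
Qed.

End Step.

Lemma nth_root (R : realType) n (x : R) : 0 <= x -> exists2 s : R, 0 <= s & s ^+ n.+1 = x.
Proof.
move=> x0; exists (x `^ (n.+1%:R^-1)); first exact: powR_ge0.
by rewrite -powR_mulrn ?powR_ge0// -powRrM mulVf ?pnatr_eq0// powRr1.
Qed.

(** * The trace inequality *)

Section Iteration.
Variables (R : realType) (n : nat) (tau : R).
Hypotheses (n_gt0 : (0 < n)%N) (tau0 : 0 < tau) (tauE : tau ^+ n = 4).

Lemma tau_ge1 : 1 <= tau.
Proof.
rewrite leNgt; apply/negP => h.
have : tau ^+ n <= 1 by rewrite exprn_ile1// ltW.
by rewrite tauE; lra.
Qed.

(** A bound for the sequence tau^k s_k of the proof of iter_bound. *)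
Definition iterB (v C1 : R) : R := Num.max 1 (Num.max (9 * (4 * (4 * tau) * C1 / v)) (4 / v)).

(** Put E k = (4 tau)^k a_k. The last hypothesis reads E_(k+1) <= C E_k^(1/(n+1)) H_k,
    where the sum of the H_k is bounded. Hence the E_k are bounded, and then the same
    inequality shows that they are summable. *)
Lemma iter_bound (a g : nat -> R) (v C1 : R) : (forall k, 0 <= a k) -> (forall k, 0 <= g k) ->
  0 < v -> 0 < C1 -> a 0%N <= 1 ->
  (forall M, \sum_(k < M) (g k + 4 ^+ k * a k.+1) <= 9) ->
  (forall k s, 0 <= s -> s ^+ n.+1 = 4 * a k / v -> 4 ^+ k * a k.+1 <= C1 * s * (g k + 4 ^+ k * a k.+1)) ->
  forall M, \sum_(k < M) (4 * tau) ^+ k * a k <= 1 + v / 4 * (4 * (4 * tau) * C1 / v) * iterB v C1 * 9.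
Proof.
move=> a0 g0 v0 C10 a01 hs st M.
have t1 := tau_ge1.
set C2 := 4 * (4 * tau) * C1 / v; set B := iterB v C1.
have C20 : 0 < C2 by rewrite divr_gt0// !mulr_gt0.
have B1 : 1 <= B by rewrite /B /iterB le_max lexx.
have B2 : 9 * C2 <= B by rewrite /B /iterB !le_max lexx orbT.
have B3 : 4 / v <= B by rewrite /B /iterB !le_max lexx !orbT.
have l0 : 0 < 4 * tau by rewrite mulr_gt0.
have sP k : exists2 s : R, 0 <= s & s ^+ n.+1 = 4 * a k / v.
  by apply: nth_root; rewrite divr_ge0 ?mulr_ge0// ltW.
pose s k := s2val (cid2 (sP k)).
have s0 k : 0 <= s k by rewrite /s; case: cid2.
have sE k : s k ^+ n.+1 = 4 * a k / v by rewrite /s; case: cid2.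
pose S k := tau ^+ k * s k.
have S0 k : 0 <= S k by rewrite mulr_ge0// exprn_ge0// ltW.
have SE k : S k ^+ n.+1 = 4 / v * ((4 * tau) ^+ k * a k).
  rewrite /S exprMn sE -exprM mulnC exprM exprSr tauE; move: ((4 * tau) ^+ k) => q; ring.
pose H k := g k + 4 ^+ k * a k.+1.
have H0 k : 0 <= H k by rewrite addr_ge0// mulr_ge0// exprn_ge0.
have H9 k : H k <= 9.
  apply: le_trans (hs k.+1); rewrite big_ord_recr/= lerDr; apply: sumr_ge0 => i _; exact: H0.
have rec k : S k.+1 ^+ n.+1 <= C2 * S k * H k.
  rewrite SE; have := st k (s k) (s0 k) (sE k); rewrite -/(H k) => h.
  have -> : 4 / v * ((4 * tau) ^+ k.+1 * a k.+1) = 4 / v * (4 * tau) * tau ^+ k * (4 ^+ k * a k.+1).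
    by rewrite exprS exprMn; move: (4 ^+ k) (tau ^+ k) => p q; ring.
  have -> : C2 * S k * H k = 4 / v * (4 * tau) * tau ^+ k * (C1 * s k * H k).
    by rewrite /C2 /S; move: (tau ^+ k) (s k) (H k) => p q r; ring.
  by apply: ler_wpM2l => //; rewrite mulr_ge0 ?exprn_ge0 ?(ltW tau0)// mulr_ge0 ?(ltW l0)// divr_ge0// ltW.
have SB k : S k <= B.
  have B0 : 0 <= B by rewrite (le_trans ler01).
  have BB : B ^+ 2 <= B ^+ n.+1 by rewrite ler_weXn2l.
  suff : S k ^+ n.+1 <= B ^+ n.+1 by rewrite ler_pXn2r// nnegrE.
  elim: k => [|k IH].
    rewrite SE expr0 mul1r (@le_trans _ _ B)//; last by rewrite (le_trans _ BB)// expr2 ler_peMr.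
    by rewrite (le_trans _ B3)// ler_piMr// divr_ge0// ltW.
  have SkB : S k <= B by move: IH; rewrite ler_pXn2r// nnegrE.
  rewrite (le_trans (rec k))// (le_trans _ BB)// expr2 mulrAC.
  apply: ler_pM => //; first by rewrite mulr_ge0// ltW.
  by rewrite (le_trans _ B2)// mulrC ler_pM2r.
case: M => [|M].
  have K0 : 0 <= v / 4 * C2 * B.
    apply: mulr_ge0; last exact: le_trans ler01 B1.
    by apply: mulr_ge0; [rewrite divr_ge0// ltW|exact: ltW].
  by rewrite big_ord0; lra.
rewrite big_ord_recl/= expr0 mul1r lerD//.
rewrite (eq_bigr (fun k : 'I_M => v / 4 * S k.+1 ^+ n.+1)); last first.
  by move=> k _; rewrite SE mulrA; field; rewrite gt_eqF.
have -> : v / 4 * C2 * B * 9 = v / 4 * (C2 * (B * 9)) by rewrite !mulrA.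
rewrite -mulr_sumr.
apply: ler_wpM2l; first by rewrite divr_ge0// ltW.
apply: (@le_trans _ _ (\sum_(k < M) C2 * (B * H k))).
  apply: ler_sum => k _; apply: (le_trans (rec k)); rewrite -mulrA.
  by apply: ler_wpM2l; [exact: ltW|apply: ler_wpM2r].
rewrite -mulr_sumr; apply: ler_wpM2l; first exact: ltW.
by rewrite -mulr_sumr; apply: ler_wpM2l; [rewrite (le_trans ler01)|exact: hs].
Qed.

(** Let 4^(j-1) <= c < 4^j. If w > tau^j, then w 4^j <= w^(n+1), because tau^n = 4.
    Otherwise w 4^j <= (4 tau)^j, and the step at level j-2 has reached the value 1. *)
Lemma young_step (w c : R) M : 0 <= w -> 0 <= c -> c < 4 ^+ M ->
  w * c <= w ^+ n.+1 + (4 * tau) ^+ 2 * (1 + \sum_(k < M) (4 * tau) ^+ k * hstep (c / 4 ^+ k)).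
Proof.
move=> w0 c0 cM; have t1 := tau_ge1.
have p4 k : 0 < 4 ^+ k :> R by rewrite exprn_gt0.
have l1 : 1 <= 4 * tau by lra.
have sum0 : 0 <= \sum_(k < M) (4 * tau) ^+ k * hstep (c / 4 ^+ k).
  by apply: sumr_ge0 => k _; rewrite mulr_ge0 ?hstep_ge0// exprn_ge0// (le_trans ler01).
have ex : exists j, c < 4 ^+ j by exists M.
case: (ex_minnP ex) => j cj jmin.
have wj : w * c <= w * 4 ^+ j by rewrite ler_wpM2l// ltW.
have r0 : 0 <= (4 * tau) ^+ 2 * (1 + \sum_(k < M) (4 * tau) ^+ k * hstep (c / 4 ^+ k)).
  by apply: mulr_ge0; [exact: sqr_ge0|exact: addr_ge0].
have [wt|wt] := leP w (tau ^+ j); last first.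
  rewrite (le_trans wj)// (le_trans _ (ler_wpDr r0 (lexx _)))//.
  rewrite exprS ler_wpM2l// -tauE -exprM mulnC exprM lerXn2r ?nnegrE//; last exact: ltW.
  by rewrite exprn_ge0// ltW.
rewrite (le_trans wj)// ler_wpDl ?exprn_ge0//.
have -> : 4 ^+ j = 4 ^+ j * 1 :> R by rewrite mulr1.
apply: (@le_trans _ _ ((4 * tau) ^+ j)).
  by rewrite exprMn mulr1 mulrC ler_pM2l.
have key : (4 * tau) ^+ 2 <= (4 * tau) ^+ 2 * (1 + \sum_(k < M) (4 * tau) ^+ k * hstep (c / 4 ^+ k)).
  by rewrite -[leLHS]mulr1 ler_wpM2l ?sqr_ge0// lerDl.
case: j cj jmin wj wt => [|[|j]] cj jmin _ _.
- by rewrite expr0 (le_trans _ key)// exprn_ege1.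
- by rewrite (le_trans _ key)// ler_weXn2l.
have jM : (j < M)%N by rewrite -ltnS ltnW// ltnS; exact: jmin.
have hj : hstep (c / 4 ^+ j) = 1.
  apply: hstep_1; rewrite ler_pdivlMr// -exprS leNgt; apply/negP => /jmin.
  by rewrite ltnn.
have -> : (4 * tau) ^+ j.+2 = (4 * tau) ^+ 2 * (4 * tau) ^+ j by rewrite -exprD.
apply: ler_wpM2l; first exact: sqr_ge0.
rewrite (bigD1 (Ordinal jM))//= hj mulr1 addrCA lerDl addr_ge0//.
by apply: sumr_ge0 => k _; rewrite mulr_ge0 ?hstep_ge0// exprn_ge0// (le_trans ler01).
Qed.

End Iteration.

Section Trace.
Variables (R : realType) (n : nat).
Notation V := (Cspace R n).
Notation S := (@sphere R n).
Hypothesis n_gt0 : (0 < n)%N.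
Local Notation vol := (@vol R n).
Implicit Types (x y : V).

Section Truncation.
Variable psi : V -> R.
Hypothesis psi1 : C1 psi.

(** Truncation of psi ^+ 2 at height 4 ^+ k. *)
Definition trunc (k : nat) x : R := hstep (psi x ^+ 2 / 4 ^+ k).

Let p4 (k : nat) : 0 < 4 ^+ k :> R. Proof. by rewrite exprn_gt0. Qed.

Let dtr k (s : R) : R := dhstep (s ^+ 2 / 4 ^+ k) * (2 * s / 4 ^+ k).

Let trunc_derive k (s : R) : is_derive s 1 (fun s : R => hstep (s ^+ 2 / 4 ^+ k)) (dtr k s).
Proof.
have d1 := pderM (pderX 2 (pder_id s 1)) (pder_cst s 1 (4 ^+ k)^-1).
apply: pder_eq (pder_comp (f := fun s : R => s ^+ 2 / 4 ^+ k) (hstep_is_derive _) d1) _.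
by rewrite /dtr /= mulr0 addr0 mulr1 expr1.
Qed.

Lemma C1_trunc k : C1 (trunc k).
Proof.
apply: (@C1_comp _ _ _ psi1 (fun s => hstep (s ^+ 2 / 4 ^+ k)) (dtr k)) => [x Sx|x Sx]; first exact: trunc_derive.
have c1 : continuous (fun s : R => s ^+ 2 / 4 ^+ k).
  by move=> s; apply: cvgM; [exact: exprn_continuous|exact: cvg_cst].
move: (psi x); apply: contf_mul.
  move=> s; apply: (@continuous_comp _ _ _ (fun s : R => s ^+ 2 / 4 ^+ k) (@dhstep R)); [exact: c1|exact: dhstep_continuous].
by move=> s; apply: cvgM; [apply: cvgM; [exact: cvg_cst|exact: cvg_id]|exact: cvg_cst].
Qed.

Lemma Gam_trunc k x : S x -> 4 ^+ k * Gam (trunc k) (trunc k) x =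
  4 * (psi x ^+ 2 / 4 ^+ k) * dhstep (psi x ^+ 2 / 4 ^+ k) ^+ 2 * Gam psi psi x.
Proof.
move=> Sx; have d := trunc_derive k (psi x).
have E chi : Gam (trunc k) chi x = dtr k (psi x) * Gam psi chi x.
  exact: (@Gam_comp _ _ _ (dtr k) psi chi x psi1 Sx d).
rewrite E GamC E /dtr; have := p4 k; move: (dhstep _) => h; move: (4 ^+ k) (psi x) (Gam psi psi x) => q p g q0.
by field; rewrite gt_eqF.
Qed.

Let a k := sint (trunc k).
Let g k := 4 ^+ k * dirichlet (trunc k).
Let ct k : contS (trunc k). Proof. exact: C1_cont (C1_trunc k). Qed.

Let a_ge0 k : 0 <= a k.
Proof. by apply: sint_ge0 => x _; exact: hstep_ge0. Qed.
Let g_ge0 k : 0 <= g k.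
Proof. by rewrite mulr_ge0 ?(ltW (p4 k))//; exact: dirichlet_ge0 (C1_trunc k). Qed.

Let c2 : contS (fun x => psi x ^+ 2). Proof. by apply: contf_exp; exact: C1_cont. Qed.

Lemma sum_dirichlet_trunc M : \sum_(k < M) 4 ^+ k * dirichlet (trunc k) <= 8 * dirichlet psi.
Proof.
have cG k : contS (fun x => 4 ^+ k * Gam (trunc k) (trunc k) x).
  by apply: contf_scale; apply: contS_Gam; exact: C1_trunc.
rewrite (eq_bigr (fun k : 'I_M => sint (fun x => 4 ^+ k * Gam (trunc k) (trunc k) x))); last first.
  by move=> k _; rewrite sintZ//; apply: contS_Gam; exact: C1_trunc.
have [cs <-] := sint_sum n_gt0 (index_enum 'I_M) (fun k : 'I_M => cG k).
have cp : contS (Gam psi psi) by exact: contS_Gam.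
rewrite -sintZ//; apply: sint_le => //; first exact: contf_scale.
move=> x Sx; rewrite (eq_bigr _ (fun (k : 'I_M) _ => Gam_trunc k Sx)) -mulr_suml.
by apply: ler_wpM2r; [exact: Gam_ge0|exact: sum_one_step].
Qed.

Lemma sum_mass_trunc M : \sum_(k < M) 4 ^+ k * a k.+1 <= sint (fun x => psi x ^+ 2).
Proof.
have cG k : contS (fun x => 4 ^+ k * trunc k.+1 x) by apply: contf_scale; exact: ct.
rewrite (eq_bigr (fun k : 'I_M => sint (fun x => 4 ^+ k * trunc k.+1 x))); last first.
  by move=> k _; rewrite sintZ.
have [cs <-] := sint_sum n_gt0 (index_enum 'I_M) (fun k : 'I_M => cG k).
by apply: sint_le => // x Sx; apply: sum_geom_step; exact: sqr_ge0.
Qed.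

Lemma trunc_next k x : trunc k.+1 x != 0 -> trunc k x = 1.
Proof.
move=> h; apply: hstep_1; rewrite leNgt; apply: contra h => h; rewrite /trunc hstep_0//.
by rewrite (exprS 4 k) invfM mulrCA ler_pdivrMl// mulr1 ltW.
Qed.

(** Where trunc k.+1 is not zero, trunc k equals 1. If the mass of trunc k is small, a
    kernel at the scale 1 - r = 2 s is spread so much that it hardly sees trunc k; there
    trunc k oscillates by 1/2 on average, and energy_bound limits the mass of that set. *)
Lemma trunc_step k s : 0 <= s -> s ^+ n.+1 = 4 * a k / vol ->
  4 ^+ k * a k.+1 <= (64 * cn R n ^+ 2 + 2) * s * (g k + 4 ^+ k * a k.+1).
Proof.
move=> s0 sE; have v0 : 0 < vol := vol_gt0 R n_gt0.
have Pg := p4 k; have a1 := a_ge0 k.+1; have gk := g_ge0 k.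
have ca : 0 <= 4 ^+ k * a k.+1 by rewrite mulr_ge0// ltW.
have cn2 : 0 <= cn R n ^+ 2 by exact: sqr_ge0.
have [s1|s1] := ltP 1 (2 * s).
  have h1 : 4 ^+ k * a k.+1 <= 2 * s * (4 ^+ k * a k.+1) by rewrite ler_peMl// ltW.
  rewrite (le_trans h1)//; apply: ler_pM => //; first by rewrite mulr_ge0.
    by rewrite ler_wpM2r// lerDr mulr_ge0.
  by rewrite lerDr.
have [s00|sn0] := eqVneq s 0.
  have ak0 : a k = 0.
    move: sE; rewrite s00 expr0n => /esym/eqP; rewrite !mulf_eq0 invr_eq0 (gt_eqF v0) orbF pnatr_eq0.
    by move=> /eqP.
  have t0 x : S x -> trunc k x = 0.
    move=> Sx; have t00 y : S y -> 0 <= trunc k y by move=> _; exact: hstep_ge0.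
    exact: (@sint_pos R n n_gt0 (trunc k) (@ct k) t00 ak0 x Sx).
  have -> : a k.+1 = 0.
    rewrite /a (@sint_ext _ _ _ (fun=> 0)) ?sint_cst ?mul0r// => x Sx.
    apply/eqP; apply: contraT => /trunc_next/eqP; rewrite t0// eq_sym oner_eq0//.
  by rewrite mulr0 s00 mulr0 mul0r.
have sp : 0 < s by rewrite lt_neqAle eq_sym sn0.
(* at this radius the kernel is at most s ^- n.+1, so that trunc k has integral at most
   vol / 4 against it *)
pose r := 1 - 2 * s.
have r0 : 0 <= r by rewrite subr_ge0.
have r1 : r < 1 by rewrite /r; lra.
have rr : `|r| < 1 by rewrite ger0_norm.
have h1 : vol / 2 * a k.+1 <= mean_osc (trunc k) r.
  have ci := @sint_within_cont R n n_gt0 V S (fun x y => poisson r x y * (trunc k x - trunc k y) ^+ 2) (cpoisson_diff (C1_trunc k) rr).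
  rewrite -sintZ//; apply: sint_le => //; first by apply: contf_scale; exact: ct.
  move=> x Sx.
  have [->|t1] := eqVneq (trunc k.+1 x) 0.
    by rewrite mulr0; apply: sint_ge0 => y Sy; rewrite mulr_ge0 ?sqr_ge0// ltW// poisson_gt0.
  rewrite (trunc_next t1).
  have cP := contS_poisson Sx rr.
  have ctP : contS (fun y => trunc k y * (2 * (2 / (1 - r)) ^+ n.+1)) by apply: contf_mul; [exact: ct|exact: (@contS_cst R n)].
  apply: (@le_trans _ _ (sint (fun y => poisson r x y - trunc k y * (2 * (2 / (1 - r)) ^+ n.+1)))).
    rewrite sintB// poisson_mass//.
    have -> : sint (fun y => trunc k y * (2 * (2 / (1 - r)) ^+ n.+1)) = (2 * (2 / (1 - r)) ^+ n.+1) * a k.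
      by rewrite -sintZ//; apply: sint_ext => y _; rewrite mulrC.
    have -> : (2 * (2 / (1 - r)) ^+ n.+1) * a k = vol / 2.
      have -> : 2 / (1 - r) = s^-1 by rewrite /r subKr invfM mulrA mulfV ?mul1r// pnatr_eq0.
      rewrite exprVn sE.
      have [a00|an0] := eqVneq (a k) 0.
        by move/eqP: sE; rewrite a00 mulr0 mul0r expf_eq0/= (negPf sn0).
      by field; rewrite an0 gt_eqF.
    have := hstep_le1 (psi x ^+ 2 / 4 ^+ k.+1); rewrite -/(trunc k.+1 x); move: (trunc _ x) => t; nra.
  apply: sint_le => //.
  - exact: contf_sub.
  - by apply: contf_mul => //; apply: contf_exp; apply: contf_sub; [exact: (@contS_cst R n)|exact: ct].
  move=> y Sy; have := poisson_le Sx Sy r0 r1; have := poisson_gt0 Sx Sy rr.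
  have := hstep_ge0 (psi y ^+ 2 / 4 ^+ k); rewrite -/(trunc k y).
  move: (trunc k y) (poisson r x y) ((2 / (1 - r)) ^+ n.+1) => t P Q t0 P0 PQ.
  have : P * t <= Q * t by rewrite ler_wpM2r.
  have := mulr_ge0 (ltW P0) (sqr_ge0 t); nra.
have h2 := energy_bound n_gt0 (C1_trunc k) r0 r1.
have h3 : vol / 2 * a k.+1 <= 16 * cn R n ^+ 2 * vol * dirichlet (trunc k) * (2 * s).
  by apply: (le_trans h1); move: h2; rewrite /r subKr.
have h4 : a k.+1 <= 64 * cn R n ^+ 2 * s * dirichlet (trunc k).
  rewrite -(ler_pM2l (_ : 0 < vol / 2)) ?divr_gt0//.
  by move: h3; congr (_ <= _); field.
have h5 : 4 ^+ k * a k.+1 <= 64 * cn R n ^+ 2 * s * g k.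
  by rewrite /g mulrCA ler_pM2l.
rewrite (le_trans h5)//.
have := mulr_ge0 cn2 s0; have := mulr_ge0 (mulr_ge0 cn2 s0) ca; have := mulr_ge0 s0 ca; have := mulr_ge0 s0 gk.
by move: (cn R n ^+ 2) (g k) (4 ^+ k * a k.+1) => c gg t; nra.
Qed.

(** Sum the levels of young_step; iter_bound controls the resulting series. *)
Lemma trace_normalized (tau : R) (w : V -> R) : 0 < tau -> tau ^+ n = 4 ->
  contS w -> (forall x, S x -> 0 <= w x) -> dirichlet psi + sint (fun x => psi x ^+ 2) <= 1 ->
  sint (fun x => w x * psi x ^+ 2) <= sint (fun x => w x ^+ n.+1) + (4 * tau) ^+ 2 * (vol +
    (1 + vol / 4 * (4 * (4 * tau) * (64 * cn R n ^+ 2 + 2) / vol) * iterB tau vol (64 * cn R n ^+ 2 + 2) * 9)).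
Proof.
move=> tau0 tauE cw w0 nrm; have v0 : 0 < vol := vol_gt0 R n_gt0.
have D0 := dirichlet_ge0 psi1.
have I0 : 0 <= sint (fun x => psi x ^+ 2) by apply: sint_ge0 => x _; exact: sqr_ge0.
have [M0 M00 hM0] := contS_bounded (C1_cont psi1).
have [M hM] : exists M : nat, M0 ^+ 2 < 4 ^+ M.
  have [M hM] : exists M : nat, M0 ^+ 2 < M%:R.
    by exists (Num.truncn (M0 ^+ 2)).+1; exact: truncnS_gt.
  exists M; apply: (lt_le_trans hM).
  by rewrite -natrX ler_nat ltnW// ltn_expl.
have cs : contS (fun x => \sum_(k < M) (4 * tau) ^+ k * trunc k x).
  by apply: contf_sum => k _; apply: contf_scale; exact: ct.
have := @iter_bound R n tau n_gt0 tau0 tauE a g vol (64 * cn R n ^+ 2 + 2) a_ge0 g_ge0 v0 _ _ _ trunc_step M.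
set C := (1 + vol / 4 * _ * _ * 9) => it.
have {}it : \sum_(k < M) (4 * tau) ^+ k * a k <= C.
  apply: it.
  - by rewrite ltr_wpDl// mulr_ge0// sqr_ge0.
  - apply: (@le_trans _ _ (sint (fun x => psi x ^+ 2))); last by lra.
    by apply: sint_le => // x Sx; rewrite /trunc expr0 divr1 hstep_le// sqr_ge0.
  - move=> K; rewrite big_split/=; have := sum_dirichlet_trunc K; have := sum_mass_trunc K.
    by rewrite -/(g _); move: (\sum_(k < K) _) (\sum_(k < K) _) => p q; lra.
have cwn : contS (fun x => w x ^+ n.+1) by exact: contf_exp.
have c1s : contS (fun x => 1 + \sum_(k < M) (4 * tau) ^+ k * trunc k x).
  by apply: contf_add => //; exact: (@contS_cst R n).
apply: (@le_trans _ _ (sint (fun x => w x ^+ n.+1 + (4 * tau) ^+ 2 * (1 + \sum_(k < M) (4 * tau) ^+ k * trunc k x)))).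
  apply: sint_le => //.
  - exact: contf_mul.
  - by apply: contf_add => //; exact: contf_scale.
  move=> x Sx; apply: young_step => //; [exact: w0|exact: sqr_ge0|].
  apply: le_lt_trans hM; rewrite -real_normK ?num_real// lerXn2r ?nnegrE//.
  exact: hM0.
rewrite sintD//; last exact: contf_scale.
rewrite sintZ// sintD//; last exact: (@contS_cst R n).
have cck (k : 'I_M) : contS (fun x => (4 * tau) ^+ k * trunc k x) by apply: contf_scale; exact: ct.
have [_ ->] := sint_sum n_gt0 (index_enum 'I_M) cck.
rewrite lerD2l; apply: ler_wpM2l; first exact: sqr_ge0.
rewrite -/vol lerD2l; apply: le_trans it; rewrite le_eqVlt; apply/orP; left; apply/eqP.
by apply: eq_bigr => k _; rewrite sintZ.
Qed.

End Truncation.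

Lemma dirichletZ c psi : C1 psi -> dirichlet (fun x => c * psi x) = c ^+ 2 * dirichlet psi.
Proof.
move=> h; rewrite /dirichlet -sintZ//; last exact: contS_Gam.
apply: sint_ext => x Sx; rewrite GamZl// GamC GamZl//; move: (Gam psi psi x) => q; ring.
Qed.

(** The Folland-Stein inequality in dual form: w lies in L^(n+1), and psi ^+ 2 in the
    dual space L^((n+1)/n). Scaling w and psi reduces it to trace_normalized. The gain
    of the small factor e at the critical exponent is what the flow needs. *)
Lemma trace_ineq : exists2 C : R, 0 < C & forall w psi e, contS w ->
  (forall x, S x -> 0 <= w x) -> C1 psi -> 0 < e ->
  sint (fun x => w x ^+ n.+1) <= e ^+ n.+1 ->
  sint (fun x => w x * psi x ^+ 2) <= C * e * (dirichlet psi + sint (fun x => psi x ^+ 2)).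
Proof.
have v0 : 0 < vol := vol_gt0 R n_gt0.
have [tau tau0 tauE] : exists2 tau : R, 0 < tau & tau ^+ n = 4.
  have [t t0] := @nth_root R n.-1 4 (ler0n R 4); rewrite prednK// => tE.
  exists t => //; rewrite lt_neqAle t0 andbT eq_sym; apply/eqP => t00.
  by move: tE; rewrite t00 expr0n gtn_eqF//= => /eqP; rewrite eq_sym pnatr_eq0.
pose K := (4 * tau) ^+ 2 * (vol +
    (1 + vol / 4 * (4 * (4 * tau) * (64 * cn R n ^+ 2 + 2) / vol) * iterB tau vol (64 * cn R n ^+ 2 + 2) * 9)).
have K0 : 0 <= K.
  have B1 : 0 <= iterB tau vol (64 * cn R n ^+ 2 + 2) by rewrite /iterB !le_max ler01.
  have c0 : 0 <= 64 * cn R n ^+ 2 + 2 by rewrite addr_ge0// mulr_ge0// sqr_ge0.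
  rewrite mulr_ge0 ?sqr_ge0// addr_ge0 ?(ltW v0)// addr_ge0//.
  by rewrite !mulr_ge0// ?invr_ge0 ?(ltW v0) ?(ltW tau0)//.
exists (1 + K); first by rewrite ltr_pwDl.
move=> w psi e cw w0 p1 e0 hw.
set E := dirichlet psi + _.
have cp2 : contS (fun x => psi x ^+ 2) by apply: contf_exp; exact: C1_cont.
have cwp : contS (fun x => w x * psi x ^+ 2) by exact: contf_mul.
have cwn : contS (fun x => w x ^+ n.+1) by exact: contf_exp.
have E0 : 0 <= E.
  by rewrite addr_ge0//; [exact: dirichlet_ge0|apply: sint_ge0 => x _; exact: sqr_ge0].
suff H d : 0 < d -> sint (fun x => w x * psi x ^+ 2) <= (1 + K) * e * (E + d).
  apply/ler_addgt0Pr => z z0.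
  have Ke : 0 < (1 + K) * e by rewrite mulr_gt0// ltr_pwDl.
  have := H (z / ((1 + K) * e)) (divr_gt0 z0 Ke); move/le_trans; apply.
  by rewrite mulrDr [X in _ + X]mulrC divfK// gt_eqF.
move=> d0; have Ed : 0 < E + d by rewrite ltr_wpDl.
pose c := (Num.sqrt (E + d))^-1.
have cE : c ^+ 2 = (E + d)^-1 by rewrite exprVn sqr_sqrtr// ltW.
have := @trace_normalized (fun x => c * psi x) (C1Z c p1) tau (fun x => e^-1 * w x) tau0 tauE _ _ _.
rewrite -/K => H.
have {}H : sint (fun x => e^-1 * w x * (c * psi x) ^+ 2) <= 1 + K.
  apply: le_trans (H _ _ _) _.
  - exact: contf_scale.
  - by move=> x Sx; rewrite mulr_ge0 ?w0// invr_ge0 ltW.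
  - rewrite dirichletZ//.
    have -> : sint (fun x => (c * psi x) ^+ 2) = c ^+ 2 * sint (fun x => psi x ^+ 2).
      by rewrite -sintZ//; apply: sint_ext => x _; rewrite exprMn.
    by rewrite -mulrDr -/E cE ler_pdivrMl// mulr1 lerDl ltW.
  - rewrite lerD2r.
    have -> : sint (fun x => (e^-1 * w x) ^+ n.+1) = e^-1 ^+ n.+1 * sint (fun x => w x ^+ n.+1).
      by rewrite -sintZ//; apply: sint_ext => x _; rewrite exprMn.
    by rewrite exprVn ler_pdivrMl ?exprn_gt0// mulr1.
have E2 : sint (fun x => e^-1 * w x * (c * psi x) ^+ 2) = e^-1 * (E + d)^-1 * sint (fun x => w x * psi x ^+ 2).
  rewrite -sintZ//; apply: sint_ext => x _; rewrite exprMn cE.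
  by move: (w x) (psi x) (e^-1) ((E + d)^-1) => p q r s; ring.
move: H; rewrite E2 -invfM ler_pdivrMl ?mulr_gt0// => H.
by rewrite (le_trans H)// le_eqVlt; apply/orP; left; apply/eqP; ring.
Qed.

End Trace.

(** * Evolution equations along the flow *)

Section ContS.
Variables (R : realType) (n : nat).
Implicit Types g h : Cspace R n -> R.
Lemma contSD g h : contS g -> contS h -> contS (fun x => g x + h x). Proof. exact: contf_add. Qed.
Lemma contSM g h : contS g -> contS h -> contS (fun x => g x * h x). Proof. exact: contf_mul. Qed.
Lemma contSN g : contS g -> contS (fun x => - g x). Proof. exact: contf_opp. Qed.
Lemma contSX k g : contS g -> contS (fun x => g x ^+ k). Proof. exact: contf_exp. Qed.
End ContS.

Ltac contS_tac := repeat (lazymatch goal with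
  | |- is_true (0 < _)%N => eassumption
  | |- contS (fun _ => ?c) => exact (@contS_cst _ _ c)
  | |- contS (fun x => GRing.add (@?F x) (@?G x)) => refine (@contSD _ _ F G _ _)
  | |- contS (fun x => GRing.opp (@?F x)) => refine (@contSN _ _ F _)
  | |- contS (fun x => GRing.mul (@?F x) (@?G x)) => refine (@contSM _ _ F G _ _)
  | |- contS (fun x => GRing.exp (@?F x) ?k) => refine (@contSX _ _ k F _)
  | |- contS _ => eassumption
  end).

Lemma contw_compat (R : realType) (T : topologicalType) (B : set T) (F : R -> R) (f : T -> R) :
  {within B, continuous f} -> (forall p, B p -> {for f p, continuous F}) ->
  {within B, continuous (fun p => F (f p))}.
Proof.
move=> /subspace_continuousP cf cF; apply/subspace_continuousP => x Bx.
exact: cvg_comp (cf x Bx) (cF x Bx).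
Qed.

Lemma contw_ext (R : realType) (T : topologicalType) (B : set T) (g h : T -> R) :
  (forall p, B p -> g p = h p) -> {within B, continuous g} -> {within B, continuous h}.
Proof.
move=> gh /within_contP cg; apply/within_contP => x Bx e e0.
by apply: filterS (cg x Bx e e0) => y hy By; rewrite -!gh// hy.
Qed.

Section FlowIdentities.
Variables (R : realType) (n : nat).
Notation V := (Cspace R n).
Notation S := (@sphere R n).
Hypothesis n_gt0 : (0 < n)%N.
Implicit Types (x : V) (t s : R).

(** A linear combination is given by the list of its coefficients and functions; it is
    integrated in one step, whatever the number of terms. *)
Fixpoint all_contS (l : seq (R * (V -> R))) : Prop :=
  if l is p :: l' then contS p.2 /\ all_contS l' else True.

Lemma sint_lin (l : seq (R * (V -> R))) : all_contS l ->
  contS (fun x => foldr (fun p s => p.1 * p.2 x + s) 0 l) /\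
  sint (fun x => foldr (fun p s => p.1 * p.2 x + s) 0 l) = foldr (fun p s => p.1 * sint p.2 + s) 0 l.
Proof.
elim: l => [_|[c g] l IH [cg /IH[cl e]]] /=.
  by split; [exact: contS_cst|rewrite sint_cst// mul0r].
by split; [apply: contf_add => //; exact: contf_scale|rewrite sintD//; [rewrite sintZ// e|exact: contf_scale]].
Qed.

(** The critical exponent 2 + 2/n. *)
Definition NN : R := 2 + 2 / n%:R.
(** The conformal sub-Laplacian. *)
Definition Lop (phi : V -> R) x : R := - (NN / 4) * Dsub phi x + webster0 R n * phi x.

Let n0 : n%:R != 0 :> R. Proof. by rewrite pnatr_eq0 -lt0n. Qed.

Lemma contS_Lop phi : C2 phi -> contS (Lop phi).
Proof.
move=> h; apply: contf_add; apply: contf_scale; first exact: contS_Dsub.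
exact: C1_cont (C2_C1 h).
Qed.

Lemma sint_Lop_sym phi psi : C2 phi -> C2 psi ->
  sint (fun x => phi x * Lop psi x) = sint (fun x => psi x * Lop phi x).
Proof.
move=> h1 h2; have c1 := C1_cont (C2_C1 h1); have c2 := C1_cont (C2_C1 h2).
have d1 := contS_Dsub h1; have d2 := contS_Dsub h2.
have e (g h dh : V -> R) : contS g -> contS h -> contS dh ->
    sint (fun x => g x * (- (NN / 4) * dh x + webster0 R n * h x)) =
    - (NN / 4) * sint (fun x => g x * dh x) + webster0 R n * sint (fun x => g x * h x).
  move=> cg ch cdh.
  have L : all_contS [:: (- (NN / 4), fun x => g x * dh x); (webster0 R n, fun x => g x * h x)].
    by rewrite /=; do !split; contS_tac.
  have [_] := sint_lin L; rewrite /= addr0 => <-; apply: sint_ext => x _; rewrite addr0.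
  by move: (- (NN / 4)) (webster0 R n) (g x) (h x) (dh x) => *; ring.
rewrite /Lop (e phi psi (Dsub psi))// (e psi phi (Dsub phi))// (sint_Dsub_sym n_gt0 h1 h2).
by congr (_ + _ * _); apply: sint_ext => x _; rewrite mulrC.
Qed.

(** Both sides expand by the product rule; the mixed terms agree, and what the left side
    has in excess is the square term that makes the moments dissipate. *)
Lemma Gam_cross (c q : R) (U W : V -> R) (F : R -> R) x : C1 U -> C1 W -> C1 (fun y => F (W y)) -> S x ->
  is_derive (W x) 1 F q ->
  Gam (fun y => F (W y) * U y) (fun y => c * W y * U y) x =
  c * (U x ^+ 2 * q * Gam W W x + Gam (fun y => F (W y) * W y * U y) U x).
Proof.
move=> hU hW hF Sx dF; have hFW := C1M hF hW.
have e0 chi : Gam (fun y => F (W y)) chi x = q * Gam W chi x by exact: Gam_comp.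
have e1 chi : Gam (fun y => c * W y * U y) chi x = c * (U x * Gam W chi x + W x * Gam U chi x).
  have -> : (fun y => c * W y * U y) = (fun y => c * (W y * U y)) by apply: funext => y; rewrite mulrA.
  rewrite GamZl; [|exact: C1M|exact: Sx]; by rewrite GamMl; [|exact: hW|exact: hU|exact: Sx].
rewrite GamC e1 (GamC W) (GamC U) (GamMl W hF hU Sx) (GamMl U hF hU Sx) (GamMl U hFW hU Sx) (GamMl U hF hW Sx).
rewrite !e0 (GamC U W).
by move: (F (W x)) (Gam W W x) (Gam W U x) (Gam U U x) (U x) (W x) => p a b d y z; ring.
Qed.

(** The pointwise identity behind moment_derive. It combines the equation for v with the
    evolution equation for its time derivative; the zeroth order terms of the conformal
    sub-Laplacian cancel. *)
Lemma moment_pointwise (k d1 d2 ga gb q p P U w m dV dA A g R0 : R) : k != 0 ->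
  (A * g - m) * w = U * (- ((2 + 2 / k) / 4) * d2 + R0 * U) ->
  dV * w = dA * g * w + (k + 1) * (A * g - m) * m * w - k / 2 * m * U * (- ((2 + 2 / k) / 4) * d2 + R0 * U)
    - U * (- ((2 + 2 / k) / 4) * d1 + R0 * (k / 2 * m * U)) ->
  p * dV * w + P * ((k + 1) * (m * w)) =
  dA * (p * g * w) + (- ((k + 1) / 4) * (U ^+ 2 * q * ga) + (1 * (p * m * (A * g - m) * w) + ((k + 1) * (P * m * w) +
   ((2 + 2 / k) / 4 * (k / 2 * (U ^+ 2 * q * ga + gb) + p * U * d1) + (- ((k + 1) / 4) * (gb + p * m * U * d2) + 0))))).
Proof.
set X := (A * g - m) * w; set Y := U * _; set Z := dV * w; set W := _ - U * (_ * d1 + _) => k0 h1 h2.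
have {}h1 : X - Y = 0 by rewrite h1 subrr.
have {}h2 : Z - W = 0 by rewrite h2 subrr.
apply/eqP; rewrite -subr_eq0; apply/eqP.
transitivity (p * (Z - W) + k * m * p * (X - Y)); last by rewrite h1 h2 !mulr0 addr0.
by rewrite /X /Y /Z /W; field.
Qed.

(** The flow at positive times: v is the curvature defect al f - R_theta, u_eq the flow
    equation, R_eq the law of conformal change of the curvature multiplied by u ^+ N, and
    v_mean the choice of al. *)
Variables (f : V -> R) (u v : R -> V -> R) (al : R -> R).
Hypotheses (cf : contS f) (f_pos : forall x, S x -> 0 < f x).
Hypotheses (su : flowC u) (u_pos : forall t x, 0 < t -> S x -> 0 < u t x).
Hypothesis u_eq : forall t x, 0 < t -> S x ->
  is_derive t 1 (fun s => u s x) (n%:R / 2 * v t x * u t x).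

(** Density of dV_theta with respect to dV_theta_0. *)
Definition wt t x : R := u t x `^ NN.

Hypothesis R_eq : forall t x, 0 < t -> S x -> (al t * f x - v t x) * wt t x = u t x * Lop (u t) x.
Hypothesis v_mean : forall t, 0 < t -> sint (fun x => v t x * wt t x) = 0.

Definition pos_time : set R := [set t | 0 < t].

Definition du t x : R := n%:R / 2 * v t x * u t x.

Lemma flowC_du : flowC du.
Proof.
have [d sd hd] := flowC_dt su.
apply: smooth_on_ext sd => -[t x] [/= t0 Sx].
have h1 := hd t x t0 Sx; have h2 := u_eq t0 Sx.
by rewrite -(@derive_val _ _ _ _ _ _ _ h1) (@derive_val _ _ _ _ _ _ _ h2).
Qed.

Lemma u_C2 t : 0 < t -> C2 (u t).
Proof. by move=> t0; apply: smooth_C2; exact: flowC_slice. Qed.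

Lemma du_C2 t : 0 < t -> C2 (du t).
Proof. by move=> t0; apply: smooth_C2; apply: flowC_slice => //; exact: flowC_du. Qed.

Lemma vE t x : 0 < t -> S x -> v t x = 2 / n%:R * (du t x * (u t x)^-1).
Proof.
move=> t0 Sx; have := u_pos t0 Sx; rewrite /du; move: (u t x) (v t x) => a b a0.
by field; rewrite n0 gt_eqF.
Qed.

Let cu_joint : {within pos_time `*` S, continuous (fun p : R * V => u p.1 p.2)}.
Proof. exact: smooth_on_cont su. Qed.
Let cdu_joint : {within pos_time `*` S, continuous (fun p : R * V => du p.1 p.2)}.
Proof. exact: smooth_on_cont flowC_du. Qed.
Let cui_joint : {within pos_time `*` S, continuous (fun p : R * V => (u p.1 p.2)^-1)}.
Proof. by apply: contw_inv => // -[t x] [/= t0 Sx]; rewrite gt_eqF// u_pos. Qed.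

Lemma cv_joint : {within pos_time `*` S, continuous (fun p : R * V => v p.1 p.2)}.
Proof.
apply: (@contw_ext R _ _ (fun p : R * V => 2 / n%:R * (du p.1 p.2 * (u p.1 p.2)^-1))).
  by move=> [t x] [/= t0 Sx]; rewrite vE.
by apply: contf_scale; exact: contf_mul.
Qed.

Lemma cwt_joint : {within pos_time `*` S, continuous (fun p : R * V => wt p.1 p.2)}.
Proof.
apply: (@contw_compat R _ _ (fun s => s `^ NN) (fun p : R * V => u p.1 p.2)) => // -[t x] [/= t0 Sx].
by apply: powR_continuous; rewrite posrE u_pos.
Qed.

Lemma cv t : 0 < t -> contS (v t).
Proof. by move=> t0; exact: (slice_contS cv_joint t0). Qed.
Lemma cwt t : 0 < t -> contS (wt t).
Proof. by move=> t0; exact: (slice_contS cwt_joint t0). Qed.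
Lemma cu t : 0 < t -> contS (u t).
Proof. by move=> t0; exact: C1_cont (C2_C1 (u_C2 t0)). Qed.

Lemma wt_pos t x : 0 < t -> S x -> 0 < wt t x.
Proof. by move=> t0 Sx; rewrite powR_gt0// u_pos. Qed.

Lemma wt_derive t x : 0 < t -> S x ->
  is_derive t 1 (fun s => wt s x) (n.+1%:R * (v t x * wt t x)).
Proof.
move=> t0 Sx; have up := u_pos t0 Sx.
apply: pder_eq (pder_comp (f := fun s => u s x) (is_derive1_powR NN up) (u_eq t0 Sx)) _.
rewrite powRB; last by apply/implyP => _; rewrite gt_eqF.
rewrite powRr1 ?ltW// /wt -[n.+1]addn1 natrD.
move: (u t x `^ _) => a; rewrite /NN; move: (u t x) up (v t x) => b b0 c.
by field; rewrite n0 gt_eqF.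
Qed.

Lemma v_C1 t : 0 < t -> C1 (v t).
Proof.
move=> t0; have h1 := C2_C1 (u_C2 t0); have h2 := C2_C1 (du_C2 t0).
apply: (@C1_ext _ _ (fun x => 2 / n%:R * (du t x * (u t x)^-1))).
  by move=> x Sx; rewrite vE.
apply: C1Z; apply: C1M => //.
apply: (@C1_comp _ _ _ h1 (fun s => s^-1) (fun s => - s^-1 ^+ 2)) => x Sx.
  have up := u_pos t0 Sx; have un : u t x != 0 by rewrite gt_eqF.
  by apply: pder_eq (pderV (f := id) (v := 1) un (pder_id _ _)) _; rewrite div1r exprVn.
have un : u t x != 0 by rewrite gt_eqF// u_pos.
apply: cvgN; have h : (fun s : R => s^-1) @ u t x --> (u t x)^-1 by apply: cvgV; [exact: un|exact: cvg_id].
by rewrite expr2; under eq_fun do rewrite expr2; apply: cvgM.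
Qed.

(** v is the logarithmic derivative of u in time, up to a constant, hence as regular as
    u_t. *)
Lemma dv_exists : exists dv : R -> V -> R,
  {within pos_time `*` S, continuous (fun p : R * V => dv p.1 p.2)} /\
  forall t x, 0 < t -> S x -> is_derive t 1 (fun s => v s x) (dv t x).
Proof.
have [dd sd hd] := flowC_dt flowC_du.
exists (fun t x => 2 / n%:R * (dd t x * (u t x)^-1 + du t x * (- (du t x / u t x ^+ 2)))); split.
  apply: contf_scale; apply: contf_add.
    by apply: contf_mul => //; exact: smooth_on_cont sd.
  apply: contf_mul => //; apply: contf_opp; apply: contf_mul => //.
  apply: contw_inv; first exact: contf_exp.
  by move=> [t x] [/= t0 Sx]; rewrite expf_neq0// gt_eqF// u_pos.
move=> t x t0 Sx; have un : u t x != 0 by rewrite gt_eqF// u_pos.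
apply: (@pder_near _ _ (fun s => 2 / n%:R * (du s x * (u s x)^-1))).
  by have : \forall s \near t, 0 < s by [exact: lt_nbhsr]; apply: filterS => s s0; rewrite vE.
apply: pderZ; apply: pderM; first exact: hd.
exact: (pderV (f := fun s => u s x) un (u_eq t0 Sx)).
Qed.

Definition dv := sval (cid dv_exists).

Lemma cdv_joint : {within pos_time `*` S, continuous (fun p : R * V => dv p.1 p.2)}.
Proof. by rewrite /dv; case: cid => ? []. Qed.
Lemma v_derive t x : 0 < t -> S x -> is_derive t 1 (fun s => v s x) (dv t x).
Proof. by rewrite /dv; case: cid => ? [? h]; exact: h. Qed.
Lemma pos_time_open : open pos_time. Proof. exact: open_gt. Qed.

Lemma flowC_Lop : flowC (fun t => Lop (u t)).
Proof.
apply: smooth_on_add; apply: smooth_on_mul => //; try exact: smooth_on_cst.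
exact: flowC_Dsub su.
Qed.

(** Testing the difference chi of the two sides against itself and moving the operator
    onto chi by symmetry, the time derivative falls on u itself. This avoids the
    symmetry of mixed derivatives. *)
Lemma Lop_derive t x : 0 < t -> S x -> is_derive t 1 (fun s => Lop (u s) x) (Lop (du t) x).
Proof.
have [dL sL hL] := flowC_dt flowC_Lop.
move=> t0 Sx; suff <- : dL t x = Lop (du t) x by exact: hL.
pose chi y := dL t y - Lop (du t) y.
have sdL : smooth_on S (dL t) by exact: flowC_slice.
have sdu : smooth_on S (du t) by apply: flowC_slice => //; exact: flowC_du.
have schi : smooth_on S chi.
  apply: smooth_on_add => //; apply: smooth_on_opp.
  apply: smooth_on_add; apply: smooth_on_mul => //; try exact: smooth_on_cst.
  exact: smooth_Dsub.
have chi2 := smooth_C2 schi; have cchi := C1_cont (C2_C1 chi2).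
have cLchi := contS_Lop chi2.
have cdL : contS (dL t) by exact: smooth_on_cont.
have cLdu := contS_Lop (du_C2 t0).
have cB (g : V -> R) : contS g -> {within pos_time `*` S, continuous (fun p : R * V => g p.2)}.
  move=> cg; apply: (contw_comp cg) => [p|p [] //]; exact: cvg_snd.
have D1 : is_derive t 1 (fun s => sint (fun y => chi y * Lop (u s) y)) (sint (fun y => chi y * dL t y)).
  apply: (@sint_is_derive R n n_gt0 pos_time (fun s y => chi y * Lop (u s) y) (fun s y => chi y * dL s y) pos_time_open _ _ _ t t0).
  - by move=> s s0; apply: contf_mul => //; apply: contS_Lop; exact: u_C2.
  - by apply: contf_mul; [exact: cB|exact: smooth_on_cont sL].
  - by move=> s y s0 Sy; apply: pderZ; exact: hL.
have D2 : is_derive t 1 (fun s => sint (fun y => chi y * Lop (u s) y)) (sint (fun y => chi y * Lop (du t) y)).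
  apply: (@pder_near _ _ (fun s => sint (fun y => Lop chi y * u s y))).
    have : \forall s \near t, 0 < s by exact: lt_nbhsr.
    apply: filterS => s s0; rewrite sint_Lop_sym//; last exact: u_C2.
    by apply: sint_ext => y _; rewrite mulrC.
  rewrite (sint_Lop_sym chi2 (du_C2 t0)).
  have -> : sint (fun y => du t y * Lop chi y) = sint (fun y => Lop chi y * du t y).
    by apply: sint_ext => y _; rewrite mulrC.
  apply: (@sint_is_derive R n n_gt0 pos_time (fun s y => Lop chi y * u s y) (fun s y => Lop chi y * du s y) pos_time_open _ _ _ t t0).
  - by move=> s s0; apply: contf_mul => //; exact: cu.
  - by apply: contf_mul; [exact: cB|exact: cdu_joint].
  - by move=> s y s0 Sy; apply: pderZ; exact: u_eq.
have E : sint (fun y => chi y ^+ 2) = 0.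
  have e : sint (fun y => chi y * dL t y) = sint (fun y => chi y * Lop (du t) y).
    by rewrite -(@derive_val _ _ _ _ _ _ _ D1) (@derive_val _ _ _ _ _ _ _ D2).
  rewrite (@sint_ext _ _ _ (fun y => chi y * dL t y - chi y * Lop (du t) y)).
    by rewrite sintB; [rewrite e subrr|contS_tac..].
  by move=> y _; rewrite expr2 {2}/chi mulrBr.
have c2 : contS (fun y => chi y ^+ 2) by contS_tac.
have := @sint_pos R n n_gt0 _ c2 (fun y _ => sqr_ge0 _) E x Sx.
by move/eqP; rewrite sqrf_eq0 => /eqP /eqP; rewrite subr_eq0 => /eqP.
Qed.

Definition Qf t : R := sint (fun x => f x * wt t x).
Definition Sf t : R := sint (fun x => u t x * Lop (u t) x).
Definition F2 t : R := sint (fun x => v t x ^+ 2 * wt t x).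
Definition fv t : R := sint (fun x => f x * v t x * wt t x).

Lemma vol_derive_gen (g : V -> R) t : contS g -> 0 < t ->
  is_derive t 1 (fun s => sint (fun x => g x * wt s x)) (n.+1%:R * sint (fun x => g x * v t x * wt t x)).
Proof.
move=> cg t0.
have cgj : {within pos_time `*` S, continuous (fun p : R * V => g p.2)}.
  apply: (contw_comp cg) => [p|p [] //]; exact: cvg_snd.
have cvt := cv t0; have cwtt := cwt t0.
rewrite -sintZ; [|contS_tac..].
have -> : sint (fun x => n.+1%:R * (g x * v t x * wt t x)) = sint (fun x => g x * (n.+1%:R * (v t x * wt t x))).
  by apply: sint_ext => x _; move: (wt t x) => w; ring.
apply: (@sint_is_derive R n n_gt0 pos_time (fun s x => g x * wt s x) (fun s x => g x * (n.+1%:R * (v s x * wt s x))) pos_time_open _ _ _ t t0).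
- by move=> s s0; apply: contf_mul => //; exact: cwt.
- apply: contf_mul => //; apply: contf_scale; apply: contf_mul; [exact: cv_joint|exact: cwt_joint].
- by move=> s x s0 Sx; apply: pderZ; exact: wt_derive.
Qed.

Lemma Q_derive t : 0 < t -> is_derive t 1 Qf (n.+1%:R * fv t).
Proof. exact: vol_derive_gen. Qed.

(** Symmetry of the operator gives twice the integral of u_t L u. *)
Lemma S_derive t : 0 < t -> is_derive t 1 Sf (n%:R * (al t * fv t - F2 t)).
Proof.
move=> t0.
have cuj := cu_joint.
have D : is_derive t 1 Sf (sint (fun x => du t x * Lop (u t) x + u t x * Lop (du t) x)).
  apply: (@sint_is_derive R n n_gt0 pos_time (fun s x => u s x * Lop (u s) x) (fun s x => du s x * Lop (u s) x + u s x * Lop (du s) x) pos_time_open _ _ _ t t0).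
  - by move=> s s0; apply: contf_mul; [exact: cu|apply: contS_Lop; exact: u_C2].
  - apply: contf_add; apply: contf_mul => //; first exact: smooth_on_cont flowC_Lop.
    apply: (@smooth_on_cont _ _ _ (fun p : R * V => Lop (du p.1) p.2)).
    apply: smooth_on_add; apply: smooth_on_mul => //; try exact: smooth_on_cst; last exact: flowC_du.
    exact: flowC_Dsub flowC_du.
  - by move=> s x s0 Sx; apply: pderM; [exact: u_eq|exact: Lop_derive].
apply: pder_eq D _.
have h1 := u_C2 t0; have h2 := du_C2 t0.
have c1 := contS_Lop h1; have c2 := contS_Lop h2; have cut := cu t0; have cdut := C1_cont (C2_C1 h2).
have cvt := cv t0; have cwtt := cwt t0.
rewrite sintD; [|contS_tac..].
rewrite (sint_Lop_sym h1 h2) /fv /F2.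
rewrite -[al t * _]sintZ; [|contS_tac..].
rewrite -sintB; [|contS_tac..].
rewrite -sintD; [|contS_tac..].
rewrite -sintZ; [|contS_tac..].
apply: sint_ext => x Sx.
have e : du t x * Lop (u t) x = n%:R / 2 * v t x * ((al t * f x - v t x) * wt t x).
  by rewrite R_eq// /du; move: (Lop (u t) x) => l; ring.
by rewrite !e; move: (wt t x) (v t x) (f x) (al t) => a b c d; field.
Qed.

Lemma Q_pos t : 0 < t -> 0 < Qf t.
Proof.
move=> t0; have c : contS (fun x => f x * wt t x) by apply: contf_mul => //; exact: cwt.
have h0 x : S x -> 0 <= f x * wt t x by move=> Sx; rewrite mulr_ge0 ?ltW// ?f_pos// wt_pos.
rewrite lt_neqAle sint_ge0// andbT eq_sym; apply/eqP => e.
have Sx : S (pole R n) by apply/sphereP; exact: edot_pole_pole.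
have := sint_pos n_gt0 c h0 e Sx => /eqP.
by rewrite gt_eqF// mulr_gt0 ?f_pos ?wt_pos.
Qed.

Lemma alQ t : 0 < t -> al t * Qf t = Sf t.
Proof.
move=> t0; have cvt := cv t0; have cwtt := cwt t0.
rewrite /Qf -sintZ; [|contS_tac..].
rewrite -[LHS]subr0 -(v_mean t0) -sintB; [|contS_tac..].
by apply: sint_ext => x Sx; rewrite -R_eq//; move: (wt t x) => w; ring.
Qed.

(** The derivative of al = Sf / Qf. *)
Definition dal t : R := - (al t * fv t + n%:R * F2 t) / Qf t.

Lemma al_derive t : 0 < t -> is_derive t 1 al (dal t).
Proof.
move=> t0; have Qp := Q_pos t0; have Qn : Qf t != 0 by rewrite gt_eqF.
apply: (@pder_near _ _ (fun s => Sf s * (Qf s)^-1)).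
  have : \forall s \near t, 0 < s by exact: lt_nbhsr.
  apply: filterS => s s0; have Qs : Qf s != 0 by exact: lt0r_neq0 (Q_pos s0).
  by rewrite -(alQ s0); exact: mulfK Qs (al s).
apply: pder_eq (pderM (S_derive t0) (pderV (f := Qf) Qn (Q_derive t0))) _.
rewrite /dal -(alQ t0) -[n.+1]addn1 natrD; move: (fv t) (F2 t) (Qf t) Qn (al t) => a b q q0 c.
by field.
Qed.

(** The time derivative of the conformal change law R_eq. *)
Lemma dvE t x : 0 < t -> S x -> dv t x * wt t x =
  dal t * f x * wt t x + n.+1%:R * (al t * f x - v t x) * v t x * wt t x
  - n%:R / 2 * v t x * u t x * Lop (u t) x - u t x * Lop (du t) x.
Proof.
move=> t0 Sx.
have D1 : is_derive t 1 (fun s => (al s * f x - v s x) * wt s x)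
   ((dal t * f x - dv t x) * wt t x + (al t * f x - v t x) * (n.+1%:R * (v t x * wt t x))).
  apply: pderM; last exact: wt_derive.
  apply: pderB; last exact: v_derive.
  by apply: pder_eq (pderM (al_derive t0) (pder_cst _ _ _)) _; rewrite mulr0 addr0.
have D2 : is_derive t 1 (fun s => (al s * f x - v s x) * wt s x) (du t x * Lop (u t) x + u t x * Lop (du t) x).
  apply: (@pder_near _ _ (fun s => u s x * Lop (u s) x)).
    have : \forall s \near t, 0 < s by exact: lt_nbhsr.
    by apply: filterS => s s0; rewrite R_eq.
  by apply: pderM; [exact: u_eq|exact: Lop_derive].
have e := etrans (esym (@derive_val _ _ _ _ _ _ _ D1)) (@derive_val _ _ _ _ _ _ _ D2).
have e2 : (dal t * f x - dv t x) * wt t x + (al t * f x - v t x) * (n.+1%:R * (v t x * wt t x)) -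
  (du t x * Lop (u t) x + u t x * Lop (du t) x) = 0 by rewrite e subrr.
apply/eqP; rewrite -subr_eq0; apply/eqP; rewrite -[RHS]oppr0 -e2 /du.
move: (Lop (u t) x) (Lop _ x) (wt t x) (dal t) (dv t x) (n.+1%:R) => l1 l2 w d e' k; ring.
Qed.

Definition Yf (psi : R -> R) t : R := sint (fun x => u t x ^+ 2 * psi (v t x) * Gam (v t) (v t) x).

(** In the evolution of v the second order terms form L (v u). Integrated by parts
    against phi(v) u they leave - (n+1)/4 times the integral of u^2 psi(v) |grad v|^2,
    and the remaining terms contain no derivatives. *)
Lemma moment_derive (Phi phi psi : R -> R) t : 0 < t ->
  (forall s : R, is_derive s 1 Phi (phi s)) -> (forall s : R, is_derive s 1 phi (psi s)) -> continuous psi ->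
  is_derive t 1 (fun s => sint (fun x => Phi (v s x) * wt s x))
   (dal t * sint (fun x => phi (v t x) * f x * wt t x) - n.+1%:R / 4 * Yf psi t
    + sint (fun x => phi (v t x) * v t x * (al t * f x - v t x) * wt t x)
    + n.+1%:R * sint (fun x => Phi (v t x) * v t x * wt t x)).
Proof.
move=> t0 dPhi dphi cpsi.
have cd (F dF : R -> R) : (forall s : R, is_derive s 1 F (dF s)) -> continuous F.
  by move=> h s; apply: differentiable_continuous; apply/derivable1_diffP; case: (h s).
have cphi := cd _ _ dphi; have cPhi := cd _ _ dPhi.
have cj (F : R -> R) : continuous F -> {within pos_time `*` S, continuous (fun p : R * V => F (v p.1 p.2))}.
  by move=> cF; apply: (contw_compat cv_joint) => x _; exact: cF.
have D : is_derive t 1 (fun s => sint (fun x => Phi (v s x) * wt s x))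
   (sint (fun x => phi (v t x) * dv t x * wt t x + Phi (v t x) * (n.+1%:R * (v t x * wt t x)))).
  apply: (@sint_is_derive R n n_gt0 pos_time (fun s x => Phi (v s x) * wt s x)
     (fun s x => phi (v s x) * dv s x * wt s x + Phi (v s x) * (n.+1%:R * (v s x * wt s x))) pos_time_open _ _ _ t t0).
  - by move=> s s0; apply: contf_mul; [exact: (@slice_contS R n R pos_time (fun t x => Phi (v t x)) s (cj _ cPhi) s0)|exact: cwt].
  - apply: contf_add; apply: contf_mul.
    + by apply: contf_mul; [exact: cj|exact: cdv_joint].
    + exact: cwt_joint.
    + exact: cj.
    + by apply: contf_scale; apply: contf_mul; [exact: cv_joint|exact: cwt_joint].
  - move=> s x s0 Sx; apply: pderM; last exact: wt_derive.
    exact: (pder_comp (f := fun s => v s x) (dPhi _) (v_derive s0 Sx)).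
apply: pder_eq D _.
have hu := u_C2 t0; have hdu := du_C2 t0; have hv := v_C1 t0.
have hu1 := C2_C1 hu; have hdu1 := C2_C1 hdu.
have c1 := contS_Lop hu; have c2 := contS_Lop hdu; have cut := cu t0; have cdut := C1_cont hdu1.
have cvt := cv t0; have cwtt := cwt t0.
have cP : contS (fun x => Phi (v t x)) := @slice_contS R n R pos_time (fun t x => Phi (v t x)) t (cj _ cPhi) t0.
have cp : contS (fun x => phi (v t x)) := @slice_contS R n R pos_time (fun t x => phi (v t x)) t (cj _ cphi) t0.
have cq : contS (fun x => psi (v t x)) := @slice_contS R n R pos_time (fun t x => psi (v t x)) t (cj _ cpsi) t0.
have hp : C1 (fun x => phi (v t x)).
  by apply: (@C1_comp _ _ _ hv phi psi) => x Sx; exact: cpsi.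
have hpu := C1M hp hu1; have hpvu := C1M (C1M hp hv) hu1.
have cD1 := contS_Dsub hu; have cD2 := contS_Dsub hdu.
have cG := contS_Gam hv hv.
have cG1 := contS_Gam hpu hdu1; have cG2 := contS_Gam hpvu hu1.
have Z1 := sint_Gam n_gt0 hpu hdu; have Z2 := sint_Gam n_gt0 hpvu hu.
set X1 := sint (fun x => phi (v t x) * f x * wt t x).
set X3 := sint (fun x => phi (v t x) * v t x * _ * wt t x).
set X4 := sint (fun x => Phi (v t x) * v t x * wt t x).
have L : all_contS [:: (dal t, fun x => phi (v t x) * f x * wt t x);
  (- (n.+1%:R / 4), fun x => u t x ^+ 2 * psi (v t x) * Gam (v t) (v t) x);
  (1, fun x => phi (v t x) * v t x * (al t * f x - v t x) * wt t x);
  (n.+1%:R, fun x => Phi (v t x) * v t x * wt t x);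
  (NN / 4, fun x => Gam (fun x => phi (v t x) * u t x) (du t) x + phi (v t x) * u t x * Dsub (du t) x);
  (- (n.+1%:R / 4), fun x => Gam (fun x => phi (v t x) * v t x * u t x) (u t) x + phi (v t x) * v t x * u t x * Dsub (u t) x)].
  by rewrite /=; do !split; contS_tac.
have [_] := sint_lin L; rewrite /= -/X1 -/X3 -/X4 -/(Yf psi t).
rewrite [sint (fun x => _ + phi (v t x) * u t x * _)]sintD; [|contS_tac..].
rewrite [sint (fun x => _ + phi (v t x) * v t x * u t x * _)]sintD; [|contS_tac..].
rewrite Z1 Z2 !addNr !mulr0 !addr0 mul1r => E.
transitivity (dal t * X1 + (- (n.+1%:R / 4) * Yf psi t + (X3 + n.+1%:R * X4))); last first.
  by move: (Yf psi t) (X1) (X3) (X4) (dal t) => a b c d e; ring.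
rewrite -E; apply: sint_ext => x Sx.
rewrite (Gam_cross (n%:R / 2) hu1 hv hp Sx (dphi (v t x))).
have hR := R_eq t0 Sx; have hdv := dvE t0 Sx.
have k1 : n.+1%:R = n%:R + 1 :> R by rewrite -[n.+1]addn1 natrD.
by rewrite k1; apply: moment_pointwise; [exact: n0|exact: hR|rewrite -k1; exact: hdv].
Qed.

End FlowIdentities.

(** * Differential inequalities on the half-line *)

(** Half-integer powers of the positive part, at least 3/2: the difference quotient at 0
    is bounded by Num.sqrt, which vanishes there. *)
Lemma sqrtX_is_derive (R : realType) k (s : R) :
  is_derive s 1 (fun s : R => Num.sqrt s ^+ k.+3) (k.+3%:R / 2 * Num.sqrt s ^+ k.+1).
Proof.
have [s0|s0|s0] := ltgtP s 0.
- rewrite ler0_sqrtr ?(ltW s0)// expr0n mulr0.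
  apply: (@pder_near R R (fun=> 0)).
  have : \forall t \near s, t < 0 by exact: lt_nbhsl.
  by apply: filterS => t t0; rewrite ler0_sqrtr ?(ltW t0)// expr0n.
- have q0 : Num.sqrt s != 0 by rewrite gt_eqF// sqrtr_gt0.
  apply: pder_eq (pderX (f := fun t : R => Num.sqrt t) (x := s) (v := 1) k.+3 (is_derive1_sqrt s0)) _.
  by rewrite /= [_ ^+ k.+2]exprS; move: (Num.sqrt s) q0 (k.+3%:R) (_ ^+ k.+1) => q q0 a b; field.
rewrite s0 sqrtr0 expr0n mulr0.
suff H : (fun h : R => h^-1 *: (((fun s : R => Num.sqrt s ^+ k.+3) \o shift (0 : R)) (h *: 1) - Num.sqrt 0 ^+ k.+3)) @ 0^' --> (0 : R).
  by apply: DeriveDef; [apply/cvg_ex; exists 0|exact/cvg_lim].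
apply/cvgrPdist_lt => e e0; rewrite near_withinE.
have : \forall t \near (0 : R), ball (0 : R) (Num.min 1 (e ^+ 2)) t.
  by apply: nbhsx_ballx; rewrite lt_min exprn_gt0// ltr01.
apply: filterS => t; rewrite /ball/= sub0r normrN lt_min => /andP[t1 te] t0.
rewrite [t *: 1]mulr1 addr0 sqrtr0 expr0n subr0 sub0r normrN [_ *: _]mulrC normrM normfV.
have [tn|tp] := leP t 0; first by rewrite ler0_sqrtr// expr0n normr0 mul0r.
move: t1 te; rewrite !gtr0_norm ?exprn_gt0 ?sqrtr_gt0// => t1 te.
have -> : Num.sqrt t ^+ k.+3 = t * Num.sqrt t ^+ k.+1 by rewrite -{2}(sqr_sqrtr (ltW tp)) -exprD.
rewrite mulrC mulKf ?gt_eqF//.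
have q1 : Num.sqrt t <= 1 by rewrite -sqrtr1 ler_sqrt ?ltr01// ltW.
apply: (@le_lt_trans _ _ (Num.sqrt t)); first by rewrite exprS ler_piMr ?sqrtr_ge0// exprn_ile1// sqrtr_ge0.
by rewrite -[e]ger0_norm ?(ltW e0)// -sqrtr_sqr ltr_sqrt// exprn_gt0.
Qed.

Section Tame.
Variable R : realType.
Implicit Types (g h G : R -> R) (t s T C : R).

Lemma nonincr_of_derive (F dF : R -> R) T : (forall t, T <= t -> is_derive t 1 F (dF t)) ->
  (forall t, T <= t -> dF t <= 0) -> forall s t, T <= s -> s <= t -> F t <= F s.
Proof.
move=> DF dF0 s t Ts; rewrite le_eqVlt => /predU1P[<-//|st].
have cF : {within `[s, t], continuous F}.
  apply: derivable_within_continuous => y; rewrite in_itv/= => /andP[sy _].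
  by case: (DF y (le_trans Ts sy)).
have DF' y : y \in `]s, t[%R -> is_derive y 1 F (dF y).
  by rewrite in_itv/= => /andP[sy _]; apply: DF; exact: le_trans Ts (ltW sy).
have [c] := MVT st DF' cF.
rewrite in_itv/= => /andP[sc _] e; rewrite -subr_le0 e mulr_le0_ge0 ?subr_ge0 ?(ltW st)//.
by apply: dF0; exact: le_trans Ts (ltW sc).
Qed.

Lemma nonincr_limit G T : (forall t, T <= t -> 0 <= G t) ->
  (forall s t, T <= s -> s <= t -> G t <= G s) ->
  exists a, forall e, 0 < e -> exists2 T', T <= T' & forall t, T' <= t -> a <= G t <= a + e.
Proof.
move=> G0 Gd; pose E := [set G t | t in [set t | T <= t]].
have E0 : E !=set0 by exists (G T); exists T => //=.
have lE : has_lbound E by exists 0 => _ [t /= Tt <-]; exact: G0.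
exists (inf E) => e e0; have [_ [T' /= TT' <-] h] := inf_adherent e0 (conj E0 lE).
exists T' => // t T't; apply/andP; split.
  by apply: ge_inf => //; exists t => //=; exact: le_trans T't.
exact: le_trans (Gd _ _ TT' T't) (ltW h).
Qed.

(** Integrability at infinity without integrals: g is eventually at most the rate of
    decrease of a nonnegative function. *)
Definition tame g := exists T (Psi dPsi : R -> R),
  forall t, T <= t -> [/\ 0 <= Psi t, is_derive t 1 Psi (dPsi t) & g t <= - dPsi t].

Definition eventually_ (P : R -> Prop) := exists T, forall t, T <= t -> P t.

Lemma evI (P Q : R -> Prop) : eventually_ P -> eventually_ Q -> eventually_ (fun t => P t /\ Q t).
Proof.
move=> [T1 h1] [T2 h2]; exists (Num.max T1 T2) => t; rewrite ge_max => /andP[t1 t2].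
by split; [exact: h1|exact: h2].
Qed.

Lemma evS (P Q : R -> Prop) : (forall t, P t -> Q t) -> eventually_ P -> eventually_ Q.
Proof. by move=> PQ [T h]; exists T => t Tt; exact/PQ/h. Qed.

Lemma ev_ge T : eventually_ (fun t => T <= t). Proof. by exists T. Qed.

Lemma tame_le g h : eventually_ (fun t => h t <= g t) -> tame g -> tame h.
Proof.
move=> [T1 h1] [T2 [P [dP h2]]]; exists (Num.max T1 T2), P, dP => t; rewrite ge_max => /andP[t1 t2].
by have [a b c] := h2 t t2; split=> //; exact: le_trans (h1 t t1) c.
Qed.

Lemma tameD g h : tame g -> tame h -> tame (fun t => g t + h t).
Proof.
move=> [T1 [P1 [d1 h1]]] [T2 [P2 [d2 h2]]].
exists (Num.max T1 T2), (fun t => P1 t + P2 t), (fun t => d1 t + d2 t) => t; rewrite ge_max => /andP[t1 t2].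
have [a b c] := h1 t t1; have [a' b' c'] := h2 t t2; split; [exact: addr_ge0|exact: pderD|].
by rewrite opprD lerD.
Qed.

Lemma tameZ c g : 0 <= c -> tame g -> tame (fun t => c * g t).
Proof.
move=> c0 [T1 [P1 [d1 h1]]]; exists T1, (fun t => c * P1 t), (fun t => c * d1 t) => t t1.
have [a b h] := h1 t t1; split; [exact: mulr_ge0|exact: pderZ|].
by rewrite -mulrN ler_wpM2l.
Qed.

Lemma tame_derive g dg : eventually_ (fun t => 0 <= g t /\ is_derive t 1 g (dg t)) -> tame (fun t => - dg t).
Proof. by move=> [T h]; exists T, g, dg => t /h[]. Qed.

(** For nonnegative g this is convergence to 0. *)
Definition vanish g := forall e, 0 < e -> eventually_ (fun t => g t <= e).

(** Let Psi_g and Psi_h witness tameness. Then G = C Psi_g + Psi_h is nonincreasing, and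
    so is g + G by the differential inequality. Hence g converges, and its limit is 0
    because g is tame. *)
Lemma ode_vanish g dg h C : 0 <= C ->
  eventually_ (fun t => 0 <= g t /\ is_derive t 1 g (dg t)) ->
  eventually_ (fun t => 0 <= h t) ->
  eventually_ (fun t => dg t <= C * g t + h t) -> tame g -> tame h -> vanish g.
Proof.
move=> C0 e1 e2 e3 [T1 [P1 [d1 h1]]] [T2 [P2 [d2 h2]]].
have [T3 h3] := evI e1 (evI e2 e3).
pose T := Num.max T1 (Num.max T2 T3).
have TT t : T <= t -> [/\ T1 <= t, T2 <= t & T3 <= t] by rewrite /T !ge_max => /and3P[].
(* nonincreasing, and still so after adding g *)
pose G t := C * P1 t + P2 t; pose dG t := C * d1 t + d2 t.
have G0 t : T <= t -> 0 <= G t.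
  by move=> /TT[/h1[a _ _] /h2[b _ _] _]; rewrite /G addr_ge0// mulr_ge0.
have DG t : T <= t -> is_derive t 1 G (dG t).
  by move=> /TT[/h1[_ a _] /h2[_ b _] _]; apply: pderD => //; exact: pderZ.
have dGle t : T <= t -> dG t <= - (C * g t + h t).
  move=> /TT[/h1[_ _ a] /h2[_ _ b] _]; rewrite /dG opprD lerD//; last by rewrite lerNr.
  by rewrite -mulrN ler_wpM2l// lerNr.
have g0 t : T <= t -> 0 <= g t by move=> /TT[_ _ /h3[[]]].
have Dg t : T <= t -> is_derive t 1 g (dg t) by move=> /TT[_ _ /h3[[]]].
have hh0 t : T <= t -> 0 <= h t by move=> /TT[_ _ /h3[_ []]].
have hd t : T <= t -> dg t <= C * g t + h t by move=> /TT[_ _ /h3[_ []]].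
have mG := nonincr_of_derive DG (fun t Tt => le_trans (dGle t Tt)
  (eq_ind_r is_true (addr_ge0 (mulr_ge0 C0 (g0 t Tt)) (hh0 t Tt)) (oppr_le0 _))).
have D2 t : T <= t -> is_derive t 1 (fun t => g t + G t) (dg t + dG t).
  by move=> Tt; apply: pderD; [exact: Dg|exact: DG].
have m2 : forall s t, T <= s -> s <= t -> g t + G t <= g s + G s.
  apply: (nonincr_of_derive D2) => t Tt.
  by have := hd t Tt; have := dGle t Tt; move: (dG t) (dg t) (C * g t + h t) => a b c; lra.
have [a Ha] := nonincr_limit G0 mG.
have [b Hb] := nonincr_limit (fun t Tt => addr_ge0 (g0 t Tt) (G0 t Tt)) m2.
have ab : b <= a.
  rewrite leNgt; apply/negP => ab; pose e := (b - a) / 2; have e0 : 0 < e by rewrite /e; move: ab; lra.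
  have [T4 TT4 H4] := Ha e e0; have [T5 TT5 H5] := Hb e e0.
  pose T6 := Num.max T4 T5.
  have T6T : T <= T6 by rewrite /T6 le_max TT4.
  have ge t : T6 <= t -> e <= g t.
    rewrite /T6 ge_max => /andP[/H4/andP[_ x1] /H5/andP[x2 _]].
    by move: x1 x2; rewrite /e; move: (G t) (g t) => y z; lra.
  have D6 t : T6 <= t -> is_derive t 1 (fun t => P1 t + e * t) (d1 t + e * 1).
    move=> tt; have [/h1[_ d _] _ _] := TT t (le_trans T6T tt).
    by apply: pderD => //; apply: pderZ; exact: pder_id.
  have m6 : forall s t, T6 <= s -> s <= t -> P1 t + e * t <= P1 s + e * s.
    apply: (nonincr_of_derive D6) => t tt; have [/h1[_ _ d] _ _] := TT t (le_trans T6T tt).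
    by have := ge t tt; move: d; move: (g t) (d1 t) => x y; lra.
  pose t := T6 + (P1 T6 + 1) / e.
  have P60 : 0 <= P1 T6 by have [/h1[]] := TT _ T6T.
  have tt : T6 <= t by rewrite /t lerDl divr_ge0// ?(ltW e0)// addr_ge0.
  have := m6 _ _ (lexx _) tt; have [/h1[P0 _ _] _ _] := TT t (le_trans T6T tt).
  have -> : e * t = e * T6 + (P1 T6 + 1) by rewrite /t mulrDr [e * (_ / e)]mulrC mulfVK// gt_eqF.
  by move: P0; move: (P1 t) (P1 T6) (e * T6) => x y z; lra.
move=> e e0; have [T4 TT4 H4] := Ha e e0; have [T5 TT5 H5] := Hb e e0.
have H5' := Hb (e / 2) (divr_gt0 e0 (ltr0Sn _ 1)).
have [T6 TT6 H6] := H5'.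
exists (Num.max T4 T6) => t; rewrite ge_max => /andP[/H4/andP[x1 _] /H6/andP[_ x2]].
by move: x1 x2 ab e0; move: (G t) (g t) => y z; lra.
Qed.

End Tame.

(** * Volume, energy and multiplier along the flow *)

(** The properties of the flow at positive times that the estimates use: u is the
    conformal factor, v = al f - R_theta the curvature defect, and fd_R the law of
    conformal change of the Webster scalar curvature. *)
Record flow_data (R : realType) (n : nat) (f : Cspace R n -> R) (u v : R -> Cspace R n -> R)
    (al : R -> R) : Prop := FlowData {
  fd_f : contS f;
  fd_f_pos : forall x : Cspace R n, sphere x -> 0 < f x;
  fd_u : flowC u;
  fd_u_pos : forall (t : R) (x : Cspace R n), 0 < t -> sphere x -> 0 < u t x;
  fd_eq : forall (t : R) (x : Cspace R n), 0 < t -> sphere x -> is_derive t 1 (fun s : R => u s x) (n%:R / 2 * v t x * u t x);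
  fd_R : forall (t : R) (x : Cspace R n), 0 < t -> sphere x -> (al t * f x - v t x) * wt u t x = u t x * Lop (u t) x;
  fd_mean : forall t : R, 0 < t -> sint (fun x => v t x * wt u t x) = 0 }.

Section Moments.
Variables (R : realType) (n : nat).
Notation V := (Cspace R n).
Notation S := (@sphere R n).
Hypothesis n_gt0 : (0 < n)%N.
Implicit Types (x : V) (t s : R).
Variables (f : V -> R) (u v : R -> V -> R) (al : R -> R).
Hypothesis H : flow_data f u v al.

Let p := wt u.
Let cf := fd_f H.
Let cvt t (t0 : 0 < t) : contS (v t) := cv n_gt0 (fd_u H) (fd_u_pos H) (fd_eq H) t0.
Let cp t (t0 : 0 < t) : contS (p t) := cwt (fd_u H) (fd_u_pos H) t0.
Let p_gt0 t x (t0 : 0 < t) (Sx : S x) : 0 < p t x := wt_pos (fd_u_pos H) t0 Sx.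

(** The integral for the measure dV_theta at time t. *)
Definition wint (g : V -> R) t := sint (fun x => g x * wt u t x).

Lemma contS_post (F : R -> R) (g : V -> R) : continuous F -> contS g -> contS (fun x => F (g x)).
Proof. by move=> cF cg; apply: (@contw_compat R V S F g cg) => x _; exact: cF. Qed.

Lemma wint_lin (l : seq (R * (V -> R))) t : 0 < t -> all_contS l ->
  contS (fun x => foldr (fun q s => q.1 * q.2 x + s) 0 l) /\
  wint (fun x => foldr (fun q s => q.1 * q.2 x + s) 0 l) t = foldr (fun q s => q.1 * wint q.2 t + s) 0 l.
Proof.
move=> t0; have ct := cp t0; elim: l => [_|[c g] l IH [cg /IH[cl e]]] /=.
  split; first exact: contS_cst.
  by rewrite /wint (@sint_ext _ _ _ (fun=> 0)) ?sint_cst// ?mul0r// => x _; rewrite mul0r.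
have cgl : contS (fun x => c * g x + foldr (fun q s => q.1 * q.2 x + s) 0 l).
  by apply: contSD => //; exact: contf_scale.
split; first exact: cgl.
have cw : contS (fun x => c * (g x * p t x)) by apply: contf_scale; exact: contSM.
have cw2 : contS (fun x => foldr (fun q s => q.1 * q.2 x + s) 0 l * p t x) by exact: contSM.
rewrite -e /wint -(sintZ n_gt0 c (contSM cg ct)) -(sintD n_gt0 cw cw2).
by apply: sint_ext => x _; rewrite mulrDl mulrA.
Qed.

(** Transfers a pointwise linear inequality between functions to their integrals. *)
Lemma wint_pos (l : seq (R * (V -> R))) t : 0 < t -> all_contS l ->
  (forall x, S x -> 0 <= foldr (fun q s => q.1 * q.2 x + s) 0 l) ->
  0 <= foldr (fun q s => q.1 * wint q.2 t + s) 0 l.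
Proof.
move=> t0 cl l0; have [_ <-] := wint_lin t0 cl; apply: sint_ge0 => x Sx.
by rewrite mulr_ge0 ?l0// ltW// p_gt0.
Qed.

Lemma wint_ge0 g t : 0 < t -> (forall x, S x -> 0 <= g x) -> 0 <= wint g t.
Proof. by move=> t0 g0; apply: sint_ge0 => x Sx; rewrite mulr_ge0 ?g0// ltW// p_gt0. Qed.

Definition mass := wint (fun=> 1) 1.

(** The curvature defect has mean zero, so the flow preserves the volume. *)
Lemma mass_eq t : 1 <= t -> wint (fun=> 1) t = mass.
Proof.
move=> t1.
have D s : 1 <= s -> is_derive s 1 (wint (fun=> 1)) 0.
  move=> s1; have s0 : 0 < s by exact: lt_le_trans ltr01 s1.
  apply: pder_eq (vol_derive_gen n_gt0 (fd_u H) (fd_u_pos H) (fd_eq H) (@contS_cst R n 1) s0) _.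
  rewrite (@sint_ext _ _ _ (fun x => v s x * wt u s x)) ?(fd_mean H)// ?mulr0// => x _.
  by rewrite mul1r.
have Dn s : 1 <= s -> is_derive s 1 (fun t => - wint (fun=> 1) t) 0.
  by move=> s1; apply: pder_eq (pderN (D s s1)) _; rewrite oppr0.
have h1 := nonincr_of_derive D (fun _ _ => lexx 0) (lexx 1) t1.
have h2 := nonincr_of_derive Dn (fun _ _ => lexx 0) (lexx 1) t1.
by move: h1 h2; rewrite /mass; move: (wint _ t) (wint _ 1) => a b h1 h2; lra.
Qed.

Lemma wint_pos_gt0 g t : 0 < t -> contS g -> (forall x, S x -> 0 < g x) -> 0 < wint g t.
Proof.
move=> t0 cg g0; have c : contS (fun x => g x * p t x) by apply: contSM => //; exact: cp.
have h0 x : S x -> 0 <= g x * p t x by move=> Sx; rewrite mulr_ge0 ?ltW// ?g0// p_gt0.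
rewrite lt_neqAle sint_ge0// andbT eq_sym; apply/eqP => e.
have Sx : S (pole R n) by apply/sphereP; exact: edot_pole_pole.
have := sint_pos n_gt0 c h0 e Sx => /eqP.
by rewrite gt_eqF// mulr_gt0 ?g0 ?p_gt0.
Qed.

Lemma mass_gt0 : 0 < mass.
Proof. by apply: wint_pos_gt0 => //; exact: contS_cst. Qed.

Lemma f_bounds : exists f0 f1 : R, [/\ 0 < f0, 0 < f1 & forall x, S x -> f0 <= f x <= f1].
Proof.
have [M M0 hM] := contS_bounded cf.
have ci : contS (fun x => (f x)^-1).
  by apply: contw_inv => // x Sx; rewrite gt_eqF// (fd_f_pos H).
have [m m0 hm] := contS_bounded ci.
exists (m + 1)^-1, (M + 1); split; [by rewrite invr_gt0 ltr_wpDl|exact: ltr_wpDl|move=> x Sx].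
have fp := fd_f_pos H Sx; apply/andP; split.
  rewrite -[f x]invrK lef_pV2 ?posrE ?invr_gt0 ?ltr_wpDl//.
  by have := hm x Sx; rewrite gtr0_norm ?invr_gt0//; move: ((f x)^-1) => a; lra.
by have := hM x Sx; rewrite gtr0_norm//; move: (f x) => a; lra.
Qed.

Definition fmin := sval (cid f_bounds).
Definition fmax := sval (cid (svalP (cid f_bounds))).
Lemma fbP : [/\ 0 < fmin, 0 < fmax & forall x, S x -> fmin <= f x <= fmax].
Proof. exact: svalP (cid (svalP (cid f_bounds))). Qed.
Let f0p : 0 < fmin. Proof. by case: fbP. Qed.
Let f1p : 0 < fmax. Proof. by case: fbP. Qed.
Let fmin_le x (Sx : S x) : fmin <= f x. Proof. by case: fbP => _ _ /(_ x Sx)/andP[]. Qed.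
Let le_fmax x (Sx : S x) : f x <= fmax. Proof. by case: fbP => _ _ /(_ x Sx)/andP[]. Qed.

Let pos1 t : 1 <= t -> 0 < t. Proof. exact: lt_le_trans ltr01. Qed.

Definition qmin := fmin * mass.
Definition qmax := fmax * mass.
Let q0p : 0 < qmin. Proof. by rewrite mulr_gt0// mass_gt0. Qed.
Let q1p : 0 < qmax. Proof. by rewrite mulr_gt0// mass_gt0. Qed.

Lemma Q_bounds t : 1 <= t -> qmin <= wint f t <= qmax.
Proof.
move=> t1; have t0 := pos1 t1; rewrite /qmin /qmax -(mass_eq t1).
have L1 : all_contS [:: (1 : R, f); (- fmin, fun=> 1)] by split=> //; split=> //; exact: contS_cst.
have L2 : all_contS [:: (- 1 : R, f); (fmax, fun=> 1)] by split=> //; split=> //; exact: contS_cst.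
have h1 : 0 <= 1 * wint f t + (- fmin * wint (fun=> 1) t + 0).
  apply: (wint_pos t0 L1) => x Sx /=; have := fmin_le Sx; move: (f x) (fmin) => a b; lra.
have h2 : 0 <= -1 * wint f t + (fmax * wint (fun=> 1) t + 0).
  apply: (wint_pos t0 L2) => x Sx /=; have := le_fmax Sx; move: (f x) (fmax) => a b; lra.
move: h1 h2; move: (wint f t) (wint _ t) fmin fmax => a b c d h1 h2; apply/andP; split.
  by move: h1; lra.
by move: h2; lra.
Qed.

Lemma S_ge0 t : 0 < t -> 0 <= Sf u t.
Proof.
move=> t0; have hu := u_C2 (fd_u H) t0; have hu1 := C2_C1 hu.
have cu := C1_cont hu1; have cD := contS_Dsub hu.
have L : all_contS [:: (- (NN R n / 4), fun x => u t x * Dsub (u t) x); (webster0 R n, fun x => u t x ^+ 2)].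
  by rewrite /=; do !split; contS_tac.
have [_] := sint_lin n_gt0 L; rewrite /= => E.
have -> : Sf u t = - (NN R n / 4) * sint (fun x => u t x * Dsub (u t) x) + (webster0 R n * sint (fun x => u t x ^+ 2) + 0).
  rewrite -E; apply: sint_ext => x _; rewrite /Lop.
  by move: (Dsub _ _) (u t x) (NN R n / 4) (webster0 R n) => a b c d; ring.
rewrite addr0 mulNr -mulrN -(sint_Gam n_gt0 hu1 hu).
have h1 : 0 <= sint (Gam (u t) (u t)) by exact: dirichlet_ge0.
have h2 : 0 <= sint (fun x => u t x ^+ 2) by apply: sint_ge0 => x _; exact: sqr_ge0.
have h3 : 0 <= NN R n by rewrite addr_ge0// divr_ge0.
have h4 : 0 <= webster0 R n by rewrite /webster0 divr_ge0// mulr_ge0// addr_ge0.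
by rewrite addr_ge0// mulr_ge0// divr_ge0.
Qed.

Let Qp t (t0 : 0 < t) : 0 < Qf f u t := Q_pos n_gt0 cf (fd_f_pos H) (fd_u H) (fd_u_pos H) t0.
Let alQ' t (t0 : 0 < t) : al t * Qf f u t = Sf u t :=
  alQ n_gt0 cf (fd_u H) (fd_u_pos H) (fd_eq H) (fd_R H) (fd_mean H) t0.

Lemma al_ge0 t : 0 < t -> 0 <= al t.
Proof. by move=> t0; have := S_ge0 t0; rewrite -(alQ' t0) pmulr_lge0// Qp. Qed.

Definition energy_exp : R := n%:R / n.+1%:R.
(** The functional that the flow decreases: total curvature, normalized by the total of
    f so as to be scale invariant. *)
Definition energy t := Sf u t * Qf f u t `^ (- energy_exp).

Lemma energy_exp_ge0 : 0 <= energy_exp. Proof. exact: divr_ge0. Qed.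

(** The contributions of fv in Sf and in Qf cancel because al = Sf / Qf. *)
Lemma energy_derive t : 0 < t -> is_derive t 1 energy (- (n%:R * F2 u v t * Qf f u t `^ (- energy_exp))).
Proof.
move=> t0; have Qt := Qp t0; have Qn : Qf f u t != 0 by rewrite gt_eqF.
have DS := S_derive n_gt0 cf (fd_u H) (fd_u_pos H) (fd_eq H) (fd_R H) t0.
have DQ := Q_derive n_gt0 cf (fd_u H) (fd_u_pos H) (fd_eq H) t0.
have DP := pder_comp (is_derive1_powR (- energy_exp) Qt) DQ.
apply: pder_eq (pderM DS DP) _.
rewrite powRB; last by apply/implyP => _.
rewrite powRr1 ?(ltW Qt)// -(alQ' t0).
have k0 : n.+1%:R != 0 :> R by rewrite pnatr_eq0.
move: (Qf f u t `^ _) => z; move: Qn; rewrite /energy_exp.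
move: (n.+1%:R : R) k0 (n%:R : R) (Qf f u t) (fv _ _ _ _) (F2 _ _ _) (al t) => k k0 m q a b c q0.
by field; rewrite k0 q0.
Qed.

Lemma F2_ge0 t : 0 < t -> 0 <= F2 u v t.
Proof. by move=> t0; apply: sint_ge0 => x Sx; rewrite mulr_ge0 ?sqr_ge0// ltW// p_gt0. Qed.

Lemma energy_ge0 t : 0 < t -> 0 <= energy t.
Proof. by move=> t0; rewrite mulr_ge0 ?S_ge0// powR_ge0. Qed.

Lemma energy_nonincr t : 1 <= t -> energy t <= energy 1.
Proof.
move=> t1; have D s (s1 : 1 <= s) := energy_derive (pos1 s1).
suff N s : 1 <= s -> - (n%:R * F2 u v s * Qf f u s `^ (- energy_exp)) <= 0 by exact: nonincr_of_derive D N _ _ (lexx 1) t1.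
move=> s1; have F0 := F2_ge0 (pos1 s1); have z0 := powR_ge0 (Qf f u s) (- energy_exp).
rewrite oppr_le0; apply: mulr_ge0 z0; apply: mulr_ge0 F0; exact: ler0n.
Qed.

Lemma Qpow_le t : 1 <= t -> Qf f u t `^ energy_exp <= qmax `^ energy_exp.
Proof.
move=> t1; have /andP[_ h] := Q_bounds t1.
by apply: ge0_ler_powR; [exact: energy_exp_ge0|rewrite nnegrE ltW// Qp// pos1|rewrite nnegrE ltW|].
Qed.

Definition amax := energy 1 * qmax `^ energy_exp / qmin.

Lemma amax_ge0 : 0 <= amax.
Proof. have e0 : 0 <= energy 1 by exact: energy_ge0.
by apply: divr_ge0; [apply: mulr_ge0; [exact: e0|exact: powR_ge0]|exact: ltW]. Qed.

(** The energy bounds al, because Qf lies between positive constants. *)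
Lemma al_le t : 1 <= t -> al t <= amax.
Proof.
move=> t1; have t0 := pos1 t1; have Qt := Qp t0.
have zp : 0 < Qf f u t `^ energy_exp by rewrite powR_gt0.
have e : al t = energy t * Qf f u t `^ energy_exp / Qf f u t.
  by rewrite /energy powRN mulfVK ?gt_eqF// -(alQ' t0) mulfK// gt_eqF.
have /andP[h _] := Q_bounds t1.
rewrite e /amax; have h1 := energy_nonincr t1; have h2 := Qpow_le t1; have h3 := energy_ge0 t0.
have h4 := ltW zp; have h5 := ltW Qt; have h6 : qmin <= Qf f u t by exact: h.
move: (energy t) (energy 1) (qmax `^ energy_exp) (Qf f u t `^ energy_exp) h1 h2 h3 h4 => a b c d h1 h2 h3 h4.
move: (Qf f u t) Qt h5 h6 => q q0 h5 h6.
apply: ler_pM; [exact: mulr_ge0|by rewrite invr_ge0|exact: ler_pM|by rewrite lef_pV2].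
Qed.

(** F2 is comparable to the rate of decrease of the energy. *)
Lemma F2_tame : tame (F2 u v).
Proof.
exists 1, (fun t => qmax `^ energy_exp * energy t), (fun t => qmax `^ energy_exp * - (n%:R * F2 u v t * Qf f u t `^ (- energy_exp))) => t t1.
have t0 := pos1 t1; split; first by rewrite mulr_ge0 ?powR_ge0 ?energy_ge0.
  by apply: pderZ; exact: energy_derive.
have zp : 0 < Qf f u t `^ energy_exp by rewrite powR_gt0// Qp.
have h := Qpow_le t1; have F0 := F2_ge0 t0; rewrite mulrN opprK powRN.
have n1 : 1 <= n%:R :> R by rewrite ler1n.
move: (qmax `^ energy_exp) (Qf f u t `^ energy_exp) zp h (F2 u v t) F0 (n%:R : R) n1 => y z z0 zy F F0 m m1.
rewrite mulrA ler_pdivlMr// mulrC [m * F]mulrC mulrA.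
apply: (le_trans (ler_wpM2r F0 zy)); rewrite ler_peMr//.
by rewrite mulr_ge0// (le_trans (ltW z0)).
Qed.

End Moments.

(** * Upper bound for the curvature defect *)

Section ScalarInequalities.
Variable R : realType.

(** Where w > K, the reaction term - k w^2 y^(k-1) dominates both N w y^k, since 2 N <=
    k, and the linear terms, since K is large. *)
Lemma upper_pointwise (m : nat) (k N a c K w y : R) : 0 <= c -> 0 <= N -> 2 * N <= k -> 0 <= K ->
  2 * (a + c) <= K -> y = pos_part (w - K) ->
  0 <= -1 * (k * y ^+ m.+2 * w * (a - w)) + (- N * (y ^+ m.+3 * w) +
    (- (k * c) * y ^+ m.+3 + (- (k * c * K) * y ^+ m.+2 + 0))).
Proof.
move=> c0 N0 Nk K0 Ka ->; have [wK|Kw] := leP w K.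
  by rewrite pos_part_0 ?subr_le0// !expr0n/= !(mulr0, mul0r) !addr0.
rewrite pos_part_id ?subr_ge0 ?(ltW Kw)// [_ ^+ m.+3]exprS.
have : 0 <= (w - K) ^+ m.+2 by rewrite exprn_ge0// subr_ge0 ltW.
move: (_ ^+ m.+2) => z z0.
have -> : -1 * (k * z * w * (a - w)) + (- N * ((w - K) * z * w) + (- (k * c) * ((w - K) * z) + (- (k * c * K) * z + 0)))
  = z * (w * (k * (w - a - c) - N * (w - K))) by ring.
apply: mulr_ge0 => //; apply: mulr_ge0; first exact: le_trans K0 (ltW Kw).
have k0 : 0 <= k by apply: le_trans Nk; rewrite mulr_ge0.
have h1 : 2 * N * (w - K) <= k * (w - K) by rewrite ler_wpM2r// subr_ge0 ltW.
have h2 : k * (2 * (a + c)) <= k * K by rewrite ler_wpM2l.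
have h3 : k * K <= k * w by rewrite ler_wpM2l// ltW.
have h4 : 0 <= k * K by rewrite mulr_ge0.
have -> : k * (w - a - c) - N * (w - K) = (2 * (k * w) - k * (2 * (a + c)) - 2 * N * (w - K)) / 2 by field.
rewrite divr_ge0// ; move: h1 h2 h3 h4; rewrite [k * (w - K)]mulrBr.
by move: (k * w) (k * K) (k * (2 * (a + c))) (2 * N * (w - K)) => b1 b2 b3 b4; lra.
Qed.

Lemma mono_pow (y a : R) j : 0 <= y -> 0 <= a -> 0 <= (y - a) * (y ^+ j - a ^+ j).
Proof.
move=> y0 a0; have [ya|/ltW ay] := leP y a.
  by rewrite mulr_le0// subr_le0// lerXn2r.
by rewrite mulr_ge0// subr_ge0// lerXn2r.
Qed.

Lemma upper_total (d X1 Y X3 X4 N k F c q0 A P0 K w1 w2 w3 : R) :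
  0 <= F -> 0 < q0 -> 0 <= A -> 0 <= K -> 0 <= N -> 0 <= k -> 0 <= w1 -> 0 <= w2 -> 0 <= Y -> 0 <= X1 -> 0 <= P0 ->
  d <= A * (F * (2 * w1 + 2 * K * P0)) / q0 -> X1 <= k * F * w2 -> w1 * w2 <= P0 * w3 ->
  c = 2 * F * (A * F / q0) * P0 ->
  0 <= -1 * X3 + (- N * X4 + (- (k * c) * w3 + (- (k * c * K) * w2 + 0))) ->
  d * X1 - N / 4 * Y + X3 + N * X4 <= 0.
Proof.
move=> F0 q0p A0 K0 N0 k0 w10 w20 Y0 X10 P00 hd hX1 hw ce hX.
pose D := A * (F * (2 * w1 + 2 * K * P0)) / q0.
have D0 : 0 <= D by rewrite /D divr_ge0 ?(ltW q0p)// !mulr_ge0// addr_ge0// !mulr_ge0.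
have h1 : d * X1 <= D * (k * F * w2).
  by apply: (le_trans (ler_wpM2r X10 hd)); apply: ler_wpM2l.
have E0 : 0 <= 2 * k * F * (A * F / q0) by apply: mulr_ge0; [apply: mulr_ge0 => //; exact: mulr_ge0|apply: divr_ge0 (ltW q0p); exact: mulr_ge0].
have h2 : D * (k * F * w2) <= k * c * (w3 + K * w2).
  have -> : D * (k * F * w2) = 2 * k * F * (A * F / q0) * (w1 * w2 + K * P0 * w2).
    by rewrite /D; field; rewrite gt_eqF.
  have -> : k * c * (w3 + K * w2) = 2 * k * F * (A * F / q0) * (P0 * w3 + K * P0 * w2).
    by rewrite ce; field; rewrite gt_eqF.
  by apply: ler_wpM2l => //; rewrite lerD2r.
have h3 : 0 <= N / 4 * Y by rewrite mulr_ge0// divr_ge0.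
have h4 : X3 + N * X4 <= - (k * c * (w3 + K * w2)).
  rewrite -subr_ge0; apply: (le_trans hX); rewrite le_eqVlt; apply/orP; left; apply/eqP; ring.
move: h1 h2 h3 h4; rewrite -addrA.
move: (d * X1) (D * _) (k * c * _) (N / 4 * Y) (X3 + _) => a1 a2 a3 a4 a5; lra.
Qed.

End ScalarInequalities.

Section Vanishing.
Variables (R : realType) (n : nat).
Notation V := (Cspace R n).
Notation S := (@sphere R n).
Hypothesis n_gt0 : (0 < n)%N.
Implicit Types (x : V) (t s : R).
Variables (f : V -> R) (u v : R -> V -> R) (al : R -> R).
Hypothesis H : flow_data f u v al.
(** The bounds of the previous part, named so as to keep the contexts small. *)
Variables (P0 f1 q0 A : R).
Hypotheses (P0p : 0 < P0) (f1p : 0 < f1) (q0p : 0 < q0) (A0 : 0 <= A).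
Hypothesis massE : forall t, 1 <= t -> wint u (fun=> 1) t = P0.
Hypothesis f_le : forall x, S x -> f x <= f1.
Hypothesis Q_ge : forall t, 1 <= t -> q0 <= wint u f t.
Hypothesis al_ge : forall t, 1 <= t -> 0 <= al t.
Hypothesis al_le : forall t, 1 <= t -> al t <= A.

Let cf := fd_f H.
Let cvt t (t0 : 0 < t) : contS (v t) := cv n_gt0 (fd_u H) (fd_u_pos H) (fd_eq H) t0.
Let cp t (t0 : 0 < t) : contS (wt u t) := cwt (fd_u H) (fd_u_pos H) t0.
Let f_gt0 x (Sx : S x) : 0 < f x := fd_f_pos H Sx.
Let pos1 t : 1 <= t -> 0 < t. Proof. exact: lt_le_trans ltr01. Qed.
Let W := wint u.
Let D := dal f u v al.
Let fvf := fv f u v.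
Let FF := F2 u v.

Let contS_pos_part (g : V -> R) : contS g -> contS (fun x => pos_part (g x)).
Proof. by apply: contS_post; exact: pos_part_continuous. Qed.

(** The inequality of Chebyshev: the powers of y are similarly ordered. In the proof a
    is the mean of y. *)
Lemma wint_cheb t (y : V -> R) j : 1 <= t -> contS y -> (forall x, S x -> 0 <= y x) ->
  W y t * W (fun x => y x ^+ j) t <= P0 * W (fun x => y x ^+ j.+1) t.
Proof.
move=> t1 cy y0; have t0 := pos1 t1.
pose a := W y t / P0.
have a0 : 0 <= a by rewrite divr_ge0 ?(ltW P0p)//; apply: (wint_ge0 H).
have aE : W y t = a * P0 by rewrite /a mulfVK// gt_eqF.
move: a a0 aE => {}a a0 aE.
have L : all_contS [:: (1 : R, fun x => y x ^+ j.+1); (- a, fun x => y x ^+ j); (- a ^+ j, y); (a ^+ j.+1, fun=> 1)].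
  by rewrite /=; do !split; contS_tac.
have hx x : S x -> 0 <= 1 * y x ^+ j.+1 + (- a * y x ^+ j + (- a ^+ j * y x + (a ^+ j.+1 * 1 + 0))).
  move=> Sx; have := mono_pow j (y0 x Sx) a0.
  suff -> : (y x - a) * (y x ^+ j - a ^+ j) = 1 * y x ^+ j.+1 + (- a * y x ^+ j + (- a ^+ j * y x + (a ^+ j.+1 * 1 + 0))) by [].
  by rewrite !exprS; move: (y x ^+ j) (a ^+ j) => z b; ring.
have := wint_pos n_gt0 H t0 L hx.
rewrite /= massE// -/W; move: (W (fun x => y x ^+ j.+1) t) (W (fun x => y x ^+ j) t) => w1 w2.
rewrite aE [a ^+ j.+1]exprS => hh.
rewrite [a * P0]mulrC -mulrA; apply: ler_wpM2l; first exact: ltW.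
rewrite -subr_ge0; apply: (le_trans hh); rewrite le_eqVlt; apply/orP; left; apply/eqP.
by move: (a ^+ j) => z; ring.
Qed.

(** As v has mean zero, the integral of |v| is twice that of its positive part. *)
Lemma fv_bound t K : 1 <= t -> 0 <= K ->
  `|fvf t| <= f1 * (2 * W (fun x => pos_part (v t x - K)) t + 2 * K * P0).
Proof.
move=> t1 K0; have t0 := pos1 t1; have cv' := cvt t0.
have cy : contS (fun x => pos_part (v t x - K)) by apply: contS_pos_part; contS_tac.
have L e : all_contS [:: (e : R, fun x => f x * v t x); (2 * f1, fun x => pos_part (v t x - K)); (2 * f1 * K, fun=> 1); (- f1, v t)].
  by rewrite /=; do !split; contS_tac.
have m0 : W (v t) t = 0 by exact: (fd_mean H).
have E e : `|e| = 1 -> 0 <= e * fvf t + (2 * f1 * W (fun x => pos_part (v t x - K)) t + (2 * f1 * K * P0 + 0)).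
  move=> e1; suff hx x : S x -> 0 <= e * (f x * v t x) + (2 * f1 * pos_part (v t x - K) + (2 * f1 * K * 1 + (- f1 * v t x + 0))).
    by have := wint_pos n_gt0 H t0 (L e) hx; rewrite /= massE// -/W m0 mulr0 addr0.
  move=> Sx; have fx := f_le Sx; have f0 := ltW (f_gt0 Sx).
  have h1 : - (e * (f x * v t x)) <= f1 * `|v t x|.
    apply: le_trans (ler_norm _) _; rewrite normrN !normrM e1 mul1r ger0_norm//.
    by rewrite ler_wpM2r.
  have h2 : `|v t x| <= 2 * pos_part (v t x - K) + 2 * K - v t x.
    have [l|l] := leP (v t x) K.
      rewrite pos_part_0 ?subr_le0//; have [l2|l2] := leP 0 (v t x).
        by rewrite ger0_norm//; move: l; lra.
      by rewrite ltr0_norm//; move: K0; lra.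
    rewrite pos_part_id ?subr_ge0 ?(ltW l)// ger0_norm ?(le_trans K0 (ltW l))//; lra.
  have h3 := ler_wpM2l (ltW f1p) h2; move: h1 h3.
  have -> : f1 * (2 * pos_part (v t x - K) + 2 * K - v t x) = 2 * f1 * pos_part (v t x - K) + (2 * f1 * K * 1 - f1 * v t x) by ring.
  have -> : - f1 * v t x = - (f1 * v t x) by rewrite mulNr.
  move: (e * _) (2 * f1 * pos_part _) (2 * f1 * K * 1) (f1 * v t x) (f1 * `|_|) => b1 b2 b3 b4 b5; lra.
have := E 1 (normr1 _); have := E (-1) (normrN1 _).
rewrite ler_norml; have -> : f1 * (2 * W (fun x => pos_part (v t x - K)) t + 2 * K * P0) =
  2 * f1 * W (fun x => pos_part (v t x - K)) t + 2 * f1 * K * P0 by ring.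
move: (fvf t) (2 * f1 * W _ t) (2 * f1 * K * P0) => b1 b2 b3 h1 h2; apply/andP; split; lra.
Qed.

Lemma F2_ge t : 1 <= t -> 0 <= FF t.
Proof. by move=> t1; exact: F2_ge0 H _ (pos1 t1). Qed.

Lemma dal_le t B : 1 <= t -> `|fvf t| <= B -> D t <= A * B / q0.
Proof.
move=> t1 hB; have t0 := pos1 t1; have Q1 : q0 <= Qf f u t by exact: Q_ge.
have F0 := F2_ge t1; have a0 := al_ge t1; have a1 := al_le t1.
have B0 : 0 <= B by exact: le_trans (normr_ge0 _) hB.
rewrite /D /dal ler_pdivrMr; last exact: lt_le_trans q0p Q1.
have h1 : - (al t * fvf t) <= A * B.
  apply: le_trans (ler_norm _) _; rewrite normrN normrM ger0_norm//; exact: ler_pM.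
have h2 : A * B <= A * B / q0 * Qf f u t.
  by rewrite -mulrA ler_peMr ?mulr_ge0// mulrC ler_pdivlMr// mul1r.
have h3 : 0 <= n%:R * FF t by rewrite mulr_ge0.
by rewrite opprD; move: h1 h2 h3; rewrite /fvf /FF; move: (al t * _) (A * B) (A * B / q0 * _) (n%:R * _) => b1 b2 b3 b4; lra.
Qed.

Lemma dal_abs t B : 1 <= t -> `|fvf t| <= B -> `|D t| <= (A * B + n%:R * FF t) / q0.
Proof.
move=> t1 hB; have t0 := pos1 t1; have Q1 : q0 <= Qf f u t by exact: Q_ge.
have F0 := F2_ge t1; have a0 := al_ge t1; have a1 := al_le t1.
have Qp : 0 < Qf f u t by exact: lt_le_trans q0p Q1.
have h3 : 0 <= n%:R * FF t by rewrite mulr_ge0.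
rewrite /D /dal normrM normrN normfV [`|Qf f u t|]gtr0_norm//.
apply: ler_pM => //; [by rewrite invr_ge0 ltW| |by rewrite lef_pV2].
apply: le_trans (ler_normD _ _) _; apply: lerD; last by rewrite ger0_norm.
by rewrite normrM ger0_norm//; exact: ler_pM.
Qed.

Lemma Yf_ge0 (psi : R -> R) t : 1 <= t -> (forall s, 0 <= psi s) -> 0 <= Yf u v psi t.
Proof.
move=> t1 h; apply: sint_ge0 => x Sx; have hv := v_C1 n_gt0 (fd_u H) (fd_u_pos H) (fd_eq H) (pos1 t1).
by apply: mulr_ge0; [apply: mulr_ge0; [exact: sqr_ge0|exact: h]|exact: Gam_ge0 hv Sx].
Qed.

Lemma level_derive K (m : nat) s : is_derive s 1 (fun s : R => pos_part (s - K) ^+ m.+2) (m.+2%:R * pos_part (s - K) ^+ m.+1).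
Proof.
have D1 : is_derive s 1 (fun s : R => s - K) (1 : R).
  by apply: pder_eq (pderB (pder_id s 1) (pder_cst s 1 K)) _; rewrite subr0.
by apply: pder_eq (@pder_comp R R (fun s : R => pos_part s ^+ m.+2) (fun s => s - K) s 1 _ _ (pos_part_is_derive m (s - K)) D1) _; rewrite mulr1.
Qed.

Lemma moment t (Phi phi psi : R -> R) : 1 <= t ->
  (forall s : R, is_derive s 1 Phi (phi s)) -> (forall s : R, is_derive s 1 phi (psi s)) -> continuous psi ->
  is_derive t 1 (fun s => W (fun x => Phi (v s x)) s)
   (D t * W (fun x => phi (v t x) * f x) t - n.+1%:R / 4 * Yf u v psi t
    + W (fun x => phi (v t x) * v t x * (al t * f x - v t x)) t
    + n.+1%:R * W (fun x => Phi (v t x) * v t x) t).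
Proof.
move=> t1 h1 h2 h3.
exact: (moment_derive n_gt0 (fd_f H) (fd_f_pos H) (fd_u H) (fd_u_pos H) (fd_eq H) (fd_R H) (fd_mean H) (pos1 t1) h1 h2 h3).
Qed.

(* at least 2 n.+1, as upper_pointwise requires, and at least 3, for two derivatives *)
Let k := n.*2.+3.
Let c := 2 * f1 * (A * f1 / q0) * P0.
Let c0 : 0 <= c. Proof.
have h1 : 0 <= 2 * f1 by rewrite mulr_ge0// ltW.
have h2 : 0 <= A * f1 / q0 by apply: divr_ge0 (ltW q0p); rewrite mulr_ge0// ltW.
by apply: mulr_ge0 (ltW P0p); exact: mulr_ge0.
Qed.

(** The terms with the derivative of al are not local, but fv_bound and wint_cheb bound
    them by moments of the truncated power itself. *)
Lemma upper_step K t : 1 <= t -> 0 <= K -> 2 * (A * f1 + c) <= K ->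
  exists2 d, is_derive t 1 (fun s => W (fun x => pos_part (v s x - K) ^+ k) s) d & d <= 0.
Proof.
move=> t1 K0 Kb; have t0 := pos1 t1; have cv' := cvt t0.
have cy : contS (fun x => pos_part (v t x - K)) by apply: contS_pos_part; contS_tac.
have y0 x : 0 <= pos_part (v t x - K) by exact: pos_part_ge0.
have d2 (s : R) : is_derive s 1 (fun s : R => k%:R * pos_part (s - K) ^+ n.*2.+2) (k%:R * (n.*2.+2%:R * pos_part (s - K) ^+ n.*2.+1)).
  by apply: pderZ; exact: level_derive.
have cpsi : continuous (fun s : R => k%:R * (n.*2.+2%:R * pos_part (s - K) ^+ n.*2.+1)).
  apply: contf_scale; apply: contf_scale; apply: contf_exp.
  apply: (contf_comp (F := @pos_part R) (f := fun s : R => s - K)); last by move=> s; exact: pos_part_continuous.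
  by apply: contf_sub => s; [exact: cvg_id|exact: cvg_cst].
have Dm := moment t1 (level_derive K n.*2.+1) d2 cpsi.
exists (D t * W (fun x => k%:R * pos_part (v t x - K) ^+ n.*2.+2 * f x) t - n.+1%:R / 4 * Yf u v (fun s : R => k%:R * (n.*2.+2%:R * pos_part (s - K) ^+ n.*2.+1)) t
    + W (fun x => k%:R * pos_part (v t x - K) ^+ n.*2.+2 * v t x * (al t * f x - v t x)) t
    + n.+1%:R * W (fun x => pos_part (v t x - K) ^+ k * v t x) t); first exact: Dm.
have Y0 : 0 <= Yf u v (fun s : R => k%:R * (n.*2.+2%:R * pos_part (s - K) ^+ n.*2.+1)) t.
  by apply: Yf_ge0 => // s; apply: mulr_ge0; [exact: ler0n|apply: mulr_ge0; [exact: ler0n|apply: exprn_ge0; exact: pos_part_ge0]].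
have L1 : all_contS [:: (k%:R * f1, fun x => pos_part (v t x - K) ^+ n.*2.+2); (-1 : R, fun x => k%:R * pos_part (v t x - K) ^+ n.*2.+2 * f x)].
  by rewrite /=; do !split; contS_tac.
have h1 : 0 <= k%:R * f1 * W (fun x => pos_part (v t x - K) ^+ n.*2.+2) t + (-1 * W (fun x => k%:R * pos_part (v t x - K) ^+ n.*2.+2 * f x) t + 0).
  apply: (wint_pos n_gt0 H t0 L1) => x Sx /=; have h := exprn_ge0 n.*2.+2 (y0 x); have := f_le Sx; have := ler0n R k.
  move: (_ ^+ _) h (k%:R : R) (f x) => z z0 kk fx hk hf; rewrite addr0 mulN1r subr_ge0 [X in X <= _]mulrAC.
  by rewrite ler_wpM2r// ler_wpM2l.
have L2 : all_contS [:: (-1 : R, fun x => k%:R * pos_part (v t x - K) ^+ n.*2.+2 * v t x * (al t * f x - v t x));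
   (- n.+1%:R, fun x => pos_part (v t x - K) ^+ k * v t x); (- (k%:R * c), fun x => pos_part (v t x - K) ^+ k);
   (- (k%:R * c * K), fun x => pos_part (v t x - K) ^+ n.*2.+2)].
  by rewrite /=; do !split; contS_tac.
have h2 := wint_pos n_gt0 H t0 L2.
apply: (@upper_total R _ _ _ _ _ n.+1%:R k%:R f1 c q0 A P0 K
  (W (fun x => pos_part (v t x - K)) t) (W (fun x => pos_part (v t x - K) ^+ n.*2.+2) t) (W (fun x => pos_part (v t x - K) ^+ k) t)
  (ltW f1p) q0p A0 K0 (ler0n _ _) (ler0n _ _) _ _ Y0 _ (ltW P0p) _ _ _ erefl _).
- by apply: (wint_ge0 H).
- by apply: (wint_ge0 H) => // x _; rewrite exprn_ge0.
- apply: (wint_ge0 H) => // x Sx; apply: mulr_ge0; last exact: ltW (f_gt0 Sx).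
  by apply: mulr_ge0; [exact: ler0n|exact: exprn_ge0].
- exact: dal_le t1 (fv_bound t1 K0).
- by move: h1; rewrite addr0 mulN1r subr_ge0.
- exact: (wint_cheb _ t1 cy (fun x _ => y0 x)).
- apply: h2 => x Sx /=; apply: upper_pointwise => //.
  + by rewrite -natrM ler_nat /k mul2n doubleS.
  + apply: le_trans Kb; rewrite ler_wpM2l// lerD2r; apply: ler_pM; [exact: al_ge|exact: ltW (f_gt0 Sx)|exact: al_le|exact: f_le].
Qed.

(** The truncated moment vanishes at time 1 if K is large and does not increase. *)
Lemma v_upper : exists2 K, 0 <= K & forall t x, 1 <= t -> S x -> v t x <= K.
Proof.
have [M M0 hM] := contS_bounded (cvt ltr01).
(* the first summand bounds v at time 1 *)
pose K := M + 2 * (A * f1 + c).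
have Kc : 0 <= 2 * (A * f1 + c) by rewrite mulr_ge0// addr_ge0// mulr_ge0// ltW.
have K0 : 0 <= K by rewrite addr_ge0.
have Kb : 2 * (A * f1 + c) <= K by rewrite lerDr.
exists K => // t x t1 Sx.
pose Z s := W (fun x => pos_part (v s x - K) ^+ k) s.
pose dZ s := xget 0 [set d | is_derive s 1 Z d /\ d <= 0].
have hZ s : 1 <= s -> is_derive s 1 Z (dZ s) /\ dZ s <= 0.
  by move=> s1; apply: (@xgetPex R 0 [set d | is_derive s 1 Z d /\ d <= 0]); have [d h1 h2] := upper_step s1 K0 Kb; exists d.
have hZ1 s : 1 <= s -> is_derive s 1 Z (dZ s) by move=> /hZ[].
have hZ2 s : 1 <= s -> dZ s <= 0 by move=> /hZ[].
have := nonincr_of_derive hZ1 hZ2 (lexx 1) t1.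
have -> : Z 1 = 0.
  rewrite /Z /W /wint (@sint_ext _ _ _ (fun=> 0)); first by rewrite (sint_cst n_gt0) mul0r.
  move=> y Sy; rewrite pos_part_0 ?expr0n ?mul0r//.
  by rewrite subr_le0 /K (le_trans (le_trans (ler_norm _) (hM y Sy)))// lerDl.
move=> Z0; have t0 := pos1 t1; have cv' := cvt t0; have cp' := cp t0.
have cy : contS (fun x => pos_part (v t x - K)) by apply: contS_pos_part; contS_tac.
have cz : contS (fun x => pos_part (v t x - K) ^+ k * wt u t x) by contS_tac.
have z0 y : S y -> 0 <= pos_part (v t y - K) ^+ k * wt u t y.
  by move=> Sy; apply: mulr_ge0; [apply: exprn_ge0; exact: pos_part_ge0|exact: ltW (wt_pos (fd_u_pos H) t0 Sy)].
have Z1 : sint (fun x => pos_part (v t x - K) ^+ k * wt u t x) = 0.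
  by apply/eqP; rewrite eq_le; apply/andP; split; [exact: Z0|exact: sint_ge0].
have /eqP := sint_pos n_gt0 cz z0 Z1 Sx.
rewrite mulf_eq0 (gt_eqF (wt_pos (fd_u_pos H) t0 Sx)) orbF expf_eq0 /= => /eqP e.
by have := le_posp (v t x - K); rewrite e subr_le0.
Qed.

End Vanishing.

(** * Bootstrapping the moments of the curvature defect *)

Section Truncations.
Variable R : realType.
Implicit Types s : R.

(** The moments of the bootstrap: the square, then the powers from 3 on of the negative
    part. The positive part of v is bounded, so the others follow. *)
Definition mom (j : nat) s : R := if j is i.+1 then pos_part (- s) ^+ i.+3 else s ^+ 2.
Definition dmom (j : nat) s : R := if j is i.+1 then - (i.+3%:R * pos_part (- s) ^+ i.+2) else 2 * s.
Definition ddmom (j : nat) s : R := if j is i.+1 then i.+3%:R * (i.+2%:R * pos_part (- s) ^+ i.+1) else 2.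
(** Square roots of mom, used as test functions in the trace inequality. *)
Definition sig (j : nat) s : R := if j is i.+1 then Num.sqrt (- s) ^+ i.+3 else s.
Definition dsig (j : nat) s : R := if j is i.+1 then - (i.+3%:R / 2 * Num.sqrt (- s) ^+ i.+1) else 1.

Let opp_derive s : is_derive s 1 (fun s : R => - s) (- 1 : R).
Proof. exact: pderN (pder_id s 1). Qed.

Let pos_part_opp_derive k s : is_derive s 1 (fun s : R => pos_part (- s) ^+ k.+2) (- (k.+2%:R * pos_part (- s) ^+ k.+1)).
Proof.
by apply: pder_eq (@pder_comp R R (fun s : R => pos_part s ^+ k.+2) (fun s => - s) s 1 _ _ (pos_part_is_derive k (- s)) (opp_derive s)) _; rewrite mulrN1.
Qed.

Lemma mom_derive j s : is_derive s 1 (mom j) (dmom j s).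
Proof.
case: j => [|i]; last exact: pos_part_opp_derive.
by apply: pder_eq (pderX (x := s) (v := 1) 2 (pder_id _ _)) _; rewrite /= mulr1 expr1.
Qed.

Lemma dmom_derive j s : is_derive s 1 (dmom j) (ddmom j s).
Proof.
case: j => [|i].
  by apply: pder_eq (pderZ 2 (pder_id s 1)) _; rewrite /= mulr1.
by apply: pder_eq (pderN (pderZ i.+3%:R (pos_part_opp_derive i s))) _; rewrite /= mulrN opprK.
Qed.

Lemma ddmom_continuous j : continuous (ddmom j).
Proof.
case: j => [|i] /=; first exact: contf_cst.
apply: contf_scale; apply: contf_scale; apply: contf_exp.
apply: (contf_comp (F := @pos_part R) (f := fun s : R => - s)); last by move=> s; exact: pos_part_continuous.
by apply: contf_opp => s; exact: cvg_id.
Qed.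

Lemma sig_derive j s : is_derive s 1 (sig j) (dsig j s).
Proof.
case: j => [|i]; first exact: pder_id.
by apply: pder_eq (@pder_comp R R (fun s : R => Num.sqrt s ^+ i.+3) (fun s => - s) s 1 _ _ (sqrtX_is_derive i (- s)) (opp_derive s)) _; rewrite /= mulrN1.
Qed.

Lemma dsig_continuous j : continuous (dsig j).
Proof.
case: j => [|i] /=; first exact: contf_cst.
apply: contf_opp; apply: contf_scale; apply: contf_exp.
apply: (contf_comp (F := fun s : R => Num.sqrt s) (f := fun s : R => - s)); last by move=> s; exact: sqrt_continuous.
by apply: contf_opp => s; exact: cvg_id.
Qed.

Let sqrt_posp s : Num.sqrt s ^+ 2 = pos_part s.
Proof.
have [s0|s0] := leP 0 s; first by rewrite sqr_sqrtr// pos_part_id.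
by rewrite ler0_sqrtr ?(ltW s0)// expr0n pos_part_0// ltW.
Qed.

Lemma sig_sqr j s : sig j s ^+ 2 = mom j s.
Proof. by case: j => [//|i] /=; rewrite -exprM mulnC exprM sqrt_posp. Qed.

Lemma mom_ge0 j s : 0 <= mom j s.
Proof. by rewrite -sig_sqr sqr_ge0. Qed.

Lemma ddmom_ge0 j s : 0 <= ddmom j s.
Proof. by case: j => [|i] /=; rewrite ?mulr_ge0// exprn_ge0// pos_part_ge0. Qed.

Lemma dsig_le j s : dsig j s ^+ 2 <= ddmom j s.
Proof.
case: j => [|i] /=; first by rewrite expr1n ler1n.
rewrite sqrrN exprMn -exprM mulnC exprM sqrt_posp mulrA ler_wpM2r ?exprn_ge0 ?pos_part_ge0//.
have -> : i.+2%:R = i.+3%:R - 1 :> R by rewrite -[i.+3]addn1 natrD addrK.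
have : 3 <= i.+3%:R :> R by rewrite (ler_nat R 3).
by move: (i.+3%:R : R) => a a3; rewrite expr_div_n; nra.
Qed.

Lemma mom_succ j s : pos_part (- s) * mom j s = mom j.+1 s.
Proof.
case: j => [|i] /=; last by rewrite -exprS.
have [s0|s0] := leP 0 s; first by rewrite pos_part_0 ?oppr_le0// expr0n mul0r.
by rewrite pos_part_id ?oppr_ge0 ?ltW//; ring.
Qed.

Lemma neg_le_mom j s : pos_part (- s) ^+ j.+2 <= mom j s.
Proof.
case: j => [|i] //=; rewrite -[s ^+ 2]sqrrN -[X in _ <= X]ger0_norm ?sqr_ge0// normrX.
by rewrite lerXn2r ?nnegrE ?pos_part_ge0// pos_part_le.
Qed.

(** For the negative part, both reaction terms are multiples of the next moment. Its
    total coefficient j + 2 - N is negative below the critical exponent, which makes the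
    next moment integrable in time. *)
Lemma mom_reaction j s (a B K N : R) : s <= K -> 0 <= K -> 0 <= B -> a <= B -> 2 <= N ->
  dmom j s * s * (a - s) + N * (mom j s * s) <= (j.+2%:R * B + N * K) * mom j s + (j.+2%:R - N) * mom j.+1 s.
Proof.
move=> sK K0 B0 aB N2; case: j => [|i].
  rewrite /=; have h1 : s ^+ 3 <= K * s ^+ 2 - pos_part (- s) ^+ 3.
    have [s0|s0] := leP 0 s.
      by rewrite pos_part_0 ?oppr_le0// expr0n subr0 exprS ler_wpM2r// sqr_ge0.
    rewrite pos_part_id; last by rewrite oppr_ge0 ltW.
    rewrite lerBrDr -subr_ge0.
    have -> : K * s ^+ 2 - (s ^+ 3 + (- s) ^+ 3) = K * s ^+ 2 by ring.
    by rewrite mulr_ge0// sqr_ge0.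
  have h2 : a * s ^+ 2 <= B * s ^+ 2 by rewrite ler_wpM2r// sqr_ge0.
  have N3 : 0 <= N - 2 by rewrite subr_ge0.
  have h3 := ler_wpM2l N3 h1; have h4 : 0 <= K * s ^+ 2 by rewrite mulr_ge0// sqr_ge0.
  move: h2 h3 h4; rewrite mulrBr mulrBl.
  have -> : 2 * s * s * (a - s) + N * (s ^+ 2 * s) = 2 * (a * s ^+ 2) + (N * s ^+ 3 - 2 * s ^+ 3) by ring.
  have -> : (2 * B + N * K) * s ^+ 2 + (2 - N) * pos_part (- s) ^+ 3 = 2 * (B * s ^+ 2) + (N - 2) * (K * s ^+ 2) + 2 * (K * s ^+ 2) - (N - 2) * pos_part (- s) ^+ 3 by ring.
  by move: (K * s ^+ 2) (a * _) (B * _) (N * s ^+ 3) (2 * s ^+ 3) ((N - 2) * pos_part _ ^+ 3) => b0 b1 b2 b3 b4 b6 g1; move: ((N - 2) * b0) => b5 g2 g3; lra.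
rewrite /=; have [s0|s0] := leP 0 s.
  by rewrite pos_part_0 ?oppr_le0// !expr0n/= !(mulr0, mul0r, oppr0, addr0).
have -> : s = - (- s) by rewrite opprK.
have : 0 < - s by rewrite oppr_gt0.
move: (- s) => z z0; rewrite opprK pos_part_id ?(ltW z0)// ![z ^+ i.+3]exprS [z ^+ i.+4]exprS [z ^+ i.+3]exprS.
have : 0 <= z ^+ i.+2 by rewrite exprn_ge0// ltW.
move: (z ^+ _) (i.+3%:R : R) (ler0n R i.+3) => y k k0 y0.
have h : k * (y * z * a) <= k * (y * z * B).
  by apply: ler_wpM2l => //; apply: ler_wpM2l => //; rewrite mulr_ge0// ltW.
have h2 : 0 <= N * K * (z * y) by rewrite !mulr_ge0// ?(ltW z0)// (le_trans _ N2).
move: h h2; rewrite -subr_ge0 => h h2; rewrite -subr_ge0.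
apply: (le_trans (addr_ge0 h h2)); rewrite le_eqVlt; apply/orP; left; apply/eqP; ring.
Qed.

Lemma linear_ineq4 (w1 w2 g1 g2 a b c : R) :
  (0 <= -1 * w1 + (- c * w2 + (a * g1 + (b * g2 + 0)))) = (w1 + c * w2 <= a * g1 + b * g2).
Proof. by rewrite -[RHS]subr_ge0; congr (0 <= _); ring. Qed.

End Truncations.

Arguments mom : simpl never.
Arguments dmom : simpl never.
Arguments ddmom : simpl never.
Arguments sig : simpl never.
Arguments dsig : simpl never.

Section Bootstrap.
Variables (R : realType) (n : nat).
Notation V := (Cspace R n).
Notation S := (@sphere R n).
Hypothesis n_gt0 : (0 < n)%N.
Implicit Types (x : V) (t s : R).
Variables (f : V -> R) (u v : R -> V -> R) (al : R -> R).
Hypothesis H : flow_data f u v al.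
Variables (P0 f1 q0 A K : R).
Hypotheses (P0p : 0 < P0) (f1p : 0 < f1) (q0p : 0 < q0) (A0 : 0 <= A) (K0 : 0 <= K).
Hypothesis massE : forall t, 1 <= t -> wint u (fun=> 1) t = P0.
Hypothesis f_le : forall x, S x -> f x <= f1.
Hypothesis Q_ge : forall t, 1 <= t -> q0 <= wint u f t.
Hypothesis al_ge : forall t, 1 <= t -> 0 <= al t.
Hypothesis al_le : forall t, 1 <= t -> al t <= A.
Hypothesis v_le : forall t x, 1 <= t -> S x -> v t x <= K.

Let cf := fd_f H.
Let cvt t (t0 : 0 < t) : contS (v t) := cv n_gt0 (fd_u H) (fd_u_pos H) (fd_eq H) t0.
Let cp t (t0 : 0 < t) : contS (wt u t) := cwt (fd_u H) (fd_u_pos H) t0.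
Let f_gt0 x (Sx : S x) : 0 < f x := fd_f_pos H Sx.
Let pos1 t : 1 <= t -> 0 < t. Proof. exact: lt_le_trans ltr01. Qed.
Let W := wint u.
Let D := dal f u v al.
Let fvf := fv f u v.
Let FF := F2 u v.
Let N : R := n.+1%:R.
Let N2 : 2 <= N. Proof. by rewrite /N (ler_nat R 2). Qed.
Let B := A * f1.
Let B0 : 0 <= B. Proof. exact: mulr_ge0 A0 (ltW f1p). Qed.

Let der_cont (F dF : R -> R) : (forall s : R, is_derive s 1 F (dF s)) -> continuous F.
Proof. by move=> h s; apply: differentiable_continuous; apply/derivable1_diffP; case: (h s). Qed.

Let cmom j t : 1 <= t -> contS (fun x => mom j (v t x)).
Proof. by move=> t1; apply: contS_post; [exact: der_cont (mom_derive j)|exact: cvt (pos1 t1)]. Qed.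
Let cdmom j t : 1 <= t -> contS (fun x => dmom j (v t x)).
Proof. by move=> t1; apply: contS_post; [exact: der_cont (dmom_derive j)|exact: cvt (pos1 t1)]. Qed.

Definition Gm j t := wint u (fun x => mom j (v t x)) t.
Definition Ym j t := Yf u v (ddmom j) t.
Definition dGm j t := dal f u v al t * wint u (fun x => dmom j (v t x) * f x) t - n.+1%:R / 4 * Ym j t
    + wint u (fun x => dmom j (v t x) * v t x * (al t * f x - v t x)) t
    + n.+1%:R * wint u (fun x => mom j (v t x) * v t x) t.

Lemma Gm_derive j t : 1 <= t -> is_derive t 1 (Gm j) (dGm j t).
Proof. by move=> t1; exact: (moment n_gt0 H t1 (mom_derive j) (dmom_derive j) (@ddmom_continuous R j)). Qed.

Lemma Gm_ge0 j t : 1 <= t -> 0 <= Gm j t.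
Proof. by move=> t1; apply: (wint_ge0 H (pos1 t1)) => x _; exact: mom_ge0. Qed.

Lemma Ym_ge0 j t : 1 <= t -> 0 <= Ym j t.
Proof. by move=> t1; apply: (Yf_ge0 n_gt0 H t1); exact: ddmom_ge0. Qed.

Lemma reaction_le j t : 1 <= t ->
  W (fun x => dmom j (v t x) * v t x * (al t * f x - v t x)) t + N * W (fun x => mom j (v t x) * v t x) t
  <= (j.+2%:R * B + N * K) * Gm j t + (j.+2%:R - N) * Gm j.+1 t.
Proof.
move=> t1; have t0 := pos1 t1; have cv' := cvt t0.
have c1 := @cmom j t t1; have c2 := @cdmom j t t1; have c3 := @cmom j.+1 t t1.
have L : all_contS [:: (-1 : R, fun x => dmom j (v t x) * v t x * (al t * f x - v t x)); (- N, fun x => mom j (v t x) * v t x);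
   (j.+2%:R * B + N * K, fun x => mom j (v t x)); (j.+2%:R - N, fun x => mom j.+1 (v t x))].
  by rewrite /=; do !split; contS_tac.
have h := wint_pos n_gt0 H t0 L.
suff hx x : S x -> 0 <= -1 * (dmom j (v t x) * v t x * (al t * f x - v t x)) + (- N * (mom j (v t x) * v t x) +
    ((j.+2%:R * B + N * K) * mom j (v t x) + ((j.+2%:R - N) * mom j.+1 (v t x) + 0))).
  by have := h hx; rewrite /= linear_ineq4.
move=> Sx; rewrite linear_ineq4; apply: mom_reaction => //; first exact: v_le.
by apply: ler_pM; [exact: al_ge|exact: ltW (f_gt0 Sx)|exact: al_le|exact: f_le].
Qed.

Definition B1 := f1 * (2 * K * P0).

Let B10 : 0 <= B1.
Proof. by apply: mulr_ge0 (ltW f1p) _; apply: mulr_ge0 (ltW P0p); exact: mulr_ge0. Qed.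

Lemma fv_le t : 1 <= t -> `|fvf t| <= B1.
Proof.
move=> t1; have := fv_bound n_gt0 H f1p massE f_le t1 K0.
have -> : wint u (fun x => pos_part (v t x - K)) t = 0.
  rewrite /wint (@sint_ext _ _ _ (fun=> 0)); first by rewrite (sint_cst n_gt0) mul0r.
  by move=> x Sx; rewrite pos_part_0 ?mul0r// subr_le0 v_le.
by rewrite mulr0 add0r.
Qed.

(** The product of fv with the derivative of al is at most C F2: its quadratic part has
    a sign, and fv is bounded. *)
Lemma base_ineq : exists2 C, 0 <= C & forall t, 1 <= t ->
  dGm 0 t <= C * Gm 0 t + (2 - N) * Gm 1 t - N / 4 * Ym 0 t.
Proof.
pose C := 2 * n%:R * B1 / q0 + (2 * B + N * K).
have C10 : 0 <= 2 * n%:R * B1 / q0 by apply: divr_ge0 (ltW q0p); exact: mulr_ge0.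
have N0 : 0 <= N by exact: ler0n.
have NK : 0 <= N * K by exact: mulr_ge0.
exists C; first by apply: addr_ge0 => //; apply: addr_ge0 NK; exact: mulr_ge0.
move=> t t1; have t0 := pos1 t1; have cv' := cvt t0; have cp' := cp t0.
have G0 := Gm_ge0 0 t1.
have := reaction_le 0 t1; rewrite /dGm -!/(W _ _).
have -> : W (fun x => dmom 0 (v t x) * f x) t = 2 * fvf t.
  rewrite /W /wint /fvf /fv -(sintZ n_gt0); last by contS_tac.
  by apply: sint_ext => x _; rewrite /dmom; move: (wt u t x) => w; ring.
have h1 : D t * (2 * fvf t) <= 2 * n%:R * B1 / q0 * Gm 0 t.
  have Q1 : q0 <= Qf f u t by exact: Q_ge.
  have Qp : 0 < Qf f u t by exact: lt_le_trans q0p Q1.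
  have F0 : 0 <= FF t by exact: G0.
  have E : Gm 0 t = FF t by [].
  have a0 := al_ge t1; have hb := fv_le t1.
  rewrite E /D /dal -/(fvf t) -/(FF t).
  have e1 : - (al t * fvf t + n%:R * FF t) / Qf f u t * (2 * fvf t) =
     - (2 * al t * fvf t ^+ 2 / Qf f u t) + 2 * n%:R * FF t * (- fvf t / Qf f u t).
    by move: (fvf t) (FF t) (Qf f u t) Qp => b1 b2 q qp; field; rewrite gt_eqF.
  have h2 : 0 <= 2 * al t * fvf t ^+ 2 / Qf f u t.
    by apply: divr_ge0 (ltW Qp); apply: mulr_ge0; [exact: mulr_ge0|exact: sqr_ge0].
  have h3 : - fvf t / Qf f u t <= B1 / q0.
    apply: (@le_trans _ _ (B1 / Qf f u t)).
      apply: ler_wpM2r; first by rewrite invr_ge0 ltW.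
      by apply: le_trans (ler_norm _) _; rewrite normrN.
    by apply: ler_wpM2l => //; rewrite lef_pV2.
  have h4 : 0 <= 2 * n%:R * FF t by rewrite !mulr_ge0.
  have h5 := ler_wpM2l h4 h3; rewrite e1.
  have -> : 2 * n%:R * B1 / q0 * FF t = 2 * n%:R * FF t * (B1 / q0) 
    by move: (FF t) (n%:R : R) => b1 b2; field; rewrite gt_eqF.
  by move: h2 h5; move: (2 * al t * _ / _) (_ * (- fvf t / _)) (_ * (B1 / q0)) => b1 b2 b3 g1 g2; lra.
move: h1; rewrite /C [(_ + (2 * B + _)) * _]mulrDl -/D -/N.
move: (D t * _) (N / 4 * _) (_ * Gm 1 t) (_ / q0 * _) ((2 * B + N * K) * Gm 0 t) (N * W _ t) (W _ t).
by move=> b1 b2 b3 b4 b5 b6 b7 g1 g4; lra.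
Qed.

Lemma tame0 : tame (fun _ : R => 0 : R).
Proof. by exists 0, (fun=> 0), (fun=> 0) => t _; split; [exact: lexx|exact: pder_cst|rewrite oppr0]. Qed.

Lemma ge1_ev (P : R -> Prop) : (forall t, 1 <= t -> P t) -> eventually_ P. Proof. by exists 1. Qed.

Lemma vanish_base : tame (Gm 0) -> vanish (Gm 0).
Proof.
move=> tG; have [C C0 hC] := base_ineq.
apply: (ode_vanish (dg := dGm 0) (h := fun=> 0) C0) => //.
- by apply: ge1_ev => t t1; split; [exact: Gm_ge0|exact: Gm_derive].
- by exists 0.
- apply: ge1_ev => t t1; rewrite addr0; apply: le_trans (hC t t1) _.
  have h2 : 0 <= N / 4 * Ym 0 t by apply: mulr_ge0 (Ym_ge0 0 t1); apply: divr_ge0; exact: ler0n.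
  have h3 : (2 - N) * Gm 1 t <= 0 by apply: mulr_le0_ge0 (Gm_ge0 1 t1); rewrite subr_le0.
  by move: h2 h3; move: (C * _) (_ * Gm 1 t) (N / 4 * _) => b1 b2 b3 h2 h3; lra.
- exact: tame0.
Qed.

(** Since F2 tends to zero, the derivative of al is eventually bounded. *)
Lemma succ_ineq i : vanish (Gm 0) -> exists2 C, 0 <= C & eventually_ (fun t =>
  dGm i.+1 t <= C * (Gm i t + Gm i.+1 t) + (i.+3%:R - N) * Gm i.+2 t - N / 4 * Ym i.+1 t).
Proof.
move=> vG; have [T hT] := vG 1 ltr01.
pose C1 := (A * B1 + n%:R) / q0.
have C10 : 0 <= C1 by apply: divr_ge0 (ltW q0p); apply: addr_ge0 => //; exact: mulr_ge0.
pose C2 := C1 * (i.+3%:R * f1); pose C3 := i.+3%:R * B + N * K.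
have C20 : 0 <= C2 by apply: mulr_ge0 => //; apply: mulr_ge0 (ltW f1p).
have C30 : 0 <= C3 by apply: addr_ge0; apply: mulr_ge0 => //; exact: ler0n.
exists (C2 + C3); first exact: addr_ge0.
exists (Num.max 1 T) => t; rewrite ge_max => /andP[t1 /hT G1]; have t0 := pos1 t1.
have cv' := cvt t0.
have hD : `|D t| <= C1.
  apply: le_trans (dal_abs H q0p Q_ge al_ge al_le t1 (fv_le t1)) _.
  apply: ler_wpM2r; first by rewrite invr_ge0 ltW.
  by rewrite lerD2l -[X in _ <= X]mulr1 ler_wpM2l.
have hX : `|W (fun x => dmom i.+1 (v t x) * f x) t| <= i.+3%:R * f1 * Gm i t.
  have c1 := @cmom i t t1; have c2 := @cdmom i.+1 t t1.
  have L e : all_contS [:: (e : R, fun x => dmom i.+1 (v t x) * f x); (i.+3%:R * f1, fun x => mom i (v t x))].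
    by rewrite /=; do !split; contS_tac.
  have E e : `|e| = 1 -> 0 <= e * W (fun x => dmom i.+1 (v t x) * f x) t + (i.+3%:R * f1 * Gm i t + 0).
    move=> e1; have h := wint_pos n_gt0 H t0 (L e).
    suff hx x : S x -> 0 <= e * (dmom i.+1 (v t x) * f x) + (i.+3%:R * f1 * mom i (v t x) + 0) by have := h hx.
    move=> Sx; have fx := f_le Sx; have f0 := f_gt0 Sx.
    have h1 : `|e * (dmom i.+1 (v t x) * f x)| <= i.+3%:R * f1 * mom i (v t x).
      rewrite !normrM e1 mul1r /dmom normrN normrM [`|f x|]gtr0_norm// [`|i.+3%:R|]ger0_norm//.
      rewrite [`|_ ^+ i.+2|]ger0_norm ?exprn_ge0 ?pos_part_ge0// mulrAC.
      have p0 : 0 <= pos_part (- v t x) ^+ i.+2 by rewrite exprn_ge0// pos_part_ge0.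
      apply: ler_pM => //; [by apply: mulr_ge0 => //; exact: ltW|by apply: ler_wpM2l|exact: neg_le_mom].
    rewrite addr0 -lerBlDr sub0r lerNl; apply: le_trans h1; rewrite -normrN; exact: ler_norm.
  have := E 1 (normr1 _); have := E (-1) (normrN1 _); rewrite ler_norml.
  move: (W _ t) (_ * Gm i t) => b1 b2 h1 h2; apply/andP; split; lra.
have h1 : D t * W (fun x => dmom i.+1 (v t x) * f x) t <= C2 * Gm i t.
  apply: le_trans (ler_norm _) _; rewrite normrM /C2 -mulrA; exact: ler_pM.
have h2 := reaction_le i.+1 t1.
have h3 : 0 <= C3 * Gm i t by apply: mulr_ge0 => //; exact: Gm_ge0.
have h4 : 0 <= C2 * Gm i.+1 t by apply: mulr_ge0 => //; exact: Gm_ge0.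
rewrite /dGm -/W -/D -/N; move: h1 h2 h3 h4; rewrite -/C3 mulrDr ![(C2 + C3) * _]mulrDl.
move: (N / 4 * _) (_ * Gm i.+2 t) (C2 * Gm i t) (C2 * Gm i.+1 t) (C3 * Gm i t) (C3 * Gm i.+1 t) (W _ t) (N * W _ t) (D t * _).
by move=> b1 b2 b3 b4 b5 b6 b7 b8 b9 g1 g2 g3 g4; lra.
Qed.

Lemma moment_ineq j : vanish (Gm 0) -> exists2 C, 0 <= C & eventually_ (fun t =>
  dGm j t <= C * (Gm j.-1 t + Gm j t) + (j.+2%:R - N) * Gm j.+1 t - N / 4 * Ym j t).
Proof.
case: j => [_|i] /=; last exact: succ_ineq.
have [C C0 hC] := base_ineq; exists C => //; apply: ge1_ev => t t1.
apply: le_trans (hC t t1) _; rewrite mulrDr -addrA -[X in _ <= X]addrA.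
rewrite lerD2r -[X in X <= _]add0r lerD2r; apply: mulr_ge0 => //; exact: Gm_ge0.
Qed.

(** The energy of a product, arranged so that its first term can be integrated by parts
    onto the equation for phi. *)
Lemma Gam_sq (phi psi : V -> R) x : C1 phi -> C1 psi -> S x ->
  Gam (fun y => phi y * psi y) (fun y => phi y * psi y) x =
  Gam phi (fun y => phi y * psi y ^+ 2) x + phi x ^+ 2 * Gam psi psi x.
Proof.
move=> h1 h2 Sx; have h3 := C1M h2 h2; rewrite [Gam phi _ x]GamC.
have -> : (fun y => phi y * psi y ^+ 2) = (fun y => phi y * (psi y * psi y)) by apply: funext => y; rewrite expr2.
rewrite (GamMl phi h1 h3 Sx) (GamMl phi h2 h2 Sx) (GamMl _ h1 h2 Sx) ![Gam _ (fun y => phi y * psi y) x]GamC.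
rewrite !(GamMl _ h1 h2 Sx) (GamC psi phi).
by move: (Gam phi phi x) (Gam phi psi x) (Gam psi psi x) => a b c; ring.
Qed.

(** The integrand of the energy of u sig(v): the equation replaces the second
    derivatives of u, and 4 R_0 / N = n^2 >= 1 absorbs the L2 norm. *)
Lemma trace_pointwise (k dd q G U Ds m m1 z w ag v0 Bd : R) : 1 <= k -> 0 <= G -> dd <= q -> 0 <= m -> 0 < w -> m1 = z * m ->
  ag <= Bd -> - v0 <= z -> 0 <= z -> 0 <= Bd ->
  (ag - v0) * w = U * (- ((2 + 2 / k) / 4) * Ds + k * (k + 1) / 2 * U) ->
  U ^+ 2 * dd * G - U * m * Ds + U ^+ 2 * m <= U ^+ 2 * q * G + 2 * Bd * (m * w) + 2 * (m1 * w).
Proof.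
move=> k1 G0 ddq m0 w0 -> aB vz z0 Bd0 e; have k0 : 0 < k by exact: lt_le_trans ltr01 k1.
pose c := 2 * k / (k + 1).
have c2 : 0 <= c <= 2.
  apply/andP; split; first by rewrite divr_ge0 ?mulr_ge0 ?addr_ge0 ?ltW.
  by rewrite ler_pdivrMr ?addr_gt0//; lra.
have -> : U ^+ 2 * dd * G - U * m * Ds + U ^+ 2 * m = U ^+ 2 * G * dd + c * m * ((ag - v0) * w) - (k ^+ 2 - 1) * (U ^+ 2 * m).
  by rewrite e /c; field; rewrite !gt_eqF// addr_gt0.
have h1 : U ^+ 2 * G * dd <= U ^+ 2 * G * q by apply: ler_wpM2l => //; rewrite mulr_ge0// sqr_ge0.
have h2 : 0 <= (k ^+ 2 - 1) * (U ^+ 2 * m).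
  by apply: mulr_ge0; [rewrite subr_ge0 -(expr1n R 2) lerXn2r ?nnegrE ?(ltW k0)|rewrite mulr_ge0// sqr_ge0].
have h3 : c * m * ((ag - v0) * w) <= 2 * m * ((Bd + z) * w).
  move/andP: c2 => [c0 c2].
  have b1 : (ag - v0) * w <= (Bd + z) * w by rewrite ler_wpM2r ?(ltW w0)// lerD.
  apply: (le_trans (ler_wpM2l (mulr_ge0 c0 m0) b1)); apply: ler_wpM2r; last by rewrite ler_wpM2r.
  by rewrite mulr_ge0 ?(ltW w0)// addr_ge0.
move: h1 h2 h3; have -> : 2 * m * ((Bd + z) * w) = 2 * Bd * (m * w) + 2 * (z * m * w) by ring.
rewrite [U ^+ 2 * G * q]mulrAC.
by move: (_ * dd) (_ * q * G) (_ - 1) (c * m * _) (2 * Bd * _) (2 * (_ * _ * w)) (U ^+ 2 * m) => b1 b2 b3 b4 b5 b6 b7; move: (b3 * b7) => b8 h1 h2 h3; lra.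
Qed.

(** trace_ineq for psi = u sig(v) and w = v^- u^(2/n), whose (n+1)-st power is the
    (n+1)-st moment of the negative part. *)
Lemma trace_mom : exists2 C, 0 < C & forall j t e, 1 <= t -> 0 < e ->
  W (fun x => pos_part (- v t x) ^+ n.+1) t <= e ^+ n.+1 ->
  Gm j.+1 t <= C * e * (Ym j t + 2 * B * Gm j t + 2 * Gm j.+1 t).
Proof.
have [C Cp hC] := @trace_ineq R n n_gt0; exists C => // j t e t1 e0 he; have t0 := pos1 t1.
have up := fd_u_pos H; have hu2 := u_C2 (fd_u H) t0; have hu := C2_C1 hu2.
have hv := v_C1 n_gt0 (fd_u H) up (fd_eq H) t0; have cv' := cvt t0; have cw := cp t0.
have cut := C1_cont hu; have cD := contS_Dsub hu2.
have csig : contS (fun x => sig j (v t x)) by apply: contS_post => //; exact: der_cont (sig_derive j).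
have cdsig : contS (fun x => dsig j (v t x)) by apply: contS_post => //; exact: dsig_continuous.
have c1 := @cmom j t t1; have c2 := @cmom j.+1 t t1.
have c3 : contS (fun x => ddmom j (v t x)) by apply: contS_post => //; exact: ddmom_continuous.
have hs : C1 (fun x => sig j (v t x)).
  apply: (@C1_comp _ _ _ hv (sig j) (dsig j)) => x Sx; [exact: sig_derive|exact: dsig_continuous].
pose psi x := u t x * sig j (v t x); have hpsi : C1 psi := C1M hu hs.
pose w x := pos_part (- v t x) * u t x `^ (2 / n%:R).
have cneg : contS (fun x => pos_part (- v t x)).
  by apply: (contS_post (F := @pos_part R) (g := fun x => - v t x)); [exact: pos_part_continuous|contS_tac].
have cpow : contS (fun x => u t x `^ (2 / n%:R)).
  apply: (@contw_compat R V S (fun s => s `^ (2 / n%:R)) (u t) cut) => x Sx.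
  by apply: powR_continuous; rewrite posrE; exact: up.
have cw' : contS w by exact: contSM.
have w0 x : S x -> 0 <= w x by move=> _; apply: mulr_ge0; [exact: pos_part_ge0|exact: powR_ge0].
have nn : n%:R != 0 :> R by rewrite pnatr_eq0 -lt0n.
have hw : sint (fun x => w x ^+ n.+1) <= e ^+ n.+1.
  apply: le_trans he; rewrite le_eqVlt; apply/orP; left; apply/eqP; apply: sint_ext => x Sx.
  rewrite /w exprMn; congr (_ * _); rewrite -powR_mulrn ?powR_ge0// -powRrM /wt /NN.
  by congr (_ `^ _); rewrite -[n.+1]addn1 natrD; field.
have := hC w psi e cw' w0 hpsi e0 hw.
have -> : sint (fun x => w x * psi x ^+ 2) = Gm j.+1 t.
  apply: sint_ext => x Sx; rewrite -mom_succ -sig_sqr /w /psi /wt /NN powRD; last by rewrite (gt_eqF (up t x t0 Sx)) implybT.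
  rewrite (powR_mulrn 2 (ltW (up t x t0 Sx))).
  by move: (pos_part _) (u t x) (sig j _) (_ `^ _) => a b c d; ring.
move=> h; apply: (le_trans h); apply: ler_wpM2l; first by rewrite mulr_ge0 ?(ltW Cp) ?(ltW e0).
have cG := contS_Gam hv hv; have hus := C1M hu (C1M hs hs).
have cG2 := contS_Gam hu hus.
have E1 : dirichlet psi = sint (fun x => u t x ^+ 2 * dsig j (v t x) ^+ 2 * Gam (v t) (v t) x - u t x * mom j (v t x) * Dsub (u t) x).
  have Z := sint_Gam n_gt0 hus hu2.
  have cx1 : contS (fun x => u t x ^+ 2 * dsig j (v t x) ^+ 2 * Gam (v t) (v t) x) by contS_tac.
  have cx2 : contS (fun x => u t x * mom j (v t x) * Dsub (u t) x) by contS_tac.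
  rewrite (sintB n_gt0 cx1 cx2).
  have -> : sint (fun x => u t x * mom j (v t x) * Dsub (u t) x) = - sint (Gam (fun y => u t y * (sig j (v t y) * sig j (v t y))) (u t)).
    by rewrite Z opprK; apply: sint_ext => x _; rewrite -sig_sqr expr2.
  have cx3 : contS (Gam (fun y => u t y * (sig j (v t y) * sig j (v t y))) (u t)) by exact: contS_Gam.
  rewrite opprK -(sintD n_gt0 cx1 cx3); apply: sint_ext => x Sx.
  rewrite (Gam_sq hu hs Sx) addrC; congr (_ + _).
    rewrite (@Gam_comp _ _ (sig j) (dsig j) (v t) _ x hv Sx (sig_derive j _)) GamC.
    rewrite (@Gam_comp _ _ (sig j) (dsig j) (v t) _ x hv Sx (sig_derive j _)).
    by move: (dsig _ _) (Gam _ _ x) => a b; ring.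
  by rewrite GamC.
have cy : contS (fun x => psi x ^+ 2) by rewrite /psi; contS_tac.
have cx : contS (fun x => u t x ^+ 2 * dsig j (v t x) ^+ 2 * Gam (v t) (v t) x - u t x * mom j (v t x) * Dsub (u t) x) by contS_tac.
rewrite E1 -(sintD n_gt0 cx cy).
have L : all_contS [:: (1 : R, fun x => u t x ^+ 2 * ddmom j (v t x) * Gam (v t) (v t) x);
   (2 * B, fun x => mom j (v t x) * wt u t x); (2 : R, fun x => mom j.+1 (v t x) * wt u t x)].
  by rewrite /=; do !split; contS_tac.
have [cl] := sint_lin n_gt0 L; rewrite /= mul1r addr0 => E2.
have -> : Ym j t + 2 * B * Gm j t + 2 * Gm j.+1 t = Ym j t + (2 * B * Gm j t + 2 * Gm j.+1 t) by rewrite addrA.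
rewrite -[Ym j t + _]E2; apply: (sint_le n_gt0) => [||x Sx]; [exact: contSD cx cy|exact: cl|].
rewrite /psi exprMn sig_sqr mul1r addr0 addrA.
apply: (@trace_pointwise n%:R _ _ _ _ _ _ _ (pos_part (- v t x)) _ (al t * f x) (v t x)).
- by rewrite ler1n.
- exact: Gam_ge0.
- exact: dsig_le.
- exact: mom_ge0.
- exact: wt_pos up _ _ t0 Sx.
- by rewrite mom_succ.
- by apply: ler_pM; [exact: al_ge|exact: ltW (f_gt0 Sx)|exact: al_le|exact: f_le].
- exact: le_posp.
- exact: pos_part_ge0.
- exact: B0.
- exact: (fd_R H t0 Sx).
Qed.

Lemma absorb_scalar (C M Y G G1 b : R) : 0 < C -> 3 <= M -> 0 <= Y -> 0 <= b -> 0 <= G -> 0 <= G1 ->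
  G1 <= C * (8 * C * M)^-1 * (Y + b * G + 2 * G1) -> M * G1 <= N / 4 * Y + N / 4 * b * G.
Proof.
move=> C0 M3 Y0 b0 G0 G10; have M0 : 0 < M by lra.
have -> : C * (8 * C * M)^-1 = (8 * M)^-1 by field; rewrite !gt_eqF.
rewrite mulrC ler_pdivlMr ?mulr_gt0// => h.
have bG : 0 <= b * G by exact: mulr_ge0.
have h2 : 2 * (Y + b * G) <= N * (Y + b * G) by rewrite ler_wpM2r// addr_ge0.
have h3 : 3 * G1 <= M * G1 by rewrite ler_wpM2r.
move: h h2 h3; have -> : G1 * (8 * M) = 8 * (M * G1) by ring.
have -> : N / 4 * Y + N / 4 * b * G = N * (Y + b * G) / 4 by field.
by move: (M * G1) (b * G) (N * _) bG => x y z bG h h2 h3; lra.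
Qed.

(** Below the critical exponent the next moment already has a good sign in moment_ineq.
    From there on it is absorbed: the (n+1)-st moment tends to zero, so trace_mom holds
    with a small constant and the dissipation Ym dominates. *)
Lemma absorb j : vanish (Gm 0) -> (j.+2 <= n)%N \/ vanish (Gm n.-1) ->
  exists2 C, 0 <= C & eventually_ (fun t => dGm j t <= C * (Gm j.-1 t + Gm j t) - Gm j.+1 t).
Proof.
move=> v0 hj; have [C C0 hC] := moment_ineq j v0; have N0 : 0 <= N by exact: ler0n.
case: hj => [jn|vn].
  exists C => //; apply: evS (evI hC (@ev_ge R 1)) => t [h t1]; apply: (le_trans h).
  have Y0 : 0 <= N / 4 * Ym j t by apply: mulr_ge0 (Ym_ge0 j t1); exact: divr_ge0.
  have h1 : (j.+2%:R - N) * Gm j.+1 t <= -1 * Gm j.+1 t.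
    apply: ler_wpM2r; first exact: Gm_ge0.
    by rewrite lerBlDr addrC lerBrDr /N -[1]/(1%:R) -natrD ler_nat addn1.
  by move: h1 Y0; rewrite mulN1r; move: (C * _) (Gm j.+1 t) (_ * Gm j.+1 t) (N / 4 * _) => b1 b3 b2 b4 h1 Y0; lra.
have [C2 C2p hC2] := trace_mom; pose M : R := j.+3%:R.
have M3 : 3 <= M by rewrite (ler_nat R 3).
(* the constant of the trace inequality becomes 1 / (8 M), see absorb_scalar *)
have ep : 0 < (8 * C2 * M)^-1 by rewrite invr_gt0 !mulr_gt0// (lt_le_trans _ M3).
have bB : 0 <= 2 * B by exact: mulr_ge0.
have NB : 0 <= N / 4 * (2 * B) by apply: mulr_ge0 bB; exact: divr_ge0.
exists (C + N / 4 * (2 * B)); first exact: addr_ge0.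
apply: evS (evI hC (evI (vn _ (exprn_gt0 n.+1 ep)) (@ev_ge R 1))) => t [h [hn t1]].
apply: (le_trans h).
have t0 := pos1 t1; have G1 := Gm_ge0 j.+1 t1; have G0 := Gm_ge0 j t1; have Y0 := Ym_ge0 j t1.
have hw : W (fun x => pos_part (- v t x) ^+ n.+1) t <= (8 * C2 * M)^-1 ^+ n.+1.
  apply: le_trans hn; have cv' := cvt t0; have cp' := cp t0; have c1 := @cmom n.-1 t t1.
  have cneg : contS (fun x => pos_part (- v t x)).
    by apply: (contS_post (F := @pos_part R) (g := fun x => - v t x)); [exact: pos_part_continuous|contS_tac].
  apply: (sint_le n_gt0) => [||x Sx]; [by contS_tac|by contS_tac|].
  apply: ler_wpM2r; first exact: ltW (wt_pos (fd_u_pos H) t0 Sx).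
  by have := neg_le_mom n.-1 (v t x); rewrite prednK.
have h1 := absorb_scalar C2p M3 Y0 bB G0 G1 (hC2 j t _ t1 ep hw).
have h2 : (j.+2%:R - N) * Gm j.+1 t <= (M - 1) * Gm j.+1 t.
  by apply: ler_wpM2r => //; rewrite /M -[j.+3]addn1 natrD addrK gerBl.
have h3 : 0 <= N / 4 * (2 * B) * Gm j.-1 t by apply: mulr_ge0 => //; exact: Gm_ge0.
move: h1 h2 h3; rewrite [(M - 1) * _]mulrBl mul1r [(C + _) * _]mulrDl [N / 4 * (2 * B) * (_ + _)]mulrDr.
move: (C * _) (Gm j.+1 t) ((j.+2%:R - N) * Gm j.+1 t) (M * Gm j.+1 t) (N / 4 * Ym j t) (_ * Gm j.-1 t) (_ * Gm j t).
by move=> b1 b2 b3 b4 b5 b6 b7 h1 h2 h3; lra.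
Qed.

(** Induction on j. By absorb, the j-th moment controls the next one, which becomes
    tame; its own differential inequality then forces it to tend to zero by ode_vanish. *)
Lemma tame_vanish j : tame (Gm 0) -> forall i, (i <= j)%N -> tame (Gm i) /\ vanish (Gm i).
Proof.
move=> t0; have v0 := vanish_base t0; elim: j => [i|j IH i].
  by rewrite leqn0 => /eqP ->.
rewrite leq_eqVlt => /predU1P[->{i}|]; last by rewrite ltnS => /IH.
have evG : eventually_ (fun t => 0 <= Gm j t /\ is_derive t 1 (Gm j) (dGm j t)).
  by apply: ge1_ev => t t1; split; [exact: Gm_ge0|exact: Gm_derive].
have hj : (j.+2 <= n)%N \/ vanish (Gm n.-1).
  have [h|h] := leqP j.+2 n; [by left|right].
  by apply: (IH _ _).2; move: h n_gt0; clear; case: n => // m; rewrite ltnS.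
have tj : tame (Gm j) by case: (IH j (leqnn j)).
have tG : tame (Gm j.+1).
  have [C C0 hC] := absorb v0 hj.
  have tj1 : tame (Gm j.-1) by case: (IH _ (leq_pred j)).
  apply: tame_le (tameD (tameZ C0 (tameD tj1 tj)) (tame_derive evG)).
  by apply: evS hC => t; move: (C * _) (dGm j t) (Gm j.+1 t) => a b c h; lra.
split => //.
have [C C0 hC] : exists2 C, 0 <= C & eventually_ (fun t => dGm j.+1 t <= C * (Gm j t + Gm j.+1 t)).
  have [jn|jn] := leqP j.+3 n.+1.
    have [C C0 hC] := moment_ineq j.+1 v0; exists C => //.
    apply: evS (evI hC (@ev_ge R 1)) => t [h t1]; apply: (le_trans h).
    have Y0 : 0 <= N / 4 * Ym j.+1 t by apply: mulr_ge0 (Ym_ge0 j.+1 t1); apply: divr_ge0; exact: ler0n.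
    have h1 : (j.+3%:R - N) * Gm j.+2 t <= 0.
      by apply: mulr_le0_ge0; [rewrite subr_le0 ler_nat|exact: Gm_ge0].
    by move: h1 Y0 => /=; move: (C * _) (_ * Gm j.+2 t) (N / 4 * _) => b1 b2 b4 h1 Y0; lra.
  have hj1 : (j.+3 <= n)%N \/ vanish (Gm n.-1).
    by right; apply: (IH _ _).2; move: jn n_gt0; clear; case: n => // m; rewrite !ltnS.
  have [C C0 hC] := absorb v0 hj1; exists C => //.
  apply: evS (evI hC (@ev_ge R 1)) => t [h t1]; apply: (le_trans h).
  by rewrite /= gerBl; exact: Gm_ge0.
apply: (ode_vanish (dg := dGm j.+1) (h := fun t => C * Gm j t) C0) => //.
- by apply: ge1_ev => t t1; split; [exact: Gm_ge0|exact: Gm_derive].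
- by apply: ge1_ev => t t1; apply: mulr_ge0 => //; exact: Gm_ge0.
- by apply: evS hC => t; rewrite mulrDr addrC.
- exact: tameZ.
Qed.

Lemma abs_pointwise j s : s <= K -> `|s| ^+ j.+3 <= K ^+ j.+1 * mom 0 s + mom j.+1 s.
Proof.
move=> sK; have [s0|s0] := leP 0 s.
  rewrite ger0_norm// [mom j.+1 s]/mom pos_part_0 ?oppr_le0// expr0n addr0.
  rewrite -[j.+3]/(j.+1.+2) -addn2 exprD ler_wpM2r ?sqr_ge0// lerXn2r// nnegrE; exact: le_trans sK.
rewrite ltr0_norm// /mom pos_part_id ?oppr_ge0 ?(ltW s0)// lerDr.
by rewrite mulr_ge0 ?sqr_ge0// exprn_ge0.
Qed.

Lemma abs_moment_vanish j : tame (Gm 0) -> vanish (fun t => wint u (fun x => `|v t x| ^+ j.+3) t).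
Proof.
move=> t0 e e0; have v0 := vanish_base t0; have [_ vj] := tame_vanish t0 (leqnn j.+1).
pose k := K ^+ j.+1; have k0 : 0 <= k by exact: exprn_ge0.
have e2 : 0 < e / 2 by exact: divr_gt0.
have ek : 0 < e / 2 / (k + 1) by apply: divr_gt0 => //; exact: ltr_wpDl.
apply: evS (evI (v0 _ ek) (evI (vj _ e2) (@ev_ge R 1))) => t [h1 [h2 t1]].
have tp := pos1 t1; have cv' := cvt tp; have c1 := @cmom 0 t t1; have c2 := @cmom j.+1 t t1.
have ca : contS (fun x => `|v t x| ^+ j.+3) by apply: contSX; exact: contf_norm.
have L : all_contS [:: (-1 : R, fun x => `|v t x| ^+ j.+3); (k, fun x => mom 0 (v t x)); (1 : R, fun x => mom j.+1 (v t x))].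
  by rewrite /=; do !split.
have hx x : S x -> 0 <= -1 * `|v t x| ^+ j.+3 + (k * mom 0 (v t x) + (1 * mom j.+1 (v t x) + 0)).
  move=> Sx; have := abs_pointwise j (v_le t1 Sx); rewrite -/k mul1r addr0 mulN1r.
  by move: (mom j.+1 _) (k * _) (`|_| ^+ _) => a b c; lra.
have := wint_pos n_gt0 H tp L hx; rewrite /= -!/(Gm _ _) mul1r addr0 mulN1r.
have h3 : k * Gm 0 t <= e / 2.
  have G0 := Gm_ge0 0 t1; move: h1; rewrite ler_pdivlMr ?ltr_wpDl// => h1.
  by apply: le_trans h1; rewrite mulrC; apply: ler_wpM2l => //; rewrite lerDl.
by move: h2 h3; move: (wint _ _ _) (k * _) (Gm _ t) => a b c h2 h3 h4; lra.
Qed.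

End Bootstrap.

(** * Convergence for the Webster scalar curvature flow *)

Section FlowDataConvergence.
Variables (R : realType) (n : nat).
Notation V := (Cspace R n).
Notation S := (@sphere R n).
Hypothesis n_gt0 : (0 < n)%N.
Implicit Types (x : V) (t s : R).
Variables (f : V -> R) (u v : R -> V -> R) (al : R -> R).
Hypothesis H : flow_data f u v al.

Lemma integer_moment_vanish j : vanish (fun t => wint u (fun x => `|v t x| ^+ j.+3) t).
Proof.
have [f0p f1p fb] := fbP H; have mp := mass_gt0 n_gt0 H.
have q0p : 0 < qmin H by exact: mulr_gt0.
have fle x : S x -> f x <= fmax H by move=> /fb/andP[].
have Qge t : 1 <= t -> qmin H <= wint u f t by move=> /(Q_bounds n_gt0 H)/andP[].
have alge t : 1 <= t -> 0 <= al t.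
  by move=> t1; apply: (al_ge0 n_gt0 H); exact: lt_le_trans t1.
have [K K0 hK] := v_upper n_gt0 H mp f1p q0p (amax_ge0 n_gt0 H) (mass_eq n_gt0 H) fle Qge alge (al_le n_gt0 H).
exact: (abs_moment_vanish n_gt0 H mp f1p q0p (amax_ge0 n_gt0 H) K0 (mass_eq n_gt0 H) fle Qge alge (al_le n_gt0 H) hK j (F2_tame n_gt0 H)).
Qed.

Lemma powR_small (a p : R) : 0 <= a -> a <= 1 -> 1 <= p -> a `^ p <= a.
Proof.
move=> a0 a1 p1; have [->|an] := eqVneq a 0; first by rewrite powR0// gt_eqF// (lt_le_trans ltr01).
have ap : 0 < a by rewrite lt_def an.
by rewrite -[X in _ <= X]powRr1//; apply: ger_powR => //; rewrite ap.
Qed.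

Lemma powR_interp (a p d : R) k : 0 <= a -> 0 < d -> d <= 1 -> 1 <= p -> p <= k%:R -> a `^ p <= d + d^-1 ^+ k * a ^+ k.
Proof.
move=> a0 d0 d1 p1 pk; have dk : 0 <= d^-1 ^+ k * a ^+ k by rewrite mulr_ge0 ?exprn_ge0// invr_ge0 ltW.
have [ad|da] := leP a d.
  apply: (@le_trans _ _ d); last by rewrite lerDl.
  by have a1 := le_trans ad d1; apply: le_trans ad; exact: powR_small.
have r1 : 1 <= d^-1 * a by rewrite mulrC ler_pdivlMr// mul1r ltW.
have r0 : 0 <= d^-1 * a by exact: le_trans ler01 r1.
apply: (@le_trans _ _ (d^-1 ^+ k * a ^+ k)); last by rewrite lerDr ltW.
have -> : a = d * (d^-1 * a) by rewrite mulVKf// gt_eqF.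
rewrite powRM// ?(ltW d0)//; apply: (@le_trans _ _ ((d^-1 * a) `^ p)).
  rewrite ler_piMl ?powR_ge0//; apply: (le_trans _ d1); exact: powR_small (ltW d0) d1 p1.
rewrite mulVKf ?gt_eqF// -exprMn -powR_mulrn//; exact: ler_powR.
Qed.

Lemma norm_powR_continuous (p : R) : 1 <= p -> continuous (fun s : R => `|s| `^ p).
Proof.
move=> p1 s; have [->|sn] := eqVneq s 0; last first.
  apply: (@cvg_comp _ _ _ (fun s : R => `|s|) (fun s => s `^ p) _ (nbhs `|s|)); first exact: norm_continuous.
  by apply: powR_continuous; rewrite posrE normr_gt0.
have p0 : p != 0 by rewrite gt_eqF// (lt_le_trans ltr01).
rewrite /continuous_at normr0 powR0//; apply/cvgrPdist_lt => e e0.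
have : \forall t \near (0 : R), ball (0 : R) (Num.min 1 e) t.
  by apply: nbhsx_ballx; rewrite lt_min e0 ltr01.
apply: filterS => t; rewrite /ball/= sub0r normrN lt_min => /andP[t1 te].
rewrite sub0r normrN ger0_norm ?powR_ge0//.
by apply: le_lt_trans te; apply: powR_small => //; exact: ltW.
Qed.

Lemma moment_vanish (p : R) : 1 <= p -> vanish (fun t => wint u (fun x => `|v t x| `^ p) t).
Proof.
move=> p1 e e0; have mp := mass_gt0 n_gt0 H; pose M := mass u.
have [j pj] : exists j, p <= j.+3%:R.
  exists (Num.truncn p); apply: (le_trans (ltW (truncnS_gt p))).
  rewrite ler_nat; exact: leqW (leqnSn _).
pose d := Num.min 1 (e / 2 / M).
have d0 : 0 < d by rewrite lt_min ltr01 !divr_gt0.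
have d1 : d <= 1 by rewrite ge_min lexx.
have dM : d * M <= e / 2 by rewrite -ler_pdivlMr// ge_min lexx orbT.
pose k := d^-1 ^+ j.+3; have k0 : 0 < k by rewrite exprn_gt0// invr_gt0.
have ek : 0 < e / 2 / k by rewrite !divr_gt0.
apply: evS (evI (integer_moment_vanish j ek) (@ev_ge R 1)) => t [h t1].
have tp : 0 < t by exact: lt_le_trans t1.
have cv' := cv n_gt0 (fd_u H) (fd_u_pos H) (fd_eq H) tp.
have ca : contS (fun x => `|v t x| ^+ j.+3) by apply: contSX; exact: contf_norm.
have cb : contS (fun x => `|v t x| `^ p).
  exact: (contS_post (F := fun s : R => `|s| `^ p) (norm_powR_continuous p1) cv').
have L : all_contS [:: (-1 : R, fun x => `|v t x| `^ p); (d, fun=> 1); (k, fun x => `|v t x| ^+ j.+3)].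
  by rewrite /=; do !split => //; exact: contS_cst.
have hx x : S x -> 0 <= -1 * `|v t x| `^ p + (d * 1 + (k * `|v t x| ^+ j.+3 + 0)).
  move=> _; rewrite mulN1r addrC subr_ge0 mulr1 addr0; exact: powR_interp.
have h2 : 0 <= -1 * wint u (fun x => `|v t x| `^ p) t + (d * wint u (fun=> 1) t + (k * wint u (fun x => `|v t x| ^+ j.+3) t + 0)).
  exact: (wint_pos n_gt0 H tp L hx).
move: h2 h; rewrite (mass_eq n_gt0 H t1) -/M.
move: (wint u (fun x => `|v t x| `^ p) t) (wint u _ t) => a b h2; rewrite ler_pdivlMr// mulrC => h.
by move: h2 h dM; move: (k * b) (d * M) => y z; lra.
Qed.

End FlowDataConvergence.

Section Sublaplacian.
Variables (R : realType) (n : nat).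
Notation V := (Cspace R n).
Notation S := (@sphere R n).
Hypothesis n_gt0 : (0 < n)%N.
Variable c : R.
Hypothesis cn : c != 0.
Hypothesis cE : forall g : V -> R, contS g -> int_theta0 g = c * sint g.

Lemma int_theta0_levi (phi psi : V -> R) : smooth_on S phi -> smooth_on S psi ->
  - int_theta0 (fun x => levi_grad phi psi x) = c * sint (fun x => 4^-1 * Dsub phi x * psi x).
Proof.
move=> h1 h2; have p1 := smooth_C1 h1; have p2 := smooth_C1 h2; have q1 := smooth_C2 h1.
have cG := contS_Gam p1 p2.
have cl : contS (fun x => levi_grad phi psi x).
  apply: (@contw_ext R V S (fun x => 4^-1 * Gam phi psi x)); first by move=> x Sx; rewrite levi_gradE.
  exact: contf_scale.
rewrite cE// (@sint_ext _ _ _ (fun x => 4^-1 * Gam psi phi x)); last by move=> x Sx; rewrite levi_gradE// GamC.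
have cG2 := contS_Gam p2 p1; have cp := C1_cont p2; have cD := contS_Dsub q1.
rewrite (sintZ n_gt0)// (sint_Gam n_gt0 p2 q1).
rewrite (@sint_ext _ _ (fun x => 4^-1 * Dsub phi x * psi x) (fun x => 4^-1 * (psi x * Dsub phi x))).
  by rewrite (sintZ n_gt0); [rewrite mulrN mulrN opprK|exact: contSM].
by move=> x _; rewrite mulrAC -mulrA mulrA.
Qed.

(** The operator 4^-1 * Dsub satisfies the defining identity. If h is another solution,
    testing with the difference shows that its square has integral zero. *)
Lemma sublaplacianE (phi : V -> R) x : smooth_on S phi -> S x -> sublaplacian phi x = 4^-1 * Dsub phi x.
Proof.
move=> h Sx; have sD : smooth_on S (fun x => 4^-1 * Dsub phi x).
  by apply: smooth_on_mul; [exact: smooth_on_cst|exact: smooth_Dsub].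
have ex : is_sublaplacian phi (fun x => 4^-1 * Dsub phi x).
  split => // psi hpsi; rewrite (int_theta0_levi h hpsi) cE//.
  by apply: contSM; exact: smooth_on_cont.
have [sh hh] : is_sublaplacian phi (sublaplacian phi) by apply: getPex; exists (fun x => 4^-1 * Dsub phi x).
pose chi x := sublaplacian phi x - 4^-1 * Dsub phi x.
have schi : smooth_on S chi by apply: smooth_on_add => //; exact: smooth_on_opp.
have cchi : contS chi := smooth_on_cont schi; have csh : contS (sublaplacian phi) := smooth_on_cont sh.
have cDD : contS (fun x => 4^-1 * Dsub phi x) := smooth_on_cont sD.
have E := hh chi schi; rewrite (int_theta0_levi h schi) cE in E; last exact: contSM.
have E1 := mulfI cn E.
have E2 : sint (fun x => chi x ^+ 2) = 0.
  rewrite (@sint_ext _ _ _ (fun x => sublaplacian phi x * chi x - 4^-1 * Dsub phi x * chi x)); last first.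
    by move=> y _; rewrite -mulrBl expr2.
  by rewrite (sintB n_gt0); [rewrite E1 subrr|exact: contSM|exact: contSM].
have := sint_pos n_gt0 (@contSX _ _ 2 _ cchi) (fun y _ => sqr_ge0 _) E2 Sx.
by move/eqP; rewrite sqrf_eq0 subr_eq0 => /eqP.
Qed.

End Sublaplacian.

(** Restriction to positive times. The mean of the curvature defect is zero by the
    choice of alpha, after division by c. *)
Lemma webster_flow_data (R : realType) (n : nat) (f u0 : Cspace R n -> R)
    (u : R -> Cspace R n -> R) (alpha : R -> R) (c : R) : (0 < n)%N -> c != 0 ->
  (forall g : Cspace R n -> R, contS g -> int_theta0 g = c * sint g) ->
  smooth_on (@sphere R n) f -> (forall x, sphere x -> 0 < f x) -> webster_flow f u0 u alpha ->
  flow_data f u (fun t x => alpha t * f x - webster (u t) x) alpha.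
Proof.
move=> n0 cn cE sf fp [su up _ ua ue].
have sC : flowC u.
  by apply: smooth_on_sub su => -[t x] [/= t0 Sx]; split => //; exact: ltW.
have up' t x : 0 < t -> sphere x -> 0 < u t x by move=> t0; apply: up; exact: ltW.
have wE t x : 0 < t -> sphere x -> webster (u t) x * wt u t x = u t x * Lop (u t) x.
  move=> t0 Sx; have ut := up' t x t0 Sx; rewrite /webster /wt /Lop /NN (sublaplacianE n0 cn cE (flowC_slice t0 sC) Sx).
  have -> : u t x `^ (2 + 2 / n%:R) = u t x * u t x `^ (1 + 2 / n%:R).
    rewrite -{2}(powRr1 (ltW ut)) -powRD; last by rewrite (gt_eqF ut) implybT.
    by congr (_ `^ _); ring.
  rewrite powRN; have : 0 < u t x `^ (1 + 2 / n%:R) by rewrite powR_gt0.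
  move: (u t x `^ _) (Dsub (u t) x) => a b a0.
  have -> : - (2 + 2 / n%:R) * (4^-1 * b) = - ((2 + 2 / n%:R) / 4) * b by rewrite mulrA mulNr.
  move: (_ + webster0 R n * _) => l.
  by field; rewrite gt_eqF.
split => //.
- exact: smooth_on_cont.
- by move=> t x t0 Sx; rewrite subKr wE.
- move=> t t0; have cf : contS f := smooth_on_cont sf; have cw := cwt sC up' t0.
  have hu := u_C2 sC t0; have cL := contS_Lop hu; have cu := C1_cont (C2_C1 hu).
  have cfw : contS (fun x => f x * wt u t x) by exact: contSM.
  have cW : contS (fun x => webster (u t) x * wt u t x).
    apply: (@contw_ext R (Cspace R n) (@sphere R n) (fun x => u t x * Lop (u t) x)); first by move=> x Sx; rewrite wE.
    exact: contSM.
  have := ua t (ltW t0); rewrite /int_theta -/(NN R n) -/(wt u t) (cE _ cfw) (cE _ cW) mulrCA => /(mulfI cn) E.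
  rewrite (@sint_ext _ _ _ (fun x => alpha t * (f x * wt u t x) - webster (u t) x * wt u t x)); last first.
    by move=> x _; rewrite mulrBl mulrA.
  by rewrite (sintB n0); [rewrite (sintZ n0)// E subrr|exact: contf_scale|exact: cW].
Qed.

Theorem lemma3p2 (R : realType) (n : nat) (f u0 : Cspace R n -> R)
    (u : R -> Cspace R n -> R) (alpha : R -> R) (p : R)
    (n_ge1 : (1 <= n)%N)
    (f_smooth : smooth_on (@sphere R n) f)
    (f_pos : forall x : Cspace R n, sphere x -> 0 < f x)
    (u0_smooth : smooth_on (@sphere R n) u0)
    (u0_pos : forall x : Cspace R n, sphere x -> 0 < u0 x)
    (u0_vol : int_theta0 (fun x => u0 x `^ (2 + 2 / n%:R)) =
              int_theta0 (fun _ : Cspace R n => 1))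
    (u_flow : webster_flow f u0 u alpha)
    (p_ge1 : 1 <= p) :
  int_theta (u t) (fun x => `|alpha t * f x - webster (u t) x| `^ p)
    @[t --> +oo] --> (0 : R).
Proof.
have [c c0 hc] := int_theta0E R n_ge1.
have [cz|cn] := eqVneq c 0.
  rewrite (_ : (fun t => _) = (fun=> 0)); first exact: cvg_cst.
  by apply: funext => t; exact: (hc _).2 cz.
have cE g (cg : contS g) := (hc g).1 cg.
have H := webster_flow_data n_ge1 cn cE f_smooth f_pos u_flow.
pose v t x := alpha t * f x - webster (u t) x.
have cp : 0 < c by rewrite lt_def cn.
apply/cvgrPdist_le => e e0; have ec : 0 < e / c by exact: divr_gt0.
have [T hT] := moment_vanish n_ge1 H p_ge1 ec.
near=> t; have t1 : 1 <= t by near: t; exact: nbhs_pinfty_ge.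
have tT : T <= t by near: t; apply: nbhs_pinfty_ge; exact: num_real.
have tp : 0 < t by exact: lt_le_trans t1.
have cv' : contS (v t) := cv n_ge1 (fd_u H) (fd_u_pos H) (fd_eq H) tp.
have cw := cwt (fd_u H) (fd_u_pos H) tp.
have cb : contS (fun x => `|v t x| `^ p * wt u t x).
  apply: contSM cw; exact: (contS_post (F := fun s : R => `|s| `^ p) (norm_powR_continuous p_ge1) cv').
have -> : int_theta (u t) (fun x => `|alpha t * f x - webster (u t) x| `^ p) = c * wint u (fun x => `|v t x| `^ p) t.
  exact: cE cb.
have w0 : 0 <= wint u (fun x => `|v t x| `^ p) t by apply: (wint_ge0 H tp) => x _; exact: powR_ge0.
rewrite sub0r normrN ger0_norm; last exact: mulr_ge0.
by have := hT t tT; rewrite ler_pdivlMr// mulrC.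
Unshelve. all: by end_near.
Qed.
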